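(* Let $\mathcal P_t=e^{t\mathcal L}$ be a primitive quantum Markov semigroup satisfying the $\sigma$-GNS detailed balance condition for its full-rank invariant state $\sigma$, and let $p\in(1,2]$. Then $(\mathcal D(\mathcal H),W_{2,p})$ is a complete geodesic metric space. In particular, for all $\rho_0,\rho_1\in\mathcal D(\mathcal H)$, a minimizer of $$W_{2,p}(\rho_0,\rho_1)^2=\inf\Big\{\int_0^1\|\mathbf B(s)\|_{-1,p,\gamma(s)}^2\,ds\ ;\ \dot\gamma(s)+\operatorname{div}\mathbf B(s)=0,\ \gamma(0)=\rho_0,\ \gamma(1)=\rho_1\Big\}\qquad( * )$$ (infimum over $\gamma\in C([0,1];\mathcal D(\mathcal H))$ and $\mathbf B\in L^1([0,1];\mathcal B(\mathcal H)^J)$, the equation being understood in the distributional sense) exists, and it gives a minimizing geodesic $(\gamma_*(s))_{s\in[0,1]}$ connecting $\rho_0$ and $\rho_1$ that satisfies $$W_{2,p}(\gamma_*(s),\gamma_*(t))=|s-t|\,W_{2,p}(\rho_0,\rho_1)\qquad\text{for all }s,t\in[0,1].$$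
   Context: $\mathcal H$ is a Hilbert space of finite dimension $d$; $\mathcal D(\mathcal H)$, $\mathcal D_+(\mathcal H)$ are the density operators and the full-rank ones; $\dagger$ is the adjoint for $\langle X,Y\rangle=\mathrm{Tr}(X^*Y)$. A quantum Markov semigroup is a $C_0$-semigroup of completely positive unital maps on $\mathcal B(\mathcal H)$ with generator $\mathcal L$; primitive means there is a unique invariant state $\sigma$ ($\mathcal P_t^\dagger(\sigma)=\sigma$) and it is full rank; $\sigma$-GNS detailed balance means $\mathcal L$ is self-adjoint for $\mathrm{Tr}(\sigma X^*Y)$. By Alicki's theorem one can write (and a choice is fixed) $$\mathcal L(X)=\sum_{j=1}^J\big(e^{-\omega_j/2}V_j^*[X,V_j]+e^{\omega_j/2}[V_j,X]V_j^*\big),$$ with $\omega_j\in\mathbb R$, $\sigma V_j\sigma^{-1}=e^{-\omega_j}V_j$, $\mathrm{Tr}(V_j)=0$, $\langle V_j,V_k\rangle=c_j\delta_{jk}$, $c_j>0$, and for each $j$ an index $j'$ with $V_j^*=V_{j'}$, $\omega_{j'}=-\omega_j$. Let $\partial_jX=[V_j,X]$, so $\partial_j^\dagger Y=[V_j^*,Y]$, and $\operatorname{div}\mathbf B=-\sum_{j=1}^J\partial_j^\dagger B_j$ for $\mathbf B=(B_1,\dots,B_J)\in\mathcal B(\mathcal H)^J$. Let $\Gamma_\sigma^s(X)=\sigma^{s/2}X\sigma^{s/2}$, $\hat p=p/(p-1)$. For $x,y>0$ let $\theta_p(x,y)=(p-1)\frac{x-y}{x^{p-1}-y^{p-1}}$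 if $x\ne y$ and $\theta_p(x,x)=x^{2-p}$. For self-adjoint $A=\sum_i\lambda_iA_i$, $B=\sum_k\mu_kB_k$ (spectral decompositions), $f(A,B)(X)=\sum_{i,k}f(\lambda_i,\mu_k)A_iXB_k$. For positive definite $\rho$ and $\omega\in\mathbb R$ define $$[\rho]_{p,\omega}=\Gamma_\sigma^{1/\hat p}\circ\theta_p\big(e^{\omega/2p}\Gamma_\sigma^{-1/\hat p}(\rho),\,e^{-\omega/2p}\Gamma_\sigma^{-1/\hat p}(\rho)\big)\circ\Gamma_\sigma^{1/\hat p},\qquad \mathfrak D_{p,\rho}(A)=\sum_{j=1}^J\partial_j^\dagger\big([\rho]_{p,\omega_j}\partial_jA\big).$$ On $T_\rho=\mathcal B^0_{sa}(\mathcal H)$ (traceless self-adjoint operators), the tangent space of $\mathcal D_+(\mathcal H)$ at $\rho$, $\mathfrak D_{p,\rho}$ is positive definite and $g_{p,\rho}(\nu_1,\nu_2)=\langle\mathfrak D_{p,\rho}^{-1}(\nu_1),\nu_2\rangle$ is a Riemannian metric. For $\rho_0,\rho_1\in\mathcal D_+(\mathcal H)$, $W_{2,p}(\rho_0,\rho_1)^2=\inf\int_0^1g_{p,\gamma(s)}(\dot\gamma(s),\dot\gamma(s))\,ds$ over smooth curves $\gamma:[0,1]\to\mathcal D_+(\mathcal H)$ from $\rho_0$ to $\rho_1$ (the Riemannian distance); $W_{2,p}$ extends continuously to $\mathcal D(\mathcal H)\times\mathcal D(\mathcal H)$, and this extension is again denoted $W_{2,p}$; it is equivalently given by $( * )$,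 where $\|\mathbf B\|_{-1,p,\rho}^2=\sum_{j=1}^J\langle B_j,[\rho]_{p,\omega_j}^{-1}B_j\rangle$ for $\rho\in\mathcal D_+(\mathcal H)$, and for singular $\rho\in\mathcal D(\mathcal H)$ it is the monotone limit $\lim_{\varepsilon\downarrow0}\sum_j\langle B_j,[\rho+\varepsilon\mathbf 1]_{p,\omega_j}^{-1}B_j\rangle\in[0,\infty]$. A metric space is geodesic if any two points are joined by a constant-speed curve whose length is their distance. *)

(* Defs.v *)
From HB Require Import structures.
From mathcomp Require Import all_boot all_order all_algebra.
From mathcomp Require Import complex.
From mathcomp Require Import all_classical all_reals all_analysis.

Set Implicit Arguments.
Unset Strict Implicit.
Unset Printing Implicit Defensive.

Import Order.TTheory GRing.Theory Num.Theory.
Import numFieldTopology.Exports numFieldNormedType.Exports.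

Local Open Scope classical_set_scope.
Local Open Scope ring_scope.
Local Open Scope complex_scope.
Local Open Scope sesquilinear_scope.

(* The modulus topology on R[i]; it induces the entrywise (hence the usual)
   topology on the matrix space 'M[R[i]]_d. *)
HB.instance Definition _ (R : realType) :=
  PseudoPointedMetric.copy R[i] (R[i]^o).
HB.instance Definition _ (R : realType) := NormedModule.copy R[i] (R[i]^o).

(* The Hilbert space of dimension d is C^d, so that B(H) = 'M[R[i]]_d. *)

Section Operators.
Variables (R : realType) (d : nat).
Local Notation C := R[i].
Local Notation M := 'M[C]_d.
Implicit Types (A B X Y : M).

Definition hs X Y : C := \tr (X ^t* *m Y).

Definition commutator X Y : M := X *m Y - Y *m X.

(* Nonnegativity in the partial order of R[i] includes being real, so psd
   implies self-adjointness. *)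
Definition psd n (A : 'M[C]_n) : Prop :=
  forall v : 'cV[C]_n, 0 <= (v ^t* *m A *m v) 0 0.

Definition states : set M := [set rho | psd rho /\ \tr rho = 1].

Definition full_states : set M := [set rho | states rho /\ rho \in unitmx].

Definition traceless_sa : set M := [set A | A ^t* = A /\ \tr A = 0].

(* Adjoint of a linear map for hs: its (i, j) entry is < E_ij , Phi^dag Y >. *)
Definition hs_adj (Phi : M -> M) Y : M :=
  \matrix_(i, j) hs (Phi (delta_mx i j)) Y.

Lemma hs_adjP (Phi : {linear M -> M}) X Y : hs (Phi X) Y = hs X (hs_adj Phi Y).
Proof.
rewrite {1}(matrix_sum_delta X) /hs.
have addE (I : finType) (F : I -> M) :
    \tr ((Phi (\sum_i F i)) ^t* *m Y) = \sum_i \tr ((Phi (F i)) ^t* *m Y).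
  apply: (big_morph (fun Z => \tr ((Phi Z) ^t* *m Y))) => [A B|].
    by rewrite linearD linearD map_mxD mulmxDl mxtraceD.
  by rewrite linear0 trmx0 map_mx0 mul0mx mxtrace0.
rewrite addE.
under eq_bigr => i _ do rewrite addE.
rewrite [RHS]/mxtrace.
under [RHS]eq_bigr => j _ do rewrite mxE.
rewrite exchange_big /=; apply: eq_bigr => j _; apply: eq_bigr => i _.
by rewrite linearZ linearZ map_mxZ -scalemxAl mxtraceZ !mxE.
Qed.

Definition unital (Phi : M -> M) : Prop := Phi 1%:M = 1%:M.

(* Positivity of id_k (x) Phi on k x k block matrices, for every k. *)
Definition completely_positive (Phi : M -> M) : Prop :=
  forall (k : nat) (B : 'I_k -> 'I_k -> M),
    psd (\mxblock_(i < k, j < k) B i j) ->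
    psd (\mxblock_(i < k, j < k) Phi (B i j)).

Record quantum_markov_semigroup (P : R -> {linear M -> M}) : Prop := {
  qms_cp : forall t, 0 <= t -> completely_positive (P t);
  qms_unital : forall t, 0 <= t -> unital (P t);
  qms_0 : forall X, P 0 X = X;
  qms_add : forall s t X, 0 <= s -> 0 <= t -> P (s + t) X = P s (P t X);
  qms_c0 : forall X, P t X @[t --> 0^'+] --> X
}.

Definition has_generator (P : R -> {linear M -> M}) (L : M -> M) : Prop :=
  forall X, (t^-1)%:C *: (P t X - X) @[t --> 0^'+] --> L X.

Definition invariant (P : R -> {linear M -> M}) (rho : M) : Prop :=
  forall t, 0 <= t -> hs_adj (P t) rho = rho.

Definition primitive (P : R -> {linear M -> M}) (sigma : M) : Prop :=
  [/\ full_states sigma, invariant P sigma &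
      forall rho, states rho -> invariant P rho -> rho = sigma].

Definition gns_detailed_balance (L : M -> M) (sigma : M) : Prop :=
  forall X Y, \tr (sigma *m (L X) ^t* *m Y) = \tr (sigma *m X ^t* *m L Y).

Record alicki_form (L : M -> M) (sigma : M) (J : nat) (V : 'I_J -> M)
    (omega : 'I_J -> R) : Prop := {
  alicki_generator : forall X, L X =
    \sum_(j < J)
      ((expR (- omega j / 2))%:C *: ((V j) ^t* *m commutator X (V j))
       + (expR (omega j / 2))%:C *: (commutator (V j) X *m (V j) ^t*));
  alicki_modular : forall j,
    sigma *m V j *m invmx sigma = (expR (- omega j))%:C *: V j;
  alicki_traceless : forall j, \tr (V j) = 0;
  alicki_orthogonal : exists c : 'I_J -> R, (forall j, 0 < c j) /\
    forall j k, hs (V j) (V k) = if j == k then (c j)%:C else 0;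
  alicki_adjoint : forall j, exists j',
    (V j) ^t* = V j' /\ omega j' = - omega j
}.

(* Functional calculus, used for self-adjoint A only.  The projections are the
   rank-one projections on the eigenvectors given by spectralmx; grouping those
   with equal eigenvalues yields the spectral projections, and leaves both
   mxfun and mxfun2 unchanged. *)
Definition eigval A (i : 'I_d) : R := complex.Re (spectral_diag A 0 i).

Definition eigproj A (i : 'I_d) : M :=
  invmx (spectralmx A) *m delta_mx i i *m spectralmx A.

Lemma eigprojE A : A ^t* = A -> A = \sum_i (eigval A i)%:C *: eigproj A i.
Proof.
move=> Asa.
have hA : A \is hermsymmx.
  by apply/is_hermitianmxP; rewrite expr0 scale1r Asa.
have nA := hermitian_normalmx hA.
have /orthomx_spectralP AE := nA.
rewrite {1}AE diag_mx_sum_delta mulmx_sumr mulmx_suml.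
apply: eq_bigr => i _; rewrite -scalemxAr -scalemxAl; congr (_ *: _).
have /mxOverP/(_ 0 i) := hermitian_spectral_diag_real hA.
by rewrite /eigval => /Creal_ReP; rewrite complexRe.
Qed.

Definition mxfun (f : R -> R) A : M :=
  \sum_i (f (eigval A i))%:C *: eigproj A i.

Definition mxfun2 (f : R -> R -> R) A B X : M :=
  \sum_i \sum_k
    (f (eigval A i) (eigval B k))%:C *: (eigproj A i *m X *m eigproj B k).

(* Inverse of Phi on the domain D. *)
Definition inv_on (D : set M) (Phi : M -> M) Y : M :=
  xget 0 [set X | D X /\ Phi X = Y].

End Operators.

Section Curves.
Variables (R : realType) (d : nat).
Local Notation C := R[i].
Local Notation M := 'M[C]_d.
Local Notation mu := (@lebesgue_measure R).

Definition smooth (f : R -> R) : Prop :=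
  forall n x, derivable (derive1n n f) x 1.

Definition re_entry (F : R -> M) i j (s : R) : R := complex.Re (F s i j).
Definition im_entry (F : R -> M) i j (s : R) : R := complex.Im (F s i j).

Definition smooth_mx (F : R -> M) : Prop :=
  forall i j, smooth (re_entry F i j) /\ smooth (im_entry F i j).

Definition derive_mx (F : R -> M) (s : R) : M :=
  \matrix_(i, j) (derive1 (re_entry F i j) s +i* derive1 (im_entry F i j) s).

Definition integrable_mx (F : R -> M) : Prop :=
  forall i j, mu.-integrable `[0, 1] (EFin \o re_entry F i j) /\
              mu.-integrable `[0, 1] (EFin \o im_entry F i j).

Definition integral_mx (F : R -> M) : M :=
  \matrix_(i, j) ((\int[mu]_(s in `[0, 1]) re_entry F i j s) +i*
                  (\int[mu]_(s in `[0, 1]) im_entry F i j s)).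

Definition test_function (phi : R -> R) : Prop :=
  smooth phi /\ exists a b : R, [/\ 0 < a, b < 1 &
    forall s, ~ (a <= s <= b) -> phi s = 0].

End Curves.

Section MetricSpaces.
Variables (R : realType) (T : Type) (D : set T) (dist : T -> T -> R).

Definition is_metric_on : Prop :=
  [/\ forall x y, D x -> D y -> 0 <= dist x y,
      forall x y, D x -> D y -> (dist x y = 0 <-> x = y),
      forall x y, D x -> D y -> dist x y = dist y x &
      forall x y z, D x -> D y -> D z -> dist x z <= dist x y + dist y z].

Definition is_complete_on : Prop :=
  forall u : nat -> T, (forall n, D (u n)) ->
    (forall e : R, 0 < e -> exists N : nat, forall m n : nat,
       (N <= m)%N -> (N <= n)%N -> dist (u m) (u n) < e) ->
    exists2 l, D l & dist (u n) l @[n --> \oo] --> (0 : R).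

(* Supremum over the partitions a < t_1 < .. < t_n = b. *)
Definition curve_length (gamma : R -> T) (a b : R) : \bar R :=
  ereal_sup [set (\sum_(i < size s)
      dist (gamma (nth b (a :: s) i)) (gamma (nth b (a :: s) i.+1)))%:E
    | s in [set s | itv_partition a b s]].

Definition constant_speed (gamma : R -> T) : Prop :=
  exists v : R, forall s t, 0 <= s -> s <= t -> t <= 1 ->
    curve_length gamma s t = (v * (t - s))%:E.

Definition minimizing_geodesic (x y : T) (gamma : R -> T) : Prop :=
  [/\ forall s, 0 <= s <= 1 -> D (gamma s),
      gamma 0 = x, gamma 1 = y, constant_speed gamma &
      curve_length gamma 0 1 = (dist x y)%:E].

Definition is_geodesic_on : Prop :=
  forall x y, D x -> D y -> exists gamma, minimizing_geodesic x y gamma.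

End MetricSpaces.

Section Transport.
Variables (R : realType) (d : nat).
Local Notation C := R[i].
Local Notation M := 'M[C]_d.
Local Notation mu := (@lebesgue_measure R).
Variables (p : R) (sigma : M) (J : nat) (V : 'I_J -> M) (omega : 'I_J -> R).

Definition partialj j (X : M) : M := commutator (V j) X.

Definition partialj_adj j (Y : M) : M := commutator ((V j) ^t*) Y.

Lemma partialj_adjP j X Y : hs (partialj j X) Y = hs X (partialj_adj j Y).
Proof.
rewrite /hs /partialj /partialj_adj /commutator.
rewrite linearB /= map_mxB mulmxBl mulmxBr !raddfB /=.
rewrite !trmx_mul !map_mxM /= -!mulmxA; congr (_ - _).
by rewrite mxtrace_mulC mulmxA.
Qed.

Definition divergence (B : 'I_J -> M) : M := - \sum_j partialj_adj j (B j).

Definition hat : R := p / (p - 1).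

Definition Gamma (s : R) (X : M) : M :=
  mxfun (fun x => x `^ (s / 2)) sigma *m X *m mxfun (fun x => x `^ (s / 2)) sigma.

Definition theta (x y : R) : R :=
  if x == y then x `^ (2 - p)
  else (p - 1) * ((x - y) / (x `^ (p - 1) - y `^ (p - 1))).

Definition bracket (w : R) (rho : M) (X : M) : M :=
  Gamma (1 / hat)
    (mxfun2 theta
       ((expR (w / (2 * p)))%:C *: Gamma (- (1 / hat)) rho)
       ((expR (- w / (2 * p)))%:C *: Gamma (- (1 / hat)) rho)
       (Gamma (1 / hat) X)).

Definition bracket_inv (w : R) (rho : M) : M -> M := inv_on setT (bracket w rho).

Definition Dop (rho : M) (A : M) : M :=
  \sum_j partialj_adj j (bracket (omega j) rho (partialj j A)).

Definition Dop_inv (rho : M) : M -> M := inv_on (@traceless_sa R d) (Dop rho).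

(* < D^-1 nu1 , nu2 > is real on self-adjoint nu1, nu2. *)
Definition metric_tensor (rho nu1 nu2 : M) : R :=
  complex.Re (hs (Dop_inv rho nu1) nu2).

(* Curves are defined on the whole line; smoothness up to the end points of
   [0, 1] is expressed by having a smooth extension, and only the values on
   [0, 1] are constrained to be full-rank states. *)
Definition smooth_curve (rho0 rho1 : M) (gamma : R -> M) : Prop :=
  [/\ smooth_mx gamma, forall s, 0 <= s <= 1 -> full_states (gamma s),
      gamma 0 = rho0 & gamma 1 = rho1].

Definition riemannian_energy (gamma : R -> M) : \bar R :=
  (\int[mu]_(s in `[0%R, 1%R])
     (metric_tensor (gamma s) (derive_mx gamma s) (derive_mx gamma s))%:E)%E.

Definition riemannian_dist (rho0 rho1 : M) : R :=
  Num.sqrt (fine (ereal_inf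
    [set riemannian_energy gamma | gamma in smooth_curve rho0 rho1])).

(* The continuous extension of the Riemannian distance from full-rank states to
   all states; it is unique on states, and its values elsewhere are junk. *)
Definition continuous_extension (W : M -> M -> R) : Prop :=
  (forall rho0 rho1, full_states rho0 -> full_states rho1 ->
     W rho0 rho1 = riemannian_dist rho0 rho1) /\
  {within @states R d `*` @states R d, continuous (fun x : M * M => W x.1 x.2)}.

Definition W2p : M -> M -> R :=
  xget (fun _ _ => 0) [set W | continuous_extension W].

Definition weighted_norm2_reg (rho : M) (B : 'I_J -> M) : R :=
  \sum_j complex.Re (hs (B j) (bracket_inv (omega j) rho (B j))).

Definition weighted_norm2 (rho : M) (B : 'I_J -> M) : \bar R :=
  if rho \in unitmx then (weighted_norm2_reg rho B)%:E
  else lim ((weighted_norm2_reg (rho + e%:C%:M) B)%:E @[e --> 0^'+]).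

(* gamma' + div B = 0 tested against smooth functions compactly supported in
   the open interval ]0, 1[. *)
Definition continuity_equation (gamma : R -> M) (B : R -> 'I_J -> M) : Prop :=
  forall phi, test_function phi ->
    - integral_mx (fun s => (derive1 phi s)%:C *: gamma s)
    + integral_mx (fun s => (phi s)%:C *: divergence (B s)) = 0.

Definition admissible (rho0 rho1 : M) (gamma : R -> M) (B : R -> 'I_J -> M)
    : Prop :=
  [/\ (forall s, 0 <= s <= 1 -> states (gamma s)) /\
        {within `[0, 1], continuous gamma},
      forall j, integrable_mx (fun s => B s j),
      continuity_equation gamma B,
      gamma 0 = rho0 & gamma 1 = rho1].

Definition action (gamma : R -> M) (B : R -> 'I_J -> M) : \bar R :=
  (\int[mu]_(s in `[0%R, 1%R]) weighted_norm2 (gamma s) (B s))%E.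

Definition inf_action (rho0 rho1 : M) : \bar R :=
  ereal_inf [set action gB.1 gB.2
    | gB in [set gB | admissible rho0 rho1 gB.1 gB.2]].

Definition minimizer (rho0 rho1 : M) (gamma : R -> M) (B : R -> 'I_J -> M)
    : Prop :=
  admissible rho0 rho1 gamma B /\ action gamma B = inf_action rho0 rho1.

End Transport.

(* Main.v *)
(* By the Loewner-Heinz inequality the quadratic form Q rho B, the square of the norm of B for
   -1, p, rho, decreases in rho, and it is homogeneous of degree p - 2 in rho; these two facts
   replace every continuity property of the tensor.  Between full-rank states the distance is
   the infimum Wc of the lengths of chains of segments along each of which the field is constant,
   and at singular states it is the supremum W over the pushes of both end points towards the
   maximally mixed state.  Smoothing the corners of a chain gives smooth curves of almost the
   same energy; conversely the dual form 2 <A, src B> - <A, D_rho A> <= Q rho B bounds W by the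
   action of any weak solution of the continuity equation.

   For the minimizer, the fields of almost optimal chains, integrated in arc length, are
   uniformly Lipschitz.  Their limit along an ultrafilter is Lipschitz, hence the primitive of
   its almost everywhere derivative, whose norm is at most W by the monotonicity of Q.  The
   resulting curve has constant speed by the bound of W by the action. *)

From HB Require Import structures.
Require Import Defs.
From mathcomp Require Import all_boot all_order all_algebra.
From mathcomp Require Import complex.
From mathcomp Require Import all_classical all_reals all_analysis.
From mathcomp Require Import measurable_realfun ring lra.

Set Implicit Arguments.
Unset Strict Implicit.
Unset Printing Implicit Defensive.
Import Order.TTheory GRing.Theory Num.Theory.
Import numFieldTopology.Exports numFieldNormedType.Exports.

Local Open Scope classical_set_scope.
Local Open Scope ring_scope.
Local Open Scope complex_scope.
Local Open Scope sesquilinear_scope.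

(** The eigenvectors behind theta_p are chosen without any continuity, so two states are only ever
    compared through the order: w >= r z with 0 < r <= 1 costs a factor r^(p-2) <= 1/r in Q.
    Antitonicity itself comes from writing 1 / theta_p(x, y) as the integral over s in [0, 1] of (s
    x + (1 - s) y)^(p-2): the exponent lies in ]-1, 0], the range of Loewner-Heinz. The obstacle is
    the boundary, where Q may be infinite. Two facts tame it: contracting the states towards the
    maximally mixed one lengthens no chain, and a path leaving a state like e t^2 has action of
    order e whatever the rank of that state. Together they bound W(x, y) by a multiple of the square
    root of |y - x|, which yields finiteness, continuity and completeness. Primitivity enters once:
    a nonscalar matrix commuting with all V_j would produce a second invariant state, so D_rho has
    only scalars in its kernel. The dual form is affine in the field. It can therefore be integrated
    in time for a fixed potential, although the action density itself is not known to be
    measurable. *)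

Lemma discr_le (R : realFieldType) (a b c : R) : 0 <= a -> 0 <= c ->
  (forall t, 0 <= a - t * (b *+ 2) + t ^+ 2 * c) -> b ^+ 2 <= a * c.
Proof.
move=> a0; rewrite le_eqVlt => /orP[/eqP <-|c0] H.
  have [-> | b0] := eqVneq b 0; first by rewrite expr0n mulr0.
  (* Here c = 0 and the condition is affine in t; at this t it would read 0 <= -1. *)
  have := H ((a + 1) / (b *+ 2)); rewrite mulr0 addr0 divfK; first by lra.
  by rewrite mulrn_eq0.
have := H (b / c).
have -> : a - b / c * (b *+ 2) + (b / c) ^+ 2 * c = (a * c - b ^+ 2) / c.
  by field; rewrite gt_eqF.
by rewrite pmulr_lge0 ?invr_gt0 // subr_ge0.
Qed.

(* Opaque copies keep unification from unfolding matrix-valued definitions. *)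
Lemma seal (T : Type) (x : T) : {y : T | y = x}.
Proof. by exists x. Qed.

(** * Real trace inner product and functional calculus of Hermitian matrices *)

Section InnerProduct.
Variables (R : realType) (d : nat).
Local Notation C := R[i].
Local Notation M := 'M[C]_d.
Implicit Types (A B X Y Z : M) (r : R).

(** Only the real part of [hs] is kept: matrices become a real Euclidean space, and equalities,
    limits, derivatives and integrals of matrices are all tested through the real functionals
    [ip A]. *)
Definition ip : M -> M -> R := sval (seal (fun X Y => complex.Re (hs X Y))).

Lemma ip_def X Y : ip X Y = complex.Re (\tr (X ^t* *m Y)).
Proof. by rewrite /ip (svalP (seal _)). Qed.

Lemma dagM m n k (A : 'M[C]_(m, n)) (B : 'M[C]_(n, k)) : (A *m B) ^t* = B ^t* *m A ^t*.
Proof. by rewrite trmx_mul map_mxM. Qed.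
Lemma dagD m n (A B : 'M[C]_(m, n)) : (A + B) ^t* = A ^t* + B ^t*.
Proof. by rewrite linearD /= map_mxD. Qed.
Lemma dagN m n (A : 'M[C]_(m, n)) : (- A) ^t* = - A ^t*.
Proof. by rewrite linearN /= map_mxN. Qed.
Lemma dagB m n (A B : 'M[C]_(m, n)) : (A - B) ^t* = A ^t* - B ^t*.
Proof. by rewrite dagD dagN. Qed.
Lemma dagZ m n (c : C) (A : 'M[C]_(m, n)) : (c *: A) ^t* = Num.conj c *: A ^t*.
Proof. by rewrite linearZ /= map_mxZ. Qed.
Lemma dag0 m n : (0 : 'M[C]_(m, n)) ^t* = 0.
Proof. by rewrite trmx0 map_mx0. Qed.
Lemma dag_sum (I : Type) (s : seq I) (P : pred I) m n (F : I -> 'M[C]_(m, n)) :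
  (\sum_(i <- s | P i) F i) ^t* = \sum_(i <- s | P i) (F i) ^t*.
Proof. by elim/big_rec2: _ => [|i x y _ <-]; [exact: dag0|exact: dagD]. Qed.
Lemma conj_real r : Num.conj r%:C = r%:C.
Proof. by apply/eqP; rewrite eq_complex /= oppr0 !eqxx. Qed.
Lemma dagZr m n r (A : 'M[C]_(m, n)) : (r%:C *: A) ^t* = r%:C *: A ^t*.
Proof. by rewrite dagZ conj_real. Qed.
Lemma dag_scalar r : (r%:C%:M : M) ^t* = r%:C%:M.
Proof. by rewrite -scalemx1 dagZr trmx1 map_mx1. Qed.
Lemma dag1 : (1%:M : M) ^t* = 1%:M.
Proof. by rewrite trmx1 map_mx1. Qed.

Lemma trace_adj A : \tr (A ^t*) = Num.conj (\tr A).
Proof. by rewrite /mxtrace rmorph_sum; apply: eq_bigr => i _; rewrite !mxE. Qed.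

Lemma Re_conj (z : C) : complex.Re (Num.conj z) = complex.Re z.
Proof. by case: z. Qed.
Lemma ReD (x y : C) : complex.Re (x + y) = complex.Re x + complex.Re y.
Proof. by case: x; case: y. Qed.
Lemma ReN (x : C) : complex.Re (- x) = - complex.Re x.
Proof. by case: x. Qed.
Lemma ReZ r (x : C) : complex.Re (r%:C * x) = r * complex.Re x.
Proof. by case: x => a b; rewrite /= mul0r subr0. Qed.
Lemma Re_sum (I : Type) (s : seq I) (P : pred I) (F : I -> C) :
  complex.Re (\sum_(i <- s | P i) F i) = \sum_(i <- s | P i) complex.Re (F i).
Proof. by apply: (big_morph (@complex.Re R)) => // x y; rewrite ReD. Qed.

Lemma ip_sym X Y : ip X Y = ip Y X.
Proof. by rewrite !ip_def -Re_conj -trace_adj dagM trmxCK. Qed.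
Lemma ipDr X Y Z : ip X (Y + Z) = ip X Y + ip X Z.
Proof. by rewrite !ip_def mulmxDr mxtraceD ReD. Qed.
Lemma ipDl X Y Z : ip (X + Y) Z = ip X Z + ip Y Z.
Proof. by rewrite ip_sym ipDr !(ip_sym Z). Qed.
Lemma ipZr r X Y : ip X (r%:C *: Y) = r * ip X Y.
Proof. by rewrite !ip_def -scalemxAr mxtraceZ ReZ. Qed.
Lemma ipZl r X Y : ip (r%:C *: X) Y = r * ip X Y.
Proof. by rewrite ip_sym ipZr ip_sym. Qed.
Lemma ipNr X Y : ip X (- Y) = - ip X Y.
Proof. by rewrite !ip_def mulmxN raddfN ReN. Qed.
Lemma ipNl X Y : ip (- X) Y = - ip X Y.
Proof. by rewrite ip_sym ipNr ip_sym. Qed.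
Lemma ipBr X Y Z : ip X (Y - Z) = ip X Y - ip X Z.
Proof. by rewrite ipDr ipNr. Qed.
Lemma ipBl X Y Z : ip (X - Y) Z = ip X Z - ip Y Z.
Proof. by rewrite ipDl ipNl. Qed.
Lemma ip0r X : ip X 0 = 0.
Proof. by rewrite !ip_def mulmx0 mxtrace0. Qed.
Lemma ip0l X : ip 0 X = 0.
Proof. by rewrite ip_sym ip0r. Qed.
Lemma ip_sumr (I : Type) (s : seq I) (P : pred I) (F : I -> M) X :
  ip X (\sum_(i <- s | P i) F i) = \sum_(i <- s | P i) ip X (F i).
Proof. by apply: (big_morph (ip X)) => [A B|]; [exact: ipDr|exact: ip0r]. Qed.
Lemma ip_suml (I : Type) (s : seq I) (P : pred I) (F : I -> M) X :
  ip (\sum_(i <- s | P i) F i) X = \sum_(i <- s | P i) ip (F i) X.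
Proof. by rewrite ip_sym ip_sumr; apply: eq_bigr => i _; rewrite ip_sym. Qed.
Lemma ip_mull A X Y : ip (A *m X) Y = ip X (A ^t* *m Y).
Proof. by rewrite !ip_def dagM mulmxA. Qed.
Lemma ip_mulr A X Y : ip (X *m A) Y = ip X (Y *m A ^t*).
Proof. by rewrite !ip_def dagM -mulmxA mxtrace_mulC mulmxA. Qed.
Lemma ip_adj X Y : ip (X ^t*) (Y ^t*) = ip X Y.
Proof. by rewrite ip_sym !ip_def trmxCK -mxtrace_mulC. Qed.

Lemma ipE X Y : ip X Y = \sum_i \sum_j
  (complex.Re (X i j) * complex.Re (Y i j) + complex.Im (X i j) * complex.Im (Y i j)).
Proof.
rewrite !ip_def /mxtrace Re_sum exchange_big /=; apply: eq_bigr => j _.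
rewrite mxE Re_sum; apply: eq_bigr => i _; rewrite !mxE.
by case: (X i j) => a b; case: (Y i j) => a' b' /=; rewrite mulNr opprK.
Qed.

Lemma ip_ge0 X : 0 <= ip X X.
Proof.
rewrite ipE; apply: sumr_ge0 => i _; apply: sumr_ge0 => j _.
by rewrite addr_ge0 // -expr2 sqr_ge0.
Qed.

Lemma ip_entry X i j :
  complex.Re (X i j) ^+ 2 + complex.Im (X i j) ^+ 2 <= ip X X.
Proof.
rewrite ipE (bigD1 i) //= (bigD1 j) //= -!expr2 -addrA lerDl.
apply: addr_ge0; first by apply: sumr_ge0 => k _; rewrite -!expr2 addr_ge0 ?sqr_ge0.
by apply: sumr_ge0 => k _; apply: sumr_ge0 => l _; rewrite -!expr2 addr_ge0 ?sqr_ge0.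
Qed.

Lemma ip_eq0 X : ip X X = 0 -> X = 0.
Proof.
move=> X0; apply/matrixP => i j; rewrite mxE.
have := ip_entry X i j; rewrite X0.
case: (X i j) => a b /= ab0.
have a0 : a = 0 by nra.
have b0 : b = 0 by nra.
by rewrite a0 b0.
Qed.

Definition nm X : R := Num.sqrt (ip X X).

Lemma nm_ge0 X : 0 <= nm X. Proof. exact: sqrtr_ge0. Qed.
Lemma nm_sqr X : nm X ^+ 2 = ip X X. Proof. by rewrite sqr_sqrtr // ip_ge0. Qed.

Lemma ip_CS X Y : ip X Y <= nm X * nm Y.
Proof.
have Y0 := ip_ge0 Y; have X0 := ip_ge0 X.
rewrite /nm -sqrtrM // (le_trans (ler_norm _)) // -sqrtr_sqr ler_wsqrtr //.
apply: discr_le => // t.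
have := ip_ge0 (X - t%:C *: Y).
rewrite ipBr !ipBl !ipZr !ipZl (ip_sym Y X).
set a := ip _ _; set b := ip _ _; set c := ip _ _.
by lra.
Qed.

Lemma nmD X Y : nm (X + Y) <= nm X + nm Y.
Proof.
rewrite -(@ler_pXn2r _ 2%N) // ?nnegrE ?addr_ge0 ?nm_ge0 //.
rewrite nm_sqr sqrrD !nm_sqr ipDr !ipDl (ip_sym Y X).
by have := ip_CS X Y; lra.
Qed.
Lemma nmZ r X : nm (r%:C *: X) = `|r| * nm X.
Proof. by rewrite /nm ipZr ipZl mulrA -expr2 sqrtrM ?sqr_ge0 // sqrtr_sqr. Qed.
Lemma nmN X : nm (- X) = nm X.
Proof. by rewrite /nm ipNr ipNl opprK. Qed.
Lemma nm_subC X Y : nm (X - Y) = nm (Y - X).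
Proof. by rewrite -nmN opprB. Qed.
Lemma nm0 : nm 0 = 0.
Proof. by rewrite /nm ip0r sqrtr0. Qed.
Lemma nm_eq0 X : nm X = 0 -> X = 0.
Proof. by move=> X0; apply: ip_eq0; rewrite -nm_sqr X0 expr0n. Qed.
Lemma nm_tri Z X Y : nm (X - Y) <= nm (X - Z) + nm (Z - Y).
Proof. by have := nmD (X - Z) (Z - Y); rewrite addrA subrK. Qed.
Lemma nm_sum (I : Type) (s : seq I) (P : pred I) (F : I -> M) :
  nm (\sum_(i <- s | P i) F i) <= \sum_(i <- s | P i) nm (F i).
Proof.
elim/big_rec2: _ => [|i x y _ h]; first by rewrite nm0.
by rewrite (le_trans (nmD _ _)) // lerD2l.
Qed.

Lemma lecP (x y : C) : (x <= y) = (complex.Im y == complex.Im x) && (complex.Re x <= complex.Re y).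
Proof. by case: x; case: y. Qed.

Definition resolution n (P : 'I_n -> M) := [/\ forall i, (P i) ^t* = P i,
  forall i j, P i *m P j = if i == j then P i else 0 & \sum_i P i = 1%:M].

Lemma spectralmxV A : invmx (spectralmx A) = (spectralmx A) ^t*.
Proof. exact/invmx_unitary/spectral_unitarymx. Qed.

Definition hproj : M -> 'I_d -> M := sval (seal (@eigproj R d)).
Definition heig : M -> 'I_d -> R := sval (seal (@eigval R d)).
Definition hfun : (R -> R) -> M -> M := sval (seal (@mxfun R d)).

Lemma hprojE : hproj = @eigproj R d. Proof. exact: (svalP (seal _)). Qed.
Lemma heigE : heig = @eigval R d. Proof. exact: (svalP (seal _)). Qed.
Lemma mxfun_hfun : @mxfun R d = hfun. Proof. exact: esym (svalP (seal _)). Qed.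
Lemma hfunE f A : hfun f A = \sum_i (f (heig A i))%:C *: hproj A i.
Proof. by rewrite -mxfun_hfun heigE hprojE. Qed.

Lemma hproj_resolution A : resolution (hproj A).
Proof.
have US : spectralmx A \in unitmx by exact: spectral_unit.
rewrite hprojE /eigproj; split.
- move=> i; rewrite !dagM spectralmxV trmxCK mulmxA; congr (_ *m _ *m _).
  by rewrite trmx_delta map_delta_mx.
- move=> i j; rewrite -!mulmxA mulKVmx // (mulmxA (delta_mx i i)) mul_delta_mx_cond.
  by rewrite mulrb; case: eqP => [->|_] //; rewrite mul0mx mulmx0.
- rewrite -mulmx_suml -mulmx_sumr.
  have -> : \sum_i delta_mx i i = 1%:M :> M.
    apply/matrixP => i j; rewrite summxE mxE (bigD1 i) //= big1 ?addr0 ?mxE ?eqxx //=.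
      by rewrite eq_sym.
    by move=> k ki; rewrite mxE eq_sym (negbTE ki).
  by rewrite mulmx1 mulVmx.
Qed.

Lemma resolution_mul n (P : 'I_n -> M) (f : 'I_n -> C) i : resolution P ->
  (\sum_k f k *: P k) *m P i = f i *: P i /\ P i *m (\sum_k f k *: P k) = f i *: P i.
Proof.
move=> [_ PP _]; split.
  rewrite mulmx_suml (bigD1 i isT).
  rewrite -[in X in X + _ = _]scalemxAl PP eqxx.
  rewrite big1 ?addr0 // => j ji.
  by rewrite -scalemxAl PP (negbTE ji) scaler0.
rewrite mulmx_sumr (bigD1 i isT).
rewrite -[in X in X + _ = _]scalemxAr PP eqxx.
rewrite big1 ?addr0 // => j ji.
by rewrite -scalemxAr PP eq_sym (negbTE ji) scaler0.
Qed.

Lemma hproj_neq0 A i : hproj A i <> 0.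
Proof.
have US : spectralmx A \in unitmx by exact: spectral_unit.
move=> h; have : spectralmx A *m hproj A i *m invmx (spectralmx A) = 0.
  by rewrite h mulmx0 mul0mx.
rewrite hprojE /eigproj !mulmxA mulmxV // mul1mx mulmxK // => /matrixP /(_ i i).
by rewrite !mxE !eqxx => /eqP; rewrite oner_eq0.
Qed.

Lemma hprojsum A : A ^t* = A -> A = \sum_i (heig A i)%:C *: hproj A i.
Proof. by rewrite hprojE heigE; exact: eigprojE. Qed.

Lemma hproj_eig A i : A ^t* = A ->
  A *m hproj A i = (heig A i)%:C *: hproj A i /\
  hproj A i *m A = (heig A i)%:C *: hproj A i.
Proof.
move=> hA; have := resolution_mul (fun k => (heig A k)%:C) i (hproj_resolution A).
by rewrite -(hprojsum hA).
Qed.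

Lemma hproj_ip_gt0 A i : 0 < ip (hproj A i) (hproj A i).
Proof.
rewrite lt_def ip_ge0 andbT; apply/eqP => h.
by apply: (@hproj_neq0 A i); apply: ip_eq0.
Qed.

Lemma hfun_adj f A : (hfun f A) ^t* = hfun f A.
Proof.
rewrite hfunE dag_sum; apply: eq_bigr => i _; rewrite dagZr.
by have [->] := hproj_resolution A.
Qed.

(** The functional calculus does not depend on the eigenbasis chosen by [spectralmx]:
    [hproj A i *m P j] vanishes unless the two eigenvalues agree. This is what makes composition
    work, since [hfun h A] comes with an eigenbasis of its own. *)
Lemma hfunP n (P : 'I_n -> M) (l : 'I_n -> R) f A : A ^t* = A ->
  \sum_i P i = 1%:M -> (forall i, A *m P i = (l i)%:C *: P i) ->
  hfun f A = \sum_i (f (l i))%:C *: P i.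
Proof.
move=> hA P1 AP; rewrite -[LHS]mulmx1 -P1 mulmx_sumr; apply: eq_bigr => j _.
have [_ _ E1] := hproj_resolution A.
have PE : P j = \sum_i hproj A i *m P j by rewrite -mulmx_suml E1 mul1mx.
rewrite [in RHS]PE scaler_sumr hfunE mulmx_suml.
apply: eq_bigr => i _; rewrite -scalemxAl.
have [-> //|ne] := eqVneq (heig A i) (l j).
suff -> : hproj A i *m P j = 0 by rewrite !scaler0.
have : hproj A i *m A *m P j = hproj A i *m (A *m P j) by rewrite mulmxA.
rewrite (hproj_eig i hA).2 AP -scalemxAl -scalemxAr => /eqP.
rewrite -subr_eq0 -scalerBl scaler_eq0 => /orP[|/eqP //].
rewrite -rmorphB /= => /eqP/(congr1 (@complex.Re R)) /= /eqP.
by rewrite subr_eq0 (negbTE ne).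
Qed.

Lemma hfun_eigproj f A i : hfun f A *m hproj A i = (f (heig A i))%:C *: hproj A i.
Proof.
rewrite hfunE; exact: (resolution_mul (fun k => (f (heig A k))%:C) i (hproj_resolution A)).1.
Qed.

Lemma hfun_comp f h A : hfun f (hfun h A) = hfun (f \o h) A.
Proof.
rewrite [RHS]hfunE; apply: hfunP; [exact: hfun_adj|by have [] := hproj_resolution A|].
by move=> i; exact: hfun_eigproj.
Qed.

Lemma hfunM f h A : hfun f A *m hfun h A = hfun (fun x => f x * h x) A.
Proof.
rewrite [in LHS](hfunE h) [in RHS]hfunE mulmx_sumr; apply: eq_bigr => i _.
by rewrite -scalemxAr hfun_eigproj scalerA mulrC -rmorphM.
Qed.

Lemma hfun_ext f h A : (forall i, f (heig A i) = h (heig A i)) ->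
  hfun f A = hfun h A.
Proof. by move=> fh; rewrite !hfunE; apply: eq_bigr => i _; rewrite fh. Qed.

Lemma hfun_id A : A ^t* = A -> hfun id A = A.
Proof. by move=> hA; rewrite hfunE; exact: esym (hprojsum hA). Qed.

Lemma hfun_cst r A : hfun (fun=> r) A = r%:C%:M.
Proof.
have [_ _ E1] := hproj_resolution A.
by rewrite hfunE -scaler_sumr E1 scalemx1.
Qed.

Lemma hfunD f h A : hfun f A + hfun h A = hfun (fun x => f x + h x) A.
Proof.
by rewrite !hfunE -big_split; apply: eq_bigr => i _; rewrite rmorphD scalerDl.
Qed.

Lemma hfunZ r f A : r%:C *: hfun f A = hfun (fun x => r * f x) A.
Proof.
by rewrite !hfunE scaler_sumr; apply: eq_bigr => i _; rewrite rmorphM scalerA.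
Qed.

Lemma hfun_quad f A Z :
  ip Z (hfun f A *m Z) = \sum_i f (heig A i) * ip (hproj A i *m Z) (hproj A i *m Z).
Proof.
rewrite hfunE mulmx_suml ip_sumr; apply: eq_bigr => i _.
rewrite -scalemxAl ipZr; congr (_ * _).
have [P PP _] := hproj_resolution A.
by rewrite ip_mull P mulmxA PP eqxx.
Qed.

Lemma colE (Z : M) A k :
  (Z ^t* *m A *m Z) k k = ((col k Z) ^t* *m A *m col k Z) 0 0.
Proof.
rewrite !mxE; apply: eq_bigr => j _; rewrite !mxE; congr (_ * _).
by apply: eq_bigr => i _; rewrite !mxE.
Qed.

Lemma hfun_herm_eq0 A : A ^t* = A -> (forall Z, \tr (Z ^t* *m A *m Z) = 0) -> A = 0.
Proof.
move=> hA A0; rewrite (hprojsum hA) big1 // => i _.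
have := A0 (hproj A i); rewrite -mulmxA (hproj_eig i hA).1 -scalemxAr mxtraceZ => h.
have : (heig A i)%:C = 0.
  have := congr1 (@complex.Re R) h; rewrite ReZ => /= /eqP; rewrite mulf_eq0.
  have /lt0r_neq0/negbTE := hproj_ip_gt0 A i; rewrite ip_def => -> /orP[/eqP->|] //.
by move=> ->; rewrite scale0r.
Qed.

(** The quadratic form of A is real, so that of A minus its adjoint vanishes; multiplied by i this
    difference is Hermitian, and its spectral decomposition forces it to be 0. *)
Lemma psd_adj A : psd A -> A ^t* = A.
Proof.
move=> pA; pose D := A - A ^t*; pose H := 'i *: D.
suff : H = 0.
  move=> /eqP; rewrite scaler_eq0 => /orP[|].
    by rewrite (negbTE (neq0Ci _)).
  by rewrite subr_eq0 => /eqP <-.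
apply: hfun_herm_eq0.
  by rewrite /H dagZ conjCi /D dagB trmxCK scaleNr -scalerN opprB.
move=> Z; rewrite -scalemxAr -scalemxAl mxtraceZ /mxtrace big1 ?mulr0 // => k _.
rewrite colE; have := pA (col k Z); move: (col k Z) => v h.
have -> : v ^t* *m D *m v = v ^t* *m A *m v - (v ^t* *m A *m v) ^t*.
  by rewrite /D mulmxBr mulmxBl !dagM trmxCK mulmxA.
by move: h; move: (v ^t* *m A *m v) => X h; rewrite !mxE (geC0_conj h) subrr.
Qed.

Lemma ip_mulE Z A : ip Z (A *m Z) = \sum_k complex.Re ((Z ^t* *m A *m Z) k k).
Proof. by rewrite ip_def mulmxA /mxtrace Re_sum. Qed.

(** Square test matrices replace vectors: the columns of Z give one direction, and Z = [hproj A i]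
    reveals the sign of each eigenvalue in the other. *)
Lemma psdP A : psd A <-> A ^t* = A /\ forall Z, 0 <= ip Z (A *m Z).
Proof.
split=> [pA|[hA A0]].
  split; first exact: psd_adj.
  move=> Z; rewrite ip_mulE; apply: sumr_ge0 => k _; rewrite colE.
  by have := pA (col k Z); rewrite lecP => /andP[].
move=> v; rewrite (hprojsum hA) mulmx_sumr mulmx_suml summxE.
apply: sumr_ge0 => i _; rewrite -scalemxAr -scalemxAl mxE.
apply: mulr_ge0.
  have := A0 (hproj A i); rewrite (hproj_eig i hA).1 ipZr.
  by rewrite pmulr_lge0 ?hproj_ip_gt0 // lecR.
have [P PP _] := hproj_resolution A.
have : (hproj A i) ^t* *m hproj A i = hproj A i by rewrite P PP eqxx.
move: (hproj A i) => E <-.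
have -> : v ^t* *m (E ^t* *m E) *m v = (E *m v) ^t* *m (E *m v) by rewrite dagM !mulmxA.
move: (E *m v) => w.
rewrite mxE; apply: sumr_ge0 => k _.
have -> : (w ^t*) 0 k = Num.conj (w k 0) by rewrite mxE mxE.
by rewrite mulrC mul_conjC_ge0.
Qed.

End InnerProduct.

Lemma cvg_sum_fin (R : realType) (T : Type) (F : set_system T) (I : Type) (s : seq I)
    (f : I -> T -> R) (l : I -> R) : Filter F ->
  (forall i, f i x @[x --> F] --> l i) ->
  \sum_(i <- s) f i x @[x --> F] --> \sum_(i <- s) l i.
Proof.
move=> FF fl; elim: s => [|i s IH].
  by rewrite big_nil; under eq_fun do rewrite big_nil; exact: cvg_cst.
by rewrite big_cons; under eq_fun do rewrite big_cons; apply: cvgD.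
Qed.

(** * The Loewner order, matrix powers and the Loewner-Heinz inequality *)

Section Order.
Variables (R : realType) (d : nat).
Local Notation C := R[i].
Local Notation M := 'M[C]_d.
Implicit Types (A B X Y Z : M) (r : R).

Lemma psd0 : psd (0 : M).
Proof. by apply/psdP; split=> [|Z]; rewrite ?dag0 // mul0mx ip0r. Qed.
Lemma psdD A B : psd A -> psd B -> psd (A + B).
Proof.
move=> /psdP[hA A0] /psdP[hB B0]; apply/psdP; split; first by rewrite dagD hA hB.
by move=> Z; rewrite mulmxDl ipDr addr_ge0.
Qed.
Lemma psdZ r A : 0 <= r -> psd A -> psd (r%:C *: A).
Proof.
move=> r0 /psdP[hA A0]; apply/psdP; split; first by rewrite dagZr hA.
by move=> Z; rewrite -scalemxAl ipZr mulr_ge0.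
Qed.
Lemma psd_conj X A : psd A -> psd (X ^t* *m A *m X).
Proof.
move=> /psdP[hA A0]; apply/psdP; split; first by rewrite !dagM trmxCK hA mulmxA.
by move=> Z; rewrite -!mulmxA -{1}(trmxCK X) -ip_mull trmxCK.
Qed.
Lemma psd_adjM X : psd (X ^t* *m X).
Proof.
apply/psdP; split; first by rewrite dagM trmxCK.
by move=> Z; rewrite -mulmxA -ip_mull ip_ge0.
Qed.
Lemma psd1 : psd (1%:M : M).
Proof. by have := psd_adjM 1%:M; rewrite mulmx1 dag1. Qed.
Lemma psd_scalar r : 0 <= r -> psd (r%:C%:M : M).
Proof. by move=> r0; rewrite -scalemx1; apply: psdZ => //; exact: psd1. Qed.
Lemma psd_refl A : psd (A - A).
Proof. by rewrite subrr; exact: psd0. Qed.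
Lemma psd_trans B A X : psd (B - A) -> psd (X - B) -> psd (X - A).
Proof. by move=> AB BX; have := psdD BX AB; rewrite addrA subrK. Qed.
Lemma psd_le_conj X A B : psd (B - A) -> psd (X ^t* *m B *m X - X ^t* *m A *m X).
Proof. by move=> /(psd_conj X); rewrite mulmxBr mulmxBl. Qed.
Lemma psd_leZ r A B : 0 <= r -> psd (B - A) -> psd (r%:C *: B - r%:C *: A).
Proof. by move=> r0 /(psdZ r0); rewrite scalerBr. Qed.

Lemma psd_hfun (f : R -> R) A : (forall i, 0 <= f (heig A i)) -> psd (hfun f A).
Proof.
move=> f0; apply/psdP; split; first exact: hfun_adj.
by move=> Z; rewrite hfun_quad; apply: sumr_ge0 => i _; rewrite mulr_ge0 ?ip_ge0.
Qed.

Lemma eigval_ge A e i : psd (A - e%:C%:M) -> e <= heig A i.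
Proof.
move=> pA; have hA : A ^t* = A.
  by have := psd_adj pA; rewrite dagB dag_scalar => /(addIr _).
have [_ /(_ (hproj A i))] := (psdP _).1 pA.
rewrite mulmxBl (hproj_eig i hA).1 mul_scalar_mx -scalerBl -rmorphB ipZr.
by rewrite pmulr_lge0 ?hproj_ip_gt0 // subr_ge0.
Qed.

Lemma eigval_psd A i : psd A -> 0 <= heig A i.
Proof. by move=> pA; apply: eigval_ge; rewrite raddf0 subr0. Qed.

Lemma hfun_sub_cst A e : A ^t* = A -> A - e%:C%:M = hfun (fun x => x - e) A.
Proof.
move=> hA; rewrite -(hfunD (fun x => x) (fun=> - e)) hfun_cst.
by rewrite (hfun_id hA) raddfN raddfN.
Qed.

Lemma psd_eigval_ge A e : A ^t* = A -> (forall i, e <= heig A i) -> psd (A - e%:C%:M).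
Proof.
by move=> hA h; rewrite hfun_sub_cst //; apply: psd_hfun => i; rewrite subr_ge0.
Qed.

Lemma psd_eigval_le A e : A ^t* = A -> (forall i, heig A i <= e) -> psd (e%:C%:M - A).
Proof.
move=> hA h; rewrite -opprB hfun_sub_cst //.
have -> : - hfun (fun x => x - e) A = hfun (fun x => -1 * (x - e)) A.
  by rewrite -hfunZ rmorphN1 scaleN1r.
by apply: psd_hfun => i; rewrite mulN1r opprB subr_ge0.
Qed.

(* Uniformly positive definite, which in finite dimension is invertibility of a psd matrix. *)
Definition pd : M -> Prop := sval (seal (fun A => exists2 e : R, 0 < e & psd (A - e%:C%:M))).
Lemma pdP A : pd A <-> exists2 e : R, 0 < e & psd (A - e%:C%:M).
Proof. by rewrite /pd (svalP (seal _)). Qed.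

Lemma pd_psd A : pd A -> psd A.
Proof.
move=> /pdP[e e0 /psdD]/(_ _ (psd_scalar (ltW e0))).
by rewrite subrK.
Qed.
Lemma pd_adj A : pd A -> A ^t* = A.
Proof. by move/pd_psd/psd_adj. Qed.
Lemma pd_eigval A i : pd A -> 0 < heig A i.
Proof. by move=> /pdP[e e0 /eigval_ge eA]; rewrite (lt_le_trans e0). Qed.

Lemma pd_of_eigval A : A ^t* = A -> (forall i, 0 < heig A i) -> pd A.
Proof.
move=> hA h; apply/pdP; exists (\big[Num.min/1]_i heig A i).
  by elim/big_ind: _ => // x y x0 y0; rewrite lt_min x0.
apply: psd_eigval_ge => // i; exact: bigmin_le_cond.
Qed.

Lemma pd_ge A B : pd A -> psd (B - A) -> pd B.
Proof.
move=> /pdP[e e0 eA] AB; apply/pdP; exists e; [exact: e0|exact: psd_trans eA AB].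
Qed.

Definition mxpow : M -> R -> M := sval (seal (fun A r => hfun (fun x => x `^ r) A)).
Lemma mxpowE A r : mxpow A r = hfun (fun x => x `^ r) A.
Proof. by rewrite /mxpow (svalP (seal _)). Qed.

Lemma mxpow_adj A r : (mxpow A r) ^t* = mxpow A r.
Proof. by rewrite mxpowE hfun_adj. Qed.
Lemma mxpowD A r s : pd A -> mxpow A r *m mxpow A s = mxpow A (r + s).
Proof.
move=> pA; rewrite !mxpowE hfunM; apply: hfun_ext => i; rewrite powRD //.
by apply/implyP => _; rewrite gt_eqF // pd_eigval.
Qed.
Lemma mxpowDA X A r s : pd A -> X *m mxpow A r *m mxpow A s = X *m mxpow A (r + s).
Proof. by move=> pA; rewrite -mulmxA mxpowD. Qed.
Lemma mxpow0 A : mxpow A 0 = 1%:M.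
Proof.
have -> : mxpow A 0 = hfun (fun=> 1) A by rewrite mxpowE; apply: hfun_ext => i; rewrite powRr0.
by rewrite hfun_cst.
Qed.
Lemma mxpow1 A : pd A -> mxpow A 1 = A.
Proof.
move=> pA; rewrite mxpowE -[RHS]hfun_id ?pd_adj //; apply: hfun_ext => i.
by rewrite powRr1 // ltW // pd_eigval.
Qed.
Lemma mxpowN A r : pd A -> mxpow A (- r) *m mxpow A r = 1%:M.
Proof. by move=> pA; rewrite mxpowD // addNr mxpow0. Qed.
Lemma mxpowNr A r : pd A -> mxpow A r *m mxpow A (- r) = 1%:M.
Proof. by move=> pA; rewrite mxpowD // subrr mxpow0. Qed.

Lemma psd_pd A : psd A -> A \in unitmx -> pd A.
Proof.
move=> pA uA; have hA := psd_adj pA; apply: pd_of_eigval => // i.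
rewrite lt_def eigval_psd // andbT; apply/eqP => h.
apply: (@hproj_neq0 _ _ A i); rewrite -(mulKmx uA (hproj A i)) (hproj_eig i hA).1 h.
by rewrite scale0r mulmx0.
Qed.
Lemma pd_unit A : pd A -> A \in unitmx.
Proof.
move=> pA; have := mxpowNr 1 pA; rewrite mxpow1 // => h.
by have [] := mulmx1_unit h.
Qed.
Lemma unitmx_dag X : X \in unitmx -> X ^t* \in unitmx.
Proof.
move=> uX; suff : X ^t* *m (invmx X) ^t* = 1%:M by case/mulmx1_unit.
by rewrite -dagM mulVmx // dag1.
Qed.
Lemma pd_conj X A : X \in unitmx -> pd A -> pd (X ^t* *m A *m X).
Proof.
move=> uX pA; apply: psd_pd; first exact/psd_conj/pd_psd.
by rewrite unitmx_mul uX unitmx_mul unitmx_dag // pd_unit.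
Qed.
Lemma pdZ r A : 0 < r -> pd A -> pd (r%:C *: A).
Proof.
move=> r0 /pdP[e e0 eA]; apply/pdP; exists (r * e); first exact: mulr_gt0.
have -> : (r * e)%:C%:M = r%:C *: (e%:C%:M : M) by rewrite scale_scalar_mx rmorphM.
by rewrite -scalerBr; apply: psdZ; [exact: ltW|exact: eA].
Qed.

Lemma ip_psd_le A B Z : psd (B - A) -> ip Z (A *m Z) <= ip Z (B *m Z).
Proof. by move=> /psdP[_ /(_ Z)]; rewrite mulmxBl ipBr subr_ge0. Qed.

Definition contraction X := forall Z, ip (X *m Z) (X *m Z) <= ip Z Z.

Lemma contractionP X : psd (1%:M - X ^t* *m X) -> contraction X.
Proof. by move=> h Z; rewrite ip_mull mulmxA; have := ip_psd_le Z h; rewrite mul1mx. Qed.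

(** With Y the image of Z under the adjoint of X, expand |Z - X Y|^2 >= 0 and bound |X Y| by |Y|. *)
Lemma contraction_adj X : contraction X -> contraction (X ^t*).
Proof.
move=> h Z; set Y := X ^t* *m Z.
have := ip_ge0 (Z - X *m Y); rewrite ipBr !ipBl (ip_sym Z).
have -> : ip (X *m Y) Z = ip Y Y by rewrite ip_mull.
by have := h Y; set a := ip _ _; set b := ip _ _; set c := ip _ _; lra.
Qed.

Lemma contractionM X Y : contraction X -> contraction Y -> contraction (X *m Y).
Proof. by move=> hX hY Z; rewrite -mulmxA (le_trans (hX _)). Qed.

Section LoewnerHeinz.
Variables (A B : M).
Hypotheses (pA : pd A) (AB : psd (B - A)).
Let pB : pd B := pd_ge pA AB.
(** Exponents for which the inequality holds. They include 0 and 1 and are stable under midpoints,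
    so they approximate every r in [0, 1]; continuity in r concludes. *)
Let H r := psd (mxpow A (- r) - mxpow B (- r)).

Let H0 : H 0. Proof. by rewrite /H oppr0 !mxpow0; exact: psd_refl. Qed.

(** With A W = B Y = Z, combine <W - Y, A (W - Y)> >= 0 with <Y, A Y> <= <Y, B Y> to get <Y, Z> <=
    <W, Z>. *)
Let H1 : H 1.
Proof.
apply/psdP; split; first by rewrite dagB !mxpow_adj.
move=> Z; rewrite mulmxBl ipBr subr_ge0.
set Y := mxpow B (- 1) *m Z; set W := mxpow A (- 1) *m Z.
have BY : B *m Y = Z by rewrite -{1}(mxpow1 pB) mulmxA (mxpowNr _ pB) mul1mx.
have AW : A *m W = Z by rewrite -{1}(mxpow1 pA) mulmxA (mxpowNr _ pA) mul1mx.
have [_ /(_ (W - Y))] := (psdP _).1 (pd_psd pA).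
have := ip_psd_le Y AB; rewrite mulmxBr AW BY !ipBl !ipBr.
have -> : ip W (A *m Y) = ip Z Y by rewrite -{1}(pd_adj pA) -ip_mull AW.
rewrite (ip_sym W Z) (ip_sym Y Z).
by set a := ip _ _; set b := ip _ _; set c := ip _ _; lra.
Qed.

(** Sandwiching B^(-r) <= A^(-r) between two factors A^(r/2) bounds the square modulus of the
    product by 1. *)
Let H_contraction r : H r ->
  contraction (mxpow B (- (r / 2)) *m mxpow A (r / 2)).
Proof.
move=> Hr; apply: contractionP; rewrite dagM !mxpow_adj mulmxA.
rewrite (mxpowDA _ _ _ pB).
have := psd_le_conj (mxpow A (r / 2)) Hr; rewrite mxpow_adj.
rewrite (mxpowD _ _ pA) (mxpowD _ _ pA).
have -> : r / 2 - r + r / 2 = 0 by field.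
have -> : - (r / 2) - r / 2 = - r by field.
by rewrite mxpow0.
Qed.

(* Pedersen's argument: A^(m/2) B^-m A^(m/2) is similar to a product of two contractions. *)
Let H_mid r s : H r -> H s -> H ((r + s) / 2).
Proof.
move=> Hr Hs; set m := (r + s) / 2.
pose T := mxpow A (m / 2) *m mxpow B (- m) *m mxpow A (m / 2).
have hT : T ^t* = T by rewrite /T !dagM !mxpow_adj mulmxA.
have hT1 : psd (1%:C%:M - T).
  apply: psd_eigval_le => // i.
  (* Conjugation by S redistributes the powers of A: S T is S multiplied on the left by A^(s/2)
     B^(-m) A^(r/2), the product of the contractions for s and r. Each eigenvalue of T is thus an
     eigenvalue of a contraction. *)
  pose S := mxpow A ((s - r) / 4).
  pose Z := S *m hproj T i.
  have Z0 : 0 < ip Z Z.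
    rewrite lt_def ip_ge0 andbT; apply/eqP => /ip_eq0 Z0.
    apply: (@hproj_neq0 _ _ T i).
    by rewrite -[LHS]mul1mx -(mxpowN ((s - r) / 4) pA) -mulmxA -/S -/Z Z0 mulmx0.
  have K : contraction (mxpow A (s / 2) *m mxpow B (- m) *m mxpow A (r / 2)).
    have -> : mxpow B (- m) = mxpow B (- (s / 2)) *m mxpow B (- (r / 2)).
      by rewrite (mxpowD _ _ pB); congr mxpow; rewrite /m; field.
    rewrite mulmxA -mulmxA; apply: contractionM; last exact: H_contraction.
    by have := contraction_adj (H_contraction Hs); rewrite dagM !mxpow_adj.
  have KZ : mxpow A (s / 2) *m mxpow B (- m) *m mxpow A (r / 2) *m Z
      = (heig T i)%:C *: Z.
    have KS : mxpow A (s / 2) *m mxpow B (- m) *m mxpow A (r / 2) *m S = S *m T.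
      rewrite -mulmxA (mxpowD _ _ pA) /T !mulmxA (mxpowD _ _ pA).
      have -> : r / 2 + (s - r) / 4 = m / 2 by rewrite /m; field.
      by have -> : (s - r) / 4 + m / 2 = s / 2 by rewrite /m; field.
    by rewrite /Z mulmxA KS -mulmxA (hproj_eig i hT).1 -scalemxAr.
  have := K Z; rewrite KZ ipZl ipZr mulrA ger_pMl //.
  have [/ltW/le_trans -> //|] := ltP (heig T i) 0.
  by move=> T0; rewrite -expr2 expr_le1.
have := psd_conj (mxpow A (- (m / 2))) hT1.
rewrite mxpow_adj mulmxBr mulmxBl mulmx1 (mxpowD _ _ pA) /T !mulmxA (mxpowN _ pA) mul1mx.
rewrite -!mulmxA (mxpowNr _ pA) mulmx1.
by have -> : - (m / 2) - m / 2 = - m by field.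
Qed.

Let H_dyadic n r : 0 <= r <= 1 -> exists a b, [/\ H a, H b, a <= r <= b & b - a = (2 ^+ n)^-1].
Proof.
move=> r01; elim: n => [|n [a [b [Ha Hb /andP[ar rb] ba]]]].
  by exists 0, 1; split; [exact: H0|exact: H1|exact: r01|rewrite subr0 expr0 invr1].
have [rm|mr] := leP r ((a + b) / 2).
  exists a, ((a + b) / 2); split; [exact: Ha|exact: H_mid|by rewrite ar|].
  by rewrite exprSr invfM -ba; field.
exists ((a + b) / 2), b; split; [exact: H_mid|exact: Hb|by rewrite rb ltW|].
by rewrite exprSr invfM -ba; field.
Qed.

Lemma mxpow_antitone r : 0 <= r <= 1 -> psd (mxpow A (- r) - mxpow B (- r)).
Proof.
move=> r01; have [u Hu] := choice (fun n => H_dyadic n r01).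
have ur : u n @[n --> \oo] --> r.
  apply/cvgrPdist_le => e e0; near=> n.
  have [b [_ _ /andP[ar rb] ba]] := Hu n.
  rewrite ger0_norm ?subr_ge0 //; apply: (@le_trans _ _ (2 ^+ n)^-1); first by lra.
  near: n; have h1 : `|2^-1| < 1 :> R by rewrite ger0_norm ?invr_ge0 // invf_lt1 // ltr1n.
  have /cvgrPdist_le/(_ e e0) := cvg_geometric 1 h1; apply: filterS => n.
  by rewrite /geometric /= mul1r sub0r normrN exprVn ger0_norm ?invr_ge0 ?exprn_ge0.
apply/psdP; split; first by rewrite dagB !mxpow_adj.
move=> Z; apply: (@cvgr_to_ge _ \oo _ R (fun n => ip Z ((mxpow A (- u n) - mxpow B (- u n)) *m Z))).
  have powZ X : pd X -> ip Z (mxpow X (- u n) *m Z) @[n --> \oo] --> ip Z (mxpow X (- r) *m Z).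
    move=> pX.
    have E t : ip Z (mxpow X t *m Z) =
        \sum_i expR (t * ln (heig X i)) * ip (hproj X i *m Z) (hproj X i *m Z).
      rewrite mxpowE hfun_quad; apply: eq_bigr => i _.
      by rewrite /powR gt_eqF // pd_eigval.
    rewrite E; under eq_fun do rewrite E.
    apply: cvg_sum_fin => i; apply: cvgMr_tmp; apply: continuous_cvg; first exact: continuous_expR.
    by apply: cvgMr_tmp; exact: cvgN.
  rewrite mulmxBl ipBr; under eq_fun do rewrite mulmxBl ipBr.
  by apply: cvgB; exact: powZ.
by near=> n; have [b [Hn _ _ _]] := Hu n; have [_] := (psdP _).1 Hn.
Unshelve. all: by end_near. Qed.

End LoewnerHeinz.

End Order.

Lemma is_derive_ext (R : realType) (f g : R -> R) (x a b : R) :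
  is_derive x (1 : R) f a -> f =1 g -> a = b -> is_derive x (1 : R) g b.
Proof. by move=> h /funext <- <-. Qed.

(** * Divided differences of a power as antitone matrix functions *)

Section DividedDifference.
Variables (R : realType) (d : nat).
Local Notation C := R[i].
Local Notation M := 'M[C]_d.
Implicit Types (A B X Y Z : M) (r : R).

Lemma hfun_quad_is_derive (G : R -> R -> R) (dG : R -> R -> R) A Z (s : R) :
  (forall i, is_derive (s : R) (1 : R) (G^~ (heig A i)) (dG s (heig A i))) ->
  is_derive (s : R) (1 : R) (fun t => ip Z (hfun (G t) A *m Z)) (ip Z (hfun (dG s) A *m Z)).
Proof.
move=> h; under eq_fun do rewrite hfun_quad.
rewrite hfun_quad.
have -> : (fun t => \sum_i G t (heig A i) * ip (hproj A i *m Z) (hproj A i *m Z)) =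
  \sum_i (fun t => G t (heig A i) * ip (hproj A i *m Z) (hproj A i *m Z)).
  by apply/funext => t; rewrite fct_sumE.
apply: is_derive_sum => i.
have -> : (fun t => G t (heig A i) * ip (hproj A i *m Z) (hproj A i *m Z)) =
  ip (hproj A i *m Z) (hproj A i *m Z) *: (G^~ (heig A i)).
  by apply/funext => t /=; rewrite /GRing.scale /= mulrC.
by apply: is_derive_eq; rewrite /GRing.scale /= mulrC.
Qed.

(** Closed form of the integral over u in [0, s] of (u x + (1 - u) y)^(q - 1). At s = 1 and q = p -
    1 it is the reciprocal of [theta p x y]. *)
Definition divdiff_path (q y s x : R) : R :=
  if x == y then s * y `^ (q - 1) else ((s * x + (1 - s) * y) `^ q - y `^ q) / (q * (x - y)).

Lemma divdiff_path_is_derive (q y s x : R) : 0 < q -> 0 < x -> 0 < y -> 0 <= s <= 1 ->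
  is_derive (s : R) (1 : R) (fun t => divdiff_path q y t x) ((s * x + (1 - s) * y) `^ (q - 1)).
Proof.
move=> q0 x0 y0 /andP[s0 s1]; rewrite /divdiff_path.
have [->|xy] := eqVneq x y.
  have -> : s * y + (1 - s) * y = y by ring.
  apply: (is_derive_ext (is_deriveZ (y `^ (q - 1)) (is_derive_id s (1 : R)))).
    by move=> t; exact: mulrC.
  exact: mulr1.
have b0 : 0 < s * x + (1 - s) * y by nra.
pose g := fun t : R => t * x + (1 - t) * y.
have dg : is_derive s (1 : R) g (x - y).
  apply: (is_derive_ext (is_deriveD (is_derive_cst y s (1 : R))
    (is_deriveZ (x - y) (is_derive_id s (1 : R))))).
    move=> t; rewrite /g; transitivity (y + (x - y) * t) => //; ring.
  by rewrite add0r; exact: mulr1.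
have dp := @is_derive1_comp R _ g s _ _ (is_derive1_powR q (b0 : 0 < g s)) dg.
apply: (is_derive_ext (is_deriveZ (q * (x - y))^-1
    (is_deriveB dp (is_derive_cst (y `^ q) s (1 : R))))).
  by move=> t; exact: mulrC.
rewrite subr0; transitivity ((q * (x - y))^-1 * (q * g s `^ (q - 1) * (x - y))) => //.
rewrite /g; field.
by rewrite subr_eq0 xy gt_eqF.
Qed.

(** The derivative in s applies the power q - 1, which lies in ]-1, 0], to an increasing affine
    function of the matrix, so [mxpow_antitone] gives the sign of the difference of derivatives; the
    difference itself grows from 0 at s = 0. *)
Lemma divdiff_antitone q y A B : 0 < q <= 1 -> 0 < y -> pd A -> psd (B - A) ->
  psd (hfun (divdiff_path q y 1) A - hfun (divdiff_path q y 1) B).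
Proof.
move=> /andP[q0 q1] y0 pA AB; have pB := pd_ge pA AB.
apply/psdP; split; first by rewrite dagB !hfun_adj.
move=> Z; pose u s := ip Z (hfun (divdiff_path q y s) A *m Z) - ip Z (hfun (divdiff_path q y s) B *m Z).
have u0 : u 0 = 0.
  rewrite /u !(@hfun_ext _ _ (divdiff_path q y 0) (fun=> 0)) ?hfun_cst ?subrr // => i.
    by rewrite /divdiff_path !mul0r subr0 mul1r add0r subrr mul0r; case: ifP.
  by rewrite /divdiff_path !mul0r subr0 mul1r add0r subrr mul0r; case: ifP.
rewrite mulmxBl ipBr -/(u 1) -u0.
pose du s := ip Z (hfun (fun x => (s * x + (1 - s) * y) `^ (q - 1)) A *m Z) -
  ip Z (hfun (fun x => (s * x + (1 - s) * y) `^ (q - 1)) B *m Z).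
have udu s : 0 <= s <= 1 -> is_derive (s : R) (1 : R) u (du s).
  move=> s01; have quad X : pd X -> is_derive s (1 : R)
      (fun t => ip Z (hfun (divdiff_path q y t) X *m Z))
      (ip Z (hfun (fun x => (s * x + (1 - s) * y) `^ (q - 1)) X *m Z)).
    move=> pX; apply: (@hfun_quad_is_derive (divdiff_path q y)
      (fun s x => (s * x + (1 - s) * y) `^ (q - 1))) => i.
    by apply: divdiff_path_is_derive; rewrite ?q0 ?y0 ?pd_eigval.
  exact: is_deriveB (quad A pA) (quad B pB).
have du0 s : 0 < s < 1 -> 0 <= du s.
  move=> /andP[s0 s1].
  have E X : X ^t* = X -> s%:C *: X + ((1 - s) * y)%:C%:M = hfun (fun x => s * x + (1 - s) * y) X.
    by move=> hX; rewrite -(hfunD (fun x => s * x)) hfun_cst -(hfunZ s id) hfun_id.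
  pose A' := s%:C *: A + ((1 - s) * y)%:C%:M; pose B' := s%:C *: B + ((1 - s) * y)%:C%:M.
  have pA' : pd A'.
    apply/pdP; exists ((1 - s) * y); first by rewrite mulr_gt0 // subr_gt0.
    by rewrite addrK; apply: psdZ; [exact: ltW|exact: pd_psd].
  have AB' : psd (B' - A').
    by rewrite /A' /B' opprD addrACA subrr addr0 -scalerBr; apply: psdZ; [exact: ltW|exact: AB].
  have r01 : 0 <= 1 - q <= 1 by lra.
  have := mxpow_antitone pA' AB' r01.
  rewrite !mxpowE /A' /B' !E ?pd_adj // !hfun_comp => /psdP[_ /(_ Z)].
  by rewrite mulmxBl ipBr opprB.
apply: (@ger0_derive1_ndecr R u 0 1) => //.
- by move=> s; rewrite in_itv /= => /andP[s0 s1]; have [] := udu s; rewrite ?(ltW s0) ?(ltW s1).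
- move=> s; rewrite in_itv /= => /andP[s0 s1].
  have h := udu s; rewrite derive1E (@derive_val _ _ _ _ _ _ _ (h _)) ?(ltW s0) ?(ltW s1) //.
  by apply: du0; rewrite s0.
- apply: derivable_within_continuous => s; rewrite in_itv /= => s01.
  by have [] := udu s s01.
Qed.

End DividedDifference.

(** * Double functional calculus and monotonicity of the kernel 1 / theta *)

Section DoubleCalculus.
Variables (R : realType) (d : nat).
Local Notation C := R[i].
Local Notation M := 'M[C]_d.
Implicit Types (A B X Y Z : M) (r : R) (f g : R -> R -> R).

Definition hfun2 : (R -> R -> R) -> M -> M -> M -> M := sval (seal (@mxfun2 R d)).
Lemma mxfun2_hfun2 : @mxfun2 R d = hfun2. Proof. exact: esym (svalP (seal _)). Qed.
Lemma hfun2E f A B X : hfun2 f A B X =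
  \sum_i \sum_k (f (heig A i) (heig B k))%:C *: (hproj A i *m X *m hproj B k).
Proof. by rewrite -mxfun2_hfun2 heigE hprojE. Qed.

Lemma hfun2_right f A B X :
  hfun2 f A B X = \sum_i hproj A i *m X *m hfun (f (heig A i)) B.
Proof.
rewrite hfun2E; apply: eq_bigr => i _; rewrite hfunE mulmx_sumr.
by apply: eq_bigr => k _; rewrite -scalemxAr.
Qed.

Lemma hfun2_left f A B X :
  hfun2 f A B X = \sum_k hfun (f^~ (heig B k)) A *m X *m hproj B k.
Proof.
rewrite hfun2E exchange_big /=; apply: eq_bigr => k _; rewrite hfunE !mulmx_suml.
by apply: eq_bigr => i _; rewrite -!scalemxAl.
Qed.

Lemma hfun2_proj f A B X k :
  hfun2 f A B X *m hproj B k = hfun (f^~ (heig B k)) A *m X *m hproj B k.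
Proof.
have [_ PP _] := hproj_resolution B.
rewrite hfun2_left mulmx_suml (bigD1 k isT).
rewrite -[in X in X + _ = _]mulmxA PP eqxx.
rewrite big1 ?addr0 // => j jk.
by rewrite -mulmxA PP (negbTE jk) mulmx0.
Qed.

Lemma hfun2_comp f g A B X :
  hfun2 f A B (hfun2 g A B X) = hfun2 (fun x y => f x y * g x y) A B X.
Proof.
rewrite [LHS]hfun2_left [RHS]hfun2_left; apply: eq_bigr => k _.
by rewrite -mulmxA hfun2_proj !mulmxA hfunM.
Qed.

Lemma hfun2_ext f g A B X :
  (forall i k, f (heig A i) (heig B k) = g (heig A i) (heig B k)) ->
  hfun2 f A B X = hfun2 g A B X.
Proof.
move=> fg; rewrite !hfun2E; apply: eq_bigr => i _; apply: eq_bigr => k _.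
by rewrite fg.
Qed.

Lemma hfun2_1 A B X : hfun2 (fun _ _ => 1) A B X = X.
Proof.
have [_ _ P1] := hproj_resolution B.
rewrite hfun2_left; under eq_bigr do rewrite hfun_cst mul1mx.
by rewrite -mulmx_sumr P1 mulmx1.
Qed.

Lemma hfun2_adj f A B X : (hfun2 f A B X) ^t* = hfun2 (fun x y => f y x) B A (X ^t*).
Proof.
have [PA _ _] := hproj_resolution A; have [PB _ _] := hproj_resolution B.
rewrite !hfun2E dag_sum exchange_big; apply: eq_bigr => i _.
rewrite dag_sum; apply: eq_bigr => k _.
by rewrite dagZr !dagM PA PB mulmxA.
Qed.

Lemma hfun2D f A B X Y : hfun2 f A B (X + Y) = hfun2 f A B X + hfun2 f A B Y.
Proof.
by rewrite !hfun2_left -big_split; apply: eq_bigr => k _; rewrite mulmxDr mulmxDl.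
Qed.
Lemma hfun2Z f A B (c : C) X : hfun2 f A B (c *: X) = c *: hfun2 f A B X.
Proof.
rewrite !hfun2_left scaler_sumr; apply: eq_bigr => k _.
by rewrite -scalemxAr -scalemxAl.
Qed.

Lemma hfun2_scale f c A B X : A ^t* = A -> B ^t* = B ->
  hfun2 f (c%:C *: A) (c%:C *: B) X = hfun2 (fun x y => f (c * x) (c * y)) A B X.
Proof.
have cE (g : R -> R) (H : M) : H ^t* = H -> hfun g (c%:C *: H) = hfun (fun x => g (c * x)) H.
  by move=> hH; rewrite -{1}(hfun_id hH) hfunZ hfun_comp.
move=> hA hB; rewrite hfun2_left.
under eq_bigr do rewrite cE //.
rewrite -(hfun2_left (fun x y => f (c * x) y)) hfun2_right.
under eq_bigr do rewrite cE //.
by rewrite -(hfun2_right (fun x y => f (c * x) (c * y))).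
Qed.

Lemma hfun2_quad f A B X : ip X (hfun2 f A B X) = \sum_i \sum_k
  f (heig A i) (heig B k) * ip (hproj A i *m X *m hproj B k) (hproj A i *m X *m hproj B k).
Proof.
have [PA PPA _] := hproj_resolution A; have [PB PPB _] := hproj_resolution B.
rewrite hfun2E ip_sumr; apply: eq_bigr => i _; rewrite ip_sumr; apply: eq_bigr => k _.
rewrite ipZr; congr (_ * _).
by rewrite ip_mulr ip_mull PA PB -!mulmxA PPB eqxx !mulmxA PPA eqxx.
Qed.

(** Freezing the eigenvalue of B turns the double calculus into a sum of one-variable calculi in A,
    to which operator monotonicity applies. *)
Lemma hfun2_quad_left f A B X : ip X (hfun2 f A B X) =
  \sum_k ip (X *m hproj B k) (hfun (f^~ (heig B k)) A *m (X *m hproj B k)).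
Proof.
have [PB PPB _] := hproj_resolution B.
rewrite hfun2_left ip_sumr; apply: eq_bigr => k _.
by rewrite ip_mulr PB -!mulmxA PPB eqxx.
Qed.

Lemma hfun2_self_adj f A B X Y : ip X (hfun2 f A B Y) = ip (hfun2 f A B X) Y.
Proof.
have [PA _ _] := hproj_resolution A; have [PB _ _] := hproj_resolution B.
rewrite !hfun2E ip_sumr ip_suml; apply: eq_bigr => i _.
rewrite ip_sumr ip_suml; apply: eq_bigr => k _.
by rewrite ipZr ipZl ip_mulr ip_mull PA PB mulmxA.
Qed.

Variable p : R.
Hypothesis p12 : 1 < p <= 2.
Let p0 : 0 < p - 1. Proof. by rewrite subr_gt0; case/andP: p12. Qed.
Let p1 : p - 1 <= 1. Proof. by rewrite lerBlDr; case/andP: p12. Qed.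

(** Kernel of the inverse of the bracket. *)
Definition phi (x y : R) : R := (theta p x y)^-1.

Lemma powR_inj_pos (q x y : R) : 0 < q -> 0 < x -> 0 < y -> x `^ q = y `^ q -> x = y.
Proof.
move=> q0 x0 y0 /(congr1 (fun z => z `^ q^-1)).
by rewrite -!powRrM divff ?gt_eqF // !powRr1 // ltW.
Qed.

Lemma powR_sub_neq0 (q x y : R) : 0 < q -> 0 < x -> 0 < y -> x != y ->
  x `^ q - y `^ q != 0.
Proof.
move=> q0 x0 y0 xy; rewrite subr_eq0; apply/eqP => /(powR_inj_pos q0 x0 y0)/eqP.
by rewrite (negbTE xy).
Qed.

Lemma phi_divdiff x y : 0 < x -> 0 < y -> divdiff_path (p - 1) y 1 x = phi x y.
Proof.
move=> x0 y0.
rewrite /divdiff_path /phi /theta; have [->|xy] := eqVneq x y.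
  by rewrite -powRN mul1r; congr (_ `^ _); ring.
have h1 : x - y != 0 by rewrite subr_eq0.
have h2 : x `^ (p - 1) - y `^ (p - 1) != 0 by exact: powR_sub_neq0.
by rewrite mul1r subrr mul0r addr0; field; rewrite h1 h2 (gt_eqF p0).
Qed.

Lemma theta_sym x y : theta p x y = theta p y x.
Proof.
rewrite /theta eq_sym; case: eqVneq => [-> //|_]; congr (_ * _).
by rewrite -opprB -[X in _ / X]opprB invrN mulrNN.
Qed.

Lemma theta_gt0 x y : 0 < x -> 0 < y -> 0 < theta p x y.
Proof.
move=> x0 y0; rewrite /theta; case: eqVneq => [_|xy]; first exact: powR_gt0.
rewrite mulr_gt0 //.
have pos (a b : R) : 0 < a -> a < b -> 0 < (b - a) / (b `^ (p - 1) - a `^ (p - 1)).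
  move=> a0 ab; rewrite divr_gt0 ?subr_gt0 // gt0_ltr_powR // nnegrE ltW //.
  exact: lt_trans ab.
have [xy'|yx|] := ltgtP x y; last by move/eqP; rewrite (negbTE xy).
  by rewrite -opprB -[X in _ / X]opprB invrN mulrNN pos.
exact: pos.
Qed.

Lemma theta_homog c x y : 0 < c -> 0 < x -> 0 < y ->
  theta p (c * x) (c * y) = c `^ (2 - p) * theta p x y.
Proof.
move=> c0 x0 y0; rewrite /theta (inj_eq (mulfI (lt0r_neq0 c0))).
case: eqVneq => [_|xy]; first by rewrite powRM // ltW.
rewrite !powRM ?ltW //.
have -> : c `^ (2 - p) = c / c `^ (p - 1).
  rewrite -powRN -{2}(powRr1 (ltW c0)) -powRD; last by rewrite (gt_eqF c0) implybT.
  by congr (_ `^ _); ring.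
have h1 : x `^ (p - 1) - y `^ (p - 1) != 0 by exact: powR_sub_neq0.
have h2 : c `^ (p - 1) != 0 by rewrite gt_eqF ?powR_gt0.
by field; rewrite h1 h2 -mulrBr mulf_neq0.
Qed.

Lemma phi_gt0 x y : 0 < x -> 0 < y -> 0 < phi x y.
Proof. by move=> x0 y0; rewrite invr_gt0 theta_gt0. Qed.

Lemma phi_quad_antitone_l A A' B Y : pd A -> pd B -> psd (A' - A) ->
  ip Y (hfun2 phi A' B Y) <= ip Y (hfun2 phi A B Y).
Proof.
move=> pA pB AA'; have pA' := pd_ge pA AA'.
have E X : pd X -> ip Y (hfun2 phi X B Y) =
    ip Y (hfun2 (fun x y => divdiff_path (p - 1) y 1 x) X B Y).
  move=> pX; congr (ip _ _); apply: hfun2_ext => i k.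
  by rewrite phi_divdiff ?pd_eigval.
rewrite !E // !hfun2_quad_left; apply: ler_sum => k _.
apply: ip_psd_le; apply: divdiff_antitone AA' => //; last exact: pd_eigval.
by rewrite p0 p1.
Qed.

(** Adjunction exchanges the two matrix arguments and theta is symmetric; monotonicity in the second
    argument thus reduces to the first. *)
Lemma phi_quad_sym A B Y : ip Y (hfun2 phi A B Y) = ip (Y ^t*) (hfun2 phi B A (Y ^t*)).
Proof.
rewrite -[LHS]ip_adj hfun2_adj; congr (ip _ _); apply: hfun2_ext => i k.
by rewrite /phi theta_sym.
Qed.

Lemma phi_quad_antitone A A' B B' Y : pd A -> pd B -> psd (A' - A) -> psd (B' - B) ->
  ip Y (hfun2 phi A' B' Y) <= ip Y (hfun2 phi A B Y).
Proof.
move=> pA pB AA' BB'; have pA' := pd_ge pA AA'.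
apply: (@le_trans _ _ (ip Y (hfun2 phi A' B Y))); last exact: phi_quad_antitone_l.
by rewrite phi_quad_sym [leRHS]phi_quad_sym; apply: phi_quad_antitone_l.
Qed.

End DoubleCalculus.

(** * Norm bounds and inverses for linear maps on matrices *)

Section Bounds.
Variables (R : realType) (d : nat).
Local Notation C := R[i].
Local Notation M := 'M[C]_d.
Implicit Types (A B X Y Z : M) (r : R).

Lemma mulmx_bound A : exists2 c : R, 0 < c & forall X, ip (A *m X) (A *m X) <= c * ip X X.
Proof.
pose H := A ^t* *m A; have pH : psd H by exact: psd_adjM.
pose c : R := 1 + \sum_i heig H i.
have c0 : 0 < c by rewrite ltr_wpDr // sumr_ge0 // => i _; exact: eigval_psd.
exists c => // X.
have Hc : psd (c%:C%:M - H).
  apply: psd_eigval_le => [|i]; first exact: psd_adj.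
  rewrite /c (bigD1 i isT) /= addrCA lerDl addr_ge0 // sumr_ge0 // => k _.
  exact: eigval_psd.
by rewrite ip_mull mulmxA (le_trans (ip_psd_le X Hc)) // mul_scalar_mx ipZr.
Qed.

Lemma mulmxr_bound A : exists2 c : R, 0 < c & forall X, ip (X *m A) (X *m A) <= c * ip X X.
Proof.
have [c c0 h] := mulmx_bound (A ^t*); exists c => // X.
by rewrite -ip_adj dagM (le_trans (h _)) // ip_adj.
Qed.

Lemma nm_iZ X : nm ('i *: X) = nm X.
Proof.
rewrite /nm !ip_def dagZ -scalemxAr -scalemxAl scalerA conjCi.
by rewrite mulrN -expr2 sqrCi opprK scale1r.
Qed.

Lemma linear_nm_le (f : {linear M -> M}) X :
  nm (f X) <= (\sum_i \sum_j 2 * nm (f (delta_mx i j))) * nm X.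
Proof.
rewrite {1}(matrix_sum_delta X) linear_sum (le_trans (nm_sum _ _ _)) //.
rewrite mulr_suml ler_sum // => i _.
rewrite linear_sum (le_trans (nm_sum _ _ _)) // mulr_suml ler_sum // => j _.
rewrite linearZ /=.
have XE : X i j = (complex.Re (X i j))%:C + (complex.Im (X i j))%:C * 'i.
  by case: (X i j) => a b; apply/eqP; rewrite eq_complex /= !mul0r !mulr0 !mulr1; apply/andP;
    split; apply/eqP; ring.
rewrite XE scalerDl (le_trans (nmD _ _)) // -scalerA !nmZ nm_iZ -mulrDl.
rewrite mulrAC ler_wpM2r ?nm_ge0 //.
have := ip_entry X i j; rewrite -nm_sqr => hX.
have re : `|complex.Re (X i j)| <= nm X.
  rewrite -(@ler_pXn2r _ 2%N) ?nnegrE ?nm_ge0 // real_normK ?num_real //.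
  by apply: le_trans hX; rewrite lerDl sqr_ge0.
have im : `|complex.Im (X i j)| <= nm X.
  rewrite -(@ler_pXn2r _ 2%N) ?nnegrE ?nm_ge0 // real_normK ?num_real //.
  by apply: le_trans hX; rewrite lerDr sqr_ge0.
by lra.
Qed.

Lemma linear_bound (f : {linear M -> M}) :
  exists2 c : R, 0 < c & forall X, nm (f X) <= c * nm X.
Proof.
have s0 : 0 <= \sum_i \sum_j 2 * nm (f (delta_mx i j)).
  by apply: sumr_ge0 => i _; apply: sumr_ge0 => j _; rewrite mulr_ge0 ?nm_ge0.
exists (1 + \sum_i \sum_j 2 * nm (f (delta_mx i j))) => [|X]; first by rewrite ltr_wpDr.
by rewrite (le_trans (linear_nm_le f X)) // ler_wpM2r ?nm_ge0 // lerDr.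
Qed.

(** Seen as a matrix on row vectors, f has a trivial kernel and is therefore invertible. *)
Lemma linear_inj_surj (f : {linear M -> M}) : (forall X, f X = 0 -> X = 0) ->
  exists g : {linear M -> M}, forall Y, f (g Y) = Y.
Proof.
move=> f0; pose A := lin_mx f.
have uA : A \in unitmx.
  rewrite -row_free_unit -kermx_eq0; apply/eqP/row_matrixP => i; rewrite row0.
  have : row i (kermx A) *m A = 0 by rewrite -row_mul mulmx_ker row0.
  rewrite -{1}(vec_mxK (row i (kermx A))) mul_vec_lin => /(congr1 vec_mx).
  by rewrite mxvecK linear0 => /f0 /(congr1 mxvec); rewrite vec_mxK linear0.
exists (vec_mx \o mulmxr (invmx A) \o mxvec) => Y.
by apply: (can_inj mxvecK); rewrite -mul_vec_lin /= vec_mxK mulmxKV.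
Qed.

Lemma sqrt_quad_triangle (a b c : R) : 0 <= a -> 0 <= c -> b ^+ 2 <= a * c ->
  Num.sqrt (a + b *+ 2 + c) <= Num.sqrt a + Num.sqrt c.
Proof.
move=> a0 c0 bac.
have bs : b <= Num.sqrt a * Num.sqrt c.
  by rewrite -sqrtrM // (le_trans (ler_norm _)) // -sqrtr_sqr ler_wsqrtr.
rewrite -[leRHS]ger0_norm ?addr_ge0 ?sqrtr_ge0 // -sqrtr_sqr ler_wsqrtr //.
rewrite sqrrD !sqr_sqrtr //; lra.
Qed.

End Bounds.

(** * The weighting operator of the tensor and its inverse *)

Section Bracket.
Variables (R : realType) (d : nat).
Local Notation C := R[i].
Local Notation M := 'M[C]_d.
Implicit Types (A B X Y Z rho : M) (r w : R).
Variables (p : R) (sigma : M).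
Hypotheses (p12 : 1 < p <= 2) (psigma : pd sigma).

Let S := mxpow sigma ((1 / hat p) / 2).
Let S' := mxpow sigma (- ((1 / hat p) / 2)).
Let SS' : S *m S' = 1%:M. Proof. exact: mxpowNr. Qed.
Let S'S : S' *m S = 1%:M. Proof. exact: mxpowN. Qed.
Let uS' : S' \in unitmx. Proof. by case/mulmx1_unit: S'S. Qed.
Let hS : S ^t* = S. Proof. exact: mxpow_adj. Qed.
Let hS' : S' ^t* = S'. Proof. exact: mxpow_adj. Qed.

(** Left argument of theta in the bracket; the right one is [twist (- w)]. It is linear and positive
    in rho, so order and homogeneity pass from rho to the arguments of theta. *)
Definition twist : R -> M -> M :=
  sval (seal (fun w rho => (expR (w / (2 * p)))%:C *: (S' *m rho *m S'))).
Lemma twistE w rho : twist w rho = (expR (w / (2 * p)))%:C *: (S' *m rho *m S').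
Proof. by rewrite /twist (svalP (seal _)). Qed.

Definition br : R -> M -> M -> M := sval (seal (fun w rho X =>
  S *m hfun2 (theta p) (twist w rho) (twist (- w) rho) (S *m X *m S) *m S)).
Lemma brE w rho X : br w rho X =
  S *m hfun2 (theta p) (twist w rho) (twist (- w) rho) (S *m X *m S) *m S.
Proof. by rewrite /br (svalP (seal _)). Qed.

Definition ibr : R -> M -> M -> M := sval (seal (fun w rho X =>
  S' *m hfun2 (phi p) (twist w rho) (twist (- w) rho) (S' *m X *m S') *m S')).
Lemma ibrE w rho X : ibr w rho X =
  S' *m hfun2 (phi p) (twist w rho) (twist (- w) rho) (S' *m X *m S') *m S'.
Proof. by rewrite /ibr (svalP (seal _)). Qed.

Lemma bracketE w rho : bracket p sigma w rho = br w rho.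
Proof.
apply/funext => X.
have GE Y : Gamma sigma (1 / hat p) Y = S *m Y *m S by rewrite /S mxpowE -mxfun_hfun.
have GE' Y : Gamma sigma (- (1 / hat p)) Y = S' *m Y *m S'.
  have e : - (1 / hat p / 2) = - (1 / hat p) / 2 by rewrite mulNr.
  by rewrite /S' e mxpowE -mxfun_hfun.
by rewrite brE !twistE -mxfun2_hfun2 /bracket !GE !GE'.
Qed.

Lemma twist_pd w rho : pd rho -> pd (twist w rho).
Proof.
move=> pr; rewrite twistE; apply: pdZ; first exact: expR_gt0.
by rewrite -{1}hS'; apply: pd_conj.
Qed.

Lemma twist_le w rho rho' : psd (rho' - rho) -> psd (twist w rho' - twist w rho).
Proof.
move=> h; rewrite !twistE; apply: psd_leZ; first exact: expR_ge0.
by rewrite -{1 3}hS'; apply: psd_le_conj.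
Qed.

Lemma twistZ w r rho : twist w (r%:C *: rho) = r%:C *: twist w rho.
Proof. by rewrite !twistE -scalemxAr -scalemxAl !scalerA mulrC. Qed.

Let sandwichK X : S' *m (S *m X *m S) *m S' = X.
Proof. by rewrite !mulmxA S'S mul1mx -mulmxA SS' mulmx1. Qed.
Let sandwichKV X : S *m (S' *m X *m S') *m S = X.
Proof. by rewrite !mulmxA SS' mul1mx -mulmxA S'S mulmx1. Qed.

Let sandwich_adj X : (S *m X *m S) ^t* = S *m X ^t* *m S.
Proof. by rewrite dagM dagM hS mulmxA. Qed.

Lemma brK w rho X : pd rho -> ibr w rho (br w rho X) = X.
Proof.
move=> pr; rewrite ibrE brE sandwichK hfun2_comp.
rewrite (@hfun2_ext _ _ _ (fun _ _ => 1)) ?hfun2_1 ?sandwichK // => i k.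
by rewrite /phi mulVf // gt_eqF // theta_gt0 // pd_eigval //; apply: twist_pd.
Qed.

Lemma ibrK w rho X : pd rho -> br w rho (ibr w rho X) = X.
Proof.
move=> pr; rewrite ibrE brE sandwichKV hfun2_comp.
rewrite (@hfun2_ext _ _ _ (fun _ _ => 1)) ?hfun2_1 ?sandwichKV // => i k.
by rewrite /phi mulfV // gt_eqF // theta_gt0 // pd_eigval //; apply: twist_pd.
Qed.

Lemma bracket_invE w rho X : pd rho -> bracket_inv p sigma w rho X = ibr w rho X.
Proof.
move=> pr; rewrite /bracket_inv /inv_on bracketE.
case: xgetP => [Y _ [_ <-]|/(_ (ibr w rho X)) []]; first by rewrite brK.
by split => //; rewrite ibrK.
Qed.

Lemma brD w rho X Y : br w rho (X + Y) = br w rho X + br w rho Y.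
Proof. by rewrite !brE mulmxDr mulmxDl hfun2D mulmxDr mulmxDl. Qed.
Lemma brZ w rho (c : C) X : br w rho (c *: X) = c *: br w rho X.
Proof. by rewrite !brE -scalemxAr -scalemxAl hfun2Z -scalemxAr -scalemxAl. Qed.
Lemma ibrD w rho X Y : ibr w rho (X + Y) = ibr w rho X + ibr w rho Y.
Proof. by rewrite !ibrE mulmxDr mulmxDl hfun2D mulmxDr mulmxDl. Qed.
Lemma ibrZ w rho (c : C) X : ibr w rho (c *: X) = c *: ibr w rho X.
Proof. by rewrite !ibrE -scalemxAr -scalemxAl hfun2Z -scalemxAr -scalemxAl. Qed.

(** The adjoint exchanges [twist w rho] and [twist (- w) rho] in a symmetric kernel, which amounts
    to changing the sign of w. *)
Lemma br_adj w rho X : (br w rho X) ^t* = br (- w) rho (X ^t*).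
Proof.
rewrite !brE.
rewrite sandwich_adj.
rewrite hfun2_adj.
rewrite sandwich_adj.
rewrite opprK.
apply: (congr1 (fun W => S *m W *m S)).
by apply: hfun2_ext => i k; rewrite theta_sym.
Qed.

Lemma ibr_ip w rho X Y : ip X (ibr w rho Y) =
  ip (S' *m X *m S') (hfun2 (phi p) (twist w rho) (twist (- w) rho) (S' *m Y *m S')).
Proof. by rewrite ibrE ip_mulr ip_mull hS' mulmxA. Qed.

Lemma ibr_sym w rho X Y : ip X (ibr w rho Y) = ip Y (ibr w rho X).
Proof. by rewrite !ibr_ip hfun2_self_adj ip_sym. Qed.

Lemma ibr_ge0 w rho X : pd rho -> 0 <= ip X (ibr w rho X).
Proof.
move=> pr; rewrite ibr_ip hfun2_quad; apply: sumr_ge0 => i _; apply: sumr_ge0 => k _.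
by rewrite mulr_ge0 ?ip_ge0 // ltW // phi_gt0 // pd_eigval //; apply: twist_pd.
Qed.

Lemma ibr_antitone w rho rho' X : pd rho -> psd (rho' - rho) ->
  ip X (ibr w rho' X) <= ip X (ibr w rho X).
Proof.
move=> pr rr; rewrite !ibr_ip; apply: phi_quad_antitone;
  by [exact: p12|exact: twist_pd|exact: twist_le].
Qed.

Lemma ibr_homog w r rho X : 0 < r -> pd rho ->
  ip X (ibr w (r%:C *: rho) X) = r `^ (p - 2) * ip X (ibr w rho X).
Proof.
move=> r0 pr; have hA := pd_adj (twist_pd w pr); have hB := pd_adj (twist_pd (- w) pr).
have pA i : 0 < heig (twist w rho) i by apply: pd_eigval; exact: twist_pd.
have pB i : 0 < heig (twist (- w) rho) i by apply: pd_eigval; exact: twist_pd.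
rewrite !ibr_ip !twistZ (hfun2_scale _ _ _ hA hB).
rewrite !hfun2_quad mulr_sumr; apply: eq_bigr => i _; rewrite mulr_sumr; apply: eq_bigr => k _.
by rewrite /phi theta_homog // invfM -powRN opprB mulrA.
Qed.

(** The constant is the least value of phi over the finitely many pairs of eigenvalues (capped at
    1), divided by the cost of recovering X from its sandwich by S'. *)
Lemma ibr_lower w rho : pd rho ->
  exists2 c : R, 0 < c & forall X, c * ip X X <= ip X (ibr w rho X).
Proof.
move=> pr; pose A := twist w rho; pose B := twist (- w) rho.
have pA i : 0 < heig A i by apply: pd_eigval; exact: twist_pd.
have pB i : 0 < heig B i by apply: pd_eigval; exact: twist_pd.
pose m := \big[Num.min/1]_(ik : 'I_d * 'I_d) phi p (heig A ik.1) (heig B ik.2).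
have m0 : 0 < m.
  by rewrite /m; elim/big_ind: _ => // [x y x0 y0|ik _]; rewrite ?lt_min ?x0 // phi_gt0.
have [c1 c10 h1] := mulmx_bound S; have [c2 c20 h2] := mulmxr_bound S.
exists (m / (c2 * c1)) => [|X]; first by rewrite divr_gt0 // mulr_gt0.
have XY : ip X X <= c2 * c1 * ip (S' *m X *m S') (S' *m X *m S').
  by rewrite -{1 2}(sandwichKV X) (le_trans (h2 _)) // -mulrA ler_wpM2l // ltW.
rewrite mulrAC ler_pdivrMr ?mulr_gt0 // ibr_ip; move: (S' *m X *m S') XY => Y XY.
apply: (@le_trans _ _ (m * (c2 * c1 * ip Y Y))); first by rewrite ler_wpM2l // ltW.
rewrite mulrCA [leRHS]mulrC; apply: ler_wpM2l; first by rewrite mulr_ge0 // ltW.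
have YY : ip Y Y = ip Y (hfun2 (fun _ _ => 1) A B Y) by rewrite hfun2_1.
rewrite YY !hfun2_quad mulr_sumr; apply: ler_sum => i _.
rewrite mulr_sumr; apply: ler_sum => k _; rewrite mul1r ler_wpM2r ?ip_ge0 //.
exact: (bigmin_le_cond _ (j := (i, k))).
Qed.

Lemma ibr_upper w rho : pd rho ->
  exists2 c : R, 0 < c & forall X, ip X (ibr w rho X) <= c * ip X X.
Proof.
move=> pr; pose A := twist w rho; pose B := twist (- w) rho.
pose m := \big[Num.max/1]_(ik : 'I_d * 'I_d) phi p (heig A ik.1) (heig B ik.2).
have m0 : 0 < m.
  by rewrite /m; elim/big_rec: _ => // ik x _ x0; rewrite lt_max x0 orbT.
have [c1 c10 h1] := mulmx_bound S'; have [c2 c20 h2] := mulmxr_bound S'.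
exists (m * (c2 * c1)) => [|X]; first by rewrite !mulr_gt0.
have XY : ip (S' *m X *m S') (S' *m X *m S') <= c2 * c1 * ip X X.
  by rewrite (le_trans (h2 _)) // -mulrA ler_wpM2l // ltW.
rewrite ibr_ip; move: (S' *m X *m S') XY => Y XY.
rewrite -mulrA; apply: (@le_trans _ _ (m * ip Y Y)); last by rewrite ler_wpM2l // ltW.
have YY : ip Y Y = ip Y (hfun2 (fun _ _ => 1) A B Y) by rewrite hfun2_1.
rewrite YY !hfun2_quad mulr_sumr; apply: ler_sum => i _.
rewrite mulr_sumr; apply: ler_sum => k _; rewrite mul1r ler_wpM2r ?ip_ge0 //.
exact: (le_bigmax_cond _ (j := (i, k))).
Qed.

End Bracket.

(** * The quadratic form Q, the operator D_rho and the metric tensor *)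

Section Tensor.
Variables (R : realType) (d : nat).
Local Notation C := R[i].
Local Notation M := 'M[C]_d.
Variables (p : R) (sigma : M) (J : nat) (V : 'I_J -> M) (omega : 'I_J -> R).
Local Notation field := ('I_J -> M).
Implicit Types (A X Y Z rho : M) (B : field) (r : R).
Hypotheses (p12 : 1 < p <= 2) (psigma : pd sigma).

Local Notation ibr := (ibr p sigma).
Local Notation br := (br p sigma).

Definition Qf rho B B' : R := \sum_j ip (B j) (ibr (omega j) rho (B' j)).
Definition Q rho B : R := Qf rho B B.
Definition fn2 B : R := \sum_j ip (B j) (B j).

Lemma weighted_norm2_regE rho B : pd rho ->
  weighted_norm2_reg p sigma omega rho B = Q rho B.
Proof.
move=> pr; apply: eq_bigr => j _.
by rewrite bracket_invE // ip_def.
Qed.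

Lemma Qf_sym rho B B' : Qf rho B B' = Qf rho B' B.
Proof. by apply: eq_bigr => j _; rewrite ibr_sym. Qed.
Lemma QfDr rho B B1 B2 : Qf rho B (B1 + B2) = Qf rho B B1 + Qf rho B B2.
Proof. by rewrite -big_split; apply: eq_bigr => j _; rewrite ibrD ipDr. Qed.
Lemma QfDl rho B B1 B2 : Qf rho (B1 + B2) B = Qf rho B1 B + Qf rho B2 B.
Proof. by rewrite Qf_sym QfDr !(Qf_sym _ B). Qed.
Lemma QfZr rho B r B' : Qf rho B (r%:C *: B') = r * Qf rho B B'.
Proof. by rewrite mulr_sumr; apply: eq_bigr => j _; rewrite ibrZ ipZr. Qed.
Lemma QfZl rho B r B' : Qf rho (r%:C *: B) B' = r * Qf rho B B'.
Proof. by rewrite Qf_sym QfZr Qf_sym. Qed.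
Lemma Q_ge0 rho B : pd rho -> 0 <= Q rho B.
Proof. by move=> pr; apply: sumr_ge0 => j _; exact: ibr_ge0. Qed.
Lemma QZ rho r B : Q rho (r%:C *: B) = r ^+ 2 * Q rho B.
Proof. by rewrite /Q QfZr QfZl mulrA. Qed.
Lemma QN rho B : Q rho (- B) = Q rho B.
Proof. by rewrite -scaleN1r -(rmorphN1 (real_complex R)) QZ sqrrN expr1n mul1r. Qed.
Lemma Q0 rho : Q rho 0 = 0.
Proof. by have := QZ rho 0 0; rewrite scaler0 expr0n mul0r. Qed.
Lemma QD rho B B' : Q rho (B + B') = Q rho B + Qf rho B B' *+ 2 + Q rho B'.
Proof. by rewrite /Q QfDr !QfDl (Qf_sym _ B' B); ring. Qed.

Lemma Qf_CS rho B B' : pd rho -> Qf rho B B' ^+ 2 <= Q rho B * Q rho B'.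
Proof.
move=> pr; apply: discr_le => [||t]; try exact: Q_ge0.
have := Q_ge0 (B + (- t)%:C *: B') pr; rewrite QD QfZr QZ sqrrN.
by rewrite -mulrnAr mulNr.
Qed.

Lemma Q_sqrt_triangle rho B B' : pd rho ->
  Num.sqrt (Q rho (B + B')) <= Num.sqrt (Q rho B) + Num.sqrt (Q rho B').
Proof.
by move=> pr; rewrite QD; apply: sqrt_quad_triangle; [exact: Q_ge0|exact: Q_ge0|exact: Qf_CS].
Qed.

Lemma Q_antitone rho rho' B : pd rho -> psd (rho' - rho) -> Q rho' B <= Q rho B.
Proof. by move=> pr h; apply: ler_sum => j _; exact: ibr_antitone. Qed.

Lemma Q_homog r rho B : 0 < r -> pd rho -> Q (r%:C *: rho) B = r `^ (p - 2) * Q rho B.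
Proof.
by move=> r0 pr; rewrite mulr_sumr; apply: eq_bigr => j _; rewrite ibr_homog.
Qed.

Lemma pd1 : pd (1%:M : M).
Proof. by apply/pdP; exists 1; [exact: ltr01|rewrite subrr; exact: psd0]. Qed.

(** The identity is the reference point: every state lies below it, so by antitonicity Q at 1 bounds
    Q from below at all full-rank states. *)
Lemma Q1_lower : exists2 c : R, 0 < c & forall B, c * fn2 B <= Q 1%:M B.
Proof.
have h j : exists c : R, 0 < c /\ forall X, c * ip X X <= ip X (ibr (omega j) 1%:M X).
  by have [c c0 hc] := ibr_lower p12 psigma (omega j) pd1; exists c.
have [c cP] := choice h.
exists (\big[Num.min/1]_j c j).
  by elim/big_ind: _ => // [x y x0 y0|j _]; [rewrite lt_min x0|have [] := cP j].
move=> B; rewrite mulr_sumr; apply: ler_sum => j _.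
have [_ /(_ (B j))] := cP j; apply: le_trans; apply: ler_wpM2r; first exact: ip_ge0.
exact: bigmin_le_cond.
Qed.

Lemma Q1_upper : exists2 c : R, 0 < c & forall B, Q 1%:M B <= c * fn2 B.
Proof.
have h j : exists c : R, 0 < c /\ forall X, ip X (ibr (omega j) 1%:M X) <= c * ip X X.
  by have [c c0 hc] := ibr_upper p sigma (omega j) pd1; exists c.
have [c cP] := choice h.
exists (\big[Num.max/1]_j c j).
  by elim/big_rec: _ => // j x _ x0; rewrite lt_max x0 orbT.
move=> B; rewrite mulr_sumr; apply: ler_sum => j _.
have [_ /(_ (B j)) hj] := cP j; apply: (le_trans hj); apply: ler_wpM2r; first exact: ip_ge0.
exact: le_bigmax_cond.
Qed.

(** Minus the divergence, so that the continuity equation reads gamma' = src B. *)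
Definition src B : M := \sum_j partialj_adj V j (B j).

Lemma divergenceE B : divergence V B = - src B. Proof. by []. Qed.

Lemma partialj_adjD j X Y : partialj_adj V j (X + Y) = partialj_adj V j X + partialj_adj V j Y.
Proof. by rewrite /partialj_adj /commutator mulmxDr mulmxDl opprD addrACA. Qed.
Lemma partialj_adjZ j (c : C) X : partialj_adj V j (c *: X) = c *: partialj_adj V j X.
Proof. by rewrite /partialj_adj /commutator -scalemxAr -scalemxAl scalerBr. Qed.
Lemma partialjD j X Y : partialj V j (X + Y) = partialj V j X + partialj V j Y.
Proof. by rewrite /partialj /commutator mulmxDr mulmxDl opprD addrACA. Qed.
Lemma partialjZ j (c : C) X : partialj V j (c *: X) = c *: partialj V j X.
Proof. by rewrite /partialj /commutator -scalemxAr -scalemxAl scalerBr. Qed.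
Lemma partialj_ip j X Y : ip (partialj V j X) Y = ip X (partialj_adj V j Y).
Proof. by rewrite !ip_def; congr complex.Re; exact: partialj_adjP. Qed.

Lemma srcD B B' : src (B + B') = src B + src B'.
Proof. by rewrite -big_split; apply: eq_bigr => j _; exact: partialj_adjD. Qed.
Lemma srcZ (c : C) B : src (c *: B) = c *: src B.
Proof. by rewrite scaler_sumr; apply: eq_bigr => j _; exact: partialj_adjZ. Qed.
Lemma srcN B : src (- B) = - src B.
Proof. by rewrite -scaleN1r srcZ scaleN1r. Qed.
Lemma srcB B B' : src (B - B') = src B - src B'.
Proof. by rewrite srcD srcN. Qed.
Lemma src_tr B : \tr (src B) = 0.
Proof.
rewrite raddf_sum big1 // => j _.
by rewrite /= /partialj_adj /commutator raddfB /= mxtrace_mulC subrr.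
Qed.
Lemma src_ip X B : ip X (src B) = \sum_j ip (partialj V j X) (B j).
Proof. by rewrite ip_sumr; apply: eq_bigr => j _; rewrite partialj_ip. Qed.

(** The tensor controls velocities; this is why the distances below dominate the norm distance. *)
Lemma src_bound : exists2 k : R, 0 < k & forall B, ip (src B) (src B) <= k * Q 1%:M B.
Proof.
have h j : exists c : R, 0 < c /\ forall X, nm (partialj_adj V j X) <= c * nm X.
  have [c1 c10 h1] := mulmx_bound ((V j) ^t*); have [c2 c20 h2] := mulmxr_bound ((V j) ^t*).
  exists (Num.sqrt c1 + Num.sqrt c2); split; first by rewrite addr_gt0 ?sqrtr_gt0.
  move=> X; rewrite /partialj_adj /commutator (le_trans (nmD _ _)) // nmN mulrDl.
  by apply: lerD; rewrite /nm -sqrtrM ?(ltW c10) ?(ltW c20) // ler_wsqrtr.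
have [c cP] := choice h; have [l l0 lP] := Q1_lower.
pose K := 1 + \sum_j c j.
have K0 : 0 < K by rewrite ltr_wpDr // sumr_ge0 // => j _; have [/ltW] := cP j.
exists (K ^+ 2 / l) => [|B]; first by rewrite divr_gt0 // exprn_gt0.
have nB j : nm (B j) <= Num.sqrt (fn2 B).
  rewrite /nm ler_wsqrtr // /fn2 (bigD1 j isT) /= lerDl sumr_ge0 // => k _.
  exact: ip_ge0.
have f0 : 0 <= fn2 B by apply: sumr_ge0 => j _; exact: ip_ge0.
have : nm (src B) <= K * Num.sqrt (fn2 B).
  rewrite (le_trans (nm_sum _ _ _)) // /K mulrDl mul1r -[leLHS]add0r lerD ?sqrtr_ge0 //.
  rewrite mulr_suml ler_sum // => j _; have [cj hj] := cP j.
  by rewrite (le_trans (hj _)) // ler_wpM2l // ltW.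
rewrite -(@ler_pXn2r _ 2%N) ?nnegrE ?nm_ge0 ?mulr_ge0 ?sqrtr_ge0 ?(ltW K0) //.
rewrite nm_sqr exprMn sqr_sqrtr // => /le_trans; apply.
rewrite -mulrA ler_wpM2l ?sqr_ge0 // ler_pdivlMl // lP //.
Qed.

Lemma DopE rho A : Dop p sigma V omega rho A = src (fun j => br (omega j) rho (partialj V j A)).
Proof. by apply: eq_bigr => j _; rewrite bracketE. Qed.

Lemma DopD rho A X : Dop p sigma V omega rho (A + X) =
  Dop p sigma V omega rho A + Dop p sigma V omega rho X.
Proof.
by rewrite !DopE -srcD; congr src; apply/funext => j; rewrite partialjD brD.
Qed.
Lemma DopZ rho (c : C) A : Dop p sigma V omega rho (c *: A) = c *: Dop p sigma V omega rho A.
Proof.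
by rewrite !DopE -srcZ; congr src; apply/funext => j; rewrite partialjZ brZ.
Qed.

(** Field with potential A. For positive definite rho it minimises Q rho among the fields with the
    same source, namely D_rho A. *)
Local Notation opt rho A := (fun j => br (omega j) rho (partialj V j A)).

Lemma Qf_opt rho A B : pd rho -> Qf rho (opt rho A) B = ip A (src B).
Proof.
move=> pr; rewrite src_ip; apply: eq_bigr => j _.
by rewrite ibr_sym brK // ip_sym.
Qed.

Lemma Q_opt rho A : pd rho -> Q rho (opt rho A) = ip A (Dop p sigma V omega rho A).
Proof. by move=> pr; rewrite /Q Qf_opt // DopE. Qed.

(** Expansion of Q rho (B - opt rho A) >= 0. The left side is affine in B, so for fixed A and rho it
    can be integrated in time. *)
Lemma support_le_Q rho A B : pd rho ->
  ip A (src B) *+ 2 - ip A (Dop p sigma V omega rho A) <= Q rho B.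
Proof.
move=> pr; have := Q_ge0 (B - opt rho A) pr; rewrite QD QN Q_opt //.
rewrite -scaleN1r -(rmorphN1 (real_complex R)) QfZr Qf_sym Qf_opt //.
by move: (ip _ _) (ip _ _) (Q _ _) => a b c; lra.
Qed.

(** Both hypotheses are established for primitive semigroups in [alicki_pairing] and
    [primitive_ergodic]. The first makes D_rho commute with the adjoint, the second reduces its
    kernel to the scalars. *)
Hypothesis pairing : exists2 jp : 'I_J -> 'I_J, injective jp &
  forall j, (V j) ^t* = V (jp j) /\ omega (jp j) = - omega j.
Hypothesis ergodic : forall A, (forall j, partialj V j A = 0) -> exists c : C, A = c%:M.

(** Reindexing by [jp] absorbs the adjoint: V_j becomes V_(jp j), omega changes sign as [br_adj]
    requires, and the two signs coming from the commutators cancel. *)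
Lemma Dop_adj rho A : (Dop p sigma V omega rho A) ^t* = Dop p sigma V omega rho (A ^t*).
Proof.
have [jp jpI jpP] := pairing.
have hV j : V (jp j) = (V j) ^t* by have [] := jpP j.
have pj j X : (partialj V j X) ^t* = (-1) *: partialj V (jp j) (X ^t*).
  by rewrite /partialj /commutator dagB !dagM hV scaleN1r opprB.
have pja j X : (partialj_adj V j X) ^t* = (-1) *: partialj_adj V (jp j) (X ^t*).
  by rewrite /partialj_adj /commutator dagB !dagM hV scaleN1r opprB.
rewrite !DopE /src dag_sum [RHS](reindex_inj jpI); apply: eq_bigr => j _.
have [_ ->] := jpP j.
rewrite pja br_adj pj brZ partialj_adjZ scalerA mulrNN mulr1.
exact: scale1r.
Qed.

Lemma Dop_tr rho A : \tr (Dop p sigma V omega rho A) = 0.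
Proof. by rewrite DopE src_tr. Qed.

Lemma br_eq0 w rho X : pd rho -> ip X (br w rho X) = 0 -> X = 0.
Proof.
move=> pr h; have [c c0 /(_ (br w rho X))] := ibr_lower p12 psigma w pr.
rewrite brK // [in leRHS]ip_sym h => hc.
have /ip_eq0 b0 : ip (br w rho X) (br w rho X) = 0.
  by apply/eqP; rewrite eq_le ip_ge0 andbT -(pmulr_rle0 _ c0).
by rewrite -[LHS](brK p12 psigma w X pr) b0 -[X in ibr _ _ X](scale0r (0 : M)) ibrZ scale0r.
Qed.

Lemma br_ge0 w rho X : pd rho -> 0 <= ip X (br w rho X).
Proof.
by move=> pr; have := ibr_ge0 p12 psigma w (br w rho X) pr; rewrite brK // ip_sym.
Qed.

Lemma Dop_ip rho A X : ip A (Dop p sigma V omega rho X) =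
  \sum_j ip (partialj V j A) (br (omega j) rho (partialj V j X)).
Proof. by rewrite DopE src_ip. Qed.

(** Adding the trace times the identity makes D_rho injective: both terms of the quadratic form are
    nonnegative, the first vanishes only on scalars by [ergodic], and a scalar of trace 0 is 0. The
    same injectivity shows that the preimage of a self-adjoint matrix is self-adjoint. *)
Lemma Dop_linear_inv rho : pd rho -> exists g : {linear M -> M}, forall Y,
  traceless_sa Y -> traceless_sa (g Y) /\ Dop p sigma V omega rho (g Y) = Y.
Proof.
move=> pr; pose f A : M := Dop p sigma V omega rho A + \tr A *: 1%:M.
have flin : linear f.
  by move=> c A X; rewrite /f DopD DopZ mxtraceD mxtraceZ scalerDl scalerDr scalerA addrACA.
pose F : {linear M -> M} := HB.pack f (GRing.isLinear.Build C M M *:%R f flin).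
have Finj A : F A = 0 -> A = 0.
  move=> /= h; have : ip A (f A) = 0 by rewrite h ip0r.
  rewrite /f ipDr Dop_ip.
  have -> : ip A (\tr A *: 1%:M) = complex.Re (Num.conj (\tr A) * \tr A).
    by rewrite ip_def -scalemxAr mulmx1 mxtraceZ trace_adj mulrC.
  have t0 : 0 <= complex.Re (Num.conj (\tr A) * \tr A).
    by case: (\tr A) => a b /=; rewrite mulNr opprK -!expr2 addr_ge0 ?sqr_ge0.
  have D0 j : 0 <= ip (partialj V j A) (br (omega j) rho (partialj V j A)) by exact: br_ge0.
  move/eqP; rewrite paddr_eq0 ?sumr_ge0 // => /andP[/eqP sD /eqP tA].
  have /ergodic[c Ac] : forall j, partialj V j A = 0.
    move=> j; apply: (@br_eq0 (omega j) rho _ pr); apply/eqP; rewrite eq_le D0 andbT -sD.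
    by rewrite (bigD1 j isT) /= lerDl sumr_ge0.
  have : \tr A = 0.
    move: tA; case: (\tr A) => a b /=; rewrite mulNr opprK => ab.
    have -> : a = 0 by nra.
    by have -> : b = 0 by nra.
  rewrite Ac mxtrace_scalar => /eqP; rewrite mulrn_eq0 => /orP[/eqP d0|/eqP ->].
    by apply/matrixP => i; have := ltn_ord i; rewrite [X in (_ < X)%N]d0.
  by rewrite raddf0.
have [g gP] := linear_inj_surj Finj; exists g => Y [Ya Yt].
have fg := gP Y; rewrite /= in fg.
have tg : \tr (g Y) = 0.
  have := congr1 mxtrace fg; rewrite /f mxtraceD Dop_tr add0r mxtraceZ Yt mxtrace1 => /eqP.
  rewrite mulf_eq0 pnatr_eq0 => /orP[/eqP //|/eqP d0].
  by rewrite /mxtrace big1 // => i _; have := ltn_ord i; rewrite [X in (_ < X)%N]d0.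
have Dg : Dop p sigma V omega rho (g Y) = Y by rewrite -[RHS]fg /f tg scale0r addr0.
split => //; split => //.
apply/eqP; rewrite -subr_eq0; apply/eqP; apply: Finj.
have Z1 : (g Y) ^t* - g Y = (g Y) ^t* + (-1) *: g Y by rewrite scaleN1r.
rewrite /= /f Z1 DopD DopZ -Dop_adj Dg Ya mxtraceD mxtraceZ trace_adj tg.
by rewrite scaleN1r subrr conjC0 mulr0 addr0 scale0r addr0.
Qed.

Lemma Dop_invP rho Y : pd rho -> traceless_sa Y ->
  traceless_sa (Dop_inv p sigma V omega rho Y) /\
  Dop p sigma V omega rho (Dop_inv p sigma V omega rho Y) = Y.
Proof.
move=> pr TY; rewrite /Dop_inv /inv_on; case: xgetP => [A _ //|h].
have [g /(_ Y TY) gP] := Dop_linear_inv pr.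
by case: (h (g Y)).
Qed.

(** Duality at the potential of src B: the metric is the least cost of a field with the given
    source, and [metric_tensor_opt] shows that it is attained. *)
Lemma metric_tensor_le rho B : pd rho -> traceless_sa (src B) ->
  metric_tensor p sigma V omega rho (src B) (src B) <= Q rho B.
Proof.
move=> pr TB; have [_ DA] := Dop_invP pr TB.
have := support_le_Q (Dop_inv p sigma V omega rho (src B)) B pr.
by rewrite DA /metric_tensor -ip_def mulr2n addrK.
Qed.

Lemma metric_tensor_opt rho Y : pd rho -> traceless_sa Y ->
  exists2 B, src B = Y & Q rho B = metric_tensor p sigma V omega rho Y Y.
Proof.
move=> pr TY; have [_ DA] := Dop_invP pr TY.
exists (opt rho (Dop_inv p sigma V omega rho Y)); first by rewrite -DopE.
by rewrite Q_opt // DA /metric_tensor -ip_def.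
Qed.

(* The optimal field is found by duality: Q rho B = ip A Y with A the potential of Y. *)
Lemma source_potential rho Y : pd rho -> traceless_sa Y ->
  exists A B, [/\ src B = Y, Q rho B = ip A Y & ip A (Dop p sigma V omega rho A) = ip A Y].
Proof.
move=> pr TY; have [_ DA] := Dop_invP pr TY.
exists (Dop_inv p sigma V omega rho Y), (opt rho (Dop_inv p sigma V omega rho Y)).
by rewrite -DopE DA; split => //; rewrite Q_opt // DA.
Qed.

(** Gives each velocity a field of comparable cost at the identity; after scaling, the same field is
    affordable wherever the spectrum is bounded below. All upper bounds on distances start here. *)
Lemma source_bound : exists2 k : R, 0 < k &
  forall Y, traceless_sa Y -> exists2 B, src B = Y & Q 1%:M B <= k * ip Y Y.
Proof.
have [g gP] := Dop_linear_inv pd1; have [c c0 cP] := linear_bound g.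
exists c => // Y TY; have [_ DA] := gP Y TY.
exists (opt 1%:M (g Y)); first by rewrite -DopE.
rewrite Q_opt; last exact: pd1.
by rewrite DA (le_trans (ip_CS _ _)) // -nm_sqr expr2 mulrA ler_wpM2r ?nm_ge0.
Qed.

End Tensor.

(** * Convergence of matrices in terms of the Hilbert-Schmidt norm *)

Section MatrixTopology.
Variables (R : realType) (d : nat).
Local Notation C := R[i].
Local Notation M := 'M[C]_d.

Lemma normC_lt (z : C) (e : R) : 0 < e ->
  (`|z| < e%:C) = (complex.Re z ^+ 2 + complex.Im z ^+ 2 < e ^+ 2).
Proof.
move=> e0; case: z => a b; rewrite normc_def /= ltcR.
rewrite -[X in _ < X]ger0_norm ?(ltW e0) // -sqrtr_sqr ltr_sqrt //.
by rewrite exprn_gt0.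
Qed.

Lemma sqr_dist_sym (x y : C) : complex.Re (x - y) ^+ 2 + complex.Im (x - y) ^+ 2 =
  complex.Re (y - x) ^+ 2 + complex.Im (y - x) ^+ 2.
Proof. by case: x => a b; case: y => a' b' /=; ring. Qed.

Lemma cvg_nm (T : Type) (F : set_system T) (FF : Filter F) (f : T -> M) (Y : M) :
  f @ F --> Y -> nm (f t - Y) @[t --> F] --> (0 : R).
Proof.
move=> fY; apply/cvgrPdist_lt => e e0.
(* With d.+1 the division makes sense for every d and the comparison is strict: d^2 entries of
   modulus below e' sum to less than e^2. *)
pose e' := e / d.+1%:R; have e'0 : 0 < e' by rewrite divr_gt0.
have : F (f @^-1` ball Y (e'%:C : C)) by apply: fY; apply: nbhsx_ballx; rewrite ltcR.
apply: filterS => t ft.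
rewrite sub0r normrN ger0_norm ?nm_ge0 //.
have lt_sq (a b : R) : 0 <= a -> 0 <= b -> a ^+ 2 < b ^+ 2 -> a < b.
  by move=> a0 b0; rewrite ltr_pXn2r.
apply: lt_sq; [exact: nm_ge0|exact: ltW|].
rewrite nm_sqr ipE.
apply: (@le_lt_trans _ _ (\sum_(i < d) \sum_(j < d) e' ^+ 2)).
  apply: ler_sum => i _; apply: ler_sum => j _; rewrite -!expr2.
  have [_ /(_ i j)] := ft; rewrite -ball_normE /= normC_lt // => /ltW.
  by rewrite [(f t - Y) i j]mxE [(- Y) i j]mxE sqr_dist_sym.
rewrite !sumr_const !card_ord -mulrnA -mulr_natr /e' exprMn exprVn -mulrA.
rewrite -[ltRHS]mulr1 ltr_pM2l ?exprn_gt0 //.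
rewrite mulrC ltr_pdivrMr ?exprn_gt0 // mul1r -natrX ltr_nat expnS expn1.
by rewrite ltn_mul.
Qed.

Lemma cvg_of_nm (T : Type) (F : set_system T) (FF : Filter F) (f : T -> M) (Y : M) :
  nm (f t - Y) @[t --> F] --> (0 : R) -> f @ F --> Y.
Proof.
move=> /cvgrPdist_lt h U /nbhs_ballP[e /= e0 eU].
have [e' e'0 ee'] : exists2 e' : R, 0 < e' & e = e'%:C.
  case: e e0 {eU} => a b; rewrite ltcE /= => /andP[/eqP -> a0]; by exists a.
have := h e' e'0; apply: filterS => t; rewrite sub0r normrN ger0_norm ?nm_ge0 // => ft.
apply: eU; split => // i j; rewrite -ball_normE /= ee' normC_lt //.
apply: (@le_lt_trans _ _ (nm (f t - Y) ^+ 2)); last by rewrite ltr_pXn2r ?nnegrE ?nm_ge0 ?ltW.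
rewrite nm_sqr; have := ip_entry (f t - Y) i j; apply: le_trans.
by rewrite [(f t - Y) i j]mxE [(- Y) i j]mxE sqr_dist_sym.
Qed.

Lemma nm_cvgP (T : Type) (F : set_system T) (FF : Filter F) (f : T -> M) (Y : M) :
  f @ F --> Y <-> nm (f t - Y) @[t --> F] --> (0 : R).
Proof. by split; [exact: cvg_nm|exact: cvg_of_nm]. Qed.

Lemma ip_norm_le (X Y : M) : `|ip X Y| <= nm X * nm Y.
Proof.
rewrite ler_norml ip_CS andbT lerNl -ipNl -(nmN X); exact: ip_CS.
Qed.

End MatrixTopology.

(** * Invariance from the annihilator of the range of the generator *)

Section Ergodicity.
Variables (R : realType) (d : nat).
Local Notation C := R[i].
Local Notation M := 'M[C]_d.
Variables (P : R -> {linear M -> M}) (L : {linear M -> M}).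
Hypotheses (qmsP : quantum_markov_semigroup P) (genP : has_generator P L).

Lemma hs_ip (X Y : M) : hs X Y = (ip X Y)%:C + (ip ('i *: X) Y)%:C * 'i.
Proof.
rewrite !ip_def dagZ -scalemxAl mxtraceZ conjCi -/(hs X Y).
by case: (hs X Y) => a b; apply/eqP; rewrite eq_complex /=; apply/andP; split; apply/eqP; ring.
Qed.

(** Strong continuity at the finitely many basis matrices gives a bound that is uniform over a short
    time interval. *)
Lemma semigroup_bounded : exists eta K : R, [/\ 0 < eta, 0 < K &
  forall t X, 0 <= t <= eta -> nm (P t X) <= K * nm X].
Proof.
have near_basis : \forall t \near 0^'+, forall ij : 'I_d * 'I_d,
    nm (P t (delta_mx ij.1 ij.2) - delta_mx ij.1 ij.2) <= 1.
  apply: filter_forall => ij.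
  have /cvg_nm/cvgrPdist_le/(_ 1 ltr01) := @qms_c0 _ _ _ qmsP (delta_mx ij.1 ij.2).
  by apply: filterS => t; rewrite sub0r normrN ger0_norm ?nm_ge0.
have [e /= e0 he] := near_basis.
pose K := 1 + \sum_i \sum_j 2 * (nm (delta_mx i j : M) + 1).
have K0 : 0 < K.
  rewrite ltr_wpDr // sumr_ge0 // => i _; rewrite sumr_ge0 // => j _.
  by rewrite mulr_ge0 // addr_ge0 // nm_ge0.
have K1 : 1 <= K.
  rewrite lerDl sumr_ge0 // => i _; rewrite sumr_ge0 // => j _.
  by rewrite mulr_ge0 // addr_ge0 // nm_ge0.
exists (e / 2), K; split => //; first exact: divr_gt0.
move=> t X /andP[]; rewrite le_eqVlt => /orP[/eqP <- _|t0 te].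
  by rewrite (qms_0 qmsP) ler_peMl ?nm_ge0.
rewrite (le_trans (linear_nm_le (P t) X)) // ler_wpM2r ?nm_ge0 // /K.
rewrite -[leLHS]add0r lerD // ler_sum // => i _; rewrite ler_sum // => j _.
rewrite ler_wpM2l //.
have ht : nm (P t (delta_mx i j) - delta_mx i j) <= 1.
  apply: (he t _ t0 (i, j)).
  by rewrite /= sub0r normrN gtr0_norm // (le_lt_trans te) // ltr_pdivrMr // ltr_pMr // ltr1n.
by have := nm_tri 0 (P t (delta_mx i j)) 0;
  have := nmD (P t (delta_mx i j) - delta_mx i j) (delta_mx i j); rewrite subrK; lra.
Qed.

(** The functional is only real linear, so it is tested on the real basis formed by E_ij and i
    E_ij. *)
Lemma functional_bound (m : M -> R) (b : R) :
  (forall X Y, m (X + Y) = m X + m Y) -> (forall r X, m (r%:C *: X) = r * m X) ->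
  (forall i j, `|m (delta_mx i j)| <= b /\ `|m ('i *: delta_mx i j)| <= b) ->
  forall X, `|m X| <= (\sum_(i < d) \sum_(j < d) 2 * b) * nm X.
Proof.
move=> mD mZ mb X.
have m0 : m 0 = 0 by have := mZ 0 0; rewrite scaler0 mul0r.
rewrite {1}(matrix_sum_delta X) (big_morph m mD m0).
rewrite (le_trans (ler_norm_sum _ _ _)) // mulr_suml ler_sum // => i _.
rewrite (big_morph m mD m0) (le_trans (ler_norm_sum _ _ _)) // mulr_suml ler_sum // => j _.
have XE : X i j = (complex.Re (X i j))%:C + (complex.Im (X i j))%:C * 'i.
  by case: (X i j) => u v; apply/eqP; rewrite eq_complex /= !mul0r !mulr0 !mulr1; apply/andP;
    split; apply/eqP; ring.
have [b1 b2] := mb i j.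
rewrite XE scalerDl -scalerA mD !mZ (le_trans (ler_normD _ _)) // !normrM.
have := ip_entry X i j; rewrite -nm_sqr => hX.
have re : `|complex.Re (X i j)| <= nm X.
  rewrite -(@ler_pXn2r _ 2%N) ?nnegrE ?nm_ge0 // real_normK ?num_real //.
  by apply: le_trans hX; rewrite lerDl sqr_ge0.
have im : `|complex.Im (X i j)| <= nm X.
  rewrite -(@ler_pXn2r _ 2%N) ?nnegrE ?nm_ge0 // real_normK ?num_real //.
  by apply: le_trans hX; rewrite lerDr sqr_ge0.
have := ler_pM (normr_ge0 _) (normr_ge0 _) re b1.
by have := ler_pM (normr_ge0 _) (normr_ge0 _) im b2; lra.
Qed.

(** When N annihilates the range of L, the increments of P_h tested on N are o(h); uniformity in X
    comes from checking a finite real basis. *)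
Lemma generator_small (N : M) : (forall X, ip (L X) N = 0) ->
  forall e : R, 0 < e -> exists2 h0 : R, 0 < h0 &
  forall h X, 0 < h < h0 -> `|ip (P h X - X) N| <= e * h * nm X.
Proof.
move=> LN e e0; pose n2 : R := \sum_(i < d) \sum_(j < d) 2.
have n20 : 0 <= n2 by apply: sumr_ge0 => i _; apply: sumr_ge0.
pose e' := e / (n2 + 1); have e'0 : 0 < e' by rewrite divr_gt0 // ltr_wpDl.
have near_X X : \forall h \near 0^'+, `|ip (P h X - X) N| <= e' * h.
  have N0 : 0 < nm N + 1 by rewrite ltr_wpDl // nm_ge0.
  have /cvg_nm/cvgrPdist_le/(_ (e' / (nm N + 1)) (divr_gt0 e'0 N0)) := @genP X.
  have : \forall h \near (0 : R)^'+, 0 < h by exact: nbhs_right_gt.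
  apply: filterS2 => h h0; rewrite sub0r normrN ger0_norm ?nm_ge0 // => hL.
  have -> : ip (P h X - X) N = h * ip ((h^-1)%:C *: (P h X - X) - L X) N.
    by rewrite [in RHS]ipBl LN subr0 ipZl mulrA mulfV ?mul1r ?gt_eqF.
  rewrite normrM gtr0_norm // mulrC ler_wpM2r ?(ltW h0) //.
  rewrite (le_trans (ip_norm_le _ _)) // (le_trans (ler_wpM2r (nm_ge0 _) hL)) //.
  rewrite mulrAC ler_pdivrMr // ler_wpM2l ?(ltW e'0) // lerDl //.
have near_basis : \forall h \near 0^'+, forall ij : 'I_d * 'I_d,
    `|ip (P h (delta_mx ij.1 ij.2) - delta_mx ij.1 ij.2) N| <= e' * h /\
    `|ip (P h ('i *: delta_mx ij.1 ij.2) - 'i *: delta_mx ij.1 ij.2) N| <= e' * h.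
  apply: filter_forall => ij; apply: filterS2 (near_X (delta_mx ij.1 ij.2))
    (near_X ('i *: delta_mx ij.1 ij.2)) => h h1 h2; split; [exact: h1|exact: h2].
have [h0 /= h00 hh] := near_basis; exists h0 => // h X /andP[h_gt h_lt].
have hb := hh h _ h_gt; rewrite /= sub0r normrN gtr0_norm // in hb.
have {hb} hb := hb h_lt.
have := @functional_bound (fun X => ip (P h X - X) N) (e' * h).
move=> /(_ _ _ _ X) => hX; apply: le_trans.
  apply: hX => [Y Z|r Y|i j]; last exact: (hb (i, j)).
    by rewrite linearD opprD addrACA ipDl.
  by rewrite linearZ /= -scalerBr ipZl.
rewrite ler_wpM2r ?nm_ge0 //.
have -> : \sum_(i < d) \sum_(j < d) 2 * (e' * h) = n2 * (e' * h).
  by rewrite mulr_suml; apply: eq_bigr => i _; rewrite mulr_suml.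
have n2e : n2 * e' <= e.
  by rewrite /e' mulrA ler_pdivrMr ?ltr_wpDl // mulrC ler_wpM2l ?(ltW e0) // lerDl.
by rewrite mulrA; apply: ler_wpM2r; [exact: ltW|exact: n2e].
Qed.

Lemma hs_delta i j (N : M) : hs (delta_mx i j) N = N i j.
Proof.
rewrite /hs trmx_delta map_delta_mx /mxtrace (bigD1 j isT) /= big1 ?addr0 => [|k kj].
  rewrite mxE (bigD1 i isT) /= big1 ?addr0 => [|k ki].
    by rewrite mxE !eqxx mul1r.
  by rewrite mxE (negbTE ki) andbF mul0r.
by rewrite mxE big1 // => l _; rewrite mxE (negbTE kj) mul0r.
Qed.

(** Telescoping over n + 1 short steps: each increment is o(h), so their sum is arbitrarily small.
    This works for t <= eta, where P_t is bounded by K; the semigroup law extends it to all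
    times. *)
Lemma invariant_of_generator (N : M) : (forall X, ip (L X) N = 0) ->
  forall t, 0 <= t -> hs_adj (P t) N = N.
Proof.
move=> LN; have [eta [K [eta0 K0 PK]]] := semigroup_bounded.
have step t X h k : 0 <= h -> t = h * k.+1%:R -> P t X = P h (P (h * k%:R) X).
  by move=> h0 ->; rewrite -natr1 mulrDr mulr1 addrC (qms_add qmsP) // mulr_ge0.
have small t X : 0 <= t <= eta -> ip (P t X) N = ip X N.
  move=> /andP[]; rewrite le_eqVlt => /orP[/eqP <- _|t0 te]; first by rewrite (qms_0 qmsP).
  apply/eqP; rewrite -subr_eq0 -ipBl -normr_eq0 eq_le normr_ge0 andbT.
  apply/ler_addgt0Pl => e e0; rewrite addr0.
  (* The tolerance e divided by this quantity makes the n + 1 increments sum to at most e; the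
     summand 1 keeps it positive. *)
  have D0 : 0 < t * K * nm X + 1 by rewrite ltr_wpDl // !mulr_ge0 ?nm_ge0 ?ltW.
  have [h0 h00 hh] := generator_small LN (divr_gt0 e0 D0).
  pose n := (Num.truncn (t / h0)); pose h := t / n.+1%:R.
  have h_gt : 0 < h by rewrite divr_gt0.
  have h_lt : h < h0 by rewrite ltr_pdivrMr // mulrC -ltr_pdivrMr // truncnS_gt.
  have hE : t = h * n.+1%:R by rewrite divfK.
  have tele k : (k <= n.+1)%N ->
      `|ip (P (h * k%:R) X - X) N| <= k%:R * (e / (t * K * nm X + 1) * h * (K * nm X)).
    elim: k => [|k IH] kn; first by rewrite mulr0 (qms_0 qmsP) subrr ip0l normr0 mul0r.
    rewrite (step _ X h k (ltW h_gt) erefl).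
    set Y := P (h * k%:R) X.
    have -> : P h Y - X = (P h Y - Y) + (Y - X) by rewrite addrA subrK.
    rewrite ipDl (le_trans (ler_normD _ _)) // -natr1 mulrDl mul1r addrC lerD //.
      exact: IH (ltnW kn).
    rewrite (le_trans (hh h Y _)) ?h_gt //.
    apply: ler_wpM2l; first by apply/ltW; rewrite mulr_gt0 ?divr_gt0.
    apply: PK; rewrite mulr_ge0 ?(ltW h_gt) //= (le_trans _ te) // hE ler_wpM2l ?(ltW h_gt) //.
    by rewrite ler_nat ltnW.
  have := tele n.+1 (leqnn _); rewrite -hE => /le_trans; apply.
  have -> : n.+1%:R * (e / (t * K * nm X + 1) * h * (K * nm X)) =
     e * ((h * n.+1%:R) * K * nm X / (t * K * nm X + 1)).
    by field; rewrite gt_eqF.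
  by rewrite -hE ger_pMr // ler_pdivrMr // mul1r lerDl.
move=> t t0.
have all X : ip (P t X) N = ip X N.
  pose n := (Num.truncn (t / eta)); pose h := t / n.+1%:R.
  have h_ge : 0 <= h by rewrite divr_ge0.
  have h_lt : h <= eta by rewrite ler_pdivrMr // mulrC -ler_pdivrMr // ltW // truncnS_gt.
  have hE : t = h * n.+1%:R by rewrite divfK.
  rewrite hE; elim: (n.+1) => [|k IH]; first by rewrite mulr0 (qms_0 qmsP).
  by rewrite (step _ X h k h_ge erefl) small ?h_ge.
by apply/matrixP => i j; rewrite mxE hs_ip -linearZ !all -hs_ip hs_delta.
Qed.

End Ergodicity.

(** * Trivial commutant of the V_j for a primitive semigroup *)

Section PrimitiveSemigroup.
Variables (R : realType) (d : nat).
Local Notation C := R[i].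
Local Notation M := 'M[C]_d.
Variables (P : R -> {linear M -> M}) (L : {linear M -> M}) (sigma : M).
Variables (J : nat) (V : 'I_J -> M) (omega : 'I_J -> R).
Hypotheses (qmsP : quantum_markov_semigroup P) (genP : has_generator P L).
Hypotheses (primP : primitive P sigma) (gnsP : gns_detailed_balance L sigma).
Hypothesis alickiP : alicki_form L sigma V omega.

Lemma full_states_pd (rho : M) : full_states rho -> pd rho.
Proof. by move=> [[psr _] ur]; exact: psd_pd. Qed.

Lemma primitive_pd : pd sigma.
Proof. by case: primP => /full_states_pd. Qed.

(** Injectivity comes from orthogonality: two indices sharing their adjoint index would give V_j =
    V_k, whereas <V_j, V_k> = 0 and <V_j, V_j> = c_j > 0. *)
Lemma alicki_pairing : exists2 jp : 'I_J -> 'I_J, injective jp &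
  forall j, (V j) ^t* = V (jp j) /\ omega (jp j) = - omega j.
Proof.
have [jp jpP] := choice (alicki_adjoint alickiP); exists jp => // j k jk.
have [c [c0 hc]] := alicki_orthogonal alickiP.
have Vjk : V j = V k.
  by rewrite -[LHS]trmxCK -[RHS]trmxCK (jpP j).1 (jpP k).1 jk.
apply/eqP; case: eqP => // /eqP jk'.
have := hc j k; rewrite (negbTE jk') -Vjk hc eqxx => /(congr1 (@complex.Re R)) /= cj.
by have := c0 j; rewrite cj ltxx.
Qed.

Definition commuting (A : M) := forall j, V j *m A = A *m V j.

Lemma commuting_adj A : commuting A -> commuting (A ^t*).
Proof.
have [jp _ jpP] := alicki_pairing.
move=> cA j; have := cA (jp j); have [<- _] := jpP j => /(congr1 (fun X => X ^t*)).
by rewrite !dagM trmxCK.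
Qed.

(** Moving V_j through sigma and through its inverse produces the same factor on both sides. *)
Lemma commuting_modular A : commuting A -> commuting (invmx sigma *m A *m sigma).
Proof.
move=> cA j; have us := pd_unit primitive_pd.
have := alicki_modular alickiP j; set c := (expR (- omega j))%:C => h.
have sV : sigma *m V j = c *: V j *m sigma by rewrite -h mulmxKV.
have Vs : V j *m invmx sigma = c *: (invmx sigma *m V j).
  transitivity (invmx sigma *m (sigma *m V j *m invmx sigma)).
    by rewrite -!mulmxA mulKmx.
  by rewrite h -scalemxAr.
have -> : V j *m (invmx sigma *m A *m sigma) = V j *m invmx sigma *m (A *m sigma).
  by rewrite !mulmxA.
have -> : invmx sigma *m A *m sigma *m V j = invmx sigma *m A *m (sigma *m V j).
  by rewrite !mulmxA.
rewrite Vs sV -!scalemxAl -scalemxAr; congr (_ *: _).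
by rewrite -!mulmxA; congr (_ *m _); rewrite !mulmxA cA.
Qed.

Lemma commuting_generator A : commuting A -> L A = 0.
Proof.
move=> cA; rewrite (alicki_generator alickiP) big1 // => j _.
by rewrite /commutator cA subrr mulmx0 mul0mx !scaler0 addr0.
Qed.

(** L vanishes on the commutant and is symmetric for Tr(sigma X^* Y). The mirrored statement below
    follows by applying this one to the modular conjugate of A. *)
Lemma commuting_trace_l A Y : commuting A -> \tr (sigma *m A *m L Y) = 0.
Proof.
move=> /commuting_adj cA; have := gnsP (A ^t*) Y.
by rewrite commuting_generator // dag0 mulmx0 mul0mx mxtrace0 trmxCK.
Qed.

Lemma commuting_trace_r A Y : commuting A -> \tr (A *m sigma *m L Y) = 0.
Proof.
move=> /commuting_modular h; have := commuting_trace_l Y h.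
by rewrite !mulmxA mulmxV ?mul1mx // pd_unit //; exact: primitive_pd.
Qed.

Lemma commuting1 : commuting 1%:M.
Proof. by move=> j; rewrite mulmx1 mul1mx. Qed.

Lemma psd_add_large (N : M) : N ^t* = N -> exists2 n : R, 0 < n & psd (N + n%:C%:M).
Proof.
move=> hN; pose n := 1 + \sum_i `|heig N i|; exists n; first by rewrite ltr_wpDr // sumr_ge0.
have nN i : - n <= heig N i.
  rewrite lerNl (le_trans (ler_norm _)) // normrN /n (bigD1 i isT) /= addrCA lerDl.
  by rewrite addr_ge0 // sumr_ge0.
by have := psd_eigval_ge hN nN; rewrite rmorphN raddfN opprK.
Qed.

Lemma hs_adjD (Phi : M -> M) X Y : hs_adj Phi (X + Y) = hs_adj Phi X + hs_adj Phi Y.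
Proof. by apply/matrixP => i j; rewrite !mxE /hs mulmxDr mxtraceD. Qed.
Lemma hs_adjZ (Phi : M -> M) c X : hs_adj Phi (c *: X) = c *: hs_adj Phi X.
Proof. by apply/matrixP => i j; rewrite !mxE /hs -scalemxAr mxtraceZ. Qed.

(** The Hermitian matrix A sigma + sigma A annihilates the range of L. Its traceless part N perturbs
    sigma into another invariant state, so uniqueness gives N = 0. Then A minus half the trace c
    anticommutes with sigma, and pairing this with itself in a positive definite form makes it 0. *)
Lemma commuting_herm_scalar A : A ^t* = A -> commuting A -> exists c : C, A = c%:M.
Proof.
move=> hA cA; have ps := primitive_pd; have hs := pd_adj ps.
have [[[psr trs] _] invs uniq] := primP.
pose rho := A *m sigma + sigma *m A.
have hrho : rho ^t* = rho by rewrite /rho dagD !dagM hA hs addrC.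
pose c := \tr rho.
have cr : c = (complex.Re c)%:C.
  apply/eqP; rewrite eq_complex /= eqxx /=; apply/eqP.
  by have : Num.conj c = c by [rewrite -trace_adj hrho]; case: (c) => a b /= [h]; move: h;
    rewrite /=; lra.
pose N := rho - c *: sigma.
have hN : N ^t* = N by rewrite /N dagB hrho cr dagZr hs.
have tN : \tr N = 0 by rewrite raddfB /= mxtraceZ trs mulr1 subrr.
have NL X : ip (L X) N = 0.
  have E : N = A *m sigma + sigma *m A + (- c) *: sigma by rewrite scaleNr.
  rewrite ip_sym ip_def hN E !mulmxDl -scalemxAl !mxtraceD mxtraceZ.
  rewrite (commuting_trace_r X cA) (commuting_trace_l X cA).
  by have := commuting_trace_l X commuting1; rewrite mulmx1 => ->; rewrite mulr0 !addr0.
have /pdP[e e0 he] := ps; have [n n0 hn] := psd_add_large hN.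
(* Since sigma >= e and N >= - n, the matrix sigma + t N is still positive. *)
pose t := e / n; have t0 : 0 < t by exact: divr_gt0.
have st : states (sigma + t%:C *: N).
  split; last by rewrite mxtraceD mxtraceZ tN mulr0 addr0.
  have -> : sigma + t%:C *: N = (sigma - e%:C%:M) + t%:C *: (N + n%:C%:M).
    rewrite [in RHS]scalerDr addrA scale_scalar_mx -rmorphM /t divfK ?gt_eqF //=.
    by rewrite addrAC subrK.
  by apply: psdD; [exact: he|apply: psdZ; [exact: ltW|exact: hn]].
have iN : Defs.invariant P (sigma + t%:C *: N).
  move=> u u0; rewrite hs_adjD hs_adjZ (invs u u0); congr (_ + _ *: _).
  exact: (invariant_of_generator qmsP genP NL).
have := uniq _ st iN => /eqP; rewrite -subr_eq0 addrAC subrr add0r scaler_eq0 => /orP[|/eqP N0].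
  by move=> /eqP/(congr1 (@complex.Re R)) /= t00; move: t0; rewrite t00 ltxx.
(* N = 0 reads A sigma + sigma A = c sigma, so subtracting c / 2 from A leaves an anticommuting
   K. *)
pose k := (complex.Re c) / 2.
pose K := A - k%:C%:M.
have hK : K ^t* = K by rewrite /K dagB hA dag_scalar.
have K0 : K *m sigma + sigma *m K = 0.
  rewrite -N0 /N /rho /K mulmxBl mulmxBr mul_scalar_mx mul_mx_scalar addrACA -opprD -scalerDl.
  rewrite -rmorphD /k; congr (_ - _ *: _).
  by rewrite [in RHS]cr; congr (_%:C); field.
have : ip K (K *m sigma + sigma *m K) = 0 by rewrite K0 ip0r.
have -> : ip K (K *m sigma + sigma *m K) = 2 * ip K (sigma *m K).
  rewrite ipDr; have -> : ip K (K *m sigma) = ip K (sigma *m K).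
    by rewrite -[LHS]ip_adj dagM hK hs.
  by ring.
move=> /eqP; rewrite mulf_eq0 pnatr_eq0 /= => /eqP Ks.
have := ip_psd_le K he; rewrite [in X in X -> _]/=.
have [_ /(_ K)] := (psdP _).1 he.
rewrite mulmxBl ipBr Ks sub0r mul_scalar_mx ipZr => h1 _.
have /ip_eq0 KK : ip K K = 0.
  by apply/eqP; rewrite eq_le ip_ge0 andbT -(pmulr_rle0 _ e0) -oppr_ge0.
exists (k%:C); apply/eqP; rewrite -subr_eq0; exact/eqP.
Qed.

(** The commutant is closed under the adjoint, so the Hermitian and anti-Hermitian parts of A are
    treated separately. *)
Lemma primitive_ergodic A : (forall j, partialj V j A = 0) -> exists c : C, A = c%:M.
Proof.
move=> h; have cA : commuting A by move=> j; apply/eqP; rewrite -subr_eq0; exact/eqP/h.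
have cA' := commuting_adj cA.
have half r : (r : M) = (2^-1)%:C *: (r + r).
  rewrite scalerDr -scalerDl -rmorphD /=.
  have -> : 2^-1 + 2^-1 = 1 :> R by field.
  by rewrite scale1r.
have [c1 h1] : exists c : C, A + A ^t* = c%:M.
  apply: commuting_herm_scalar; first by rewrite dagD trmxCK addrC.
  by move=> j; rewrite mulmxDr mulmxDl cA cA'.
have [c2 h2] : exists c : C, 'i *: (A - A ^t*) = c%:M.
  apply: commuting_herm_scalar.
    by rewrite dagZ dagB trmxCK conjCi scaleNr -scalerN opprB.
  by move=> j; rewrite -scalemxAr -scalemxAl mulmxBr mulmxBl cA cA'.
have h3 : A - A ^t* = (- 'i * c2)%:M.
  by rewrite -scale_scalar_mx -h2 scalerA mulNr -expr2 sqrCi opprK scale1r.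
exists ((2^-1)%:C * (c1 + - 'i * c2)).
have E : (c1 + - 'i * c2)%:M = c1%:M + (- 'i * c2)%:M :> M by rewrite raddfD.
rewrite (half A) -scale_scalar_mx E -h1 -h3; congr (_ *: _).
by rewrite addrACA subrr addr0.
Qed.

End PrimitiveSemigroup.

(** * Density matrices, segments and the push towards the maximally mixed state *)

Section States.
Variables (R : realType) (d : nat).
Local Notation C := R[i].
Local Notation M := 'M[C]_d.
Implicit Types (x y z X : M) (e r s t : R).

Lemma hproj_ip1 X i : ip (hproj X i) (hproj X i) = 1.
Proof.
have [P PP _] := hproj_resolution X.
rewrite ip_def P PP eqxx hprojE /eigproj -mulmxA mxtrace_mulC -mulmxA mulmxV ?mulmx1.
  rewrite /mxtrace (bigD1 i isT) /= big1 ?mxE ?eqxx //= ?addr0 // => k ki.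
  by rewrite mxE (negbTE ki).
exact: spectral_unit.
Qed.

Lemma hproj_tr X i : complex.Re (\tr (hproj X i)) = 1.
Proof.
have [P PP _] := hproj_resolution X.
by rewrite -(hproj_ip1 X i) ip_def P PP eqxx.
Qed.

Lemma tr_heig X : X ^t* = X -> complex.Re (\tr X) = \sum_i heig X i.
Proof.
move=> hX; have -> : \tr X = \sum_i (heig X i)%:C * \tr (hproj X i).
  rewrite {1}(hprojsum hX) raddf_sum; apply: eq_bigr => i _; exact: mxtraceZ.
by rewrite Re_sum; apply: eq_bigr => i _; rewrite ReZ hproj_tr mulr1.
Qed.

Lemma ip_heig X : X ^t* = X -> ip X X = \sum_i heig X i ^+ 2.
Proof.
move=> hX; rewrite {2}(hprojsum hX) ip_sumr; apply: eq_bigr => i _.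
rewrite ipZr; have -> : ip X (hproj X i) = heig X i; last by [].
have [P PP _] := hproj_resolution X.
have -> : hproj X i = hproj X i *m hproj X i by rewrite PP eqxx.
by rewrite -{1}(P i) -ip_mull (hproj_eig i hX).2 ipZl hproj_ip1 mulr1.
Qed.

(** The norm dominates the modulus of each eigenvalue. This converts closeness in norm into the
    order, which is the form that the antitonicity of Q requires. *)
Lemma psd_add_nm X : X ^t* = X -> psd (X + (nm X)%:C%:M).
Proof.
move=> hX; have h i : - nm X <= heig X i.
  rewrite lerNl (le_trans (ler_norm _)) // normrN -sqrtr_sqr /nm ler_wsqrtr // ip_heig //.
  by rewrite (bigD1 i isT) /= lerDl sumr_ge0 // => k _; exact: sqr_ge0.
by have := psd_eigval_ge hX h; rewrite rmorphN raddfN opprK.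
Qed.

Lemma states_psd x : states x -> psd x. Proof. by case. Qed.
Lemma states_adj x : states x -> x ^t* = x. Proof. by case=> /psd_adj. Qed.
Lemma full_statesP x : full_states x <-> pd x /\ \tr x = 1.
Proof.
split=> [h|[px tx]]; first by split; [exact: full_states_pd|case: h => -[]].
by split; [split; [exact: pd_psd|]|exact: pd_unit].
Qed.
Lemma full_pd x : full_states x -> pd x. Proof. exact: full_states_pd. Qed.
Lemma full_state x : full_states x -> states x. Proof. by case. Qed.
Lemma states_pd_full x : states x -> pd x -> full_states x.
Proof. by move=> [_ tx] px; apply/full_statesP. Qed.

Lemma states_eig x i : states x -> 0 <= heig x i <= 1.
Proof.
move=> sx; have px := states_psd sx.
rewrite eigval_psd //=; have := tr_heig (states_adj sx).
have [_ ->] := sx; rewrite (bigD1 i isT) /= => ->.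
by rewrite lerDl sumr_ge0 // => k _; exact: eigval_psd.
Qed.

Lemma states_le1 x : states x -> psd (1%:M - x).
Proof.
move=> sx; apply: (@psd_eigval_le _ _ x 1) => [|i]; first exact: states_adj.
by have /andP[] := states_eig i sx.
Qed.

Lemma states_ip x : states x -> ip x x <= 1.
Proof.
move=> sx; rewrite (ip_heig (states_adj sx)); have := tr_heig (states_adj sx).
have [_ ->] := sx => /= ->; apply: ler_sum => i _.
by have /andP[h0 h1] := states_eig i sx; rewrite expr2 ler_piMr.
Qed.

Lemma states_nm x : states x -> nm x <= 1.
Proof. by move=> sx; rewrite -[leRHS]sqrtr1 ler_wsqrtr // states_ip. Qed.

Lemma states_sub_T x y : states x -> states y -> traceless_sa (y - x).
Proof.
move=> sx sy; split; first by rewrite dagB !states_adj.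
by rewrite raddfB /=; case: sx => _ ->; case: sy => _ ->; rewrite subrr.
Qed.

Definition seg x y s : M := x + s%:C *: (y - x).

Lemma segE x y s : seg x y s = (1 - s)%:C *: x + s%:C *: y.
Proof. by rewrite /seg rmorphB scalerBl scale1r scalerBr addrA addrAC. Qed.

Lemma seg_states x y s : states x -> states y -> 0 <= s <= 1 -> states (seg x y s).
Proof.
move=> [px tx] [py ty] /andP[s0 s1]; rewrite segE; split.
  by apply: psdD; apply: psdZ; rewrite ?subr_ge0.
by rewrite mxtraceD !mxtraceZ tx ty !mulr1 -rmorphD subrK.
Qed.

Lemma seg_ge x y s w : psd (x - w) -> psd (y - w) -> 0 <= s <= 1 -> psd (seg x y s - w).
Proof.
move=> px py /andP[s0 s1]; rewrite segE.
have -> : (1 - s)%:C *: x + s%:C *: y - w = (1 - s)%:C *: (x - w) + s%:C *: (y - w).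
  rewrite !scalerBr addrACA -opprD -scalerDl -rmorphD subrK scale1r //.
by apply: psdD; apply: psdZ; rewrite ?subr_ge0.
Qed.

Lemma seg_sym x y s : seg x y s = seg y x (1 - s).
Proof. by rewrite !segE opprB addrC (_ : 1 + (s - 1) = s) //; ring. Qed.

Lemma seg_full x y s : full_states x -> full_states y -> 0 <= s <= 1 -> full_states (seg x y s).
Proof.
move=> fx fy s01; apply: states_pd_full; first by apply: seg_states => //; exact: full_state.
have /pdP[e e0 he] := full_pd fx; have /pdP[f f0 hf] := full_pd fy.
apply/pdP; exists (Num.min e f); first by rewrite lt_min e0.
have mono (u v : R) : u <= v -> psd (v%:C%:M - u%:C%:M : M).
  by move=> uv; rewrite -raddfB -rmorphB; apply: psd_scalar; rewrite subr_ge0.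
apply: seg_ge s01.
  by apply: psd_trans (mono _ _ _) he; rewrite ge_min lexx.
by apply: psd_trans (mono _ _ _) hf; rewrite ge_min lexx orbT.
Qed.

Hypothesis d0 : (0 < d)%N.

Definition mixed : M := (d%:R^-1)%:C%:M.
(** For e in ]0, 1], an affine map from the states into those with spectrum at least e / d; it sends
    segments to segments and multiplies velocities by 1 - e. *)
Definition push e x : M := seg x mixed e.

Lemma mixed_full : full_states mixed.
Proof.
apply/full_statesP; split.
  by apply/pdP; exists (d%:R^-1); [rewrite invr_gt0 ltr0n|rewrite subrr; exact: psd0].
rewrite mxtrace_scalar -rmorphMn /= -mulr_natr mulVf //.
by rewrite pnatr_eq0 -lt0n.
Qed.

Lemma push_states e x : states x -> 0 <= e <= 1 -> states (push e x).
Proof. by move=> sx; apply: seg_states => //; exact: full_state mixed_full. Qed.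

Lemma push_ge e x : states x -> 0 <= e <= 1 -> psd (push e x - (e / d%:R)%:C%:M).
Proof.
move=> sx /andP[e0 e1]; rewrite /push segE /mixed scale_scalar_mx -rmorphM addrK.
by apply: psdZ; [rewrite subr_ge0|exact: states_psd].
Qed.

Lemma push_full e x : states x -> 0 < e <= 1 -> full_states (push e x).
Proof.
move=> sx /andP[e0 e1]; apply: states_pd_full; first by apply: push_states => //; rewrite ltW.
apply/pdP; exists (e / d%:R); first by rewrite divr_gt0 ?ltr0n.
by apply: push_ge => //; rewrite ltW.
Qed.

Lemma push_sub e x y : push e y - push e x = (1 - e)%:C *: (y - x).
Proof. by rewrite /push !segE opprD addrACA subrr addr0 scalerBr. Qed.

Lemma push_seg e x y s : push e (seg x y s) = seg (push e x) (push e y) s.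
Proof.
have pE z : push e z = (1 - e)%:C *: z + e%:C *: mixed by exact: segE.
rewrite [RHS]/seg push_sub pE pE [in LHS]/seg.
rewrite [in LHS]scalerDr !scalerA [s%:C * _]mulrC.
by move: (_ *: x) (_ *: (y - x)) (_ *: mixed) => u v w; exact: addrAC.
Qed.

Lemma push_nm e x : states x -> 0 <= e -> nm (push e x - x) <= 2 * e.
Proof.
move=> sx e0; rewrite /push /seg addrAC subrr add0r nmZ ger0_norm // mulrC ler_wpM2r //.
rewrite (le_trans (nmD _ _)) // nmN.
by have := states_nm sx; have := states_nm (full_state mixed_full); lra.
Qed.

End States.

(** * Two real inequalities *)

Section RealInequalities.
Variable R : realType.
Implicit Types a b c u v x y : R.

(** Planar Cauchy-Schwarz; it adds up the lengths sqrt(duration * action) of consecutive pieces of a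
    curve. *)
Lemma sqrt_CS u v x y : 0 <= u -> 0 <= v -> 0 <= x -> 0 <= y ->
  Num.sqrt (u * x) + Num.sqrt (v * y) <= Num.sqrt ((u + v) * (x + y)).
Proof.
move=> u0 v0 x0 y0.
rewrite -[leLHS]ger0_norm ?addr_ge0 ?sqrtr_ge0 // -sqrtr_sqr ler_wsqrtr //.
rewrite sqrrD !sqr_sqrtr ?mulr_ge0 //.
have : Num.sqrt (u * x) * Num.sqrt (v * y) = Num.sqrt (u * y) * Num.sqrt (v * x).
  by rewrite -!sqrtrM ?mulr_ge0 //; congr Num.sqrt; ring.
have : Num.sqrt (u * y) ^+ 2 = u * y by rewrite sqr_sqrtr ?mulr_ge0.
have : Num.sqrt (v * x) ^+ 2 = v * x by rewrite sqr_sqrtr ?mulr_ge0.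
move: (Num.sqrt (u * y)) (Num.sqrt (v * x)) => s t ht hs ->.
have := sqr_ge0 (s - t); nra.
Qed.

Lemma ler_add_eps_mul x y k : (forall e, 0 < e -> e < 1 -> x <= y + e * k) -> x <= y.
Proof.
move=> h; apply/ler_addgt0Pl => e e0.
pose f := Num.min (e / (`|k| + 1)) (2^-1).
have k1 : 0 < `|k| + 1 by rewrite ltr_wpDl.
have f0 : 0 < f by rewrite /f lt_min divr_gt0 ?invr_gt0 ?ltr0n.
have f1 : f < 1 by rewrite /f gt_min invf_lt1 // ltr1n orbT.
rewrite (le_trans (h f f0 f1)) // addrC lerD2r.
apply: (@le_trans _ _ (f * (`|k| + 1))).
  by rewrite ler_wpM2l ?(ltW f0) // (le_trans (ler_norm _)) // lerDl.
by rewrite -ler_pdivlMr // /f ge_min lexx.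
Qed.

End RealInequalities.

(** * Chains of segments and the distance Wc between full-rank states *)

Section Chains.
Variables (R : realType) (d : nat).
Local Notation C := R[i].
Local Notation M := 'M[C]_d.
Variables (p : R) (sigma : M) (J : nat) (V : 'I_J -> M) (omega : 'I_J -> R).
Local Notation field := ('I_J -> M).
Implicit Types (A X Y x y z w : M) (B : field) (r s t l e : R).
Hypotheses (p12 : 1 < p <= 2) (psigma : pd sigma) (d0 : (0 < d)%N).
Hypothesis pairing : exists2 jp : 'I_J -> 'I_J, injective jp &
  forall j, (V j) ^t* = V (jp j) /\ omega (jp j) = - omega j.
Hypothesis ergodic : forall A, (forall j, partialj V j A = 0) -> exists c : C, A = c%:M.

Local Notation Q := (Q p sigma omega).
Local Notation src := (src V).
Local Notation Dop := (Dop p sigma V omega).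

(** Antitonicity and homogeneity give the factor r^(p-2), which is at most 1/r because r <= 1 < p.
    The cruder exponent serves all p at once. *)
Lemma Q_le_scale z w r B : pd z -> 0 < r <= 1 -> psd (w - r%:C *: z) -> Q w B <= r^-1 * Q z B.
Proof.
move=> pz /andP[r0 r1] h; have prz := pdZ r0 pz.
rewrite (le_trans (Q_antitone omega p12 psigma B prz h)) // Q_homog //.
apply: ler_wpM2r; first exact: Q_ge0.
rewrite -powR_inv1 ?(ltW r0) //.
have p1 : 1 < p by case/andP: p12.
have -> : p - 2 = -1 + (p - 1) by ring.
rewrite powRD; last by rewrite (gt_eqF r0) implybT.
rewrite ger_pMr ?powR_gt0 //.
apply: (@le_trans _ _ (1 `^ (p - 1))); last by rewrite powR1.
rewrite ge0_ler_powR ?nnegrE ?subr_ge0 ?(ltW r0) ?(ltW p1) //.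
Qed.

Lemma Q1_le z B : states z -> pd z -> Q 1%:M B <= Q z B.
Proof. by move=> sz pz; apply: Q_antitone => //; exact: states_le1. Qed.

Lemma Q_le_eta z r B : 0 < r <= 1 -> psd (z - r%:C%:M) -> Q z B <= r^-1 * Q 1%:M B.
Proof.
move=> r01 h; apply: Q_le_scale r01 _; first exact: pd1.
by rewrite scale_scalar_mx mulr1.
Qed.

(** c bounds the speed, hence the length, of the segment run in unit time by one constant field. It
    is positive so that the segment can be run again at unit speed, dividing time by c. *)
Definition step x y c := [/\ 0 < c, full_states x, full_states y &
  exists2 B, src B = y - x & forall s, 0 <= s <= 1 -> Q (seg x y s) B <= c ^+ 2].

Inductive chain : M -> M -> R -> Prop :=
| chain0 x : full_states x -> chain x x 0
| chainS x y z c l : step x y c -> chain y z l -> chain x z (c + l).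

Lemma step_sym x y c : step x y c -> step y x c.
Proof.
move=> [c0 fx fy [B sB hB]]; split => //; exists (- B); first by rewrite srcN sB opprB.
move=> s /andP[s0 s1]; rewrite QN seg_sym; apply: hB.
by rewrite subr_ge0 s1 lerBlDr lerDl s0.
Qed.

Lemma chain_ge0 x y l : chain x y l -> 0 <= l.
Proof. by elim=> // {}x {}y z c {}l [c0 _ _ _] _ l0; rewrite addr_ge0 // ltW. Qed.

Lemma chain_cat x y z l m : chain x y l -> chain y z m -> chain x z (l + m).
Proof.
elim=> [{}x _|{}x {}y w c {}l st _ IH] h; first by rewrite add0r.
by rewrite -addrA; apply: chainS st _; exact: IH.
Qed.

Lemma chain1 x y c : step x y c -> chain x y c.
Proof.
move=> st; rewrite -[c]addr0; apply: (chainS st); apply: chain0.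
by case: st.
Qed.

Lemma chain_sym x y l : chain x y l -> chain y x l.
Proof.
elim=> [{}x fx|{}x {}y z c {}l st _ IH]; first exact: chain0.
by rewrite addrC; apply: (chain_cat IH); apply: chain1; exact: step_sym.
Qed.

(** The field is multiplied by 1 - e, which contributes (1 - e)^2, while push e z >= (1 - e) z costs
    at most 1 / (1 - e). *)
Lemma step_push e x y c : 0 < e < 1 -> step x y c -> step (push e x) (push e y) c.
Proof.
move=> /andP[e0 e1] [c0 fx fy [B sB hB]].
have e01 : 0 < e <= 1 by rewrite e0 ltW.
split => //; [exact/push_full/e01/full_state|exact/push_full/e01/full_state|].
exists ((1 - e)%:C *: B); first by rewrite srcZ sB push_sub.
move=> s s01; rewrite QZ -push_seg.
have fz := seg_full fx fy s01.
have /(le_trans _) : (1 - e) ^+ 2 * ((1 - e)^-1 * Q (seg x y s) B) <= c ^+ 2.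
  rewrite mulrA expr2 mulfK ?gt_eqF ?subr_gt0 //.
  apply: (@le_trans _ _ (Q (seg x y s) B)); last exact: hB.
  rewrite ler_piMl //; first by apply: Q_ge0 => //; exact: full_pd.
  by rewrite lerBlDr lerDl ltW.
apply; rewrite ler_wpM2l ?sqr_ge0 //; apply: Q_le_scale; first exact: full_pd.
  by rewrite subr_gt0 e1 lerBlDr lerDl ltW.
rewrite /push segE addrAC subrr add0r; apply: psdZ; first exact: ltW.
exact/states_psd/full_state/mixed_full.
Qed.

Lemma chain_push e x y l : 0 < e < 1 -> chain x y l -> chain (push e x) (push e y) l.
Proof.
move=> e01; elim=> [{}x fx|{}x {}y z c {}l st _ IH].
  apply: chain0; apply: push_full; [exact: d0|exact: full_state|].
  by case/andP: e01 => -> /ltW ->.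
by apply: chainS (step_push e01 st) IH.
Qed.

Lemma chain_lower : exists2 k : R, 0 < k & forall x y l, chain x y l -> nm (y - x) <= k * l.
Proof.
have [k k0 kP] := src_bound V omega p12 psigma; exists (Num.sqrt k); first by rewrite sqrtr_gt0.
move=> x y l; elim=> [{}x _|{}x {}y z c {}l [c0 fx fy [B sB hB]] _ IH].
  by rewrite subrr nm0 mulr0.
rewrite (le_trans (nm_tri y _ _)) // mulrDr addrC lerD //.
rewrite -sB /nm -[X in _ * X]ger0_norm ?(ltW c0) // -sqrtr_sqr -sqrtrM ?(ltW k0) // ler_wsqrtr //.
rewrite (le_trans (kP B)) // ler_wpM2l ?(ltW k0) //.
have h0 : 0 <= (0 : R) <= 1 by rewrite lexx ler01.
apply: le_trans (hB 0 h0); apply: Q1_le; first by apply: seg_states => //; exact: full_state.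
exact/full_pd/seg_full.
Qed.

Lemma step_of_bound x y r c B : full_states x -> full_states y -> 0 < r <= 1 ->
  psd (x - r%:C%:M) -> psd (y - r%:C%:M) -> src B = y - x -> 0 < c ->
  r^-1 * Q 1%:M B <= c ^+ 2 -> step x y c.
Proof.
move=> fx fy r01 hx hy sB c0 hc; split; [exact: c0|exact: fx|exact: fy|].
exists B; [exact: sB|move=> s s01].
apply: le_trans hc; apply: Q_le_eta r01 _; exact: seg_ge.
Qed.

Lemma full_lower x : full_states x -> exists2 r, 0 < r <= 1 & psd (x - r%:C%:M).
Proof.
move=> fx; have /pdP[e e0 he] := full_pd fx; exists e; last exact: he.
rewrite e0; have dlt := d0; have := eigval_ge (Ordinal dlt) he.
by have /andP[_] := states_eig (Ordinal dlt) (full_state fx); move=> h1 /le_trans; apply.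
Qed.

(** One segment is enough: its spectrum is bounded below by the smaller of the bounds at its
    ends. *)
Lemma chain_exists x y : full_states x -> full_states y -> exists l, chain x y l.
Proof.
move=> fx fy; have [r /andP[r0 r1] hr] := full_lower fx.
have [q /andP[q0 q1] hq] := full_lower fy.
have mono (u v : R) : u <= v -> psd (v%:C%:M - u%:C%:M : M).
  by move=> uv; rewrite -raddfB -rmorphB; apply: psd_scalar; rewrite subr_ge0.
have [k k0 kP] := source_bound p12 psigma pairing ergodic.
have [B sB _] := kP _ (states_sub_T (full_state fx) (full_state fy)).
pose m := Num.min r q; have m0 : 0 < m by rewrite /m lt_min r0.
(* The summand 1 keeps the speed positive. *)
exists (Num.sqrt (m^-1 * Q 1%:M B) + 1); apply: chain1.
apply: (@step_of_bound x y m _ B fx fy _ _ _ sB).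
- by rewrite m0 /m ge_min r1.
- by apply: psd_trans (mono _ _ _) hr; rewrite /m ge_min lexx.
- by apply: psd_trans (mono _ _ _) hq; rewrite /m ge_min lexx orbT.
- by rewrite ltr_wpDl ?sqrtr_ge0.
have Q0 : 0 <= m^-1 * Q 1%:M B.
  by rewrite mulr_ge0 ?invr_ge0 ?(ltW m0) // Q_ge0 //; exact: pd1.
rewrite -[leLHS]sqr_sqrtr // ler_pXn2r ?nnegrE ?addr_ge0 ?sqrtr_ge0 //.
by rewrite lerDl.
Qed.

Definition Wc : M -> M -> R := sval (seal (fun x y => inf [set l | chain x y l])).
Lemma WcE x y : Wc x y = inf [set l | chain x y l].
Proof. by rewrite /Wc (svalP (seal _)). Qed.

Lemma Wc_has_inf x y : full_states x -> full_states y -> has_inf [set l | chain x y l].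
Proof.
move=> fx fy; split; first exact: chain_exists.
by exists 0 => l; exact: chain_ge0.
Qed.

Lemma Wc_le x y l : chain x y l -> Wc x y <= l.
Proof.
move=> h; rewrite WcE; apply: ge_inf => //; by exists 0 => m; exact: chain_ge0.
Qed.

Lemma Wc_approx x y e : full_states x -> full_states y -> 0 < e ->
  exists2 l, chain x y l & l < Wc x y + e.
Proof.
move=> fx fy e0; have [l hl hlt] := inf_adherent e0 (Wc_has_inf fx fy).
by exists l; rewrite ?WcE.
Qed.

Lemma Wc_ge x y k : full_states x -> full_states y ->
  (forall l, chain x y l -> k <= l) -> k <= Wc x y.
Proof.
move=> fx fy h; rewrite WcE; apply: lb_le_inf; first exact: chain_exists.
by move=> l; exact: h.
Qed.

Lemma Wc_ge0 x y : full_states x -> full_states y -> 0 <= Wc x y.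
Proof. by move=> fx fy; apply: Wc_ge => // l; exact: chain_ge0. Qed.

Lemma Wc_sym x y : full_states x -> full_states y -> Wc x y = Wc y x.
Proof.
move=> fx fy; apply/eqP; rewrite eq_le; apply/andP; split; apply: Wc_ge => // l h;
  by apply: Wc_le; exact: chain_sym.
Qed.

Lemma Wc_triangle x y z : full_states x -> full_states y -> full_states z ->
  Wc x z <= Wc x y + Wc y z.
Proof.
move=> fx fy fz; apply/ler_addgt0Pl => e e0.
have e2 : 0 < e / 2 by rewrite divr_gt0.
have [l hl l1] := Wc_approx fx fy e2; have [m hm m1] := Wc_approx fy fz e2.
by have := Wc_le (chain_cat hl hm); lra.
Qed.

Lemma Wc_refl x : full_states x -> Wc x x = 0.
Proof.
move=> fx; apply/eqP; rewrite eq_le Wc_ge0 // andbT.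
by apply: Wc_le; exact: chain0.
Qed.

Lemma Wc_lower : exists2 k : R, 0 < k & forall x y, full_states x -> full_states y ->
  nm (y - x) <= k * Wc x y.
Proof.
have [k k0 kP] := chain_lower; exists k => // x y fx fy.
rewrite -ler_pdivrMl //; apply: Wc_ge => // l h; rewrite ler_pdivrMl //; exact: kP.
Qed.

Lemma Wc_push e x y : 0 < e < 1 -> full_states x -> full_states y ->
  Wc (push e x) (push e y) <= Wc x y.
Proof.
by move=> e01 fx fy; apply: Wc_ge => // l h; apply: Wc_le; exact: chain_push.
Qed.

(* The segment between two states of spectrum at least e/d has speed of order e^(-1/2). *)
Lemma Wc_push_upper : exists2 k : R, 0 < k & forall e x y, 0 < e < 1 ->
  states x -> states y -> Wc (push e x) (push e y) <= k * (Num.sqrt e)^-1 * nm (y - x).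
Proof.
have [k k0 kP] := source_bound p12 psigma pairing ergodic.
exists (Num.sqrt (d%:R * k)) => [|e x y /andP[e0 e1] sx sy].
  by rewrite sqrtr_gt0 mulr_gt0 // ltr0n.
have e01 : 0 <= e <= 1 by rewrite (ltW e0) (ltW e1).
have e01' : 0 < e <= 1 by rewrite e0 ltW.
have fx := push_full d0 sx e01'; have fy := push_full d0 sy e01'.
have [B sB QB] := kP _ (states_sub_T (full_state fx) (full_state fy)).
apply/ler_addgt0Pl => f f0; apply: Wc_le; apply: chain1.
have r01 : 0 < e / d%:R <= 1.
  rewrite divr_gt0 ?ltr0n //= ler_pdivrMr ?ltr0n // mul1r (le_trans (ltW e1)) //.
  by rewrite ler1n.
apply: (@step_of_bound _ _ (e / d%:R) _ B fx fy r01 _ _ sB).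
- exact: push_ge.
- exact: push_ge.
- by rewrite ltr_pwDl // !mulr_ge0 ?invr_ge0 ?sqrtr_ge0 ?nm_ge0.
have -> : Num.sqrt (d%:R * k) * (Num.sqrt e)^-1 * nm (y - x) =
    Num.sqrt ((e / d%:R)^-1 * (k * ip (y - x) (y - x))).
  have d0' : 0 <= d%:R :> R by rewrite ler0n.
  have s1 : Num.sqrt (k * ip (y - x) (y - x)) = Num.sqrt k * nm (y - x) by rewrite sqrtrM // ltW.
  have s2 : Num.sqrt ((e / d%:R)^-1) = Num.sqrt d%:R * (Num.sqrt e)^-1.
    by rewrite invf_div sqrtrM // sqrtrV // ltW.
  rewrite [RHS]sqrtrM ?invr_ge0 ?divr_ge0 ?(ltW e0) // s1 s2 sqrtrM //.
  by ring.
have Qle : (e / d%:R)^-1 * Q 1%:M B <= (e / d%:R)^-1 * (k * ip (y - x) (y - x)).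
  apply: ler_wpM2l; first by rewrite invr_ge0 divr_ge0 ?ler0n ?(ltW e0).
  rewrite (le_trans QB) // ler_wpM2l ?(ltW k0) // push_sub ipZr ipZl mulrA ler_piMl ?ip_ge0 //.
  by rewrite -expr2 expr_le1 // ?subr_ge0 ?(ltW e1) // lerBlDr lerDl ltW.
have R0 : 0 <= (e / d%:R)^-1 * (k * ip (y - x) (y - x)).
  by rewrite !mulr_ge0 ?invr_ge0 ?divr_ge0 ?ler0n ?ip_ge0 ?(ltW k0) ?(ltW e0).
rewrite (le_trans Qle) // -[leLHS]sqr_sqrtr // ler_pXn2r ?nnegrE ?sqrtr_ge0 //.
  by rewrite lerDr ltW.
by rewrite addr_ge0 ?sqrtr_ge0 // ltW.
Qed.

End Chains.

(** * Bound of Wc along a curve by a dual form of its action *)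

Section CurveBound.
Variables (R : realType) (d : nat).
Local Notation C := R[i].
Local Notation M := 'M[C]_d.
Variables (p : R) (sigma : M) (J : nat) (V : 'I_J -> M) (omega : 'I_J -> R).
Local Notation field := ('I_J -> M).
Implicit Types (A X Y x y z w : M) (B : field) (r s t l e : R).
Hypotheses (p12 : 1 < p <= 2) (psigma : pd sigma) (d0 : (0 < d)%N).
Hypothesis pairing : exists2 jp : 'I_J -> 'I_J, injective jp &
  forall j, (V j) ^t* = V (jp j) /\ omega (jp j) = - omega j.
Hypothesis ergodic : forall A, (forall j, partialj V j A = 0) -> exists c : C, A = c%:M.

Local Notation Q := (Q p sigma omega).
Local Notation src := (src V).
Local Notation Dop := (Dop p sigma V omega).
Local Notation step := (step p sigma V omega).
Local Notation chain := (chain p sigma V omega).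
Local Notation Wc := (Wc p sigma V omega).

(* m s t bounds the action on [s, t]; the last clause is the dual (Legendre) form of
   |gamma t - gamma s|^2 / (t - s) <= m s t, in every tensor smaller than the one along gamma. *)
Definition action_bound (gamma : R -> M) (m : R -> R -> R) a b := [/\
  forall s t, a <= s -> s <= t -> t <= b -> 0 <= m s t,
  forall s t u, a <= s -> s <= t -> t <= u -> u <= b -> m s t + m t u <= m s u &
  forall s t z, a <= s -> s < t -> t <= b -> pd z ->
    (forall r, s <= r -> r <= t -> psd (z - gamma r)) ->
    forall A, ip A (gamma t - gamma s) *+ 2 - (t - s) * ip A (Dop z A) <= m s t].

(** On a short interval z = (1 + delta) gamma(s) dominates the curve, so the dual clause at z bounds
    the optimal field there. The straight segment stays above (1 - delta) gamma(s), a fixed fraction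
    of z, which carries the bound over to it. The term delta * (t - s) makes the speed positive. *)
Lemma piece_step gamma m a b s t eta delta : a <= s -> s < t -> t <= b ->
  full_states (gamma s) -> full_states (gamma t) -> psd (gamma s - eta%:C%:M) ->
  0 < delta -> delta <= 2^-1 ->
  (forall r, s <= r -> r <= t -> psd (gamma s - gamma r + (delta * eta)%:C%:M)) ->
  psd (gamma t - gamma s + (delta * eta)%:C%:M) ->
  action_bound gamma m a b ->
  step (gamma s) (gamma t) ((1 + 4 * delta) * Num.sqrt ((t - s) * m s t) + delta * (t - s)).
Proof.
move=> ha st hb fs ft heta de0 de1 hr ht [m0 _ hm].
have d1 : delta < 1 by apply: le_lt_trans de1 _; rewrite invf_lt1 // ltr1n.
set x := gamma s; set y := gamma t; set h := t - s.
have h0 : 0 < h by rewrite subr_gt0.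
have px : pd x := full_pd fs.
pose z := (1 + delta)%:C *: x.
have pz : pd z by apply: pdZ px; rewrite addr_gt0.
have dx : psd (delta%:C *: x - (delta * eta)%:C%:M).
  have -> : (delta * eta)%:C%:M = delta%:C *: (eta%:C%:M : M) by rewrite scale_scalar_mx rmorphM.
  by rewrite -scalerBr; apply: psdZ; [exact: ltW|exact: heta].
have TY : traceless_sa (y - x) := states_sub_T (full_state fs) (full_state ft).
have [A [B [sB QB DA]]] := source_potential p12 psigma pairing ergodic pz TY.
have Qm : Q z B <= h * m s t.
  have zr r : s <= r -> r <= t -> psd (z - gamma r).
    move=> sr rt; have := psdD (hr r sr rt) dx.
    rewrite /z rmorphD scalerDl scale1r.
    have -> : gamma s - gamma r + (delta * eta)%:C%:M + (delta%:C *: x - (delta * eta)%:C%:M) =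
      x + delta%:C *: x - gamma r by rewrite addrA addrAC addrK -/x addrAC.
    by [].
  (* Dividing the potential by the duration h optimises the dual bound, which becomes <A, y - x> / h
     = Q z B / h. *)
  have := hm s t z ha st hb pz zr ((h^-1)%:C *: A).
  rewrite DopZ !ipZl ipZr -/x -/y -/h DA -QB => hq.
  rewrite -ler_pdivrMl //; apply: le_trans hq.
  rewrite [h * _]mulrA mulfV ?gt_eqF // mul1r mulr2n addrK //.
have m_ge0 : 0 <= m s t by apply: m0 => //; exact: ltW.
have hm0 : 0 <= h * m s t by rewrite mulr_ge0 // ltW.
have c0 : 0 < (1 + 4 * delta) * Num.sqrt (h * m s t) + delta * h.
  apply: ltr_wpDl; last exact: mulr_gt0.
  by rewrite mulr_ge0 ?sqrtr_ge0 // addr_ge0 // mulr_ge0 // ltW.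
split; [exact: c0|exact: fs|exact: ft|exists B; [exact: sB|move=> u u01]].
(* (1 - delta) x = k z, and 1 / k <= 1 + 4 delta because delta <= 1/2. *)
pose k := (1 - delta) / (1 + delta).
have D1 : 0 < 1 + delta by rewrite addr_gt0.
have D2 : 0 < 1 - delta by rewrite subr_gt0.
have k01 : 0 < k <= 1.
  rewrite divr_gt0 //= ler_pdivrMr // mul1r; lra.
have wz : psd (seg x y u - k%:C *: z).
  have -> : k%:C *: z = (1 - delta)%:C *: x.
    by rewrite /z scalerA -rmorphM /k divfK // gt_eqF.
  have xd : x - (1 - delta)%:C *: x = delta%:C *: x.
    by rewrite rmorphB scalerBl scale1r opprB addrC subrK.
  apply: seg_ge u01; rewrite ?xd.
    by apply: psdZ; [exact: ltW|exact: pd_psd].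
  have -> : y - (1 - delta)%:C *: x = (y - x + (delta * eta)%:C%:M) +
      (delta%:C *: x - (delta * eta)%:C%:M).
    by rewrite addrA addrAC addrK -xd addrA subrK.
  by apply: psdD; [exact: ht|exact: dx].
rewrite (le_trans (Q_le_scale omega p12 psigma B pz k01 wz)) //.
apply: (@le_trans _ _ ((1 + 4 * delta) * (h * m s t))).
  apply: ler_pM => //; first by rewrite invr_ge0; case/andP: k01 => /ltW.
    exact: Q_ge0.
  rewrite /k invf_div ler_pdivrMr //; nra.
have s0 := sqrtr_ge0 (h * m s t).
have ss : Num.sqrt (h * m s t) ^+ 2 = h * m s t by rewrite sqr_sqrtr.
move: (Num.sqrt (h * m s t)) s0 ss => q q0 <-.
have dh : 0 <= delta * h by rewrite mulr_ge0 // ltW.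
apply: (@le_trans _ _ (((1 + 4 * delta) * q) ^+ 2)).
  rewrite exprMn ler_wpM2r ?sqr_ge0 //; nra.
have c1 : 0 <= (1 + 4 * delta) * q by rewrite mulr_ge0 // addr_ge0 // mulr_ge0 // ltW.
by rewrite ler_pXn2r ?nnegrE ?addr_ge0 // lerDl.
Qed.

(** Uniform continuity and the spectral bound eta allow a subdivision into pieces covered by
    [piece_step]; [sqrt_CS] and the superadditivity of m add their lengths, with an error
    proportional to delta. *)
Lemma curve_bound gamma m a b eta : a < b ->
  (forall t, a <= t <= b -> full_states (gamma t)) ->
  0 < eta -> (forall t, a <= t <= b -> psd (gamma t - eta%:C%:M)) ->
  (forall e, 0 < e -> exists2 r, 0 < r & forall s t, a <= s <= b -> a <= t <= b ->
     `|s - t| <= r -> nm (gamma s - gamma t) <= e) ->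
  action_bound gamma m a b ->
  Wc (gamma a) (gamma b) <= Num.sqrt ((b - a) * m a b).
Proof.
move=> ab fg eta0 heta cont hm; have [m0 msup _] := hm.
have ba0 : 0 < b - a by rewrite subr_gt0.
(* The relative error 4 delta and the additive error delta (b - a), with delta = e / 2. *)
apply: (@ler_add_eps_mul _ _ _ (2 * Num.sqrt ((b - a) * m a b) + (b - a) / 2)) => e e0 e1.
pose delta := e / 2.
have de0 : 0 < delta by rewrite divr_gt0.
have de1 : delta <= 2^-1 by rewrite ler_pdivrMr // mulVf // ltW.
have [r r0 hr] := cont (delta * eta) (mulr_gt0 de0 eta0).
pose n := Num.truncn ((b - a) / r); pose h := (b - a) / n.+1%:R.
have h0 : 0 < h by rewrite divr_gt0.
have hr' : h <= r by rewrite ler_pdivrMr // mulrC -ler_pdivrMr // ltW // truncnS_gt.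
have hn : h * n.+1%:R = b - a by rewrite divfK.
pose t k := a + h * k%:R.
have tb k : (k <= n.+1)%N -> t k <= b.
  by move=> kn; rewrite /t -lerBrDl -hn ler_wpM2l ?(ltW h0) // ler_nat.
have ta k : a <= t k by rewrite lerDl mulr_ge0 // ltW.
have tS k : t k.+1 - t k = h by rewrite /t -natr1; ring.
have near u v : a <= u -> u <= v -> v <= b -> v - u <= h ->
    psd (gamma u - gamma v + (delta * eta)%:C%:M) /\ psd (gamma v - gamma u + (delta * eta)%:C%:M).
  move=> au uv vb vu.
  have Iu : a <= u <= b by rewrite au (le_trans uv).
  have Iv : a <= v <= b by rewrite vb (le_trans au).
  have gap X : X ^t* = X -> nm X <= delta * eta -> psd (X + (delta * eta)%:C%:M).
    move=> hX nX.
    have -> : (delta * eta)%:C%:M = (nm X)%:C%:M + (delta * eta - nm X)%:C%:M :> M.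
      by rewrite -raddfD -rmorphD addrC subrK.
    by rewrite addrA; apply: psdD; [exact: psd_add_nm|apply: psd_scalar; rewrite subr_ge0].
  have hu := states_adj (full_state (fg u Iu)); have hv := states_adj (full_state (fg v Iv)).
  have uvr : `|u - v| <= r by rewrite distrC ger0_norm ?subr_ge0 // (le_trans vu).
  split; apply: gap; rewrite ?dagB ?hu ?hv //; first exact: hr.
  by rewrite nm_subC; exact: hr.
have claim k : (k <= n.+1)%N -> exists2 l, chain (gamma a) (gamma (t k)) l &
    l <= (1 + 4 * delta) * Num.sqrt ((t k - a) * m a (t k)) + delta * (t k - a).
  elim: k => [_|k IH kn].
    exists 0; first by rewrite /t mulr0 addr0; apply: chain0; apply: fg; rewrite lexx ltW.
    by rewrite /t mulr0 addr0 subrr mul0r sqrtr0 !mulr0 addr0.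
  have [l hl hle] := IH (ltnW kn).
  have tk : t k < t k.+1 by rewrite -subr_gt0 tS.
  have Ik : a <= t k <= b by rewrite ta tb // ltnW.
  have IkS : a <= t k.+1 <= b by rewrite ta tb.
  have hstep : step (gamma (t k)) (gamma (t k.+1))
     ((1 + 4 * delta) * Num.sqrt ((t k.+1 - t k) * m (t k) (t k.+1)) + delta * (t k.+1 - t k)).
    apply: (@piece_step gamma m a b (t k) (t k.+1) eta delta) => //; try exact: fg; try exact: tb.
    - exact: heta.
    - move=> u ku uk; apply: (near (t k) u (ta k) ku _ _).1; first exact: le_trans uk (tb _ kn).
      by rewrite -(tS k) lerD2r.
    - by apply: (near (t k) (t k.+1) (ta k) (ltW tk) (tb _ kn) _).2; rewrite tS.
  exists (l + ((1 + 4 * delta) * Num.sqrt ((t k.+1 - t k) * m (t k) (t k.+1)) + delta * (t k.+1 - t k))).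
    by apply: (chain_cat hl); exact: chain1.
  have cs : Num.sqrt ((t k - a) * m a (t k)) + Num.sqrt ((t k.+1 - t k) * m (t k) (t k.+1)) <=
      Num.sqrt ((t k.+1 - a) * m a (t k.+1)).
    apply: (le_trans (sqrt_CS _ _ _ _)).
    - by rewrite subr_ge0.
    - by rewrite subr_ge0 ltW.
    - by apply: m0 => //; apply: tb; exact: ltnW.
    - by apply: m0 => //; [exact: ltW|exact: tb].
    have -> : t k - a + (t k.+1 - t k) = t k.+1 - a by rewrite addrC addrA subrK.
    rewrite ler_wsqrtr // ler_wpM2l ?subr_ge0 //.
    by apply: msup => //; [exact: ltW|exact: tb].
  have k4 : 0 <= 1 + 4 * delta by rewrite addr_ge0 // mulr_ge0 // ltW.
  have := ler_wpM2l k4 cs; rewrite mulrDr => cs'.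
  have -> : t k.+1 - a = (t k - a) + (t k.+1 - t k) by rewrite [RHS]addrC addrA subrK.
  rewrite mulrDr; have -> : (t k - a) + (t k.+1 - t k) = t k.+1 - a by rewrite addrC addrA subrK.
  by move: hle cs'; move: (Num.sqrt _) (Num.sqrt _) (Num.sqrt _) => q1 q2 q3; lra.
have [l hl hle] := claim n.+1 (leqnn _).
have tE : t n.+1 = b by rewrite /t hn addrC subrK.
rewrite tE in hl hle; rewrite (le_trans (Wc_le hl)) // (le_trans hle) //.
by rewrite /delta; move: (Num.sqrt _) => q; lra.
Qed.

End CurveBound.

(** * The distance W on all states: modulus of continuity and agreement with Wc *)

Section Distance.
Variables (R : realType) (d : nat).
Local Notation C := R[i].
Local Notation M := 'M[C]_d.
Variables (p : R) (sigma : M) (J : nat) (V : 'I_J -> M) (omega : 'I_J -> R).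
Local Notation field := ('I_J -> M).
Implicit Types (A X Y x y z w : M) (B : field) (r s t l e : R).
Hypotheses (p12 : 1 < p <= 2) (psigma : pd sigma) (d0 : (0 < d)%N).
Hypothesis pairing : exists2 jp : 'I_J -> 'I_J, injective jp &
  forall j, (V j) ^t* = V (jp j) /\ omega (jp j) = - omega j.
Hypothesis ergodic : forall A, (forall j, partialj V j A = 0) -> exists c : C, A = c%:M.

Local Notation Q := (Q p sigma omega).
Local Notation src := (src V).
Local Notation Dop := (Dop p sigma V omega).
Local Notation chain := (chain p sigma V omega).
Local Notation Wc := (Wc p sigma V omega).
Local Notation action_bound := (action_bound p sigma V omega).

Let Wc_triangle' x y z := @Wc_triangle _ _ _ _ _ _ _ p12 psigma d0 pairing ergodic x y z.
Let Wc_sym' x y := @Wc_sym _ _ _ _ _ _ _ p12 psigma d0 pairing ergodic x y.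
Let Wc_ge0' x y := @Wc_ge0 _ _ _ _ _ _ _ p12 psigma d0 pairing ergodic x y.
Let Wc_refl' x := @Wc_refl _ _ _ _ _ _ _ p12 psigma d0 pairing ergodic x.
Let Wc_push' e x y := @Wc_push _ _ _ _ _ _ _ p12 psigma d0 pairing ergodic e x y.

Lemma psd_scalar_mono r s : r <= s -> psd (s%:C%:M - r%:C%:M : M).
Proof. by move=> rs; rewrite -raddfB -rmorphB; apply: psd_scalar; rewrite subr_ge0. Qed.

Lemma seg0 x y : seg x y 0 = x.
Proof. by rewrite /seg scale0r addr0. Qed.
Lemma seg_sub x y s t : seg x y t - seg x y s = (t - s)%:C *: (y - x).
Proof. by rewrite /seg opprD addrACA subrr add0r -scalerBl -rmorphB. Qed.

(* Along push (e t^2) x the tensor blows up like 1 / (e t^2) and the squared speed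
   vanishes like (e t)^2, so the action is of order e even at singular states. *)
Lemma Wc_push_self : exists2 k : R, 0 < k & forall e x, 0 < e < 1 -> full_states x ->
  Wc x (push e x) <= k * Num.sqrt e.
Proof.
have [k k0 kP] := source_bound p12 psigma pairing ergodic.
have dR : 0 < d%:R :> R by rewrite ltr0n.
(* One factor 4 is (t + s)^2 <= 4 t^2, the other the square distance from x to the centre; d comes
   from the spectral bound e t^2 / d. *)
pose K := 16 * d%:R * k; have K0 : 0 < K by rewrite !mulr_gt0.
exists (Num.sqrt K) => [|e x /andP[e0 e1] fx]; first by rewrite sqrtr_gt0.
have sx := full_state fx; have fm := mixed_full R d0; have sm := full_state fm.
have [B0 sB0 QB0] := kP _ (states_sub_T sx sm).
have nmx : nm (mixed R d - x) <= 2.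
  by rewrite (le_trans (nmD _ _)) // nmN; have := states_nm sx; have := states_nm sm; lra.
have ipx : ip (mixed R d - x) (mixed R d - x) <= 4.
  by rewrite -nm_sqr (_ : 4 = 2 ^+ 2) ?ler_pXn2r ?nnegrE ?nm_ge0 //; ring.
pose gamma t := push (e * t ^+ 2) x.
have [r /andP[r0 r1] hr] := full_lower d0 fx.
pose eta := Num.min r (d%:R^-1).
have eta0 : 0 < eta by rewrite /eta lt_min r0 invr_gt0.
have et t : 0 <= t -> t <= 1 -> 0 <= e * t ^+ 2 <= 1.
  move=> t0 t1; rewrite mulr_ge0 ?sqr_ge0 ?(ltW e0) //=.
  by rewrite mulr_ile1 ?sqr_ge0 ?(ltW e0) ?(ltW e1) // expr_le1.
have g0 : gamma 0 = x by rewrite /gamma expr0n mulr0 /push seg0.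
have g1 : gamma 1 = push e x by rewrite /gamma expr1n mulr1.
suff : Wc (gamma 0) (gamma 1) <= Num.sqrt ((1 - 0) * (K * e * (1 - 0))).
  by rewrite g0 g1 subr0 mul1r mulr1 sqrtrM ?(ltW K0).
apply: (@curve_bound R d p sigma J V omega p12 psigma pairing ergodic
  gamma (fun s t => K * e * (t - s)) 0 1 eta ltr01 _ eta0).
- by move=> t /andP[t0 t1]; apply: seg_full => //; exact: et.
- move=> t /andP[t0 t1]; apply: seg_ge; last exact: et.
    by apply: psd_trans hr; apply: psd_scalar_mono; rewrite /eta ge_min lexx.
  by apply: psd_scalar_mono; rewrite /eta ge_min lexx orbT.
- move=> f f0; exists (f / 4); first exact: divr_gt0.
  move=> s t /andP[s0 s1] /andP[t0 t1] st.
  rewrite /gamma /push seg_sub nmZ -mulrBr normrM gtr0_norm // subr_sqr normrM.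
  have h1 : `|s + t| <= 2 by rewrite ger0_norm ?addr_ge0 //; lra.
  have h2 := normr_ge0 (s - t); have h3 := nm_ge0 (mixed R d - x).
  have h4 : `|s - t| * `|s + t| <= f / 4 * 2 by apply: ler_pM.
  have h5 : 0 <= `|s - t| * `|s + t| by rewrite mulr_ge0.
  have h6 : e * (`|s - t| * `|s + t|) <= 1 * (f / 4 * 2) by apply: ler_pM => //; exact: ltW.
  have h7 : 0 <= e * (`|s - t| * `|s + t|) by rewrite mulr_ge0 // ltW.
  by have := ler_pM h7 h3 h6 nmx; lra.
split.
- by move=> s t s0 st t1; apply: mulr_ge0; [exact: ltW (mulr_gt0 K0 e0)|rewrite subr_ge0].
- by move=> s t u _ _ _ _; rewrite -mulrDr (_ : t - s + (u - t) = u - s) //; ring.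
move=> s t z s0 st t1 pz hz A.
have t0 : 0 < t by exact: le_lt_trans st.
have ts0 : 0 < t - s by rewrite subr_gt0.
pose q := e * (t + s).
have -> : gamma t - gamma s = (t - s)%:C *: src (q%:C *: B0).
  rewrite srcZ sB0 /gamma /push seg_sub scalerA -rmorphM; congr (_%:C *: _).
  by rewrite /q; ring.
rewrite ipZr -mulrnAr -mulrBr mulrC ler_wpM2r ?(ltW ts0) //.
rewrite (le_trans (support_le_Q V omega p12 psigma A (q%:C *: B0) pz)) // QZ.
pose rr := e * t ^+ 2 / d%:R.
have et2 : 0 < e * t ^+ 2 by rewrite mulr_gt0 // exprn_gt0.
have /andP[_ et1] := et t (ltW t0) t1.
have rr01 : 0 < rr <= 1.
  rewrite divr_gt0 //= ler_pdivrMr // mul1r (le_trans et1) // ler1n //.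
have hzr : psd (z - rr%:C%:M).
  apply: (@psd_trans _ _ (gamma t)); last exact: hz (ltW st) (lexx t).
  by apply: push_ge => //; rewrite et1 ltW.
have Qz := Q_le_eta omega p12 psigma B0 rr01 hzr.
have q0 : 0 <= q ^+ 2 by rewrite sqr_ge0.
rewrite (le_trans (ler_wpM2l q0 Qz)) // mulrA.
have Q1B : Q 1%:M B0 <= k * 4 by rewrite (le_trans QB0) // ler_wpM2l // ltW.
have qr : 0 <= q ^+ 2 * rr^-1 by rewrite mulr_ge0 // invr_ge0; case/andP: rr01 => /ltW.
rewrite (le_trans (ler_wpM2l qr Q1B)) //.
have qle : q ^+ 2 <= e ^+ 2 * (4 * t ^+ 2).
  rewrite /q exprMn ler_wpM2l ?sqr_ge0 //.
  by move: st s0 => /ltW; move: (t) (s) => t' s'; nra.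
have -> : K * e = e ^+ 2 * (4 * t ^+ 2) * rr^-1 * (k * 4).
  by rewrite /K /rr; field; rewrite !gt_eqF.
rewrite ler_wpM2r ?mulr_ge0 ?(ltW k0) // ler_wpM2r // invr_ge0.
by case/andP: rr01 => /ltW.
Qed.

(** Go from x to push e x, across to push e y and back to y: the ends cost sqrt(e) and the middle |y
    - x| / sqrt(e). Taking e proportional to |y - x| balances them. *)
Lemma Wc_modulus : exists2 k : R, 0 < k & forall x y, full_states x -> full_states y ->
  Wc x y <= k * Num.sqrt (nm (y - x)).
Proof.
have [k1 k10 h1] := Wc_push_self; have [k2 k20 h2] := Wc_push_upper p12 psigma d0 pairing ergodic.
exists (2 * k1 + 4 * k2) => [|x y fx fy]; first by rewrite addr_gt0 ?mulr_gt0.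
have [->|xy] := eqVneq x y; first by rewrite Wc_refl' // subrr nm0 sqrtr0 mulr0.
pose n := nm (y - x); have n0 : 0 < n.
  rewrite lt_def nm_ge0 andbT; apply/eqP => /nm_eq0/eqP.
  by rewrite subr_eq0 eq_sym (negbTE xy).
have n2 : n <= 2.
  rewrite /n (le_trans (nmD _ _)) // nmN.
  by have := states_nm (full_state fx); have := states_nm (full_state fy); lra.
(* Two states are at distance at most 2, so this e is an admissible push parameter. *)
pose e := n / 4; have e0 : 0 < e by rewrite divr_gt0.
have e1 : e < 1 by rewrite /e; lra.
have e01 : 0 < e < 1 by rewrite e0.
have e01' : 0 < e <= 1 by rewrite e0 ltW.
have px := push_full d0 (full_state fx) e01'; have py := push_full d0 (full_state fy) e01'.
rewrite (le_trans (Wc_triangle' fx px fy)) //.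
have t2 := Wc_triangle' px py fy.
have a1 := h1 e x e01 fx; have a2 := h1 e y e01 fy; rewrite Wc_sym' // in a2.
have a3 := h2 e x y e01 (full_state fx) (full_state fy).
have s0 : 0 < Num.sqrt e by rewrite sqrtr_gt0.
have a4 : k2 * (Num.sqrt e)^-1 * nm (y - x) = 4 * k2 * Num.sqrt e.
  have -> : nm (y - x) = 4 * (Num.sqrt e) ^+ 2.
    by rewrite sqr_sqrtr ?(ltW e0) // /e -/n; field.
  by field; rewrite gt_eqF.
have a5 : Num.sqrt e <= Num.sqrt n.
  by rewrite ler_wsqrtr // /e ler_pdivrMr // ler_peMr ?(ltW n0) // ler1n.
rewrite a4 in a3.
have a6 : (2 * k1 + 4 * k2) * Num.sqrt e <= (2 * k1 + 4 * k2) * Num.sqrt n.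
  by rewrite ler_wpM2l // addr_ge0 // mulr_ge0 // ltW.
move: a1 a2 a3 a6 t2; rewrite -/n.
move: (Wc _ _) (Wc _ _) (Wc _ _) (Wc _ _) (Num.sqrt e) (Num.sqrt n) => u1 u2 u3 u4 q1 q2.
by lra.
Qed.

Definition W : M -> M -> R := sval (seal (fun x y =>
  sup [set Wc (push e x) (push e y) | e in [set e : R | 0 < e < 1]])).
Lemma WE x y : W x y = sup [set Wc (push e x) (push e y) | e in [set e : R | 0 < e < 1]].
Proof. by rewrite /W (svalP (seal _)). Qed.

Lemma push_full' e x : states x -> 0 < e < 1 -> full_states (push e x).
Proof. by move=> sx /andP[e0 e1]; apply: push_full => //; rewrite e0 ltW. Qed.

Lemma W_has_sup x y : states x -> states y ->
  has_sup [set Wc (push e x) (push e y) | e in [set e : R | 0 < e < 1]].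
Proof.
move=> sx sy; split.
  by exists (Wc (push (2^-1) x) (push (2^-1) y)), 2^-1 => //=;
    rewrite invr_gt0 ltr0n invf_lt1 // ltr1n.
have [k k0 kP] := Wc_modulus; exists (k * Num.sqrt (nm (y - x))) => _ [e e01 <-].
rewrite (le_trans (kP _ _ (push_full' sx e01) (push_full' sy e01))) //.
rewrite ler_wpM2l ?(ltW k0) // ler_wsqrtr // push_sub nmZ ler_piMl ?nm_ge0 //.
by case/andP: e01 => e0 e1; rewrite ger0_norm ?subr_ge0 ?(ltW e1) // lerBlDr lerDl ltW.
Qed.

Lemma W_ge e x y : states x -> states y -> 0 < e < 1 -> Wc (push e x) (push e y) <= W x y.
Proof.
move=> sx sy e01; rewrite WE; apply: ub_le_sup; first by have [] := W_has_sup sx sy.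
by exists e.
Qed.

Lemma W_le x y k : states x -> states y ->
  (forall e, 0 < e < 1 -> Wc (push e x) (push e y) <= k) -> W x y <= k.
Proof.
move=> sx sy h; rewrite WE; apply: ge_sup; first by have [] := W_has_sup sx sy.
by move=> _ [e e01 <-]; exact: h.
Qed.

Lemma W_modulus : exists2 k : R, 0 < k & forall x y, states x -> states y ->
  W x y <= k * Num.sqrt (nm (y - x)).
Proof.
have [k k0 kP] := Wc_modulus; exists k => // x y sx sy; apply: W_le => // e e01.
rewrite (le_trans (kP _ _ (push_full' sx e01) (push_full' sy e01))) //.
rewrite ler_wpM2l ?(ltW k0) // ler_wsqrtr // push_sub nmZ ler_piMl ?nm_ge0 //.
by case/andP: e01 => e0 e1; rewrite ger0_norm ?subr_ge0 ?(ltW e1) // lerBlDr lerDl ltW.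
Qed.

Lemma half01 : 0 < (2^-1 : R) < 1.
Proof. by rewrite invr_gt0 ltr0n invf_lt1 // ltr1n. Qed.

Lemma W_ge0 x y : states x -> states y -> 0 <= W x y.
Proof.
move=> sx sy; apply: le_trans (W_ge sx sy half01); apply: Wc_ge0' => //;
  by apply: push_full' half01.
Qed.

Lemma W_sym x y : states x -> states y -> W x y = W y x.
Proof.
move=> sx sy; apply/eqP; rewrite eq_le; apply/andP; split; apply: W_le => // e e01.
  by rewrite Wc_sym' ?W_ge //; exact: push_full'.
by rewrite Wc_sym' ?W_ge //; exact: push_full'.
Qed.

Lemma W_triangle x y z : states x -> states y -> states z -> W x z <= W x y + W y z.
Proof.
move=> sx sy sz; apply: W_le => // e e01.
by rewrite (le_trans (Wc_triangle' (push_full' sx e01) (push_full' sy e01) (push_full' sz e01)))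
  // lerD // W_ge.
Qed.

Lemma W_lower : exists2 k : R, 0 < k & forall x y, states x -> states y -> nm (y - x) <= k * W x y.
Proof.
have [k k0 kP] := Wc_lower p12 psigma d0 pairing ergodic; exists k => // x y sx sy.
apply: (@ler_add_eps_mul _ _ _ (nm (y - x))) => e e0 e1; have e01 : 0 < e < 1 by rewrite e0.
have := kP _ _ (push_full' sx e01) (push_full' sy e01).
rewrite push_sub nmZ ger0_norm ?subr_ge0 ?(ltW e1) // mulrBl mul1r.
have := ler_wpM2l (ltW k0) (W_ge sx sy e01); lra.
Qed.

Lemma W_eq0 x y : states x -> states y -> (W x y = 0 <-> x = y).
Proof.
move=> sx sy; split=> [w0|->].
  have [k k0 /(_ x y sx sy)] := W_lower; rewrite w0 mulr0 => h.
  have /nm_eq0/eqP : nm (y - x) = 0 by apply/eqP; rewrite eq_le h nm_ge0.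
  by rewrite subr_eq0 => /eqP.
apply/eqP; rewrite eq_le W_ge0 // andbT; have [k k0 /(_ y y sy sy)] := W_modulus.
by rewrite subrr nm0 sqrtr0 mulr0.
Qed.

Lemma W_cont : exists2 k : R, 0 < k & forall x y x' y', states x -> states y ->
  states x' -> states y' ->
  `|W x y - W x' y'| <= k * (Num.sqrt (nm (x - x')) + Num.sqrt (nm (y - y'))).
Proof.
have [k k0 kP] := W_modulus; exists k => // x y x' y' sx sy sx' sy'.
have h1 := kP x' x sx' sx; have h2 := kP y' y sy' sy.
have t1 := W_triangle sx sx' sy; have t2 := W_triangle sx' sy' sy.
have t3 := W_triangle sx' sx sy'; have t4 := W_triangle sx sy sy'.
rewrite (W_sym sx sx') in t1; rewrite (W_sym sy sy') in t4.
by rewrite ler_norml; apply/andP; split; lra.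
Qed.

(** Contraction under the push bounds W above by Wc. Conversely [Wc_push_self] at e = f^2 gives an
    error linear in f. *)
Lemma W_full x y : full_states x -> full_states y -> W x y = Wc x y.
Proof.
move=> fx fy; have sx := full_state fx; have sy := full_state fy.
apply/eqP; rewrite eq_le; apply/andP; split.
  by apply: W_le => // e e01; exact: Wc_push'.
have [k k0 kP] := Wc_push_self.
apply: (@ler_add_eps_mul _ _ _ (2 * k)) => f f0 f1.
pose e := f ^+ 2; have e01 : 0 < e < 1 by rewrite exprn_gt0 // expr_lt1 // ltW.
have px := push_full' sx e01; have py := push_full' sy e01.
have t1 := Wc_triangle' fx px fy; have t2 := Wc_triangle' px py fy.
have a1 := kP e x e01 fx; have a2 := kP e y e01 fy; rewrite Wc_sym' // in a2.
have a3 := W_ge sx sy e01.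
have se : Num.sqrt e = f by rewrite sqrtr_sqr gtr0_norm.
by rewrite se in a1 a2; lra.
Qed.

End Distance.

(** * Integrals of functions that may fail to be measurable *)

Section NonmeasurableIntegral.
Context d (T : measurableType d) (R : realType) (mu : {measure set T -> \bar R}).
Local Open Scope ereal_scope.
Import HBNNSimple.
Implicit Types (f g : T -> \bar R) (D : set T).

(* No measurability is needed: the integral of a nonnegative function is the supremum of
   the integrals of the simple functions below it. *)
Lemma ge0_integral_mono D f g : (forall x, D x -> 0 <= f x) ->
  (forall x, D x -> f x <= g x) ->
  \int[mu]_(x in D) f x <= \int[mu]_(x in D) g x.
Proof.
move=> f0 fg; have g0 x : D x -> 0 <= g x by move=> Dx; exact: le_trans (f0 x Dx) (fg x Dx).
rewrite !ge0_integralE //; apply: ub_ereal_sup => _ [h hf <-].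
apply: ereal_sup_ubound; exists h => // x; apply: le_trans (hf x) _.
by apply: lee_restrict.
Qed.

(** The negative part of f only lowers its integral, and its positive part lies below g. *)
Lemma integral_le_pos D f g : (forall x, D x -> 0 <= g x) ->
  (forall x, D x -> f x <= g x) ->
  \int[mu]_(x in D) f x <= \int[mu]_(x in D) g x.
Proof.
move=> g0 fg; rewrite integralE.
apply: (@le_trans _ _ (\int[mu]_(x in D) f^\+ x)).
  rewrite -[leRHS]adde0; apply: leeD2l; rewrite oppe_le0.
  by apply: integral_ge0 => x _; exact: funeneg_ge0.
apply: ge0_integral_mono => x Dx; first exact: funepos_ge0.
by rewrite funeposE ge_max fg // g0.
Qed.

(** Simple functions below f on D1 and on D2 add up to one below f on the union. Without
    measurability only this inequality is available, and it is the one that [action_bound] asks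
    for. *)
Lemma ge0_integral_superadditive D1 D2 f : D1 `&` D2 = set0 ->
  (forall x, (D1 `|` D2) x -> 0 <= f x) ->
  \int[mu]_(x in D1) f x + \int[mu]_(x in D2) f x <= \int[mu]_(x in D1 `|` D2) f x.
Proof.
move=> D12 f0; set I := (X in _ <= X).
have [->|Ioo] := eqVneq I +oo; first exact: leey.
have I0 : 0 <= I by exact: integral_ge0.
have If : I \is a fin_num by rewrite ge0_fin_numE // lt_neqAle Ioo leey.
have f1 x : D1 x -> 0 <= f x by move=> Dx; apply: f0; left.
have f2 x : D2 x -> 0 <= f x by move=> Dx; apply: f0; right.
have key (h1 h2 : {nnsfun T >-> R}) : (forall x, (h1 x)%:E <= (f \_ D1) x) ->
    (forall x, (h2 x)%:E <= (f \_ D2) x) -> sintegral mu h1 + sintegral mu h2 <= I.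
  move=> H1 H2; rewrite -sintegralD /I ge0_integralE //.
  apply: ereal_sup_ubound; exists (h1 \+ h2)%R => // x.
  rewrite EFinD (le_trans (leeD (H1 x) (H2 x))) // !patchE.
  case: ifPn => [/set_mem D1x|D1x]; case: ifPn => [/set_mem D2x|D2x].
  - by have : (D1 `&` D2) x by []; rewrite D12.
  - by rewrite adde0 mem_set //; left.
  - by rewrite add0e mem_set //; right.
  - by rewrite adde0; case: ifPn => // /set_mem; exact: f0.
have sfin (h : {nnsfun T >-> R}) : (exists D, D `<=` D1 `|` D2 /\ forall x, (h x)%:E <= (f \_ D) x) ->
    sintegral mu h \is a fin_num.
  move=> [D [DD hf]]; rewrite ge0_fin_numE ?sintegral_ge0 //.
  apply: (@le_lt_trans _ _ I); last by rewrite -ge0_fin_numE.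
  rewrite /I ge0_integralE //; apply: ereal_sup_ubound; exists h => // x.
  apply: (le_trans (hf x)); rewrite !patchE; case: ifPn => [/set_mem Dx|_].
    by rewrite mem_set //; exact: DD.
  by case: ifPn => // /set_mem; exact: f0.
have I1le : \int[mu]_(x in D1) f x <= I.
  rewrite ge0_integralE //; apply: ub_ereal_sup => _ [h hf <-].
  apply: le_trans (key h (nnsfun0) hf _) => [|x].
    by rewrite leeDl // sintegral_ge0.
  by rewrite patchE; case: ifPn => // /set_mem; exact: f2.
have I1f : \int[mu]_(x in D1) f x \is a fin_num.
  rewrite ge0_fin_numE ?integral_ge0 // (le_lt_trans I1le) // -ge0_fin_numE //.
rewrite addeC -leeBrDr // ge0_integralE //; apply: ub_ereal_sup => _ [h2 hf2 <-].
rewrite leeBrDr // addeC -leeBrDr; last first.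
  by apply: sfin; exists D2; split => // x; right.
rewrite ge0_integralE //; apply: ub_ereal_sup => _ [h1 hf1 <-].
rewrite leeBrDr; last by apply: sfin; exists D2; split => // x; right.
exact: key.
Qed.

Lemma ge0_integral_subset A D f : A `<=` D -> (forall x, D x -> 0 <= f x) ->
  \int[mu]_(x in A) f x <= \int[mu]_(x in D) f x.
Proof.
move=> AD f0; have := @ge0_integral_superadditive A (D `\` A) f.
rewrite setDUK // => h; apply: le_trans (h _ _) => //.
  by rewrite leeDl //; apply: integral_ge0 => x [Dx _]; exact: f0.
by apply/seteqP; split => // x [Ax [_ nAx]].
Qed.

End NonmeasurableIntegral.

(** * Bound of W by the action of a weak solution *)

Section IntegralBound.
Variables (R : realType) (d : nat).
Local Notation C := R[i].
Local Notation M := 'M[C]_d.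
Local Notation mu := (@lebesgue_measure R).
Variables (p : R) (sigma : M) (J : nat) (V : 'I_J -> M) (omega : 'I_J -> R).
Local Notation field := ('I_J -> M).
Implicit Types (A X Y x y z w : M) (B : field) (r s t l e : R).
Hypotheses (p12 : 1 < p <= 2) (psigma : pd sigma) (d0 : (0 < d)%N).
Hypothesis pairing : exists2 jp : 'I_J -> 'I_J, injective jp &
  forall j, (V j) ^t* = V (jp j) /\ omega (jp j) = - omega j.
Hypothesis ergodic : forall A, (forall j, partialj V j A = 0) -> exists c : C, A = c%:M.

Local Notation Q := (Q p sigma omega).
Local Notation src := (src V).
Local Notation Dop := (Dop p sigma V omega).
Local Notation Wc := (Wc p sigma V omega).
Local Notation W := (W p sigma V omega).

Definition weak_primitive (gamma v : R -> M) a b := forall A s t, a <= s -> s <= t -> t <= b ->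
  mu.-integrable `]s, t] (EFin \o (fun r => ip A (v r))) /\
  \int[mu]_(r in `]s, t]) ip A (v r) = ip A (gamma t - gamma s).

Definition unif_continuous_on (gamma : R -> M) a b := forall e, 0 < e -> exists2 r, 0 < r &
  forall s t, a <= s <= b -> a <= t <= b -> `|s - t| <= r -> nm (gamma s - gamma t) <= e.

(** The push is the regularisation x + f, with f = e / ((1 - e) d), followed by multiplication by 1
    - e. This relates the two ways of leaving the boundary: pushing, and adding a multiple of the
    identity. *)
Lemma push_Q_le e x B : 0 < e < 1 -> states x ->
  Q (push e x) ((1 - e)%:C *: B) <= Q (x + (e / ((1 - e) * d%:R))%:C%:M) B.
Proof.
move=> /andP[e0 e1] sx; set f := e / _.
have e1' : 0 < 1 - e by rewrite subr_gt0.
have dR : 0 < d%:R :> R by rewrite ltr0n.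
have f0 : 0 < f by rewrite divr_gt0 // mulr_gt0.
have px : pd (x + f%:C%:M).
  by apply/pdP; exists f; [exact: f0|rewrite addrK; exact: states_psd].
have -> : push e x = (1 - e)%:C *: (x + f%:C%:M).
  rewrite /push segE scalerDr /mixed !scale_scalar_mx -!rmorphM; congr (_ + _%:C%:M).
  by rewrite /f; field; rewrite !gt_eqF.
have h : 0 < 1 - e <= 1 by rewrite e1' lerBlDr lerDl ltW.
rewrite QZ.
have := Q_le_scale omega p12 psigma B px h (psd_refl _).
move/(ler_wpM2l (sqr_ge0 (1 - e)))/le_trans; apply.
rewrite mulrA expr2 mulfK ?gt_eqF // ler_piMl ?(Q_ge0 omega p12 psigma B px) //.
by rewrite lerBlDr lerDl ltW.
Qed.

(** [curve_bound] is applied to the pushed curve with m the integral of G, which carries no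
    measurability and is only superadditive. The dual clause holds because the integral of the
    affine expression in v lies below that of G. *)
Lemma W_action_bound gamma v (G : R -> \bar R) a b : a < b ->
  (forall t, a <= t <= b -> states (gamma t)) -> unif_continuous_on gamma a b ->
  weak_primitive gamma v a b ->
  (forall t, a <= t <= b -> (0 <= G t)%E) ->
  (forall t e, a <= t <= b -> 0 < e ->
     exists2 B, src B = v t & ((Q (gamma t + e%:C%:M) B)%:E <= G t)%E) ->
  (((W (gamma a) (gamma b)) ^+ 2)%:E <= (b - a)%:E * \int[mu]_(t in `]a, b]) G t)%E.
Proof.
move=> ab sg cg wp G0 GQ.
have ba0 : 0 < b - a by rewrite subr_gt0.
set I := (\int[mu]_(t in `]a, b]) G t)%E.
have Isub u v' : `]u, v'] `<=` `]a, b] -> forall t, `]u, v']%classic t -> (0 <= G t)%E.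
  move=> sub t /sub; rewrite /= in_itv /= => /andP[/ltW at' tb]; apply: G0.
  by rewrite at'.
have I0 : (0 <= I)%E by apply: integral_ge0 => t; exact: Isub.
have [->|Ioo] := eqVneq I +oo%E.
  by rewrite mulry gtr0_sg // mul1e leey.
have If : I \is a fin_num by rewrite ge0_fin_numE // lt_neqAle Ioo leey.
have sub_itv s t : a <= s -> t <= b -> `]s, t] `<=` `]a, b].
  move=> as' tb x; rewrite /= !in_itv /= => /andP[sx xt].
  by rewrite (le_lt_trans as') // (le_trans xt).
have mono s t : a <= s -> s <= t -> t <= b -> (\int[mu]_(x in `]s, t]) G x <= I)%E.
  move=> as' st tb.
  have split3 : `]a, b]%classic = `]s, t] `|` (`]a, b] `\` `]s, t]).
    by rewrite setDUK //; exact: sub_itv.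
  have := @ge0_integral_superadditive _ _ _ mu `]s, t] (`]a, b] `\` `]s, t]) G _ _.
  rewrite -split3 => h; apply: le_trans (h _ _).
  - rewrite leeDl //; apply: integral_ge0 => x [xI _].
    exact: (Isub a b (@subset_refl _ _) x xI).
  - by apply/seteqP; split => // x [Hx [_ nHx]].
  - by move=> x; exact: (Isub a b (@subset_refl _ _)).
pose m s t := fine (\int[mu]_(x in `]s, t]) G x)%E.
have mfin s t : a <= s -> s <= t -> t <= b -> (\int[mu]_(x in `]s, t]) G x)%E \is a fin_num.
  move=> as' st tb; rewrite ge0_fin_numE; last by apply: integral_ge0 => x; apply: Isub; exact: sub_itv.
  by apply: le_lt_trans (mono s t as' st tb) _; rewrite -ge0_fin_numE.
suff key : W (gamma a) (gamma b) <= Num.sqrt ((b - a) * m a b).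
  have W0 : 0 <= W (gamma a) (gamma b).
    by apply: W_ge0 => //; apply: sg; rewrite lexx ltW.
  rewrite -[I]fineK // -EFinM lee_fin.
  rewrite -[leRHS]sqr_sqrtr; last by rewrite mulr_ge0 ?(ltW ba0) // fine_ge0.
  by rewrite ler_pXn2r ?nnegrE ?sqrtr_ge0.
have Ia : a <= a <= b by rewrite lexx ltW.
have Ib : a <= b <= b by rewrite lexx ltW.
apply: (W_le p12 psigma d0 pairing ergodic (sg a Ia) (sg b Ib)) => e e01.
have /andP[e0 e1] := e01.
have e1' : 0 < 1 - e by rewrite subr_gt0.
have eta0 : 0 < e / d%:R by rewrite divr_gt0 // ltr0n.
apply: (@curve_bound R d p sigma J V omega p12 psigma pairing ergodic
  (fun t => push e (gamma t)) m a b (e / d%:R) ab _ eta0).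
- by move=> t It; apply: push_full' e01 => //; exact: sg.
- by move=> t It; apply: push_ge; [exact: sg|rewrite !ltW].
- move=> f f0; have [r r0 hr] := cg f f0; exists r => // s t Is It st.
  rewrite push_sub nmZ ger0_norm ?(ltW e1') // (le_trans _ (hr s t Is It st)) //.
  by rewrite ler_piMl ?nm_ge0 // lerBlDr lerDl ltW.
split.
- by move=> s t as' st tb; rewrite fine_ge0 // integral_ge0 // => x; apply: Isub; exact: sub_itv.
- move=> s t u as' st tu ub; have st' := le_trans as' st; have tb := le_trans tu ub.
  rewrite -lee_fin EFinD !fineK ?mfin // ?(le_trans st) //.
  have -> : `]s, u]%classic = `]s, t] `|` `]t, u].
    by rewrite -itv_bndbnd_setU // bnd_simp.
  apply: ge0_integral_superadditive.
    apply/seteqP; split => // x [/=]; rewrite !in_itv /= => /andP[_ xt] /andP[tx _].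
    by move: (le_lt_trans xt tx); rewrite ltxx.
  by move=> x [|]; apply: Isub; apply: sub_itv.
move=> s t z as' st tb pz hz A.
have [intv Iv] := wp A s t as' (ltW st) tb.
rewrite push_sub ipZr -lee_fin fineK ?mfin ?(ltW st) //.
(* The dual expression at time r. It is integrable, being affine in v, and it is bounded pointwise
   by G. *)
pose g r := (1 - e) *+ 2 * ip A (v r) - ip A (Dop z A).
have mI : measurable (`]s, t]%classic : set (measurableTypeR R)) by exact: measurable_itv.
have muI : mu `]s, t]%classic = (t - s)%:E.
  by rewrite lebesgue_measure_itv /= lte_fin st -EFinB.
have intc (c : R) : mu.-integrable `]s, t] (EFin \o (fun=> c)).
  apply/integrableP; split; first exact: measurable_cst.
  by rewrite integral_cst //= muI -EFinM ltry.
have intA : mu.-integrable `]s, t] (EFin \o (fun r => (1 - e) *+ 2 * ip A (v r))).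
  have := integrableZl mI ((1 - e) *+ 2) intv.
  by apply: eq_integrable.
have Ig : \int[mu]_(r in `]s, t]) g r =
    (1 - e) *+ 2 * ip A (gamma t - gamma s) - (t - s) * ip A (Dop z A).
  rewrite RintegralB // RintegralZl // Iv Rintegral_cst //; congr (_ - _).
  by rewrite mulrC; congr (_ * _); rewrite [X in fine X]muI.
have intg : mu.-integrable `]s, t] (EFin \o g).
  have := integrableB mI intA (intc (ip A (Dop z A))).
  by apply: eq_integrable.
have -> : (1 - e) * ip A (gamma t - gamma s) *+ 2 - (t - s) * ip A (Dop z A) =
    \int[mu]_(r in `]s, t]) g r by rewrite Ig mulrnAl.
rewrite /Rintegral fineK; last by apply: integrable_fin_num.
apply: integral_le_pos => r Ir.
  by apply: Isub Ir; exact: sub_itv.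
have Irab : a <= r <= b.
  move: Ir; rewrite /= in_itv /= => /andP[sr rt].
  by rewrite (le_trans as' (ltW sr)) (le_trans rt tb).
have f0 : 0 < e / ((1 - e) * d%:R) by rewrite divr_gt0 // mulr_gt0 // ltr0n.
have [B sB hB] := GQ r _ Irab f0.
apply: le_trans hB; rewrite lee_fin.
apply: le_trans (push_Q_le B e01 (sg r Irab)).
have ppr : pd (push e (gamma r)) by apply: full_pd; apply: push_full' e01 => //; exact: sg.
apply: le_trans (Q_antitone omega p12 psigma _ ppr _); last first.
  by move: Ir; rewrite /= in_itv /= => /andP[sr rt]; exact: (hz r (ltW sr) rt).
have := support_le_Q V omega p12 psigma A ((1 - e)%:C *: B) pz.
by rewrite srcZ ipZr sB /g mulrnAl.
Qed.

End IntegralBound.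

(** * Lipschitz functions as integrals of their derivative *)

Section LipschitzDensity.
Variable R : realType.
Local Notation mu := (@lebesgue_measure R).

Lemma stieltjes_ocitv (f : cumulative R R) (s t : R) : s <= t ->
  lebesgue_stieltjes_measure f (`]s, t]%classic : set (measurableTypeR R)) = (f t - f s)%:E.
Proof.
move=> st; rewrite /lebesgue_stieltjes_measure /measure_extension /=.
by rewrite measurable_mu_extE /= ?wlength_itv_bnd //; exact: is_ocitv.
Qed.

Lemma lip_cont (f : R -> R) (K : R) : (forall x y, `|f x - f y| <= K * `|x - y|) ->
  continuous f.
Proof.
move=> lip x; apply/cvgrPdist_le => e e0; near=> y.
apply: le_trans (lip x y) _.
have K1 : 0 < `|K| + 1 by rewrite ltr_wpDl.
apply: (@le_trans _ _ ((`|K| + 1) * `|x - y|)).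
  by apply: ler_wpM2r => //; rewrite (le_trans (ler_norm K)) // lerDl.
rewrite mulrC -ler_pdivlMr //; near: y.
have e1 : 0 < e / (`|K| + 1) by rewrite divr_gt0.
exact: cvgr_dist_le.
Unshelve. all: by end_near. Qed.

Lemma nd_lip (f : R -> R) : {homo f : x y / x <= y} ->
  (forall x y, x <= y -> f y - f x <= y - x) -> forall x y, `|f x - f y| <= 1 * `|x - y|.
Proof.
move=> ndf lipf x y; rewrite mul1r; wlog xy : x y / y <= x.
  by move=> h; case/orP: (le_total x y) => xy; [rewrite distrC [leRHS]distrC|]; exact: h.
by rewrite !ger0_norm ?subr_ge0 ?ndf //; exact: lipf.
Qed.

(* f and id - f are both cumulative, so the Stieltjes measure of f is dominated by the Lebesgue
   measure, and Radon-Nikodym applies. *)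
Lemma monotone_density (f : R -> R) : {homo f : x y / x <= y} ->
  (forall x y, x <= y -> f y - f x <= y - x) -> exists2 h : R -> R, mu.-integrable setT (EFin \o h) &
  forall s t, 0 <= s -> s <= t -> t <= 1 -> \int[mu]_(x in `]s, t]) h x = f t - f s.
Proof.
move=> ndf lipf.
have rcf : right_continuous f by apply: right_continuousW; exact: lip_cont (nd_lip ndf lipf).
pose F : cumulative R R := HB.pack f (isCumulative.Build R _ R f ndf rcf).
pose g x := x - f x.
have ndg : {homo g : x y / x <= y}.
  by move=> x y /lipf; rewrite /g; lra.
have rcg : right_continuous g.
  apply: right_continuousW; apply: lip_cont (nd_lip ndg _) => x y xy.
  by have := ndf x y xy; rewrite /g; lra.
pose G : cumulative R R := HB.pack g (isCumulative.Build R _ R g ndg rcg).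
pose nuF := lebesgue_stieltjes_measure F; pose nuG := lebesgue_stieltjes_measure G.
have sumE (A : set (measurableTypeR R)) : measurable A -> mu A = measure_add nuF nuG A.
  apply: (@lebesgue_stieltjes_measure_unique R idfun (measure_add nuF nuG)) => _ [[a b]] _ <-.
  have [ab|ba] := leP a b; last by rewrite set_itv_ge ?measure0 // bnd_simp -leNgt ltW.
  apply: etrans (esym (measure_addE nuF nuG _)).
  apply: etrans (stieltjes_ocitv idfun ab) _.
  apply: etrans (esym (congr2 adde (stieltjes_ocitv F ab) (stieltjes_ocitv G ab))).
  apply: (congr1 EFin (_ : b - a = (f b - f a) + (g b - g a))).
  by rewrite /g; lra.
pose D : set (measurableTypeR R) := `]0 : R, 1 : R]%classic.
have mD : measurable D by exact: measurable_itv.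
have Doo : (nuF D < +oo)%E.
  by apply: (@le_lt_trans _ _ (f 1 - f 0)%:E); [rewrite -(stieltjes_ocitv F (@ler01 R))|exact: ltry].
(* Restriction to ]0, 1] makes the measure finite, hence a charge. *)
pose nu := mfrestr mD Doo.
have dom : charge_of_finite_measure nu `<< mu.
  apply/null_content_dominatesP => A mA /=; rewrite sumE // => h0.
  have {h0} h : (nuF A + nuG A)%E = 0%E := etrans (esym (measure_addE nuF nuG A)) h0.
  rewrite /charge_of_finite_measure /nu /mfrestr /mrestr.
  apply/eqP; rewrite -measure_le0 -h; apply: (@le_trans _ _ (nuF A)).
    by apply: le_measure; rewrite ?inE //; exact: measurableI.
  by rewrite leeDl // measure_ge0.
pose h := Radon_Nikodym (charge_of_finite_measure nu) mu.
have hE : EFin \o (fine \o h) = h.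
  by apply/funext => x /=; rewrite fineK //; exact: Radon_Nikodym_fin_num.
exists (fine \o h); first by rewrite hE; exact: Radon_Nikodym_integrable.
move=> s t s0 st t1; rewrite /Rintegral; have -> : (\int[mu]_(x in `]s, t]) ((fine \o h) x)%:E =
  \int[mu]_(x in `]s, t]) h x)%E by apply: eq_integral => x _; rewrite -[in RHS]hE.
have mst : measurable (`]s, t]%classic : set (measurableTypeR R)) by exact: measurable_itv.
have stD : `]s, t]%classic `&` D = `]s, t]%classic.
  apply: setIidl => x; rewrite /D /= !in_itv /= => /andP[sx xt].
  by apply/andP; split; [exact: le_lt_trans s0 sx|exact: le_trans xt t1].
apply: (congr1 fine (y := (f t - f s)%:E)).
apply: etrans (esym (Radon_Nikodym_integral dom mst)) _.
exact: etrans (congr1 nuF stD) (stieltjes_ocitv F st).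
Qed.

(** (psi + K id) / (2 K) is nondecreasing and 1-Lipschitz, so [monotone_density] applies and the
    affine change is undone. Lebesgue differentiation of the primitive of the density gives the
    derivative almost everywhere. *)
Lemma lipschitz_density (psi : R -> R) (K : R) : 0 < K ->
  (forall x y, `|psi x - psi y| <= K * `|x - y|) ->
  exists beta : R -> R, [/\ mu.-integrable `[0, 1] (EFin \o beta),
    forall s t, 0 <= s -> s <= t -> t <= 1 ->
      \int[mu]_(x in `]s, t]) beta x = psi t - psi s &
    {ae mu, forall x : R, 0 < x < 1 -> is_derive x 1 psi (beta x)}].
Proof.
move=> K0 lip; pose f x := (psi x + K * x) / (2 * K).
have K2 : 0 < 2 * K by rewrite mulr_gt0.
have ndf : {homo f : x y / x <= y}.
  move=> x y xy; rewrite ler_pM2r ?invr_gt0 //.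
  have := lip x y; rewrite ler_norml (ler0_norm (_ : x - y <= 0)) ?subr_le0 // => /andP[_].
  by rewrite opprB; lra.
have lipf x y : x <= y -> f y - f x <= y - x.
  move=> xy; rewrite -mulrBl ler_pdivrMr //.
  have := lip x y; rewrite ler_norml (ler0_norm (_ : x - y <= 0)) ?subr_le0 // => /andP[+ _].
  by rewrite opprB; nra.
have [h inth hE] := monotone_density ndf lipf.
have mI : measurable (`[0, 1]%classic : set (measurableTypeR R)) by exact: measurable_itv.
pose beta x := 2 * K * h x - K.
have intK (s t : R) : mu.-integrable `]s, t] (EFin \o (fun=> K)).
  apply/integrableP; split; first exact: measurable_cst.
  by rewrite integral_cst //= [X in (_ * X)%E]lebesgue_measure_itv /=; case: ifP => _;
    rewrite ?mule0 ?ltry // -EFinB -EFinM ltry.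
have inth2 (A : set (measurableTypeR R)) : measurable A ->
   mu.-integrable A (EFin \o (fun x => 2 * K * h x)).
  move=> mA; have := integrableZl mA (2 * K) (integrableS measurableT mA (@subsetT _ _) inth).
  exact: eq_integrable.
exists beta; split.
- have intK1 : mu.-integrable `[0, 1] (EFin \o (fun=> K)).
    apply/integrableP; split; first exact: measurable_cst.
    by rewrite integral_cst //= [X in (_ * X)%E]lebesgue_measure_itv /= lte01 -EFinB -EFinM ltry.
  by have := integrableB mI (inth2 _ mI) intK1; exact: eq_integrable.
- move=> s t s0 st t1; rewrite RintegralB //; last exact: inth2.
  rewrite RintegralZl //; last exact: (integrableS measurableT).
  rewrite hE // Rintegral_cst //.
  have -> : fine (mu `]s, t]%classic) = t - s.
    rewrite lebesgue_measure_itv /= lte_fin; case: ifP => [//|]; move/negbT; rewrite -leNgt => ts.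
    by apply/esym/eqP; rewrite subr_eq0 eq_le ts.
  by rewrite /f -mulrBl [_ * (_ / _)]mulrC divfK ?gt_eqF //; lra.
have loc : locally_integrable [set: R] h.
  by have := integrable_locally measurableT inth; rewrite patch_setT.
have inty y : mu.-integrable `]-oo, y] (EFin \o h) by apply: (integrableS measurableT).
have := FTC1Ny inty loc; apply: filterS; first exact: (ae_filter_ringOfSetsType mu).
move=> x [dF dE] x01; have /andP[x0 x1] := x01.
pose F y := \int[mu]_(t in `]-oo, y]) h t.
have near_eq : {near x, psi =1 (fun y => 2 * K * (F y + (f 0 - F 0)) - K * y)}.
  have xo : x \in `]0, 1[ by rewrite in_itv /= x0.
  have := near_in_itvoo xo; apply: filterS => y; rewrite in_itv /= => /andP[y0 y1].
  have -> : F y + (f 0 - F 0) = f y.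
    have := hE 0 y (lexx 0) (ltW y0) (ltW y1).
    rewrite -(Rintegral_itvB (a := -oo%O) (b := BRight y)) // ?bnd_simp ?(ltW y0) //.
    by rewrite -/(F y) -/(F 0); move: (F y) (F 0) => u v; lra.
  by rewrite /f [_ * (_ / _)]mulrC divfK ?gt_eqF //; lra.
have dFx : is_derive x 1 F (h x) by apply: DeriveDef; [exact: dF|rewrite -derive1E; exact: dE].
apply: near_eq_is_derive (_ : is_derive x 1 _ _).
  by apply: filterS near_eq => y ->.
have dG : is_derive x 1 (2 * K *: (F + cst (f 0 - F 0)) - K *: id) (2 * K *: (h x + 0) - K *: 1).
  by apply: is_deriveB; apply: is_deriveZ; apply: is_deriveD.
apply: (is_derive_ext dG) => [y //|].
by rewrite /beta /GRing.scale /= addr0 mulr1.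
Qed.

End LipschitzDensity.

(** * A class of smooth functions and smooth steps of prescribed slope *)

Section SmoothFunctions.
Variable R : realType.
Implicit Types (f g F : R -> R) (a b c t x : R).

Definition flat (m : nat) t : R := if 0 < t then t^-1 ^+ m * expR (- t^-1) else 0.

(** exp(1/t) exceeds the term of order m + 2 of its series. The resulting square makes [flat m]
    differentiable at 0 with derivative 0. *)
Lemma flat_bound m t : 0 < t -> `|flat m t| <= m.+2`!%:R * t ^+ 2.
Proof.
move=> t0; rewrite /flat t0 expRN.
have x0 : 0 < t^-1 by rewrite invr_gt0.
have f0 : 0 < (m.+2`!%:R : R) by rewrite ltr0n fact_gt0.
rewrite ger0_norm; last by rewrite mulr_ge0 ?exprn_ge0 ?invr_ge0 ?expR_ge0 // ltW.
rewrite ler_pdivrMr ?expR_gt0 // -mulrA mulrC -ler_pdivrMr //.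
have := expR_ge1Dxn m.+1 (ltW x0).
have : t^-1 ^+ m / m.+2`!%:R = t ^+ 2 * (t^-1 ^+ m.+2 / m.+2`!%:R).
  by rewrite -addn2 exprD; field; rewrite !gt_eqF.
move=> ->; move: (_ / _) => u h; apply: ler_wpM2l; first exact: sqr_ge0.
by apply: le_trans h; rewrite lerDr.
Qed.

Lemma is_derive_sqr f (x l K : R) : (forall h, `|f (x + h) - f x - h * l| <= K * h ^+ 2) ->
  is_derive x 1 f l.
Proof.
move=> hf; have cv : h^-1 *: ((f \o shift x) (h *: (1:R)) - f x) @[h --> 0^'] --> l.
  apply/cvgrPdist_le => e e0; near=> h.
  have hn0 : h != 0 by near: h; exact: nbhs_dnbhs_neq.
  have h0 : 0 < `|h| by rewrite normr_gt0.
  have K1 : 0 < `|K| + 1 by rewrite ltr_wpDl.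
  rewrite /= distrC; have -> : h^-1 *: (f (h *: (1:R) + x) - f x) - l = h^-1 * (f (x + h) - f x - h * l).
    by rewrite /GRing.scale /= mulr1 [h + x]addrC [RHS]mulrBr [_ * (h * l)]mulrA mulVf // mul1r.
  rewrite normrM normfV ler_pdivrMl //; apply: le_trans (hf h) _.
  have -> : h ^+ 2 = `|h| ^+ 2 by rewrite real_normK ?num_real.
  apply: (@le_trans _ _ (`|h| * ((`|K| + 1) * `|h|))).
    rewrite [leRHS]mulrCA -expr2 ler_wpM2r ?sqr_ge0 //.
    by rewrite (le_trans (ler_norm K)) // lerDl.
  rewrite ler_wpM2l // mulrC -ler_pdivlMr //; near: h.
  by apply: dnbhs0_le; rewrite divr_gt0.
apply: DeriveDef; first by apply/cvg_ex; exists l.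
by apply/cvg_lim; [exact: Rhausdorff|].
Unshelve. all: by end_near. Qed.

(* flat m is t^-m exp(-1/t), so this class is closed under differentiation. *)
Inductive gsm : (R -> R) -> Prop :=
| gsm_flat m : gsm (flat m)
| gsm_cst c : gsm (cst c)
| gsm_id : gsm id
| gsm_add f g : gsm f -> gsm g -> gsm (f + g)
| gsm_mul f g : gsm f -> gsm g -> gsm (f * g)
| gsm_aff f a b : gsm f -> gsm (fun t => f (a * t + b))
| gsm_anti f F : gsm f -> (forall x, is_derive x 1 F (f x)) -> gsm F.

Lemma flat_derive m x : is_derive x 1 (flat m) (flat m.+2 x - m%:R * flat m.+1 x).
Proof.
have [x0|x0|->] := ltgtP x 0.
- rewrite /flat !(ltNge 0) (ltW x0) /= mulr0 subr0.
  apply: near_eq_is_derive (is_derive_cst (0:R) x (1:R)).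
  by have := lt_nbhsl x0; apply: filterS => y y0; rewrite /flat ltNge (ltW y0).
- pose f t : R := t^-1 ^+ m * expR (- t^-1).
  have xn0 : x != 0 by rewrite gt_eqF.
  have dV : is_derive x 1 (fun t : R => t^-1) (- x ^- 2).
    by have := is_deriveV xn0 (is_derive_id x (1:R)); rewrite /GRing.scale /= mulr1.
  have dE := @is_derive1_comp R expR _ x _ _ (is_derive_expR _) (is_deriveN dV).
  have dX : is_derive x 1 (fun t : R => t^-1 ^+ m) (m%:R * x^-1 ^+ m.-1 * - x ^- 2).
    apply: (is_derive_ext (is_deriveX m dV)) => [t|]; first by rewrite fctE.
    by [].
  apply: near_eq_is_derive (_ : is_derive x 1 f _).
    have xi : x \in `]0, +oo[ by rewrite in_itv /= x0.
    have := near_in_itvoy xi; apply: filterS => y; rewrite in_itv /= andbT /flat => -> //.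
  apply: (is_derive_ext (is_deriveM dX dE)) => [t //|].
  rewrite /flat x0 /GRing.scale /= opprK.
  move: (expR _) => E; case: m {f dX} => [|m]; rewrite !(exprS, expr0) /=; field => //.
- rewrite /flat ltxx mulr0 subr0; apply: (@is_derive_sqr _ _ _ m.+2`!%:R) => h.
  rewrite add0r mulr0 !subr0; have [h0|h0] := ltP 0 h.
    by have := flat_bound m h0; rewrite /flat h0 ltxx subr0.
  by rewrite ltxx subr0 normr0 mulr_ge0 ?sqr_ge0 // ler0n.
Qed.

Lemma gsm_derive f : gsm f -> exists2 g, gsm g & forall x, is_derive x 1 f (g x).
Proof.
elim => {f} [m|c||f g gf [f' gf' hf] gg [g' gg' hg]|f g gf [f' gf' hf] gg [g' gg' hg]
  |f a b gf [f' gf' hf]|f F gf _ hF].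
- exists (flat m.+2 + cst (- m%:R) * flat m.+1).
    by apply: gsm_add; [exact: gsm_flat|apply: gsm_mul; [exact: gsm_cst|exact: gsm_flat]].
  by move=> x; have := flat_derive m x; rewrite -mulNr.
- by exists (cst 0); [exact: gsm_cst|move=> x; exact: is_derive_cst].
- by exists (cst 1); [exact: gsm_cst|move=> x; exact: is_derive_id].
- by exists (f' + g'); [exact: gsm_add|move=> x; exact: is_deriveD (hf x) (hg x)].
- exists (f * g' + g * f'); first by apply: gsm_add; apply: gsm_mul.
  by move=> x; exact: is_deriveM (hf x) (hg x).
- exists (cst a * (fun t => f' (a * t + b))).
    by apply: gsm_mul; [exact: gsm_cst|exact: gsm_aff].
  move=> x; have da : is_derive x 1 (fun t => a * t + b) a.
    apply: (is_derive_ext (is_deriveD (is_deriveZ a (is_derive_id x (1:R))) (is_derive_cst b x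
      (1:R)))) => [t //|].
    by rewrite /GRing.scale /= mulr1 addr0.
  apply: (is_derive_ext (@is_derive1_comp R f _ x _ _ (hf _) da)) => [t //|].
  exact: mulrC.
- by exists f.
Qed.

Lemma gsm_smooth f : gsm f -> smooth f.
Proof.
move=> gf n x; have {gf} : gsm (derive1n n f).
  elim: n => [//|n IH]; rewrite derive1nS; have [g gg hg] := gsm_derive IH.
  suff -> : derive1 (derive1n n f) = g by [].
  by apply/funext => y; rewrite derive1E; exact: derive_val.
by case/gsm_derive => g _ /(_ x) [].
Qed.

Lemma gsm_cont f : gsm f -> continuous f.
Proof.
case/gsm_derive => g _ h x; apply: differentiable_continuous.
by apply/derivable1_diffP; case: (h x).
Qed.

Lemma derive_ge0_homo f f' : (forall x, is_derive x 1 f (f' x)) -> forall a b, a <= b ->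
  (forall x, a < x < b -> 0 <= f' x) -> f a <= f b.
Proof.
move=> df a b ab h.
have cf : {within `[a, b], continuous f}.
  apply: continuous_subspaceT => x; apply: differentiable_continuous.
  by apply/derivable1_diffP; case: (df x).
have dfi x : x \in `]a, b[ -> is_derive x 1 f (f' x) by [].
move: ab; rewrite le_eqVlt => /predU1P[->//|ab].
have [c] := MVT ab dfi cf; rewrite in_itv /= => /h f'c E.
by rewrite -subr_ge0 E mulr_ge0 // subr_ge0 ltW.
Qed.

Lemma gsm_antiderivative f : gsm f -> (forall t, t <= 0 -> f t = 0) ->
  exists F, [/\ gsm F, forall x, is_derive x 1 F (f x) & forall t, t <= 0 -> F t = 0].
Proof.
(* The integral starts at -1 so that every x >= 0 is interior, as the fundamental theorem requires;
   nothing is contributed before 0. *)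
move=> gf f0; pose F x := \int[@lebesgue_measure R]_(t in `[-1, x]) f t.
have F0 t : t <= 0 -> F t = 0.
  move=> t0; rewrite /F -(Rintegral_set0 (@lebesgue_measure R) f); rewrite Rintegral_set0.
  rewrite /Rintegral integral0_eq // => x; rewrite /= in_itv /= => /andP[_ xt].
  by rewrite f0 // (le_trans xt).
have cf := gsm_cont gf.
have dF x : is_derive x 1 F (f x).
  have [x0|x0] := ltP x 0.
    rewrite f0 ?ltW //; apply: near_eq_is_derive (is_derive_cst (0:R) x (1:R)).
    by have := lt_nbhsl x0; apply: filterS => y /ltW/F0 ->.
  have xm : -1 < x by apply: lt_le_trans x0; rewrite oppr_lt0.
  have xx : x < x + 1 by rewrite ltrDl.
  have cint : (@lebesgue_measure R).-integrable `[-1, x + 1] (EFin \o f).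
    apply: continuous_compact_integrable; first exact: segment_compact.
    exact: continuous_subspaceT.
  have [dFx EF] := @continuous_FTC1_closed R f (-1) x (x + 1) xx cint xm (cf x).
  by apply: DeriveDef; [exact: dFx|rewrite -derive1E; exact: EF].
by exists F; split => //; exact: gsm_anti dF.
Qed.

Definition unit_step f f' := [/\ gsm f /\ gsm f', forall x, is_derive x 1 f (f' x),
  forall x, 0 <= f' x, forall x, x <= 0 -> f x = 0 & forall x, 1 <= x -> f x = 1].

Lemma unit_step_range f f' : unit_step f f' -> {homo f : x y / x <= y} /\ forall x, 0 <= f x <= 1.
Proof.
move=> [_ df f'0 f0 f1].
have hf : {homo f : x y / x <= y} by move=> x y xy; exact: (derive_ge0_homo df xy).
split => // x; apply/andP; split.
  by have [/f0 -> //|/ltW/hf] := leP x 0; rewrite f0.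
by have [/f1 -> //|/ltW/hf] := leP 1 x; rewrite [f 1]f1.
Qed.

Lemma unit_step_primitive k F : gsm k -> gsm F -> (forall x, is_derive x 1 F (k x)) ->
  (forall x, 0 <= k x) -> (forall x, 1 <= x -> k x = 0) -> (forall x, x <= 0 -> F x = 0) ->
  0 < F 1 -> unit_step (fun x => (F 1)^-1 * F x) (fun x => (F 1)^-1 * k x).
Proof.
move=> gk gF dF k0 k1 F0 F1; split.
- by split; [exact: gsm_mul (gsm_cst (F 1)^-1) gF|exact: gsm_mul (gsm_cst (F 1)^-1) gk].
- by move=> x; exact: (is_derive_ext (is_deriveZ (F 1)^-1 (dF x))).
- by move=> x; rewrite mulr_ge0 ?invr_ge0 // ltW.
- by move=> x /F0 ->; rewrite mulr0.
- move=> x x1; suff -> : F x = F 1 by rewrite mulVf ?gt_eqF.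
  apply/eqP; rewrite eq_le (derive_ge0_homo dF x1) ?andbT //.
  rewrite -lerN2; apply: (@derive_ge0_homo (- F) (- k) _ 1 x x1).
  by move=> y /andP[/ltW/k1 h _]; rewrite -[(- k) y]/(- (k y)) h oppr0.
Qed.

(** Normalised primitive of the bump exp(-1/x) exp(-1/(1-x)) on [0, 1]; its mass is positive by the
    mean value theorem. *)
Lemma unit_step_exists : exists f f', unit_step f f'.
Proof.
pose k x := flat 0 x * flat 0 (-1 * x + 1).
have gk : gsm k by apply: (gsm_mul (gsm_flat 0)); exact: (gsm_aff (-1) 1 (gsm_flat 0)).
have k0 x : 0 <= k x.
  by rewrite /k /flat; do 2?case: ifP => _; rewrite ?mulr0 ?mul0r // !mulr_ge0 ?expr0 ?expR_ge0.
have kz x : x <= 0 -> k x = 0 by move=> x0; rewrite /k /flat ltNge x0 mul0r.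
have k1 x : 1 <= x -> k x = 0.
  by move=> x1; rewrite /k {2}/flat ltNge (_ : -1 * x + 1 <= 0) ?mulr0 //; lra.
have [F [gF dF F0]] := gsm_antiderivative gk kz.
exists (fun x => (F 1)^-1 * F x), (fun x => (F 1)^-1 * k x).
apply: unit_step_primitive => //.
have cF : {within `[0, 1], continuous F} by apply: continuous_subspaceT; exact: gsm_cont.
have [c] := MVT (@ltr01 R) (fun x _ => dF x) cF; rewrite in_itv /= => /andP[c0 c1].
rewrite (F0 0 (lexx 0)) subr0 => ->; rewrite subr0 mulr1 /k /flat c0.
by rewrite (_ : 0 < -1 * c + 1) ?expr0 ?mul1r ?mulr_gt0 ?expR_gt0 //; lra.
Qed.

(* chi' is proportional to a plateau equal to 1 on [a, 1 - a], where 1 - 2a = 1 / (1 + e). *)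
Lemma smooth_step e : 0 < e -> exists chi chi' : R -> R,
  [/\ unit_step chi chi', forall x, chi' x <= 1 + e &
      forall x, x <= 0 \/ 1 <= x -> chi' x = 0].
Proof.
move=> e0; have [S [S' US]] := unit_step_exists.
have [hS rS] := unit_step_range US; have [[gS _] dS S'0 S0 S1] := US.
pose a := e / (2 * (1 + e)); pose b := 1 - a.
have e1 : 0 < 1 + e by lra.
have a0 : 0 < a by rewrite divr_gt0 // mulr_gt0.
have ba : b - a = (1 + e)^-1 by rewrite /b /a; field; rewrite gt_eqF.
have ab : a < b by rewrite -subr_gt0 ba invr_gt0.
have b1 : b < 1 by rewrite /b; lra.
pose k x := S (a^-1 * x + 0) + -1 * S (a^-1 * x + - (b / a)).
have arg x : a^-1 * x + - (b / a) = (x - b) / a by field; rewrite gt_eqF.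
have gk : gsm k.
  by apply: (gsm_add (gsm_aff _ _ gS)); exact: gsm_mul (gsm_cst (-1)) (gsm_aff _ _ gS).
have k0 x : 0 <= k x.
  rewrite /k mulN1r subr_ge0 hS // lerD2l oppr_le0 divr_ge0 // ltW //.
  by rewrite (lt_trans a0).
have k1 x : k x <= 1.
  have /andP[_ h1] := rS (a^-1 * x + 0); have /andP[h2 _] := rS (a^-1 * x + - (b / a)).
  by rewrite /k; move: (S _) (S _) h1 h2 => u v; lra.
have kz x : x <= 0 -> k x = 0.
  move=> x0; have h : a^-1 * x + 0 <= 0 by rewrite addr0 mulr_ge0_le0 ?invr_ge0 // ltW.
  have h2 : a^-1 * x + - (b / a) <= 0.
    by rewrite arg mulr_le0_ge0 ?invr_ge0 ?(ltW a0) //; lra.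
  by rewrite /k !S0 // mulr0 addr0.
have ko x : 1 <= x -> k x = 0.
  move=> x1; have h : 1 <= a^-1 * x + 0 by rewrite addr0 mulrC ler_pdivlMr //; lra.
  have h2 : 1 <= a^-1 * x + - (b / a) by rewrite arg ler_pdivlMr // /b; lra.
  by rewrite /k !S1 //; lra.
have kab x : a < x < b -> k x = 1.
  move=> /andP[ax xb]; have h : 1 <= a^-1 * x + 0 by rewrite addr0 mulrC ler_pdivlMr //; lra.
  have h2 : a^-1 * x + - (b / a) <= 0.
    by rewrite arg mulr_le0_ge0 ?invr_ge0 ?(ltW a0) //; lra.
  by rewrite /k S1 // S0 // mulr0 addr0.
have [F [gF dF F0]] := gsm_antiderivative gk kz.
have F1 : (1 + e)^-1 <= F 1.
  have h1 : F b <= F 1 by apply: (derive_ge0_homo dF (ltW b1)).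
  have h0 : F 0 <= F a by apply: (derive_ge0_homo dF (ltW a0)).
  have h : (F - id) a <= (F - id) b.
    apply: (@derive_ge0_homo (F - id) (k - cst 1) _ a b (ltW ab)).
    by move=> x /kab kx; rewrite -[(k - cst 1) x]/(k x - 1) kx subrr.
  move: h; rewrite -[(F - id) a]/(F a - a) -[(F - id) b]/(F b - b) -ba.
  by move: h0; rewrite F0 //; lra.
have F1p : 0 < F 1 by rewrite (lt_le_trans _ F1) // invr_gt0.
exists (fun x => (F 1)^-1 * F x), (fun x => (F 1)^-1 * k x); split.
- by apply: unit_step_primitive.
- move=> x; rewrite ler_pdivrMl // (le_trans (k1 x)) //.
  by move: F1; rewrite -[(1 + e)^-1]mul1r ler_pdivrMr.
- by move=> x [/kz|/ko] ->; rewrite mulr0.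
Qed.

End SmoothFunctions.

(** * Du Bois-Reymond lemma: a weak derivative determines increments *)

Section DuBoisReymond.
Variable R : realType.
Local Notation mu := (@lebesgue_measure R).
Local Notation I01 := (`[0%R, 1%R]%classic : set (measurableTypeR R)).
Implicit Types (f u phi : R -> R) (s t r x e : R).

Lemma FTC2_deriv (F f : R -> R) (a b : R) : a < b -> continuous f ->
  (forall x, is_derive x 1 F (f x)) -> \int[mu]_(x in `[a, b]) f x = F b - F a.
Proof.
move=> ab cf dF; rewrite /Rintegral (@continuous_FTC2 _ f F) //.
- exact: continuous_subspaceT.
- have cF : continuous F.
    by move=> x; apply: differentiable_continuous; apply/derivable1_diffP; case: (dF x).
  split => [x _||]; first by case: (dF x).
    exact: cvg_at_right_filter (cF a).
  exact: cvg_at_left_filter (cF b).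
- by move=> x _; rewrite derive1E; exact: derive_val.
Qed.

Lemma continuous_integrable01 f : {within I01, continuous f} -> mu.-integrable I01 (EFin \o f).
Proof. by move=> h; apply: continuous_compact_integrable => //; exact: segment_compact. Qed.

Lemma measurable_bounded_mul u b (C : R) : mu.-integrable I01 (EFin \o b) ->
  measurable_fun I01 u -> (forall x, I01 x -> `|u x| <= C) ->
  mu.-integrable I01 (EFin \o (fun x => u x * b x)).
Proof.
move=> ib mU uC; have mb : measurable_fun I01 b by apply/measurable_EFinP; exact: measurable_int ib.
have ig : mu.-integrable I01 (fun x => C%:E * `|(b x)%:E|)%E.
  by apply: integrableZl => //; exact: integrable_norm.
apply: le_integrable ig => //.
  by apply/measurable_EFinP; exact: measurable_funM.
move=> x Ix; have C0 : 0 <= C by exact: le_trans (normr_ge0 _) (uC x Ix).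
apply: (@le_trans _ _ (C * `|b x|)%:E); last first.
  by rewrite lee_fin /= normrM (ger0_norm C0) normr_id.
by rewrite lee_fin normrM ler_wpM2r // uC.
Qed.

Lemma Rintegral_cvg01 (f_ : nat -> R -> R) f (g : R -> R) :
  (forall n, measurable_fun I01 (f_ n)) -> measurable_fun I01 f ->
  mu.-integrable I01 (EFin \o g) -> (forall n x, I01 x -> `|f_ n x| <= g x) ->
  (forall x, I01 x -> f_ n x @[n --> \oo] --> f x) ->
  \int[mu]_(x in I01) f_ n x @[n --> \oo] --> \int[mu]_(x in I01) f x.
Proof.
move=> mf_ mf ig hg cv.
have mI : measurable I01 by exact: measurable_itv.
have [] := @dominated_convergence _ _ R mu I01 mI (fun n => EFin \o f_ n) (EFin \o f) (EFin \o g).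
- by move=> n; apply/measurable_EFinP; exact: mf_.
- by apply/measurable_EFinP.
- apply: aeW => x Ix; apply/fine_cvgP; split; first exact: nearW.
  exact: (cv x Ix).
- exact: ig.
- by apply: aeW => x n Ix; rewrite /= lee_fin; exact: hg.
move=> iF _ c; apply: fine_cvg; rewrite /Rintegral fineK; first exact: c.
exact: integrable_fin_num.
Qed.

Section Kernel.
Variables f f' : R -> R.
Hypothesis US : unit_step f f'.

(** Smooth stand-in for the indicator of ]s, +oo[, rising on [s, s + de]. *)
Definition ramp (de s x : R) := f (de^-1 * x + - (s / de)).
Definition ramp' (de s x : R) := de^-1 * f' (de^-1 * x + - (s / de)).

Lemma ramp_arg de s x : 0 < de -> de^-1 * x + - (s / de) = (x - s) / de.
Proof. by move=> d0; field; rewrite gt_eqF. Qed.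

Lemma ramp_gsm de s : gsm (ramp de s) /\ gsm (ramp' de s).
Proof.
have [[gf gf'] _ _ _ _] := US; split; first exact: gsm_aff.
by apply: (gsm_mul (gsm_cst de^-1)); exact: gsm_aff.
Qed.

Lemma ramp_derive de s x : is_derive x 1 (ramp de s) (ramp' de s x).
Proof.
have [_ df _ _ _] := US.
have da : is_derive x 1 (fun t => de^-1 * t + - (s / de)) de^-1.
  apply: (is_derive_ext (is_deriveD (is_deriveZ de^-1 (is_derive_id x (1:R))) (is_derive_cst (-
    (s / de)) x (1:R)))) => [t //|].
  by rewrite /GRing.scale /= mulr1 addr0.
apply: (is_derive_ext (@is_derive1_comp R f _ x _ _ (df _) da)) => [t //|].
exact: mulrC.
Qed.

Lemma ramp0 de s x : 0 < de -> x <= s -> ramp de s x = 0.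
Proof.
move=> d0 xs; have [_ _ _ h _] := US; rewrite /ramp h // ramp_arg //.
by rewrite mulr_le0_ge0 ?invr_ge0 ?(ltW d0) // subr_le0.
Qed.

Lemma ramp1 de s x : 0 < de -> s + de <= x -> ramp de s x = 1.
Proof.
move=> d0 xs; have [_ _ _ _ h] := US; rewrite /ramp h // ramp_arg // ler_pdivlMr //.
by rewrite mul1r lerBrDl.
Qed.

Lemma step_deriv_supp x : ~ (0 <= x <= 1) -> f' x = 0.
Proof.
move=> nx; have [_ df _ h0 h1] := US.
suff H : is_derive x 1 f 0 by rewrite -(@derive_val _ _ _ _ _ _ _ (df x)) derive_val.
have [x0|x0] := ltP x 0.
  apply: near_eq_is_derive (is_derive_cst (0:R) x (1:R)).
  by have := lt_nbhsl x0; apply: filterS => y /ltW/h0 ->.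
have x1 : 1 < x by rewrite ltNge; apply/negP => x1; apply: nx; rewrite x0.
have xi : x \in `]1, +oo[ by rewrite in_itv /= x1.
apply: near_eq_is_derive (is_derive_cst (1:R) x (1:R)).
by have := near_in_itvoy xi; apply: filterS => y; rewrite in_itv /= andbT => /ltW/h1 ->.
Qed.

Lemma ramp'_supp de s x : 0 < de -> ~ (s <= x <= s + de) -> ramp' de s x = 0.
Proof.
move=> d0 nx; rewrite /ramp' step_deriv_supp ?mulr0 // ramp_arg //.
rewrite ler_pdivrMr // mul1r pmulr_lge0 ?invr_gt0 // subr_ge0 lerBlDl; exact: nx.
Qed.

(* ramp' de s is an approximate identity supported in [s, s + de]. *)
Lemma kernel_mean u de s e : {within I01, continuous u} -> 0 < de -> 0 <= s -> s + de <= 1 ->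
  (forall r, s <= r <= s + de -> `|u r - u s| <= e) ->
  `|\int[mu]_(r in I01) (ramp' de s r * u r) - u s| <= e.
Proof.
move=> cu d0 s0 s1 hu; have [_ gr'] := ramp_gsm de s.
have mI : measurable I01 by exact: measurable_itv.
have cr := gsm_cont gr'.
have cru : {within I01, continuous (fun r => ramp' de s r * u r)}.
  move=> x; apply: continuousM; last exact: cu.
  exact: (continuous_subspaceT cr).
have Ir : \int[mu]_(r in I01) ramp' de s r = 1.
  rewrite (FTC2_deriv ltr01 cr (ramp_derive de s)) ramp1 // ramp0 // subr0 //.
have iru := continuous_integrable01 cru.
have ir : mu.-integrable I01 (EFin \o ramp' de s).
  by apply: continuous_integrable01; exact: continuous_subspaceT.
have iru2 : mu.-integrable I01 (EFin \o (fun r => ramp' de s r * u s)).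
  by apply: continuous_integrable01; apply: continuous_subspaceT => x; apply: continuousM;
    [exact: cr|exact: cst_continuous].
have -> : \int[mu]_(r in I01) (ramp' de s r * u r) - u s =
    \int[mu]_(r in I01) (ramp' de s r * u r - ramp' de s r * u s).
  by rewrite RintegralB // RintegralZr // Ir mul1r.
have idf : mu.-integrable I01 (EFin \o (fun r => ramp' de s r * u r - ramp' de s r * u s)).
  by have := integrableB mI iru iru2; exact: eq_integrable.
apply: le_trans (le_normr_Rintegral mI idf) _.
have -> : e = \int[mu]_(r in I01) (ramp' de s r * e) by rewrite RintegralZr // Ir mul1r.
apply: le_Rintegral => //.
- by have := integrable_norm idf; exact: eq_integrable.
- by apply: continuous_integrable01; apply: continuous_subspaceT => x; apply: continuousM;
  [exact: cr|exact: cst_continuous].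
move=> r _; rewrite -mulrBr normrM.
have [Hr|Hr] := pselect (s <= r <= s + de); last by rewrite ramp'_supp // normr0 !mul0r.
have r0 : 0 <= ramp' de s r.
  by have [_ _ h _ _] := US; rewrite /ramp' mulr_ge0 // invr_ge0 ltW.
by rewrite ger0_norm // ler_wpM2l // hu.
Qed.

End Kernel.

Lemma within_dist u x e : {within I01, continuous u} -> 0 <= x <= 1 -> 0 < e ->
  exists2 de, 0 < de & forall y, 0 <= y <= 1 -> `|x - y| <= de -> `|u x - u y| <= e.
Proof.
move=> cu x01 e0; have /subspace_continuousP/(_ x) := cu.
rewrite /= in_itv /= => /(_ x01)/cvgrPdist_le/(_ e e0).
rewrite near_withinE => /nbhs_ballP[de /= de0 h].
exists (de / 2); first by rewrite divr_gt0.
move=> y y01 xy; apply: h; last by rewrite in_itv.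
by rewrite /ball /= (le_lt_trans xy) // ltr_pdivrMr // ltr_pMr // ltr1n.
Qed.

(** Continuity carries the constant to the end points: x + th (1/2 - x) is interior and within [de]
    of x. *)
Lemma within_const u : {within I01, continuous u} ->
  (forall s t, 0 < s -> s < t -> t < 1 -> u s = u t) -> forall x, 0 <= x <= 1 -> u x = u 2^-1.
Proof.
move=> cu hu x x01; apply/eqP; rewrite -subr_eq0 -normr_le0; apply/ler_addgt0Pr => e e0.
rewrite add0r; have [de de0 hde] := within_dist cu x01 e0; have /andP[x0 x1] := x01.
pose th := Num.min de 2^-1.
have th0 : 0 < th by rewrite lt_min de0 invr_gt0 ltr0n.
have th1 : th <= 2^-1 by rewrite ge_min lexx orbT.
have thd : th <= de by rewrite ge_min lexx.
pose y := x + th * (2^-1 - x).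
have y0 : 0 < y by rewrite /y; nra.
have y1 : y < 1 by rewrite /y; nra.
have -> : u 2^-1 = u y.
  have [h|h|-> //] := ltgtP y 2^-1; [apply/esym|]; apply: hu => //; lra.
apply: hde; first by rewrite !ltW.
rewrite /y opprD addNKr normrN normrM (gtr0_norm th0) (le_trans _ thd) //.
rewrite ler_piMr ?(ltW th0) // ler_norml; lra.
Qed.

(** Test with the difference of two ramps at s and t: it converges to the indicator of ]s, t] while
    its derivative concentrates at s and, with the opposite sign, at t. Dominated convergence
    handles the side of b. *)
Lemma du_bois_reymond_interior u (b : R -> R) : {within I01, continuous u} -> mu.-integrable I01
  (EFin \o b) ->
  (forall phi, test_function phi ->
    \int[mu]_(r in I01) (derive1 phi r * u r) = - \int[mu]_(r in I01) (phi r * b r)) ->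
  forall s t, 0 < s -> s < t -> t < 1 -> \int[mu]_(r in `]s, t]) b r = u t - u s.
Proof.
move=> cu ib hphi s t s0 st t1; have [f [f' US]] := unit_step_exists R.
have mI : measurable I01 by exact: measurable_itv.
have [_ f01] := unit_step_range US.
(* Widths at most (1 - t) / 2 keep the test functions supported in [s, t + c], inside ]0, 1[. *)
pose c := (1 - t) / 2; pose de (n : nat) := c / n.+1%:R.
have c0 : 0 < c by rewrite divr_gt0 // subr_gt0.
have de0 n : 0 < de n by rewrite divr_gt0.
have dec n : de n <= c by rewrite ler_pdivrMr // ler_peMr ?(ltW c0) // ler1n.
have tc : t + c < 1 by rewrite /c; lra.
pose phi n := ramp f (de n) s - ramp f (de n) t.
have [g1 g2] : (forall n x, gsm (ramp f (de n) x)) /\ (forall n x, gsm (ramp' f' (de n) x)).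
  by split=> n x; have [] := ramp_gsm US (de n) x.
have gphi n : gsm (phi n).
  have -> : phi n = ramp f (de n) s + cst (-1) * ramp f (de n) t.
    by apply/funext => x; rewrite /phi !fctE mulN1r.
  by apply: gsm_add => //; apply: gsm_mul => //; exact: gsm_cst.
have tphi n : test_function (phi n).
  split; first exact: gsm_smooth.
  exists s, (t + c); split => // x nx; rewrite /phi !fctE.
  have [xs|sx] := leP x s.
    by rewrite !(ramp0 US) // ?subrr // (le_trans xs) // ltW.
  have xt : t + c < x by rewrite ltNge; apply/negP => h; apply: nx; rewrite (ltW sx).
  have dn := dec n.
  by rewrite !(ramp1 US) ?subrr //; lra.
have dphi n x : derive1 (phi n) x = ramp' f' (de n) s x - ramp' f' (de n) t x.
  rewrite derive1E; apply: derive_val.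
  exact: is_deriveB (ramp_derive US _ _ _) (ramp_derive US _ _ _).
have de_cvg : forall e, 0 < e -> \forall n \near \oo, de n <= e.
  move=> e e0; near=> n; rewrite ler_pdivrMr // mulrC -ler_pdivrMr //.
  apply: (@le_trans _ _ n%:R); last by rewrite ler_nat.
  by near: n; exact: nbhs_infty_ger.
have kc x : 0 <= x -> x + c <= 1 ->
    \int[mu]_(r in I01) (ramp' f' (de n) x r * u r) @[n --> \oo] --> u x.
  move=> x0 xc; apply/cvgrPdist_le => e e0.
  have x01 : 0 <= x <= 1 by rewrite x0; lra.
  have [r r0 hr] := within_dist cu x01 e0.
  near=> n; rewrite distrC; have dn := dec n.
  apply: (kernel_mean US) => //; first lra.
  move=> y /andP[xy yx]; rewrite distrC; apply: hr; first by rewrite (le_trans x0 xy); lra.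
  have der : de n <= r by near: n; exact: de_cvg.
  by rewrite distrC ger0_norm ?subr_ge0 //; lra.
have ci n x : mu.-integrable I01 (EFin \o (fun r => ramp' f' (de n) x r * u r)).
  apply: continuous_integrable01 => y; apply: continuousM; last exact: cu.
  exact: (continuous_subspaceT (gsm_cont (g2 n x))).
have L1 : (- (\int[mu]_(r in I01) (phi n r * b r))) @[n --> \oo] --> u s - u t.
  have e1 n : - (\int[mu]_(r in I01) (phi n r * b r)) = \int[mu]_(r in I01) (ramp' f' (de n) s r * u r) -
      \int[mu]_(r in I01) (ramp' f' (de n) t r * u r).
    rewrite -hphi // -RintegralB //; apply: eq_Rintegral => r _.
    by rewrite dphi mulrBl.
  under eq_fun do rewrite e1.
  by apply: cvgB; apply: kc; lra.
have mb : measurable_fun I01 b by apply/measurable_EFinP; exact: measurable_int ib.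
have mst : measurable (`]s, t]%classic : set (measurableTypeR R)) by exact: measurable_itv.
pose g r := \1_(`]s, t]%classic : set (measurableTypeR R)) r * b r.
have L2 : \int[mu]_(r in I01) (phi n r * b r) @[n --> \oo] --> \int[mu]_(r in I01) g r.
  apply: (@Rintegral_cvg01 _ _ (fun r => `|b r|)).
  - move=> n; apply: measurable_funM => //; apply: measurable_funTS;
    apply: continuous_measurable_fun; exact: gsm_cont (gphi n).
  - by apply: measurable_funM => //; exact: measurable_indic.
  - by have := integrable_norm ib; exact: eq_integrable.
  - move=> n x _; rewrite normrM ler_piMl // /phi !fctE ler_norml.
    have := f01 ((de n)^-1 * x + - (s / de n)); have := f01 ((de n)^-1 * x + - (t / de n)).
    by rewrite /ramp; move: (f _) (f _) => v w; lra.
  move=> x _; apply: cvgMl; rewrite indicE.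
  have [xs|sx] := leP x s.
    rewrite memNset /=; last by rewrite in_itv /= ltNge xs.
    apply: cvg_near_cst; apply: nearW => n; rewrite /phi !fctE.
    by rewrite !(ramp0 US) // ?subrr // (le_trans xs) // ltW.
  have near1 y : y < x -> \forall n \near \oo, ramp f (de n) y x = 1.
    move=> yx; have xy0 : 0 < x - y by rewrite subr_gt0.
    by apply: filterS (de_cvg _ xy0) => n h; rewrite (ramp1 US) //; lra.
  have [xt|tx] := leP x t.
    rewrite mem_set /=; last by rewrite in_itv /= sx.
    apply: cvg_near_cst; apply: filterS (near1 s sx) => n h.
    by rewrite /phi !fctE h (ramp0 US) // subr0.
  rewrite memNset /=; last by rewrite in_itv /= sx leNgt tx.
  apply: cvg_near_cst; apply: filterS2 (near1 s sx) (near1 t tx) => n h h'.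
  by rewrite /phi !fctE h h' subrr.
have -> : \int[mu]_(r in `]s, t]) b r = \int[mu]_(r in I01) g r.
  rewrite [LHS]Rintegral_mkcond [RHS]Rintegral_mkcond; apply: eq_Rintegral => x _.
  rewrite !patchE /g indicE; case: (boolP (x \in `]s, t]%classic)) => xst.
    rewrite mul1r ifT //; move: xst; rewrite !inE /= !in_itv /= => /andP[sx xt].
    by rewrite (ltW (lt_trans s0 sx)) (le_trans xt (ltW t1)).
  by rewrite mul0r; case: ifP.
have /cvg_unique : (- (\int[mu]_(r in I01) (phi n r * b r))) @[n --> \oo] --> - (\int[mu]_(r in
  I01) g r).
  exact: cvgN.
move/(_ (@Rhausdorff R) _ L1) => h; rewrite -[LHS]opprK h; lra.
Unshelve. all: by end_near. Qed.

(** By the interior case u minus the primitive of b is constant on ]0, 1[, and by continuity on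
    [0, 1]. *)
Lemma du_bois_reymond u (b : R -> R) : {within I01, continuous u} -> mu.-integrable I01 (EFin \o b) ->
  (forall phi, test_function phi ->
    \int[mu]_(r in I01) (derive1 phi r * u r) = - \int[mu]_(r in I01) (phi r * b r)) ->
  forall s t, 0 <= s -> s <= t -> t <= 1 -> \int[mu]_(r in `]s, t]) b r = u t - u s.
Proof.
move=> cu ib h; have hi := du_bois_reymond_interior cu ib h.
pose G x := \int[mu]_(r in `[0, x]) b r.
have cG : {within I01, continuous G} by exact: parameterized_integral_continuous.
have GE s t : 0 <= s -> s <= t -> t <= 1 -> \int[mu]_(r in `]s, t]) b r = G t - G s.
  move=> s0 st t1; rewrite -(@Rintegral_itvB _ _ (BLeft 0) (BRight t) s) // ?bnd_simp //.
  apply: integrableS ib => //; [exact: measurable_itv..|].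
  by move=> x; rewrite /= !in_itv /= => /andP[-> /le_trans]; exact.
move=> s t s0 st t1; rewrite GE //.
have cuG : {within I01, continuous (fun x => u x - G x)} by move=> x; apply: continuousB;
  [exact: cu|exact: cG].
have W := within_const cuG _.
have {}W : forall x, 0 <= x <= 1 -> u x - G x = u 2^-1 - G 2^-1.
  apply: W => x y x0 xy y1.
  have := hi x y x0 xy y1; rewrite GE ?ltW //; lra.
have := W s; have := W t; rewrite s0 t1 (le_trans s0 st) (le_trans st t1) => /(_ isT) + /(_ isT).
by lra.
Qed.

End DuBoisReymond.

(** * Matrix integrals and the continuity equation in scalar form *)

Section MatrixIntegrals.
Variables (R : realType) (d : nat).
Local Notation C := R[i].
Local Notation M := 'M[C]_d.
Local Notation mu := (@lebesgue_measure R).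
Local Notation I01 := (`[0%R, 1%R]%classic : set (measurableTypeR R)).
Implicit Types (gamma F : R -> M) (A : M) (s t r x e : R).

Lemma Rintegral_sum (D : set (measurableTypeR R)) (I : Type) (s : seq I) (h : I -> R -> R) :
  measurable D -> (forall i, mu.-integrable D (EFin \o h i)) ->
  mu.-integrable D (EFin \o (fun x => \sum_(i <- s) h i x)) /\
  \int[mu]_(x in D) (\sum_(i <- s) h i x) = \sum_(i <- s) \int[mu]_(x in D) h i x.
Proof.
move=> mD ih; elim: s => [|i s [IH1 IH2]].
  have -> : (fun x => \sum_(i <- [::]) h i x) = cst 0.
    by apply/funext => x; rewrite big_nil.
  split; first exact: integrable0.
  by rewrite big_nil; apply: etrans (Rintegral_cst _ mD 0) _; rewrite mul0r.
have e1 : (fun x => \sum_(j <- i :: s) h j x) = fun x => h i x + \sum_(j <- s) h j x.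
  by apply/funext => x; rewrite big_cons.
split.
  by rewrite e1; have := integrableD mD (ih i) IH1; exact: eq_integrable.
by rewrite big_cons -IH2 -RintegralD //; apply: eq_Rintegral => x _; rewrite big_cons.
Qed.

Lemma mI01 : measurable I01. Proof. exact: measurable_itv. Qed.

Lemma integrableMl (D : set (measurableTypeR R)) (k : R) (h : R -> R) : measurable D ->
  mu.-integrable D (EFin \o h) -> mu.-integrable D (EFin \o (fun x => k * h x)).
Proof. by move=> mD ih; have := integrableZl mD k ih; exact: eq_integrable. Qed.

Lemma ip_integral_mx F A : integrable_mx F ->
  mu.-integrable I01 (EFin \o (fun s => ip A (F s))) /\
  ip A (integral_mx F) = \int[mu]_(s in I01) ip A (F s).
Proof.
move=> iF; pose h (i j : 'I_d) s := complex.Re (A i j) * re_entry F i j s + complex.Im (A i j) *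
  im_entry F i j s.
have ih i j : mu.-integrable I01 (EFin \o h i j).
  have [i1 i2] := iF i j.
  by have := integrableD mI01 (integrableMl (complex.Re (A i j)) mI01 i1)
    (integrableMl (complex.Im (A i j)) mI01 i2); exact: eq_integrable.
have S1 i := Rintegral_sum (index_enum 'I_d) mI01 (ih i).
have S2 := @Rintegral_sum I01 _ (index_enum 'I_d) (fun i x => \sum_j h i j x) mI01 (fun i => (S1 i).1).
have -> : (fun s => ip A (F s)) = fun s => \sum_i \sum_j h i j s by apply/funext => s; rewrite ipE.
split; first exact: S2.1.
rewrite S2.2 ipE; apply: eq_bigr => i _; rewrite (S1 i).2; apply: eq_bigr => j _.
have [i1 i2] := iF i j; rewrite mxE /= RintegralD ?RintegralZl //; exact: integrableMl.
Qed.

Lemma re_entry_ip F i j : re_entry F i j = fun s => ip (delta_mx i j) (F s).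
Proof. by apply/funext => s; rewrite ip_def -/(hs _ _) hs_delta. Qed.

Lemma im_entry_ip F i j : im_entry F i j = fun s => ip ('i *: delta_mx i j) (F s).
Proof.
apply/funext => s; rewrite /im_entry -hs_delta hs_ip.
by rewrite /= !(mulr0, mul0r, mulr1, subr0, addr0, add0r).
Qed.

Lemma integrable_mxP F : integrable_mx F <-> forall A, mu.-integrable I01 (EFin \o (fun s => ip A
  (F s))).
Proof.
split=> [iF A|iF i j]; first exact: (ip_integral_mx A iF).1.
by rewrite re_entry_ip im_entry_ip.
Qed.

Lemma mx_eq_ip (X Y : M) : (forall A, ip A X = ip A Y) -> X = Y.
Proof. by move=> h; apply/eqP; rewrite -subr_eq0; apply/eqP/ip_eq0; rewrite ipBr h subrr. Qed.

Lemma within_nm gamma x e : {within `[0, 1], continuous gamma} -> 0 <= x <= 1 -> 0 < e ->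
  exists2 de, 0 < de & forall y, 0 <= y <= 1 -> `|x - y| <= de -> nm (gamma x - gamma y) <= e.
Proof.
move=> cg x01 e0; have /subspace_continuousP/(_ x) := cg.
rewrite /= in_itv /= => /(_ x01)/cvg_nm/cvgrPdist_le/(_ e e0).
rewrite near_withinE => /nbhs_ballP[de /= de0 h].
exists (de / 2); first by rewrite divr_gt0.
move=> y y01 xy; rewrite nm_subC.
have := h y; rewrite /= sub0r normrN ger0_norm ?nm_ge0 //; apply; last by rewrite in_itv.
by rewrite /ball /= (le_lt_trans xy) // ltr_pdivrMr // ltr_pMr // ltr1n.
Qed.

Lemma nm_within gamma : (forall x e, 0 <= x <= 1 -> 0 < e ->
  exists2 de, 0 < de & forall y, 0 <= y <= 1 -> `|x - y| <= de -> nm (gamma x - gamma y) <= e) ->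
  {within `[0, 1], continuous gamma}.
Proof.
move=> h; apply/subspace_continuousP => x; rewrite /= in_itv /= => x01.
apply/nm_cvgP; apply/cvgrPdist_le => e e0; have [de de0 hde] := h x e x01 e0.
rewrite near_withinE; apply/nbhs_ballP; exists de => //= y xy; rewrite in_itv /= => y01.
by rewrite sub0r normrN ger0_norm ?nm_ge0 // nm_subC hde // ltW.
Qed.

Lemma heine gamma : {within `[0, 1], continuous gamma} -> unif_continuous_on gamma 0 1.
Proof.
move=> cg e e0; pose P (de : R) (x : R) := 0 <= x <= 1 ->
  forall y, 0 <= y <= 1 -> `|x - y| <= de -> nm (gamma x - gamma y) <= e.
have /compact_near_coveringP/(_ R (0^'+) P _) := @segment_compact R 0 1.
case.
- move=> x; rewrite /= in_itv /= => x01; have e2 : 0 < e / 2 by rewrite divr_gt0.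
  have [de de0 hde] := within_nm cg x01 e2.
  have de2 : 0 < de / 2 by rewrite divr_gt0.
  exists (ball x (de / 2), [set r | r <= de / 2]) => /=.
    split; first exact: nbhsx_ballx.
    by apply: nbhs_right_le.
  move=> [y r] /= [xy rd] y01 z z01 yz.
  have -> : gamma y - gamma z = (gamma y - gamma x) + (gamma x - gamma z) by rewrite addrA subrK.
  apply: le_trans (nmD _ _) _; rewrite [e]splitr; apply: lerD.
    rewrite nm_subC; apply: hde => //; rewrite /ball /= in xy.
    by rewrite ltW // (lt_trans xy) // ltr_pdivrMr // ltr_pMr // ltr1n.
  apply: hde => //; rewrite /ball /= in xy.
  have -> : x - z = (x - y) + (y - z) by rewrite addrA subrK.
  apply: le_trans (ler_normD _ _) _; rewrite [de]splitr; apply: lerD; first exact: ltW.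
  exact: le_trans yz rd.
- move=> de /= de0 hde; exists (de / 2); first by rewrite divr_gt0.
  have dd : de / 2 < de by rewrite ltr_pdivrMr // ltr_pMr // ltr1n.
  move=> s t s01 t01 st; apply: (hde (de / 2)) => //=.
  + by rewrite sub0r normrN gtr0_norm // divr_gt0.
  + by rewrite divr_gt0.
Qed.

Lemma ip_cont gamma A : {within `[0, 1], continuous gamma} ->
  {within I01, continuous (fun s => ip A (gamma s))}.
Proof.
move=> cg; apply/subspace_continuousP => x xI.
have /subspace_continuousP/(_ x xI)/cvg_nm := cg => h.
apply/cvgrPdist_le => e e0.
have A1 : 0 < nm A + 1 by rewrite ltr_wpDl ?nm_ge0.
have ea : 0 < e / (nm A + 1) by rewrite divr_gt0.
move/cvgrPdist_le: h => /(_ _ ea); apply: filterS => y.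
rewrite sub0r normrN ger0_norm ?nm_ge0 // ler_pdivlMr // => h.
rewrite -ipBr; apply: le_trans (ip_norm_le _ _) _; rewrite nm_subC mulrC.
by apply: le_trans h; rewrite ler_wpM2l ?nm_ge0 // lerDl.
Qed.

Lemma smooth_cont (phi : R -> R) : smooth phi -> continuous phi /\ continuous (derive1 phi).
Proof.
move=> sp; split => x; apply: differentiable_continuous; apply/derivable1_diffP.
  exact: (sp 0%N x).
exact: (sp 1%N x).
Qed.

Lemma cont_bounded01 (phi : R -> R) : continuous phi ->
  exists C, forall x, I01 x -> `|phi x| <= C.
Proof.
move=> cp; have cw : {within `[0, 1], continuous phi} by exact: continuous_subspaceT.
have /compact_bounded[K [_ hK]] := continuous_compact cw (@segment_compact R 0 1).
exists (`|K| + 1) => x xI; apply: (hK (`|K| + 1)); last by exists x.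
by rewrite ltr_pwDr // ler_norm.
Qed.

Lemma integrable_mul01 (phi b : R -> R) : continuous phi -> mu.-integrable I01 (EFin \o b) ->
  mu.-integrable I01 (EFin \o (fun x => phi x * b x)).
Proof.
move=> cp ib; have [C hC] := cont_bounded01 cp.
apply: measurable_bounded_mul ib _ hC.
by apply: measurable_funTS; exact: continuous_measurable_fun.
Qed.

Section Continuity.
Variables (J : nat) (V : 'I_J -> M).
Local Notation src := (src V).

Lemma src_integrable (B : R -> 'I_J -> M) A : (forall j, integrable_mx (fun s => B s j)) ->
  mu.-integrable I01 (EFin \o (fun r => ip A (src (B r)))).
Proof.
move=> iB; have -> : (fun r => ip A (src (B r))) = fun r => \sum_j ip (partialj V j A) (B r j).
  by apply/funext => r; rewrite src_ip.
apply: (@Rintegral_sum I01 _ (index_enum 'I_J) (fun j r => ip (partialj V j A) (B r j)) mI01 _).1 => j.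
by have /integrable_mxP := iB j; exact.
Qed.

Lemma continuity_equationP gamma (B : R -> 'I_J -> M) : {within `[0, 1], continuous gamma} ->
  (forall j, integrable_mx (fun s => B s j)) ->
  continuity_equation V gamma B <-> forall phi, test_function phi -> forall A,
    \int[mu]_(r in I01) (derive1 phi r * ip A (gamma r)) =
    - (\int[mu]_(r in I01) (phi r * ip A (src (B r)))).
Proof.
move=> cg iB.
have main phi A : test_function phi ->
    ip A (- integral_mx (fun s => (derive1 phi s)%:C *: gamma s)
          + integral_mx (fun s => (phi s)%:C *: divergence V (B s))) =
    - (\int[mu]_(r in I01) (derive1 phi r * ip A (gamma r))) -
      \int[mu]_(r in I01) (phi r * ip A (src (B r))).
  move=> [/smooth_cont[cp cp'] _].
  have i1 : integrable_mx (fun s => (derive1 phi s)%:C *: gamma s).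
    apply/integrable_mxP => A'.
    have := integrable_mul01 cp' (continuous_integrable01 (@ip_cont gamma A' cg)).
    by apply: eq_integrable => // r _ /=; rewrite ipZr.
  have i2 : integrable_mx (fun s => (phi s)%:C *: divergence V (B s)).
    apply/integrable_mxP => A'.
    have := integrableMl (-1) mI01 (integrable_mul01 cp (src_integrable A' iB)).
    by apply: eq_integrable => // r _ /=; rewrite ipZr divergenceE ipNr mulN1r mulrN.
  rewrite ipDr ipNr (ip_integral_mx A i1).2 (ip_integral_mx A i2).2; congr (- _ + _).
    by apply: eq_Rintegral => r _; rewrite ipZr.
  have <- : -1 * (\int[mu]_(r in I01) (phi r * ip A (src (B r)))) =
      - (\int[mu]_(r in I01) (phi r * ip A (src (B r)))) by rewrite mulN1r.
  rewrite -RintegralZl //; last exact: (integrable_mul01 cp (src_integrable A iB)).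
  by apply: eq_Rintegral => r _; rewrite ipZr divergenceE ipNr mulN1r mulrN.
split=> [ce phi tp A|h phi tp].
  have := main phi A tp; rewrite (ce phi tp) ip0r.
  by move: (Rintegral _ _ _) (Rintegral _ _ _) => u v; lra.
apply: mx_eq_ip => A; rewrite main // h // ip0r opprK subrr //.
Qed.

(** Du Bois-Reymond for each functional [ip A] turns the distributional equation into increments,
    the form required by [W_action_bound]. *)
Lemma admissible_weak_primitive rho0 rho1 gamma (B : R -> 'I_J -> M) :
  admissible V rho0 rho1 gamma B -> weak_primitive gamma (fun s => src (B s)) 0 1.
Proof.
move=> [[_ cg] iB /(continuity_equationP cg iB) ce _ _] A s t s0 st t1; split.
  apply: (integrableS mI01) (src_integrable A iB) => //.
  move=> x; rewrite /= !in_itv /= => /andP[sx xt].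
  by rewrite (ltW (le_lt_trans s0 sx)) (le_trans xt).
rewrite ipBr; apply: (du_bois_reymond (@ip_cont gamma A cg) (src_integrable A iB)) => //.
by move=> phi tp; exact: ce.
Qed.

End Continuity.

End MatrixIntegrals.

(** * Agreement of the Riemannian distance with Wc on full-rank states *)

Section SmoothCurves.
Variables (R : realType) (d : nat).
Local Notation C := R[i].
Local Notation M := 'M[C]_d.
Local Notation mu := (@lebesgue_measure R).
Variables (p : R) (sigma : M) (J : nat) (V : 'I_J -> M) (omega : 'I_J -> R).
Local Notation field := ('I_J -> M).
Implicit Types (A X Y x y z w : M) (B : field) (r s t l e : R) (gamma v : R -> M).
Hypotheses (p12 : 1 < p <= 2) (psigma : pd sigma) (d0 : (0 < d)%N).
Hypothesis pairing : exists2 jp : 'I_J -> 'I_J, injective jp &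
  forall j, (V j) ^t* = V (jp j) /\ omega (jp j) = - omega j.
Hypothesis ergodic : forall A, (forall j, partialj V j A = 0) -> exists c : C, A = c%:M.

Local Notation Q := (Q p sigma omega).
Local Notation src := (src V).
Local Notation Wc := (Wc p sigma V omega).
Local Notation W := (W p sigma V omega).
Local Notation chain := (chain p sigma V omega).
Local Notation metric := (metric_tensor p sigma V omega).

Lemma cvg_ip (T : Type) (F : set_system T) (FF : Filter F) (f : T -> M) Y :
  (forall A, ip A (f t) @[t --> F] --> ip A Y) -> f @ F --> Y.
Proof.
move=> h; apply/nm_cvgP.
have -> : (fun u => nm (f u - Y)) = fun u => Num.sqrt (ip (f u - Y) (f u - Y)).
  by apply/funext => t; rewrite -nm_sqr sqrtr_sqr ger0_norm ?nm_ge0.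
rewrite -(@sqrtr0 R); apply: continuous_cvg; first exact: sqrt_continuous.
have -> : 0 = \sum_(i < d) \sum_(j < d) (0 * 0 + 0 * 0) :> R.
  by rewrite big1 // => i _; rewrite big1 // => j _; rewrite mulr0 addr0.
under eq_fun do rewrite ipE; apply: cvg_sum_fin => i; apply: cvg_sum_fin => j.
have e1 u : complex.Re ((f u - Y) i j) = ip (delta_mx i j) (f u) - ip (delta_mx i j) Y.
  by rewrite -ipBr; exact: (congr1 (fun g => g 0) (re_entry_ip (fun=> f u - Y) i j)).
have e2 u : complex.Im ((f u - Y) i j) = ip ('i *: delta_mx i j) (f u) - ip ('i *: delta_mx i j) Y.
  by rewrite -ipBr; exact: (congr1 (fun g => g 0) (im_entry_ip (fun=> f u - Y) i j)).
have c A : ip A (f t) - ip A Y @[t --> F] --> (0 : R).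
  by rewrite -(subrr (ip A Y)); apply: cvgB; [exact: h|exact: cvg_cst].
under eq_fun do rewrite e1 e2.
by apply: cvgD; apply: cvgM; exact: c.
Qed.

Lemma ip_derive_mx gamma A t : smooth_mx gamma ->
  is_derive t 1 (fun s => ip A (gamma s)) (ip A (Defs.derive_mx gamma t)).
Proof.
move=> sg; pose h (i j : 'I_d) : R -> R :=
  complex.Re (A i j) *: re_entry gamma i j + complex.Im (A i j) *: im_entry gamma i j.
have dE (g : R -> R) s : smooth g -> is_derive s 1 g (derive1 g s).
  by move=> sm; rewrite derive1E; apply: DeriveDef => //; exact: (sm 0%N s).
have dh i j : is_derive t 1 (h i j) (complex.Re (A i j) * derive1 (re_entry gamma i j) t +
    complex.Im (A i j) * derive1 (im_entry gamma i j) t).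
  have [s1 s2] := sg i j.
  by apply: is_deriveD; apply: is_deriveZ; exact: dE.
apply: (is_derive_ext (is_derive_sum (fun i => is_derive_sum (dh i)))).
  by move=> s; rewrite ipE fct_sumE; apply: eq_bigr => i _; rewrite fct_sumE.
by rewrite ipE; apply: eq_bigr => i _; apply: eq_bigr => j _; rewrite mxE.
Qed.

Lemma ip_derive_mx_cont gamma A : smooth_mx gamma -> continuous (fun t => ip A (Defs.derive_mx gamma t)).
Proof.
move=> sg; have -> : (fun t => ip A (Defs.derive_mx gamma t)) = fun t => \sum_i \sum_j
    (complex.Re (A i j) * derive1 (re_entry gamma i j) t + complex.Im (A i j) * derive1 (im_entry
      gamma i j) t).
  by apply/funext => t; rewrite ipE; apply: eq_bigr => i _; apply: eq_bigr => j _; rewrite mxE.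
move=> t; apply: cvg_sum_fin => i; apply: cvg_sum_fin => j.
have [/smooth_cont[_ c1] /smooth_cont[_ c2]] := sg i j.
by apply: cvgD; apply: cvgMr; [exact: c1|exact: c2].
Qed.

Lemma derive_mx_eq gamma v : (forall A t, is_derive t 1 (fun s => ip A (gamma s)) (ip A (v t))) ->
  Defs.derive_mx gamma = v.
Proof.
move=> h; apply/funext => t; apply/matrixP => i j; rewrite mxE re_entry_ip im_entry_ip.
have E A : derive1 (fun s => ip A (gamma s)) t = ip A (v t).
  by rewrite derive1E; have hA := h A t; exact: derive_val.
rewrite !E; have := re_entry_ip v i j; have := im_entry_ip v i j.
move=> /(congr1 (fun f => f t)) <- /(congr1 (fun f => f t)) <-.
by rewrite /re_entry /im_entry; case: (v t i j).
Qed.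

(** A real subspace is the annihilator of its annihilator, a form that passes to derivatives and
    limits. The functionals used are antisymmetrised matrices, the identity and i times the
    identity. *)
Lemma traceless_saP Y : (forall A, (forall Z, traceless_sa Z -> ip A Z = 0) -> ip A Y = 0) ->
  traceless_sa Y.
Proof.
move=> h; split.
  apply: mx_eq_ip => A; apply/eqP; rewrite -subr_eq0; apply/eqP.
  have e1 Z : ip (A^t* - A) Z = ip A (Z^t*) - ip A Z by rewrite ipBl -[ip (A^t*) Z]ip_adj trmxCK.
  rewrite -e1; apply: h => Z [ZE _]; by rewrite e1 ZE subrr.
have trE Z : \tr Z = (ip 1%:M Z)%:C + (ip ('i *: 1%:M) Z)%:C * 'i.
  by rewrite -hs_ip /hs dag1 mul1mx.
have tr0 Z : \tr Z = 0 -> ip 1%:M Z = 0 /\ ip ('i *: 1%:M) Z = 0.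
  rewrite trE => /eqP; rewrite eq_complex /= !(mulr0, mul0r, mulr1, subr0, addr0, add0r).
  by case/andP => /eqP-> /eqP->.
rewrite trE !h ?mul0r ?addr0 // => Z [_ /tr0[]] //.
Qed.

Lemma smooth_velocity gamma x y : smooth_curve x y gamma ->
  forall t, 0 <= t <= 1 -> traceless_sa (Defs.derive_mx gamma t).
Proof.
move=> [sg fg _ _] t t01; apply: traceless_saP => A hA.
pose u s := ip A (Defs.derive_mx gamma s).
have cu : {within (`[0%R, 1%R]%classic : set (measurableTypeR R)), continuous u}.
  by apply: continuous_subspaceT; exact: ip_derive_mx_cont.
have u0 s : 0 < s -> s < 1 -> u s = 0.
  move=> s0 s1; suff H : is_derive s 1 (fun r => ip A (gamma r)) 0.
    have H2 := ip_derive_mx A s sg.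
    by rewrite /u -(@derive_val _ _ _ _ _ _ _ H2) (@derive_val _ _ _ _ _ _ _ H).
  have si : s \in `]0, 1[ by rewrite in_itv /= s0.
  apply: near_eq_is_derive (is_derive_cst (ip A (gamma 0)) s (1:R)).
  have := near_in_itvoo si; apply: filterS => r; rewrite in_itv /= => /andP[r0 r1].
  apply/eqP; rewrite -subr_eq0 -ipBr; apply/eqP/hA/states_sub_T; apply: full_state; apply: fg.
    by rewrite !ltW.
  by rewrite lexx ler01.
have half : u 2^-1 = 0 by apply: u0; lra.
rewrite -/(u t) (within_const cu) // => a b a0 ab b1.
by rewrite !u0 // ?(lt_trans a0) // (lt_trans ab).
Qed.

(** The optimal fields of the velocity make the metric along the curve a density G to which
    [W_action_bound] applies. *)
Lemma smooth_energy_ge x y gamma : smooth_curve x y gamma ->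
  ((Wc x y ^+ 2)%:E <= riemannian_energy p sigma V omega gamma)%E.
Proof.
move=> hc; have [sg fg g0 g1] := hc.
have fx : full_states x by rewrite -g0; apply: fg; rewrite lexx ler01.
have fy : full_states y by rewrite -g1; apply: fg; rewrite lexx ler01.
rewrite -(W_full p12 psigma d0 pairing ergodic fx fy) -g0 -g1.
pose G t := (metric (gamma t) (Defs.derive_mx gamma t) (Defs.derive_mx gamma t))%:E.
have opt t : 0 <= t <= 1 -> exists2 B, src B = Defs.derive_mx gamma t & (Q (gamma t) B)%:E = G t.
  move=> t01; have [B sB QB] := metric_tensor_opt p12 psigma pairing ergodic
    (full_pd (fg t t01)) (smooth_velocity hc t01).
  by exists B => //; rewrite QB.
have cg : {within `[0, 1], continuous gamma}.
  apply: continuous_subspaceT => t; apply: cvg_ip => A.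
  have [dt _] := ip_derive_mx A t sg.
  by have : {for t, continuous (fun s => ip A (gamma s))} by apply: differentiable_continuous;
    apply/derivable1_diffP.
have G0 t : 0 <= t <= 1 -> (0 <= G t)%E.
  move=> t01; have [B _ <-] := opt t t01; rewrite lee_fin.
  exact: (Q_ge0 omega p12 psigma B (full_pd (fg t t01))).
apply: (@le_trans _ _ (\int[mu]_(t in `]0%R, 1%R]) G t)%E); last first.
  apply: ge0_integral_subset; first exact: subset_itv_oc_cc.
  by move=> t; rewrite /= in_itv /=; exact: G0.
have h := @W_action_bound R d p sigma J V omega p12 psigma d0 pairing ergodic gamma
  (Defs.derive_mx gamma) G 0 1 ltr01.
rewrite subr0 mul1e in h; apply: h; [|exact: heine cg| |exact: G0|].
- by move=> t t01; exact/full_state/fg.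
- move=> A s t s0 st t1.
  have cA := ip_derive_mx_cont (A := A) sg.
  have is_ : mu.-integrable `[s, t] (EFin \o (fun r => ip A (Defs.derive_mx gamma r))).
    apply: continuous_compact_integrable; first exact: segment_compact.
    exact: continuous_subspaceT.
  have ist : mu.-integrable `]s, t] (EFin \o (fun r => ip A (Defs.derive_mx gamma r))).
    apply: integrableS is_ => //; [exact: measurable_itv..|exact: subset_itv_oc_cc].
  split => //; rewrite Rintegral_itv_obnd_cbnd // ipBr.
  move: st; rewrite le_eqVlt => /predU1P[->|st].
    by rewrite subrr set_itv1 Rintegral_set1.
  by rewrite (FTC2_deriv st cA (fun r => ip_derive_mx A r sg)).
- move=> t e t01 e0; have [B sB QB] := opt t t01; exists B => //; rewrite -QB lee_fin.
  have pt := full_pd (fg t t01).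
  by apply: (Q_antitone omega p12 psigma B pt); rewrite addrAC subrr add0r; apply: psd_scalar;
    exact: ltW.
Qed.

(* The curve rests at both ends, so that consecutive pieces can be added up. *)
Definition arc x y l k gamma v := [/\ forall A, gsm (fun t => ip A (gamma t)),
  forall A t, is_derive t 1 (fun s => ip A (gamma s)) (ip A (v t)),
  forall t, full_states (gamma t) /\ exists2 B, src B = v t & Q (gamma t) B <= k ^+ 2,
  forall t, t <= 0 -> gamma t = x /\ v t = 0 &
  forall t, l <= t -> gamma t = y /\ v t = 0].

(** Each segment is run by a smooth step of slope at most k, so its speed grows by at most that
    factor. Pieces are superposed rather than glued: while one moves the other rests at y, and
    smoothness is that of a sum. *)
Lemma chain_arc x y l k : 1 < k -> chain x y l -> exists gamma v, arc x y l k gamma v.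
Proof.
move=> k1; have km : 0 < k - 1 by rewrite subr_gt0.
have [f [f' [US hf' f'0]]] := smooth_step km.
have [_ rf] := unit_step_range US; have [[gf gf'] df f'p f0 f1] := US.
elim=> [{}x fx|{}x {}y z c {}l [c0 fx fy [B sB hB]] ch [gamma [v [IH1 IH2 IH3 IH4 IH5]]]].
  exists (fun=> x), (fun=> 0); split=> //.
  - by move=> A; exact: gsm_cst.
  - by move=> A t; rewrite ip0r; exact: is_derive_cst.
  - move=> t; split => //; exists 0; last by rewrite Q0 sqr_ge0.
    by rewrite -[0 : field](subrr 0) srcB subrr.
have l0 := chain_ge0 ch.
pose h t := c^-1 * t + 0; pose h2 t := 1 * t + (- c).
have hE t : h t = t / c by rewrite /h addr0 mulrC.
exists (fun t => x + (f (h t))%:C *: (y - x) + (gamma (h2 t) - y)),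
       (fun t => (c^-1 * f' (h t))%:C *: (y - x) + v (h2 t)).
have lec t : t <= c -> gamma (h2 t) = y /\ v (h2 t) = 0.
  by move=> tc; apply: IH4; rewrite /h2 mul1r subr_le0.
have gec t : c <= t -> f (h t) = 1 /\ f' (h t) = 0.
  move=> ct; have h1 : 1 <= h t by rewrite hE ler_pdivlMr // mul1r.
  by rewrite f1 // f'0 //; right.
have le0 t : t <= 0 -> f (h t) = 0 /\ f' (h t) = 0.
  move=> t0; have h1 : h t <= 0 by rewrite hE mulr_le0_ge0 // invr_ge0 ltW.
  by rewrite f0 // f'0 //; left.
split.
- move=> A.
  have -> : (fun t => ip A (x + (f (h t))%:C *: (y - x) + (gamma (h2 t) - y))) =
      (cst (ip A x) + (cst (ip A (y - x)) * (fun t => f (h t)))) +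
      ((fun t => ip A (gamma (h2 t))) + cst (- ip A y)).
    by apply/funext => t; rewrite (ipDr A (x + _)) (ipDr A x) ipZr (ipBr A (gamma _)) [f _ * _]mulrC.
  apply: gsm_add; apply: gsm_add; try exact: gsm_cst.
    by apply: gsm_mul; [exact: gsm_cst|exact: gsm_aff].
  exact: (gsm_aff 1 (- c) (IH1 A)).
- move=> A t.
  have dh : is_derive t 1 h c^-1.
    apply: (is_derive_ext (is_deriveD (is_deriveZ c^-1 (is_derive_id t (1:R))) (is_derive_cst 0 t
      (1:R)))) => [s //|].
    by rewrite /GRing.scale /= mulr1 addr0.
  have dh2 : is_derive t 1 h2 1.
    apply: (is_derive_ext (is_deriveD (is_deriveZ 1 (is_derive_id t (1:R))) (is_derive_cst (- c)
      t (1:R)))) => [s //|].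
    by rewrite /GRing.scale /= mulr1 addr0.
  have d1 := is_deriveZ (ip A (y - x)) (@is_derive1_comp R f h t _ _ (df _) dh).
  have d2 := @is_derive1_comp R (fun s => ip A (gamma s)) h2 t _ _ (IH2 A _) dh2.
  apply: (is_derive_ext (is_deriveD (is_deriveD (is_derive_cst (ip A x - ip A y) t (1:R)) d1) d2)).
    move=> s; rewrite (ipDr A (x + _)) (ipDr A x) ipZr (ipBr A (gamma _)).
    transitivity (ip A x - ip A y + ip A (y - x) * f (h s) + ip A (gamma (h2 s))) => //.
    rewrite ipBr; move: (f _) (ip _ _) (ip _ _) (ip _ _) => *; ring.
  rewrite (ipDr A (_ *: _)) ipZr /GRing.scale /=; move: (f' _) (ip _ _) (ip _ _) => *; ring.
- move=> t; have [tc|ct] := leP t c.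
    have [-> ->] := lec t tc; rewrite subrr !addr0.
    have f01 := rf (h t); split; first exact: seg_full.
    exists ((c^-1 * f' (h t))%:C *: B); first by rewrite srcZ sB.
    rewrite QZ; apply: (@le_trans _ _ ((c^-1 * k) ^+ 2 * c ^+ 2)).
      apply: ler_pM; rewrite ?sqr_ge0 ?(Q_ge0 omega p12 psigma) //.
      + by apply: full_pd; exact: seg_full.
      + rewrite ler_pXn2r ?nnegrE ?mulr_ge0 ?invr_ge0 ?(ltW c0) //;
        last by rewrite (le_trans ler01) // ltW.
        by rewrite ler_pM2l ?invr_gt0 // (le_trans (hf' _)) //; lra.
      + exact: hB.
    by rewrite -exprMn mulrAC mulVf ?mul1r // gt_eqF.
  have [-> ->] := gec t (ltW ct); rewrite mulr0 scale0r add0r scale1r.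
  by rewrite [x + _]addrC subrK [y + _]addrC subrK; exact: IH3.
- move=> t t0; have [-> ->] := le0 t t0; have tc : t <= c by rewrite (le_trans t0) // ltW.
  by have [-> ->] := lec t tc; rewrite subrr mulr0 !scale0r !addr0.
move=> t lt; have ct : c <= t by rewrite (le_trans _ lt) // lerDl.
have [-> ->] := gec t ct; have [|-> ->] := IH5 (h2 t); first by rewrite /h2 mul1r lerBrDl.
by rewrite mulr0 scale0r add0r scale1r [x + _]addrC subrK [y + _]addrC subrK.
Qed.

(** The arc has duration l and square speed at most k^2; run in unit time its metric is at most (k
    l)^2. *)
Lemma chain_energy x y l k : 1 < k -> chain x y l -> exists2 gamma, smooth_curve x y gamma &
  (riemannian_energy p sigma V omega gamma <= ((k * l) ^+ 2)%:E)%E.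
Proof.
move=> k1 ch; have l0 := chain_ge0 ch.
have [gamma [v [h1 h2 h3 h4 h5]]] := chain_arc k1 ch.
pose g t := gamma (l * t + 0).
have dg A t : is_derive t 1 (fun s => ip A (g s)) (ip A (l%:C *: v (l * t + 0))).
  have dh : is_derive t 1 (fun s => l * s + 0) l.
    apply: (is_derive_ext (is_deriveD (is_deriveZ l (is_derive_id t (1:R))) (is_derive_cst 0 t
      (1:R)))) => [s //|].
    by rewrite /GRing.scale /= mulr1 addr0.
  apply: (is_derive_ext (@is_derive1_comp R (fun s => ip A (gamma s)) _ t _ _ (h2 A _) dh)) => [s //|].
  by rewrite ipZr mulrC.
have cg : smooth_curve x y g.
  split.
  - move=> i j; rewrite re_entry_ip im_entry_ip; split; apply: gsm_smooth; exact: (gsm_aff l 0 (h1 _)).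
  - by move=> s _; exact: (h3 _).1.
  - by rewrite /g mulr0 addr0; apply: (h4 0 (lexx 0)).1.
  - by rewrite /g mulr1 addr0; apply: (h5 l (lexx l)).1.
exists g => //.
have gE := derive_mx_eq dg.
have bd t : 0 <= t <= 1 -> 0 <= metric (g t) (Defs.derive_mx g t) (Defs.derive_mx g t) <= (k * l) ^+ 2.
  move=> t01; have [ft [B sB hB]] := h3 (l * t + 0).
  have pt := full_pd ft; have tv := smooth_velocity cg t01.
  apply/andP; split.
    have [B' _ <-] := metric_tensor_opt p12 psigma pairing ergodic pt tv.
    exact: (Q_ge0 omega p12 psigma B' pt).
  have sB' : src (l%:C *: B) = Defs.derive_mx g t by rewrite srcZ sB gE.
  rewrite -sB'; rewrite -sB' in tv.
  apply: le_trans (metric_tensor_le p12 psigma pairing ergodic pt tv) _.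
  by rewrite QZ exprMn mulrC ler_wpM2r ?sqr_ge0.
rewrite /riemannian_energy.
apply: (@le_trans _ _ (\int[mu]_(s in `[0%R, 1%R]) ((k * l) ^+ 2)%:E)%E).
  apply: ge0_integral_mono => t; rewrite /= in_itv /= => /bd/andP[b1 b2]; rewrite lee_fin //.
rewrite integral_cst; last exact: mI01.
by rewrite [X in (_ * X)%E]lebesgue_measure_itv /= lte_fin ltr01 oppr0 adde0 mule1.
Qed.

Lemma riemannian_distE x y : full_states x -> full_states y ->
  riemannian_dist p sigma V omega x y = Wc x y.
Proof.
move=> fx fy; rewrite /riemannian_dist.
have W0 := Wc_ge0 p12 psigma d0 pairing ergodic fx fy : 0 <= Wc x y.
suff -> : ereal_inf [set riemannian_energy p sigma V omega gamma | gamma in smooth_curve x y] =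
    (Wc x y ^+ 2)%:E by rewrite /= sqrtr_sqr ger0_norm.
apply/eqP; rewrite eq_le; apply/andP; split; last first.
  by apply: le_ereal_inf_tmp => _ [gamma hg <-]; exact: smooth_energy_ge.
apply/lee_addgt0Pr => e e0.
(* Chosen so that (w + n (w + 2))^2 <= w^2 + n k for 0 <= n <= 1, where w + n (w + 2) bounds (1 + n)
   l. *)
set w := Wc x y in W0 *; pose k := (w + 2) * (3 * w + 2).
have k0 : 0 < k by rewrite /k; nra.
pose n := Num.min 1 (e / k).
have n0 : 0 < n by rewrite lt_min ltr01 divr_gt0.
have n1 : n <= 1 by rewrite ge_min lexx.
have nk : n * k <= e by rewrite -ler_pdivlMr // ge_min lexx orbT.
have [l ch lw] := Wc_approx p12 psigma d0 pairing ergodic fx fy n0.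
have l0 := chain_ge0 ch.
have n1' : 1 < 1 + n by rewrite ltrDl.
have [gamma hg he] := chain_energy n1' ch.
apply: (@le_trans _ _ (riemannian_energy p sigma V omega gamma)).
  by apply: ereal_inf_lbound; exists gamma.
apply: le_trans he _; rewrite -EFinD lee_fin.
have h1 : (1 + n) * l <= w + n * (w + 2) by rewrite -/w in lw; nra.
have h2 : 0 <= (1 + n) * l by rewrite mulr_ge0 // addr_ge0 ?ler01 // ltW.
apply: (@le_trans _ _ ((w + n * (w + 2)) ^+ 2)).
  by rewrite ler_pXn2r ?nnegrE // (le_trans h2).
apply: (@le_trans _ _ (w ^+ 2 + n * k)); last by rewrite lerD2l.
have : 0 <= n * (1 - n) * (w + 2) ^+ 2.
  by rewrite mulr_ge0 ?sqr_ge0 // mulr_ge0 ?(ltW n0) // subr_ge0.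
by rewrite /k; nra.
Qed.

End SmoothCurves.

(** * The norm at singular states and integrated fields of chains *)

Section WeightedNorm.
Variables (R : realType) (d : nat).
Local Notation C := R[i].
Local Notation M := 'M[C]_d.
Local Notation mu := (@lebesgue_measure R).
Variables (p : R) (sigma : M) (J : nat) (V : 'I_J -> M) (omega : 'I_J -> R).
Local Notation field := ('I_J -> M).
Implicit Types (A X Y x y z w rho : M) (B D : field) (r s t l e c : R) (gamma v : R -> M).
Hypotheses (p12 : 1 < p <= 2) (psigma : pd sigma) (d0 : (0 < d)%N).
Hypothesis pairing : exists2 jp : 'I_J -> 'I_J, injective jp &
  forall j, (V j) ^t* = V (jp j) /\ omega (jp j) = - omega j.
Hypothesis ergodic : forall A, (forall j, partialj V j A = 0) -> exists c : C, A = c%:M.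

Local Notation Q := (Q p sigma omega).
Local Notation src := (src V).
Local Notation W := (W p sigma V omega).
Local Notation chain := (chain p sigma V omega).
Local Notation wn := (weighted_norm2 p sigma omega).

Lemma pd_reg rho e : states rho -> 0 < e -> pd (rho + e%:C%:M).
Proof. by move=> sr e0; apply/pdP; exists e; [exact: e0|rewrite addrK; exact: states_psd]. Qed.

Lemma Q_reg_antitone rho e r B : states rho -> 0 < e -> e <= r ->
  Q (rho + r%:C%:M) B <= Q (rho + e%:C%:M) B.
Proof.
move=> sr e0 er; apply: (Q_antitone omega p12 psigma B (pd_reg sr e0)).
rewrite opprD addrACA subrr add0r -raddfB /= -rmorphB; apply: psd_scalar.
by rewrite subr_ge0.
Qed.

Lemma weighted_norm2_sup rho B : states rho -> rho \notin unitmx ->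
  wn rho B = ereal_sup [set (weighted_norm2_reg p sigma omega (rho + e%:C%:M) B)%:E | e in `]0, +oo[].
Proof.
move=> sr nr; rewrite /weighted_norm2 (negbTE nr).
apply: (@cvg_lim _ (@ereal_hausdorff R)).
apply: (@nonincreasing_at_right_cvge R _ 0 +oo%O); first by [].
move=> e r; rewrite !in_itv /= !andbT => e0 r0 er.
rewrite lee_fin !(weighted_norm2_regE omega p12 psigma); [exact: Q_reg_antitone|exact: pd_reg..].
Qed.

Lemma Q_le_weighted_norm2 rho e B : states rho -> 0 < e -> ((Q (rho + e%:C%:M) B)%:E <= wn rho B)%E.
Proof.
move=> sr e0; have [ur|nr] := boolP (rho \in unitmx).
  have pr : pd rho by apply: full_pd.
  rewrite /weighted_norm2 ur (weighted_norm2_regE omega p12 psigma) // lee_fin.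
  apply: (Q_antitone omega p12 psigma B pr); rewrite addrAC subrr add0r.
  by apply: psd_scalar; exact: ltW.
rewrite weighted_norm2_sup //; apply: ereal_sup_ubound; exists e; first by rewrite /= in_itv /= e0.
by rewrite (weighted_norm2_regE omega p12 psigma) //; exact: pd_reg.
Qed.

(** At full rank, rho >= n gives rho >= n / (n + e) times rho + e, so homogeneity recovers Q at rho
    from its regularisations as e tends to 0. *)
Lemma weighted_norm2_le rho B c : states rho -> (forall e, 0 < e -> Q (rho + e%:C%:M) B <= c) ->
  (wn rho B <= c%:E)%E.
Proof.
move=> sr h; have [ur|nr] := boolP (rho \in unitmx); last first.
  rewrite weighted_norm2_sup //; apply: ge_ereal_sup => u [e]; rewrite /= in_itv /= andbT => e0 <-.
  by rewrite lee_fin (weighted_norm2_regE omega p12 psigma); [exact: h|exact: pd_reg].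
have pr : pd rho by apply: full_pd.
rewrite /weighted_norm2 ur (weighted_norm2_regE omega p12 psigma) // lee_fin.
have /pdP[n n0 hn] := pr.
apply: (@ler_add_eps_mul _ _ _ (c / n)) => e e0 _.
have en : 0 < n + e by rewrite addr_gt0.
have r01 : 0 < n / (n + e) <= 1 by rewrite divr_gt0 //= ler_pdivrMr // mul1r lerDl ltW.
have h1 : psd (rho - (n / (n + e))%:C *: (rho + e%:C%:M)).
  have -> : rho - (n / (n + e))%:C *: (rho + e%:C%:M) =
      (e / (n + e))%:C *: (rho - n%:C%:M).
    rewrite scalerDr scalerBr opprD addrA.
    have -> : rho - (n / (n + e))%:C *: rho = (e / (n + e))%:C *: rho.
      rewrite -[X in X - _]scale1r -scalerBl -(rmorph1 (real_complex R)) -rmorphB.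
      by congr (_%:C *: _); field; rewrite gt_eqF.
    rewrite !scale_scalar_mx -!rmorphM; congr (_ - _%:C%:M).
    by field; rewrite gt_eqF.
  by apply: psdZ hn; rewrite divr_ge0 // ltW.
have := Q_le_scale omega p12 psigma B (pd_reg sr e0) r01 h1.
move=> /le_trans; apply; apply: (@le_trans _ _ ((n / (n + e))^-1 * c)).
  by apply: ler_wpM2l (h e e0); rewrite invr_ge0 divr_ge0 // ltW.
by rewrite le_eqVlt; apply/orP; left; apply/eqP; field; rewrite !gt_eqF.
Qed.

Lemma action_ge x y gamma (B : R -> field) : admissible V x y gamma B ->
  (((W x y) ^+ 2)%:E <= action p sigma omega gamma B)%E.
Proof.
move=> had; have [[sg cg] _ _ <- <-] := had.
have h := @W_action_bound R d p sigma J V omega p12 psigma d0 pairing ergodic gamma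
  (fun s => src (B s)) (fun s => wn (gamma s) (B s)) 0 1 ltr01 sg (heine cg)
  (admissible_weak_primitive had).
have wn0 t : 0 <= t <= 1 -> (0 <= wn (gamma t) (B t))%E.
  move=> t01; apply: le_trans (Q_le_weighted_norm2 (B t) (sg t t01) ltr01).
  rewrite lee_fin; apply: (Q_ge0 omega p12 psigma (B t)); exact: pd_reg (sg t t01) ltr01.
rewrite subr0 mul1e in h; apply: le_trans (h _ _) _; first exact: wn0.
  by move=> t e t01 e0; exists (B t) => //; apply: Q_le_weighted_norm2 e0; exact: sg.
apply: ge0_integral_subset; first exact: subset_itv_oc_cc.
by move=> t; rewrite /= in_itv /=; exact: wn0.
Qed.

Lemma Q_fn2 z : pd z -> exists2 k, 0 < k & forall D, Q z D <= k * fn2 D.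
Proof.
move=> pz; have /pdP[e e0 he] := pz; have [k k0 hk] := @Q1_upper R d p sigma J omega.
pose r := Num.min e 1.
have r01 : 0 < r <= 1 by rewrite lt_min e0 ltr01 ge_min lexx orbT.
have hr : psd (z - r%:C%:M).
  apply: psd_trans he; rewrite -raddfB /= -rmorphB; apply: psd_scalar.
  by rewrite subr_ge0 ge_min lexx.
have /andP[r0 _] := r01; exists (r^-1 * k); first by rewrite mulr_gt0 // invr_gt0.
move=> D; have := Q_le_eta omega p12 psigma D r01 hr => /le_trans; apply.
by rewrite -mulrA ler_pM2l ?invr_gt0.
Qed.

(** For fixed z the form is dominated by [fn2], so its balls are closed; the triangle inequality for
    its square root gives the estimate. *)
Lemma Q_closed z B c : pd z -> 0 <= c ->
  (forall f, 0 < f -> exists2 D, Q z D <= (c + f) ^+ 2 & fn2 (B - D) <= f ^+ 2) ->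
  Q z B <= c ^+ 2.
Proof.
move=> pz c0 h; have [k k0 hk] := Q_fn2 pz.
suff : Num.sqrt (Q z B) <= c.
  move=> hs; rewrite -[leLHS]sqr_sqrtr; last exact: (Q_ge0 omega p12 psigma B pz).
  by rewrite ler_pXn2r ?nnegrE ?sqrtr_ge0.
apply: (@ler_add_eps_mul _ _ _ (1 + Num.sqrt k)) => f f0 _.
have [D hD hBD] := h f f0.
have -> : B = D + (B - D) by rewrite addrC subrK.
apply: le_trans (Q_sqrt_triangle omega p12 psigma _ _ pz) _.
have -> : c + f * (1 + Num.sqrt k) = (c + f) + f * Num.sqrt k by ring.
apply: lerD.
  by rewrite -[leRHS]ger0_norm ?addr_ge0 ?(ltW f0) // -sqrtr_sqr ler_wsqrtr.
rewrite -[f]ger0_norm ?(ltW f0) // -sqrtr_sqr mulrC -sqrtrM ?(ltW k0) //.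
by rewrite ler_wsqrtr // (le_trans (hk _)) // ler_pM2l.
Qed.

(** F is the field integrated in arc length, so the curve is x + src (F t). The last clause is a
    unit-speed bound in Q z for every z above the curve on [a, b], a form that survives passage to
    the limit. *)
Definition field_path x y l (F : R -> field) := [/\ F 0 = 0, x + src (F l) = y,
  forall t, 0 <= t <= l -> states (x + src (F t)) &
  forall a b z, 0 <= a -> a <= b -> b <= l -> pd z ->
    (forall r, a <= r <= b -> psd (z - (x + src (F r)))) -> Q z (F b - F a) <= (b - a) ^+ 2].

Lemma src0 : src 0 = 0.
Proof. by rewrite -[0 in LHS](subrr 0) srcB subrr. Qed.

(** The first segment uses B at rate 1 / c on [0, c] and the rest follows shifted by c; an interval
    containing c is split there by the triangle inequality of the square root of Q. *)
Lemma chain_path x y l : chain x y l -> exists F, field_path x y l F.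
Proof.
elim=> [{}x fx|{}x {}y z c {}l [c0 fx fy [B sB hB]] ch [F [F0 Fl Fs FQ]]].
  exists (fun=> 0); split => //; first by rewrite src0 addr0.
    by move=> t _; rewrite src0 addr0; exact: full_state.
  by move=> a b z _ _ _ _ _; rewrite subrr Q0 sqr_ge0.
have l0 := chain_ge0 ch.
pose G t : field := if t <= c then (t / c)%:C *: B else B + F (t - c).
have Gle t : t <= c -> G t = (t / c)%:C *: B by rewrite /G => ->.
have Gge t : c <= t -> G t = B + F (t - c).
  rewrite le_eqVlt => /predU1P[<-|ct]; last by rewrite /G leNgt ct.
  by rewrite Gle // subrr F0 addr0 divff ?gt_eqF // scale1r.
have sle t : t <= c -> x + src (G t) = seg x y (t / c).
  by move=> tc; rewrite Gle // srcZ sB.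
have sge t : c <= t -> x + src (G t) = y + src (F (t - c)).
  by move=> ct; rewrite (Gge t ct) srcD sB addrA [x + _]addrC subrK.
have t01 t : 0 <= t -> t <= c -> 0 <= t / c <= 1.
  by move=> t0 tc; rewrite divr_ge0 ?(ltW c0) //= ler_pdivrMr // mul1r.
exists G; split.
- by rewrite Gle ?(ltW c0) // mul0r scale0r.
- have cl : c + l - c = l by rewrite addrAC subrr add0r.
  by rewrite sge ?cl; [exact: Fl|rewrite lerDl].
- move=> t /andP[t0 tl]; have [tc|/ltW ct] := leP t c.
    by rewrite sle //; apply: seg_states (t01 t t0 tc); exact: full_state.
  by rewrite sge //; apply: Fs; rewrite subr_ge0 ct lerBlDl.
have low a b w : 0 <= a -> a <= b -> b <= c -> pd w ->
    (forall r, a <= r <= b -> psd (w - (x + src (G r)))) -> Q w (G b - G a) <= (b - a) ^+ 2.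
  move=> a0 ab bc pw hw; have ac := le_trans ab bc.
  rewrite !Gle // -scalerBl -rmorphB QZ -mulrBl exprMn -[leRHS]mulr1 -mulrA.
  rewrite ler_wpM2l ?sqr_ge0 // exprVn mulrC ler_pdivrMr ?exprn_gt0 // mul1r.
  have ps : pd (seg x y (a / c)) by apply: full_pd; apply: seg_full (t01 a a0 ac).
  apply: le_trans (Q_antitone omega p12 psigma B ps _) (hB _ (t01 a a0 ac)).
  by rewrite -sle //; apply: hw; rewrite lexx.
have high a b w : c <= a -> a <= b -> b <= c + l -> pd w ->
    (forall r, a <= r <= b -> psd (w - (x + src (G r)))) -> Q w (G b - G a) <= (b - a) ^+ 2.
  move=> ca ab bl pw hw; have cb := le_trans ca ab.
  rewrite !Gge // opprD addrACA subrr add0r.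
  have -> : b - a = (b - c) - (a - c) by ring.
  apply: FQ => //; rewrite ?subr_ge0 ?lerD2r ?lerBlDl // => r /andP[ar rb].
  have := hw (r + c); rewrite sge; last by rewrite lerDr (le_trans _ ar) // subr_ge0.
  by rewrite addrK; apply; rewrite -lerBlDr ar -lerBrDr.
move=> a b w a0 ab bl pw hw.
have [bc|/ltW cb] := leP b c; first exact: low.
have [ca|/ltW ac] := leP c a; first exact: high.
have -> : G b - G a = (G b - G c) + (G c - G a) by rewrite addrA subrK.
have h1 : Q w (G b - G c) <= (b - c) ^+ 2.
  by apply: high => // r /andP[cr rb]; apply: hw; rewrite (le_trans ac).
have h2 : Q w (G c - G a) <= (c - a) ^+ 2.
  by apply: low => // r /andP[ar rc]; apply: hw; rewrite ar (le_trans rc).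
have sq D f : 0 <= f -> Q w D <= f ^+ 2 -> Num.sqrt (Q w D) <= f.
  by move=> f0 hD; rewrite -[leRHS]ger0_norm // -sqrtr_sqr ler_wsqrtr.
rewrite -[leLHS]sqr_sqrtr; last exact: (Q_ge0 omega p12 psigma _ pw).
rewrite ler_pXn2r ?nnegrE ?sqrtr_ge0 ?subr_ge0 //.
apply: le_trans (Q_sqrt_triangle omega p12 psigma _ _ pw) _.
have -> : b - a = (b - c) + (c - a) by ring.
by apply: lerD; apply: sq => //; rewrite subr_ge0.
Qed.

End WeightedNorm.

(** * Limits along an ultrafilter *)

Section UltraLimits.
Variables (R : realType) (d : nat).
Local Notation C := R[i].
Local Notation M := 'M[C]_d.
Variable U : set_system nat.
Hypothesis UU : UltraFilter U.

(** A cluster point of an ultrafilter is its limit. A single ultrafilter serves all times and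
    indices at once, in place of extracting subsequences. *)
Lemma ultra_real (u : nat -> R) (K : R) : (forall n, `|u n| <= K) -> exists l : R, u @ U --> l.
Proof.
move=> uK; have UP : ProperFilter U := @ultra_proper _ _ UU.
have hU : (u @ U) `[- K, K]%classic.
  apply: (@filterS _ U _ setT); last exact: filterT.
  by move=> n _; rewrite /= in_itv /= -ler_norml; exact: uK.
have [l [_ hl]] := @segment_compact R (- K) K (u @ U) _ hU.
exists l => A /= nA.
have [//|hC] := in_ultra_setVsetC (u @^-1` A) UU.
have [z [zA nz]] := hl (~` A) A hC nA.
by [].
Qed.

Lemma ultra_mx (u : nat -> M) (K : R) : (forall n, nm (u n) <= K) ->
  exists Y, nm (u n - Y) @[n --> U] --> (0 : R).
Proof.
move=> uK; have UP : ProperFilter U := @ultra_proper _ _ UU.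
have lim A : exists l : R, ip A (u n) @[n --> U] --> l.
  apply: (@ultra_real _ (nm A * K)) => n.
  by apply: le_trans (ip_norm_le _ _) _; rewrite ler_wpM2l ?nm_ge0.
have [m mP] := choice lim.
pose Y : M := \matrix_(i, j) (m (delta_mx i j) +i* m ('i *: delta_mx i j)).
exists Y; apply/nm_cvgP; apply: cvg_ip => A.
have re n i j : complex.Re (u n i j) = ip (delta_mx i j) (u n).
  exact: (congr1 (fun g => g 0) (re_entry_ip (fun=> u n) i j)).
have im n i j : complex.Im (u n i j) = ip ('i *: delta_mx i j) (u n).
  exact: (congr1 (fun g => g 0) (im_entry_ip (fun=> u n) i j)).
under eq_fun do rewrite ipE; rewrite ipE.
apply: cvg_sum_fin => i; apply: cvg_sum_fin => j.
under eq_fun do rewrite re im.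
by rewrite mxE /=; apply: cvgD; apply: cvgMr; exact: mP.
Qed.

End UltraLimits.

(** * Closedness of the set of states *)

Section StatesClosed.
Variables (R : realType) (d : nat).
Local Notation C := R[i].
Local Notation M := 'M[C]_d.
Implicit Types (x y A : M).

Lemma sub_sub_sub (Z : zmodType) (a b c e : Z) : a - b - (c - e) = (e - b) - (c - a).
Proof. by rewrite !opprB [RHS]addrC addrACA [RHS]addrACA [- b - c]addrC. Qed.

Lemma small_eq0 (K r : R) : (forall f, 0 < f -> r <= K * f) -> r <= 0.
Proof.
move=> h; apply: (@ler_add_eps_mul _ _ _ K) => e e0 _.
by rewrite add0r mulrC; exact: h.
Qed.

(** Self-adjointness and trace pass to the limit through [traceless_saP], relative to the maximally
    mixed state; positivity passes through each test matrix Z. *)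
Lemma states_closed x : (0 < d)%N -> (forall f : R, 0 < f -> exists2 y, states y & nm (y - x) <= f) ->
  states x.
Proof.
move=> d0 h; have sm := full_state (mixed_full R d0).
have tx : traceless_sa (x - mixed R d).
  apply: traceless_saP => A hA; apply/eqP; rewrite -normr_le0.
  apply: (@small_eq0 (nm A)) => f f0; have [y sy yx] := h f f0.
  have -> : x - mixed R d = (x - y) + (y - mixed R d) by rewrite addrA subrK.
  rewrite ipDr (hA _ (states_sub_T sm sy)) addr0.
  by apply: le_trans (ip_norm_le _ _) _; rewrite ler_wpM2l ?nm_ge0 // nm_subC.
have xE : x = (x - mixed R d) + mixed R d by rewrite subrK.
have [tx1 tx2] := tx; split; last first.
  by rewrite xE mxtraceD tx2 add0r; case: sm.
apply/psdP; split; first by rewrite xE dagD tx1 (states_adj sm).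
move=> Z; have [c c0 hc] := mulmxr_bound Z.
rewrite -oppr_le0; apply: (@small_eq0 (nm Z * Num.sqrt c)) => f f0; have [y sy yx] := h f f0.
have [/psdP[_ /(_ Z) hy] _] := sy.
have -> : - ip Z (x *m Z) = ip Z ((y - x) *m Z) - ip Z (y *m Z) by rewrite mulmxBl ipBr; ring.
rewrite lerBlDr (le_trans (ip_CS _ _)) //.
apply: (@le_trans _ _ (nm Z * Num.sqrt c * f)); last by rewrite lerDl.
rewrite -mulrA ler_wpM2l ?nm_ge0 //.
rewrite -(ler_pXn2r (n := 2)) ?nnegrE ?nm_ge0 ?mulr_ge0 ?sqrtr_ge0 ?(ltW f0) //.
rewrite nm_sqr (le_trans (hc _)) // exprMn sqr_sqrtr ?(ltW c0) // ler_pM2l // -nm_sqr.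
by rewrite ler_pXn2r ?nnegrE ?nm_ge0 // ltW.
Qed.

Section Fields.
Variable J : nat.
Implicit Types B D : 'I_J -> M.

Lemma nm_fn2 B j : nm (B j) ^+ 2 <= fn2 B.
Proof.
rewrite nm_sqr /fn2 (bigD1 j) //= lerDl sumr_ge0 // => i _; exact: ip_ge0.
Qed.

Lemma fn2_sub B D : fn2 (B - D) <= 2 * (fn2 B + fn2 D).
Proof.
rewrite /fn2 -big_split mulr_sumr; apply: ler_sum => j _ /=.
have := ip_ge0 (B j + D j); rewrite -[(B - D) j]/(B j - D j).
rewrite !(ipBl, ipBr, ipDl, ipDr) (ip_sym (D j) (B j)).
move: (ip _ _) (ip _ _) (ip _ _) => a b c; lra.
Qed.

End Fields.
End StatesClosed.

(** * Limit of the integrated fields of almost optimal chains *)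

Section LimitField.
Variables (R : realType) (d : nat).
Local Notation C := R[i].
Local Notation M := 'M[C]_d.
Variables (p : R) (sigma : M) (J : nat) (V : 'I_J -> M) (omega : 'I_J -> R).
Local Notation field := ('I_J -> M).
Implicit Types (A X Y x y z : M) (B D : field) (r s t l e f : R).
Hypotheses (p12 : 1 < p <= 2) (psigma : pd sigma) (d0 : (0 < d)%N).
Hypothesis pairing : exists2 jp : 'I_J -> 'I_J, injective jp &
  forall j, (V j) ^t* = V (jp j) /\ omega (jp j) = - omega j.
Hypothesis ergodic : forall A, (forall j, partialj V j A = 0) -> exists c : C, A = c%:M.

Local Notation Q := (Q p sigma omega).
Local Notation src := (src V).
Local Notation W := (W p sigma V omega).
Local Notation Wc := (Wc p sigma V omega).

Lemma src_fn2 : exists2 k, 0 < k & forall B, nm (src B) <= k * Num.sqrt (fn2 B).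
Proof.
have [k k0 hk] := src_bound V omega p12 psigma.
have [c c0 hc] := @Q1_upper R d p sigma J omega.
exists (Num.sqrt (k * c)); first by rewrite sqrtr_gt0 mulr_gt0.
move=> B; rewrite -sqrtrM ?mulr_ge0 ?(ltW k0) ?(ltW c0) //.
rewrite -[leLHS]ger0_norm ?nm_ge0 // -sqrtr_sqr ler_wsqrtr // nm_sqr (le_trans (hk B)) //.
by rewrite -mulrA ler_pM2l.
Qed.

Definition lipschitz_field K (F : R -> field) := forall s t, 0 <= s -> s <= t -> t <= 1 ->
  forall j, nm (F t j - F s j) <= K * (t - s).

(* The bound at a only controls small increments: Q is monotone along the approximating curves as
   soon as they stay below x + src (F a) + e, which the Lipschitz bound ensures near a. *)
Lemma limit_field x y : states x -> states y -> exists F K, [/\ 0 < K /\ lipschitz_field K F,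
  F 0 = 0, x + src (F 1) = y, forall t, 0 <= t <= 1 -> states (x + src (F t)) &
  forall a e, 0 <= a <= 1 -> 0 < e -> exists2 de, 0 < de & forall b, a <= b -> b <= 1 -> b - a <= de ->
    Q (x + src (F a) + e%:C%:M) (F b - F a) <= (W x y * (b - a)) ^+ 2].
Proof.
move=> sx sy; set w := W x y.
have w0 : 0 <= w by exact: W_ge0.
(* 1 / (n + 2), because the push parameter must be strictly below 1 also at n = 0. *)
pose en (n : nat) : R := n.+2%:R^-1.
have en01 n : 0 < en n < 1 by rewrite invr_gt0 ltr0n invf_lt1 ?ltr0n // ltr1n.
have ex n : exists lF : R * (R -> field), [/\ 0 <= lF.1, lF.1 <= w + en n &
    field_path p sigma V omega (push (en n) x) (push (en n) y) lF.1 lF.2].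
  have /andP[e0 e1] := en01 n.
  have fx := push_full' d0 sx (en01 n); have fy := push_full' d0 sy (en01 n).
  have [l ch lw] := Wc_approx p12 psigma d0 pairing ergodic fx fy e0.
  have [F hF] := chain_path p12 psigma ch; exists (l, F); split => //=; first exact: chain_ge0 ch.
  rewrite (le_trans (ltW lw)) // lerD2r.
  exact: (W_ge p12 psigma d0 pairing ergodic sx sy (en01 n)).
have [lF lFP] := choice ex.
(* Time is rescaled to [0, 1], so [H n] has speed at most [l n], which may be 0. *)
pose l n := (lF n).1; pose H n t := (lF n).2 (l n * t).
pose g n t := push (en n) x + src (H n t).
have l0 n : 0 <= l n by have [] := lFP n.
have lw n : l n <= w + en n by have [] := lFP n.
have lt n t : 0 <= t <= 1 -> 0 <= l n * t <= l n.
  by move=> /andP[t0 t1]; rewrite mulr_ge0 // ler_piMr.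
have gs n t : 0 <= t <= 1 -> states (g n t).
  by move=> t01; have [_ _ [_ _ h _]] := lFP n; apply: h; exact: lt.
have HQ n a b z : 0 <= a -> a <= b -> b <= 1 -> pd z ->
    (forall r, a <= r <= b -> psd (z - g n r)) -> Q z (H n b - H n a) <= (l n * (b - a)) ^+ 2.
  move=> a0 ab b1 pz hz; have [_ _ [_ _ _ h]] := lFP n.
  rewrite mulrBr; have [ln0|] := leP (l n) 0.
    have E : l n = 0 by apply/eqP; rewrite eq_le ln0 l0.
    by rewrite /H E !mul0r subrr Q0 subrr sqr_ge0.
  move=> lp; apply: h; rewrite ?mulr_ge0 ?ler_wpM2l //; first by rewrite ler_piMr.
  move=> r /andP[ar rb]; have := hz (r / l n); rewrite /g /H mulrCA divff ?mulr1 ?gt_eqF //; apply.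
  by rewrite ler_pdivlMr // ler_pdivrMr // mulrC ar mulrC.
have [c c0 hc] := @Q1_lower R d p sigma J omega p12 psigma.
(* Q at 1 is at least c times [fn2] and the speeds are at most w + 1, which makes this a common
   Lipschitz constant of the [H n]. *)
pose K := (w + 1) / Num.sqrt c.
have w1 : 0 < w + 1 by rewrite ltr_wpDl.
have sc0 : 0 < Num.sqrt c by rewrite sqrtr_gt0.
have K0 : 0 < K by rewrite divr_gt0.
have en1 n : en n <= 1 by case/andP: (en01 n) => _ /ltW.
have HL n a b : 0 <= a -> a <= b -> b <= 1 -> fn2 (H n b - H n a) <= (K * (b - a)) ^+ 2.
  move=> a0 ab b1.
  have h1 : Q 1%:M (H n b - H n a) <= (l n * (b - a)) ^+ 2.
    apply: HQ => //; first exact: pd1.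
    by move=> r /andP[ar rb]; apply: states_le1; apply: gs; rewrite (le_trans a0 ar) (le_trans rb b1).
  have h2 : (l n * (b - a)) ^+ 2 <= ((w + 1) * (b - a)) ^+ 2.
    rewrite ler_pXn2r ?nnegrE ?mulr_ge0 ?subr_ge0 ?(ltW w1) //.
    by rewrite ler_wpM2r ?subr_ge0 // (le_trans (lw n)) // lerD2l.
  have -> : (K * (b - a)) ^+ 2 = ((w + 1) * (b - a)) ^+ 2 / c.
    by rewrite /K mulrAC expr_div_n sqr_sqrtr // ltW.
  by rewrite ler_pdivlMr // mulrC (le_trans (hc _)) // (le_trans h1).
have H0 n : H n 0 = 0 by have [_ _ [h _ _ _]] := lFP n; rewrite /H mulr0.
have [U [UU UT]] := @ultraFilterLemma nat \oo _.
have UP : ProperFilter U := @ultra_proper _ _ UU.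
have exF (tj : R * 'I_J) : exists Y, 0 <= tj.1 <= 1 -> nm (H n tj.1 tj.2 - Y) @[n --> U] --> (0 : R).
  case: tj => t j /=; have [/andP[t0 t1]|nt] := boolP (0 <= t <= 1); last by exists 0.
  have bd n : nm (H n t j) <= K.
    rewrite -(ler_pXn2r (n := 2)) ?nnegrE ?nm_ge0 ?(ltW K0) //.
    apply: le_trans (nm_fn2 _ _) _; have := HL n 0 t (lexx 0) t0 t1.
    rewrite H0 !subr0 => /le_trans; apply.
    have Kt : 0 <= K * t by rewrite mulr_ge0 ?(ltW K0).
    by rewrite !expr2; apply: ler_pM => //; rewrite ler_piMr ?(ltW K0).
  by have [Y hY] := ultra_mx UU bd; exists Y.
have [Phi0 Phi0P] := choice exF; pose Phi t j := Phi0 (t, j).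
have Cv t f : 0 <= t <= 1 -> 0 < f -> \forall n \near U, fn2 (H n t - Phi t) <= f ^+ 2.
  move=> t01 f0.
  have : \sum_j nm (H n t j - Phi t j) * nm (H n t j - Phi t j) @[n --> U] --> \sum_(j < J) (0 * 0 : R).
    by apply: cvg_sum_fin => j; apply: cvgM; exact: (Phi0P (t, j) t01).
  rewrite big1 => [|j _]; last by rewrite mulr0.
  have f2 : 0 < f ^+ 2 by rewrite exprn_gt0.
  move/cvgrPdist_le => /(_ _ f2); apply: filterS => n.
  rewrite sub0r normrN; apply: le_trans; apply: le_trans (ler_norm _).
  by apply: ler_sum => j _; rewrite -expr2 nm_sqr.
have Cen f : 0 < f -> \forall n \near U, en n <= f.
  move=> f0; apply: UT; near=> n; rewrite /en -[leRHS]invrK lef_pV2 ?posrE ?invr_gt0 ?ltr0n //.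
  apply: (@le_trans _ _ n%:R); last by rewrite ler_nat -addn2 leq_addr.
  by near: n; exact: nbhs_infty_ger.
have [k k0 hk] := src_fn2.
have hks B f : 0 < f -> fn2 B <= (f / k) ^+ 2 -> nm (src B) <= f.
  move=> f0 hB; apply: le_trans (hk B) _; rewrite mulrC -ler_pdivlMr //.
  have fk : 0 <= f / k by rewrite divr_ge0 ?ltW.
  by rewrite -[leRHS]ger0_norm // -sqrtr_sqr ler_wsqrtr.
pose ga t := x + src (Phi t).
have Cg t f : 0 <= t <= 1 -> 0 < f -> \forall n \near U, nm (g n t - ga t) <= f.
  move=> t01 f0; have f4 : 0 < f / 4 by rewrite divr_gt0.
  have f2 : 0 < f / 2 by rewrite divr_gt0.
  have f2k : 0 < f / 2 / k by rewrite divr_gt0.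
  apply: filterS2 (Cen _ f4) (Cv t _ t01 f2k) => n h1 h2.
  have -> : g n t - ga t = (push (en n) x - x) + src (H n t - Phi t).
    by rewrite srcB /g /ga opprD addrACA.
  apply: le_trans (nmD _ _) _; rewrite [f]splitr; apply: lerD; last exact: hks.
  have e0 : 0 <= en n by have /andP[/ltW] := en01 n.
  by apply: le_trans (push_nm d0 sx e0) _; lra.
(* The bound passes to the limit as soon as z dominates the approximating curves on [a, b] for
   U-almost all n. *)
have HQlim a b z : 0 <= a -> a <= b -> b <= 1 -> pd z ->
    (\forall n \near U, forall r, a <= r <= b -> psd (z - g n r)) ->
    Q z (Phi b - Phi a) <= (w * (b - a)) ^+ 2.
  move=> a0 ab b1 pz hz; have ba : 0 <= b - a by rewrite subr_ge0.
  have b01 : 0 <= b <= 1 by rewrite (le_trans a0 ab).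
  have a01 : 0 <= a <= 1 by rewrite a0 (le_trans ab).
  apply: (@Q_closed R d p sigma J omega p12 psigma z _ (w * (b - a)) pz); first by rewrite mulr_ge0.
  move=> f f0; have f2 : 0 < f / 2 by rewrite divr_gt0.
  have [n [[[h1 h2] h3] h4]] : exists n, (([/\ True & forall r, a <= r <= b -> psd (z - g n r)]
    /\ en n <= f)
      /\ fn2 (H n a - Phi a) <= (f / 2) ^+ 2) /\ fn2 (H n b - Phi b) <= (f / 2) ^+ 2.
    apply: (@filter_ex _ U _); apply: filterI; last exact: Cv.
    apply: filterI; last exact: Cv.
    by apply: filterI; [apply: filterS hz => n h; split|exact: Cen].
  exists (H n b - H n a).
    apply: le_trans (HQ n a b z a0 ab b1 pz _) _; first by case: h1.
    have p1 : 0 <= l n * (b - a) by rewrite mulr_ge0.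
    have p2 : 0 <= w * (b - a) + f by rewrite addr_ge0 ?mulr_ge0 ?(ltW f0).
    rewrite ler_pXn2r ?nnegrE //.
    apply: (@le_trans _ _ ((w + en n) * (b - a))); first by rewrite ler_wpM2r.
    rewrite mulrDl lerD2l; apply: le_trans h2.
    by rewrite ler_piMr //; [have /andP[/ltW] := en01 n|rewrite lerBlDr (le_trans b1) // lerDl].
  rewrite sub_sub_sub; apply: le_trans (fn2_sub _ _) _; rewrite exprMn in h4;
    rewrite exprMn in h3; move: h3 h4; lra.
have sga t : 0 <= t <= 1 -> states (ga t).
  move=> t01; apply: states_closed d0 _ => f f0.
  by have [n hn] := @filter_ex _ U _ _ (Cg t f t01 f0); exists (g n t) => //; exact: gs.
have I0 : 0 <= (0 : R) <= (1 : R) by rewrite lexx ler01.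
have I1 : 0 <= (1 : R) <= (1 : R) by rewrite lexx ler01.
have LPhi : lipschitz_field K Phi.
  move=> a b a0 ab b1; have b01 : 0 <= b <= 1 by rewrite (le_trans a0 ab).
  have a01 : 0 <= a <= 1 by rewrite a0 (le_trans ab).
  move=> j; rewrite -subr_le0; apply: (@small_eq0 _ 2) => f f0.
  have [n [h3 h4]] : exists n, fn2 (H n a - Phi a) <= f ^+ 2 /\ fn2 (H n b - Phi b) <= f ^+ 2.
    by apply: (@filter_ex _ U _); apply: filterI; exact: Cv.
  have nf D : fn2 D <= f ^+ 2 -> nm (D j) <= f.
    move=> hD; have := le_trans (nm_fn2 D j) hD.
    by rewrite ler_pXn2r ?nnegrE ?nm_ge0 // ltW.
  have hL : nm (H n b j - H n a j) <= K * (b - a).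
    have := le_trans (nm_fn2 _ j) (HL n a b a0 ab b1).
    by rewrite ler_pXn2r ?nnegrE ?nm_ge0 // mulr_ge0 ?(ltW K0) // subr_ge0.
  have E : Phi b j - Phi a j = (H n b j - H n a j) + ((H n a - Phi a) j - (H n b - Phi b) j).
    transitivity ((H n b j - H n a j) + ((H n a j - Phi a j) - (H n b j - Phi b j))) => //.
    by rewrite -sub_sub_sub [RHS]addrC subrK.
  rewrite E lerBlDr; apply: le_trans (nmD _ _) _; rewrite [2 * f + _]addrC; apply: lerD => //.
  apply: le_trans (nmD _ _) _; rewrite nmN; apply: le_trans (lerD (nf _ h3) (nf _ h4)) _; lra.
exists Phi, K; split.
- by [].
- apply/funext => j; apply: nm_eq0; apply/eqP; rewrite -normr_le0 ger0_norm ?nm_ge0 //.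
  apply: (@small_eq0 _ 1) => f f0; rewrite mul1r.
  have [n] := @filter_ex _ U _ _ (Cv 0 f I0 f0).
  rewrite H0 sub0r => /(le_trans (nm_fn2 _ j)).
  by rewrite -[(- Phi 0) j]/(- Phi 0 j) nmN ler_pXn2r ?nnegrE ?nm_ge0 // ltW.
- apply/eqP; rewrite -subr_eq0; apply/eqP; apply: nm_eq0; apply/eqP;
  rewrite -normr_le0 ger0_norm ?nm_ge0 //.
  apply: (@small_eq0 _ 3) => f f0.
  have [n [h1 h2]] : exists n, nm (g n 1 - ga 1) <= f /\ en n <= f.
    by apply: (@filter_ex _ U _); apply: filterI; [exact: Cg|exact: Cen].
  have g1 : g n 1 = push (en n) y by have [_ _ [_ h _ _]] := lFP n; rewrite /g /H mulr1.
  have e0 : 0 <= en n by have /andP[/ltW] := en01 n.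
  apply: le_trans (nm_tri (g n 1) _ _) _; rewrite nm_subC.
  have := push_nm d0 sy e0; rewrite -g1; lra.
- exact: sga.
move=> a e a01 e0; have /andP[a0 a1] := a01.
have e2 : 0 < e / 2 by rewrite divr_gt0.
have kK : 0 < k * K by rewrite mulr_gt0.
(* k turns field increments into curve increments and K is the Lipschitz constant, so the
   approximating curves move by at most e / 2 on [a, b]; the other half of e absorbs their distance
   to the limit at a. *)
exists (e / 2 / (k * K)); first by rewrite divr_gt0.
move=> b ab b1 hab; apply: HQlim => //; first exact: pd_reg (sga a a01) e0.
apply: filterS (Cg a _ a01 e2) => n hn r /andP[ar rb].
have r1 := le_trans rb b1.
have r01 : 0 <= r <= 1 by rewrite (le_trans a0 ar).
rewrite -/(ga a) addrAC; set X := ga a - g n r.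
have hX : nm X <= e.
  apply: le_trans (nm_tri (g n a) _ _) _; rewrite [e]splitr; apply: lerD; first by rewrite nm_subC.
  rewrite nm_subC; have -> : g n r - g n a = src (H n r - H n a).
    by rewrite srcB /g opprD addrACA subrr add0r.
  apply: hks => //; apply: le_trans (HL n a r a0 ar r1) _.
  have ra : 0 <= r - a by rewrite subr_ge0.
  have h : K * (r - a) <= e / 2 / k.
    have : r - a <= e / 2 / (k * K) by apply: le_trans hab; rewrite lerD2r.
    rewrite ler_pdivlMr // => hh; rewrite ler_pdivlMr //; apply: le_trans hh.
    by rewrite (_ : K * (r - a) * k = (r - a) * (k * K)) //; ring.
  have h0 : 0 <= K * (r - a) by rewrite mulr_ge0 ?(ltW K0).
  by rewrite !expr2; apply: ler_pM.
have saX : X^t* = X by rewrite /X dagB !states_adj //; [exact: gs|exact: sga].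
have -> : X + e%:C%:M = (X + (nm X)%:C%:M) + (e%:C%:M - (nm X)%:C%:M).
  by rewrite -[RHS]addrA [(nm X)%:C%:M + _]addrC subrK.
by apply: psdD; [exact: psd_add_nm|exact: psd_scalar_mono].
Unshelve. all: by end_near. Qed.

End LimitField.

(** * Lipschitz functions on the unit interval *)

Section LipschitzPrimitive.
Variable R : realType.
Local Notation mu := (@lebesgue_measure R).
Local Notation I01 := (`[0%R, 1%R]%classic : set (measurableTypeR R)).
Implicit Types (psi v : R -> R) (s t r K : R).

(** Composition with this 1-Lipschitz retraction extends a Lipschitz function from [0, 1] to the
    line, where [lipschitz_density] applies. *)
Definition clamp t : R := Num.max 0 (Num.min t 1).

Lemma clamp01 t : 0 <= clamp t <= 1.
Proof. by rewrite /clamp le_max lexx /= ge_max ler01 ge_min lexx orbT. Qed.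

Lemma clamp_id t : 0 <= t <= 1 -> clamp t = t.
Proof. by move=> /andP[t0 t1]; rewrite /clamp min_l // max_r. Qed.

Lemma clamp_lip s t : `|clamp s - clamp t| <= `|s - t|.
Proof.
have h1 := ler_norm (s - t); have h2 := ler_norm (t - s); rewrite distrC in h2.
move: (`|s - t|) h1 h2 => n h1 h2; rewrite ler_norml /clamp.
case: (leP s 1) => s1; case: (leP t 1) => t1; rewrite ?[Num.max 0 1]max_r ?ler01 //.
- by case: (leP 0 s) => s0; case: (leP 0 t) => t0; apply/andP; split; lra.
- by case: (leP 0 s) => s0; apply/andP; split; lra.
- by case: (leP 0 t) => t0; apply/andP; split; lra.
- by apply/andP; split; lra.
Qed.

Definition lipschitz01 K psi := forall s t, 0 <= s <= 1 -> 0 <= t <= 1 -> `|psi s - psi t| <= K *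
  `|s - t|.

Lemma lipschitz01_density K psi : 0 < K -> lipschitz01 K psi ->
  exists beta : R -> R, [/\ mu.-integrable I01 (EFin \o beta),
    forall s t, 0 <= s -> s <= t -> t <= 1 -> \int[mu]_(x in `]s, t]) beta x = psi t - psi s &
    {ae mu, forall x : R, 0 < x < 1 -> is_derive x 1 psi (beta x)}].
Proof.
move=> K0 lip; have lipc x y : `|(psi \o clamp) x - (psi \o clamp) y| <= K * `|x - y|.
  apply: le_trans (lip _ _ (clamp01 x) (clamp01 y)) _.
  by rewrite ler_pM2l // clamp_lip.
have [beta [ib hb db]] := lipschitz_density K0 lipc; exists beta; split => //.
  move=> s t s0 st t1; rewrite hb // /= !clamp_id //; first by rewrite s0 (le_trans st).
  by rewrite (le_trans s0).
apply: filterS db; first exact: (ae_filter_ringOfSetsType mu).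
move=> x h x01; apply: near_eq_is_derive (h x01).
have xi : x \in `]0, 1[ by rewrite in_itv.
have := near_in_itvoo xi; apply: filterS => y; rewrite in_itv /= => /andP[y0 y1].
by rewrite clamp_id // !ltW.
Qed.

(** Both v and the density of psi are its derivative almost everywhere in ]0, 1[, so their integrals
    agree. *)
Lemma lipschitz_primitive K psi v : 0 < K -> lipschitz01 K psi -> mu.-integrable I01 (EFin \o v) ->
  {ae mu, forall x : R, 0 < x < 1 -> is_derive x 1 psi (v x)} ->
  forall s t, 0 <= s -> s <= t -> t <= 1 -> \int[mu]_(x in `]s, t]) v x = psi t - psi s.
Proof.
move=> K0 lip iv dv s t s0 st t1; have [beta [ib hb db]] := lipschitz01_density K0 lip.
rewrite -hb //.
have sub : `]s, t[ `<=` I01.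
  by move=> x; rewrite /= !in_itv /= => /andP[sx xt]; rewrite !ltW ?(le_lt_trans s0) ?(lt_le_trans xt).
have sub2 : `]s, t] `<=` I01.
  by move=> x; rewrite /= !in_itv /= => /andP[sx xt]; rewrite (ltW (le_lt_trans s0 sx)) (le_trans xt).
have mst : measurable (`]s, t[%classic : set (measurableTypeR R)) by exact: measurable_itv.
have ioo (g : R -> R) : mu.-integrable I01 (EFin \o g) -> mu.-integrable `]s, t[ (EFin \o g).
  by move=> ig; apply: integrableS ig; [exact: mI01|exact: mst|exact: sub].
rewrite -!Rintegral_itv_bndo_bndc; [|exact: ioo..].
rewrite /Rintegral; congr fine; apply: ae_eq_integral => //.
- exact: measurable_int (ioo _ iv).
- exact: measurable_int (ioo _ ib).
apply: (@filterS2 _ _ (ae_filter_ringOfSetsType mu) _ _ _ _ dv db) => x h1 h2.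
rewrite /= in_itv /= => /andP[sx xt]; congr EFin.
have x01 : 0 < x < 1 by rewrite (le_lt_trans s0 sx) (lt_le_trans xt t1).
have := h1 x01 => d1; have := h2 x01 => d2.
by rewrite -(@derive_val _ _ _ _ _ _ _ d1) (@derive_val _ _ _ _ _ _ _ d2).
Qed.

End LipschitzPrimitive.

(** * Almost everywhere derivative of a Lipschitz field *)

Section FieldDensity.
Variables (R : realType) (d J : nat).
Local Notation C := R[i].
Local Notation M := 'M[C]_d.
Local Notation mu := (@lebesgue_measure R).
Local Notation field := ('I_J -> M).
Local Notation I01 := (`[0%R, 1%R]%classic : set (measurableTypeR R)).
Implicit Types (A X Y : M) (F B : R -> field) (s t r K : R).

Lemma lipschitz_field_ip K F A j : 0 < K -> lipschitz_field K F ->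
  lipschitz01 ((nm A + 1) * K) (fun t => ip A (F t j)).
Proof.
move=> K0 lip s t; wlog st : s t / s <= t.
  move=> h s01 t01; case/orP: (le_total s t) => st; first exact: h.
  by rewrite distrC [`|s - t|]distrC; exact: h.
move=> /andP[s0 _] /andP[_ t1]; rewrite distrC -ipBr.
apply: le_trans (ip_norm_le _ _) _; rewrite -mulrA distrC ger0_norm ?subr_ge0 //.
apply: ler_pM; rewrite ?nm_ge0 ?lerDl //; exact: lip.
Qed.

Lemma is_derive_ip (G : R -> M) X r :
  (forall i k, is_derive r 1 (fun t => ip (delta_mx i k) (G t)) (ip (delta_mx i k) X) /\
    is_derive r 1 (fun t => ip ('i *: delta_mx i k) (G t)) (ip ('i *: delta_mx i k) X)) ->
  forall A, is_derive r 1 (fun t => ip A (G t)) (ip A X).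
Proof.
move=> h A; pose f (i k : 'I_d) : R -> R :=
  complex.Re (A i k) *: (fun t => ip (delta_mx i k) (G t)) +
  complex.Im (A i k) *: (fun t => ip ('i *: delta_mx i k) (G t)).
have df i k : is_derive r 1 (f i k) (complex.Re (A i k) * ip (delta_mx i k) X +
    complex.Im (A i k) * ip ('i *: delta_mx i k) X).
  by have [h1 h2] := h i k; apply: is_deriveD; apply: is_deriveZ.
have ipEE Y : ip A Y = \sum_i \sum_k (complex.Re (A i k) * ip (delta_mx i k) Y +
    complex.Im (A i k) * ip ('i *: delta_mx i k) Y).
  rewrite ipE; apply: eq_bigr => i _; apply: eq_bigr => k _; congr (_ * _ + _ * _).
    exact: (congr1 (fun g => g 0) (re_entry_ip (fun=> Y) i k)).
  exact: (congr1 (fun g => g 0) (im_entry_ip (fun=> Y) i k)).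
apply: (is_derive_ext (is_derive_sum (fun i => is_derive_sum (df i)))) => [t|].
  by rewrite ipEE fct_sumE; apply: eq_bigr => i _; rewrite fct_sumE.
by rewrite ipEE.
Qed.

(* B vanishes on a Borel null set containing the points of non-differentiability: this keeps it
   Borel measurable and lets bounds on the derivative hold at every point. *)
Lemma field_density K F : 0 < K -> lipschitz_field K F -> exists B : R -> field,
  let good s := 0 < s < 1 /\ forall A j, is_derive s 1 (fun t => ip A (F t j)) (ip A (B s j)) in
  [/\ forall j, integrable_mx (fun s => B s j),
      forall s, B s = 0 \/ good s & {ae mu, forall s, 0 < s < 1 -> good s}].
Proof.
move=> K0 lip.
have ex (jA : 'I_J * M) : exists beta : R -> R, mu.-integrable I01 (EFin \o beta) /\
    {ae mu, forall x : R, 0 < x < 1 -> is_derive x 1 (fun t => ip jA.2 (F t jA.1)) (beta x)}.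
  have K1 : 0 < (nm jA.2 + 1) * K by rewrite mulr_gt0 // ltr_wpDl ?nm_ge0.
  by have [beta [h1 _ h3]] := lipschitz01_density K1 (lipschitz_field_ip jA.2 jA.1 K0 lip); exists beta.
have [beta betaP] := choice ex.
pose B0 s j : M := \matrix_(i, k) (beta (j, delta_mx i k) s +i* beta (j, 'i *: delta_mx i k) s).
pose good0 s := forall j i k,
  is_derive s 1 (fun t => ip (delta_mx i k) (F t j)) (beta (j, delta_mx i k) s) /\
  is_derive s 1 (fun t => ip ('i *: delta_mx i k) (F t j)) (beta (j, 'i *: delta_mx i k) s).
have FF := ae_filter_ringOfSetsType mu.
have /= [N [mN N0 NP]] : {ae mu, forall s : R, 0 < s < 1 -> good0 s}.
  have h : {ae mu, forall s : R, forall jik : 'I_J * ('I_d * 'I_d), 0 < s < 1 ->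
    is_derive s 1 (fun t => ip (delta_mx jik.2.1 jik.2.2) (F t jik.1)) (beta (jik.1, delta_mx
      jik.2.1 jik.2.2) s) /\
    is_derive s 1 (fun t => ip ('i *: delta_mx jik.2.1 jik.2.2) (F t jik.1)) (beta (jik.1, 'i *:
      delta_mx jik.2.1 jik.2.2) s)}.
    apply: filter_forall => -[j [i k]] /=.
    have [_ h1] := betaP (j, delta_mx i k); have [_ h2] := betaP (j, 'i *: delta_mx i k).
    by apply: filterS2 h1 h2 => s g1 g2 s01; split; [exact: g1|exact: g2].
  by apply: filterS h => s hs s01 j i k; exact: (hs (j, (i, k)) s01).
have mO : measurable (`]0, 1[%classic `\` N : set (measurableTypeR R)).
  by apply: measurableD => //; exact: measurable_itv.
pose ind : R -> R := \1_(`]0, 1[%classic `\` N : set (measurableTypeR R)).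
exists (fun s j => (ind s)%:C *: B0 s j).
pose good s := 0 < s < 1 /\ forall A j, is_derive s 1 (fun t => ip A (F t j)) (ip A ((ind s)%:C
  *: B0 s j)).
have gP s : (`]0, 1[%classic `\` N) s -> good s.
  move=> [s01 nN]; rewrite /= in_itv /= in s01; split => // A j.
  have g0 : good0 s by apply: contrapT => h; apply: nN; apply: NP => /=; move=> /(_ s01).
  rewrite /ind indicE mem_set ?scale1r; last by split; rewrite //= in_itv.
  apply: is_derive_ip => i k; have [d1 d2] := g0 j i k.
  have := re_entry_ip (fun=> B0 s j) i k; have := im_entry_ip (fun=> B0 s j) i k.
  by move=> /(congr1 (fun f => f 0)) <- /(congr1 (fun f => f 0)) <-; rewrite /re_entry /im_entry mxE.
split.
- move=> j i k.
  have mi : measurable_fun I01 ind by exact: measurable_indic.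
  have bi x : I01 x -> `|ind x| <= 1.
    by move=> _; rewrite /ind indicE; case: (_ \in _); rewrite ?normr1 ?normr0 ?ler01.
  have [i1 _] := betaP (j, delta_mx i k); have [i2 _] := betaP (j, 'i *: delta_mx i k).
  split.
    have := measurable_bounded_mul i1 mi bi; apply: eq_integrable; first exact: mI01.
    by move=> s _ /=; rewrite /re_entry !mxE /= mul0r subr0.
  have := measurable_bounded_mul i2 mi bi; apply: eq_integrable; first exact: mI01.
  by move=> s _ /=; rewrite /im_entry !mxE /= mul0r addr0.
- move=> s; have [h|h] := pselect ((`]0, 1[%classic `\` N) s); [right; exact: gP|left].
  by apply/funext => j; rewrite /ind indicE memNset // scale0r.
exists N; split => // s /= hs; apply: contrapT => nN; apply: hs => s01.
by apply: gP; split => //=; rewrite in_itv.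
Qed.

End FieldDensity.

(** * Existence of a minimizer of constant speed *)

Section Minimizer.
Variables (R : realType) (d : nat).
Local Notation C := R[i].
Local Notation M := 'M[C]_d.
Local Notation mu := (@lebesgue_measure R).
Local Notation I01 := (`[0%R, 1%R]%classic : set (measurableTypeR R)).
Variables (p : R) (sigma : M) (J : nat) (V : 'I_J -> M) (omega : 'I_J -> R).
Local Notation field := ('I_J -> M).
Implicit Types (A X Y x y z : M) (r s t l e f : R).
Hypotheses (p12 : 1 < p <= 2) (psigma : pd sigma) (d0 : (0 < d)%N).
Hypothesis pairing : exists2 jp : 'I_J -> 'I_J, injective jp &
  forall j, (V j) ^t* = V (jp j) /\ omega (jp j) = - omega j.
Hypothesis ergodic : forall A, (forall j, partialj V j A = 0) -> exists c : C, A = c%:M.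

Local Notation Q := (Q p sigma omega).
Local Notation src := (src V).
Local Notation W := (W p sigma V omega).
Local Notation wn := (weighted_norm2 p sigma omega).

(** The difference quotients are one-sided because the bound of [limit_field] only looks forward in
    time. *)
Lemma derivative_limit (F : R -> field) (B : field) s f : 0 < f ->
  (forall A j, is_derive s 1 (fun t => ip A (F t j)) (ip A (B j))) ->
  \forall h \near 0^'+, fn2 (B - h^-1%:C *: (F (s + h) - F s)) <= f ^+ 2.
Proof.
move=> f0 dF.
have cj j : nm (h^-1%:C *: (F (s + h) j - F s j) - B j) @[h --> 0^'+] --> (0 : R).
  apply/nm_cvgP; apply: cvg_ip => A; have [ex <-] := dF A j.
  have -> : (fun h => ip A (h^-1%:C *: (F (s + h) j - F s j))) =
      fun h => h^-1 *: (((fun t => ip A (F t j)) \o shift s) (h *: (1:R)) - ip A (F s j)).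
    by apply/funext => h; rewrite ipZr ipBr /GRing.scale /= mulr1 [h + s]addrC.
  exact: cvg_dnbhs_at_right ex.
have : \sum_j (nm (h^-1%:C *: (F (s + h) j - F s j) - B j) * nm (h^-1%:C *: (F (s + h) j - F s j) - B j))
    @[h --> 0^'+] --> \sum_(j < J) (0 * 0 : R).
  by apply: cvg_sum_fin => j; apply: cvgM; exact: cj.
rewrite big1 => [|j _]; last by rewrite mulr0.
have f2 : 0 < f ^+ 2 by rewrite exprn_gt0.
move/cvgrPdist_le => /(_ _ f2); apply: filterS => h.
rewrite sub0r normrN; apply: le_trans; apply: le_trans (ler_norm _).
by apply: ler_sum => j _; rewrite -expr2 nm_subC nm_sqr.
Qed.

Lemma test_lipschitz (phi : R -> R) : smooth phi -> exists2 k, 0 <= k & lipschitz01 k phi.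
Proof.
move=> sp; have [cp cp'] := smooth_cont sp; have [k hk] := cont_bounded01 cp'.
have I0 : I01 (0 : R) by rewrite /= in_itv /= lexx ler01.
exists k => [|s t]; first exact: le_trans (hk _ I0).
wlog st : s t / s <= t.
  move=> h s01 t01; case/orP: (le_total s t) => st; first exact: h.
  by rewrite distrC [`|s - t|]distrC; exact: h.
move=> /andP[s0 _] /andP[_ t1]; rewrite distrC [`|s - t|]distrC.
have dphi (x : R) : x \in `]s, t[ -> is_derive x 1 phi (derive1 phi x).
  by move=> _; rewrite derive1E; apply: DeriveDef => //; exact: (sp 0%N x).
have [c] := MVT_segment st dphi (continuous_subspaceT cp).
rewrite in_itv /= => /andP[sc ct] ->; rewrite normrM ler_wpM2r //.
by apply: hk; rewrite /= in_itv /= (le_trans s0 sc) (le_trans ct t1).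
Qed.

Lemma tight_triangle (w u1 u2 u3 u4 s t : R) : w <= u1 + u2 -> u2 <= u3 + u4 ->
  u1 <= (s - 0) * w -> u4 <= (1 - t) * w -> (t - s) * w <= u3.
Proof. lra. Qed.

Lemma minimizer_exists x y : states x -> states y -> exists gamma B,
  [/\ admissible V x y gamma B,
      forall t, 0 <= t <= 1 -> (wn (gamma t) (B t) <= (W x y ^+ 2)%:E)%E &
      forall s t, 0 <= s <= 1 -> 0 <= t <= 1 -> W (gamma s) (gamma t) = `|s - t| * W x y].
Proof.
move=> sx sy; set w := W x y.
have w0 : 0 <= w by apply: (W_ge0 p12 psigma d0 pairing ergodic).
have [F [K [[K0 lip] F0 F1 sg hQ]]] := limit_field p12 psigma d0 pairing ergodic sx sy.
have [B [iB Bgood Bae]] := field_density K0 lip.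
pose ga t := x + src (F t).
have ga0 : ga 0 = x by rewrite /ga F0 src0 addr0.
have [k k0 hk] := src_fn2 V omega p12 psigma.
have [L L0 hL] : exists2 L, 0 < L & forall s t, 0 <= s <= 1 -> 0 <= t <= 1 -> nm (ga s - ga t) <=
  L * `|s - t|.
  (* Each of the J components is K-Lipschitz, so the square root of [fn2] of an increment is at most
     sqrt(J) K times its duration; 1 keeps L positive. *)
  exists (k * (Num.sqrt J%:R * K) + 1).
    by rewrite ltr_wpDl // mulr_ge0 ?(ltW k0) // mulr_ge0 ?sqrtr_ge0 ?(ltW K0).
  move=> s t; wlog st : s t / s <= t.
    move=> h s01 t01; case/orP: (le_total s t) => st; first exact: h.
    by rewrite nm_subC [`|s - t|]distrC; exact: h.
  move=> /andP[s0 _] /andP[_ t1]; rewrite nm_subC distrC ger0_norm ?subr_ge0 //.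
  have ts : 0 <= t - s by rewrite subr_ge0.
  have -> : ga t - ga s = src (F t - F s) by rewrite srcB /ga opprD addrACA subrr add0r.
  apply: le_trans (hk _) _; rewrite mulrDl mul1r -[leLHS]addr0; apply: lerD => //.
  rewrite -!mulrA ler_pM2l //.
  have Kts : 0 <= K * (t - s) by rewrite mulr_ge0 // ltW.
  rewrite -[K * (t - s)]ger0_norm // -sqrtr_sqr -sqrtrM ?ler0n // ler_wsqrtr //.
  rewrite /fn2 mulr_natl -[J in _ *+ J]card_ord -sumr_const; apply: ler_sum => j _.
  by rewrite -nm_sqr ler_pXn2r ?nnegrE ?nm_ge0 //; exact: lip.
have cg : {within `[0, 1], continuous ga}.
  apply: nm_within => s e s01 e0; exists (e / L); first by rewrite divr_gt0.
  move=> t t01 st; apply: le_trans (hL s t s01 t01) _.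
  by rewrite mulrC -ler_pdivlMr.
have dga A : {ae mu, forall r, 0 < r < 1 -> is_derive r 1 (fun t => ip A (ga t)) (ip A (src (B r)))}.
  apply: filterS Bae; first exact: (ae_filter_ringOfSetsType mu).
  move=> r h r01; have [_ dr] := h r01.
  apply: (is_derive_ext (is_deriveD (is_derive_cst (ip A x) r (1:R))
    (is_derive_sum (fun j => dr (partialj V j A) j)))) => [t|].
    transitivity (ip A x + (\sum_j (fun u => ip (partialj V j A) (F u j))) t) => //.
    by rewrite fct_sumE /ga ipDr src_ip.
  by rewrite add0r src_ip.
have ipb A r : 0 <= r <= 1 -> `|ip A (ga r)| <= nm A.
  move=> r01; apply: le_trans (ip_norm_le _ _) _.
  by rewrite ler_piMr ?nm_ge0 // states_nm //; exact: sg.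
have ipl A : lipschitz01 (nm A * L) (fun t => ip A (ga t)).
  move=> s t s01 t01; rewrite -ipBr; apply: le_trans (ip_norm_le _ _) _.
  by rewrite -mulrA ler_wpM2l ?nm_ge0 //; exact: hL.
have adm : admissible V x y ga B.
  split; [by split|exact: iB| |exact: ga0|exact: F1].
  apply/(continuity_equationP V cg iB) => phi tp A.
  have [sp [a [b [a0 b1 hphi]]]] := tp.
  have [cp cp'] := smooth_cont sp; have [k2 k20 hk2] := test_lipschitz sp.
  have [c1 hc1] := cont_bounded01 cp.
  have phi0 : phi 0 = 0 by apply: hphi => /andP[]; rewrite leNgt a0.
  have phi1 : phi 1 = 0 by apply: hphi => /andP[_]; rewrite leNgt b1.
  (* Lipschitz and 0 at both ends, so its almost everywhere derivative v integrates to 0: this is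
     the continuity equation tested on phi and A. *)
  pose psi r := phi r * ip A (ga r).
  pose v r := phi r * ip A (src (B r)) + derive1 phi r * ip A (ga r).
  have i1 := integrable_mul01 cp (src_integrable V A iB).
  have i2 := integrable_mul01 cp' (continuous_integrable01 (@ip_cont _ _ ga A cg)).
  have iv : mu.-integrable I01 (EFin \o v).
    by have := integrableD (@mI01 R) i1 i2; exact: eq_integrable.
  pose K2 := `|c1| * (nm A * L) + k2 * nm A + 1.
  have K20 : 0 < K2.
    rewrite ltr_wpDl // addr_ge0 ?mulr_ge0 ?nm_ge0 ?(ltW L0) //.
  have lpsi : lipschitz01 K2 psi.
    move=> s t s01 t01.
    have -> : psi s - psi t = phi s * (ip A (ga s) - ip A (ga t)) + (phi s - phi t) * ip A (ga t).
      by rewrite mulrBr mulrBl addrA subrK.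
    apply: le_trans (ler_normD _ _) _; rewrite !normrM.
    have h1 : `|phi s| * `|ip A (ga s) - ip A (ga t)| <= `|c1| * (nm A * L * `|s - t|).
      apply: ler_pM => //; last exact: ipl.
      by apply: le_trans (hc1 s _) (ler_norm _); rewrite /= in_itv.
    have h2 : `|phi s - phi t| * `|ip A (ga t)| <= (k2 * `|s - t|) * nm A.
      by apply: ler_pM => //; [exact: hk2|exact: ipb].
    apply: le_trans (lerD h1 h2) _; rewrite /K2.
    by have := normr_ge0 (s - t); move: (`|s - t|) => n n0; nra.
  have dpsi : {ae mu, forall r : R, 0 < r < 1 -> is_derive r 1 psi (v r)}.
    apply: filterS (dga A); first exact: (ae_filter_ringOfSetsType mu).
    move=> r h r01; have dr := h r01.
    have dp : is_derive r 1 phi (derive1 phi r).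
      by rewrite derive1E; apply: DeriveDef => //; exact: (sp 0%N r).
    apply: (is_derive_ext (is_deriveM dp dr)) => [t //|].
    by rewrite /v /GRing.scale /=; congr (_ + _); exact: mulrC.
  have psi1 : psi 1 = 0 := etrans (congr1 (fun u => u * _) phi1) (mul0r _).
  have psi0 : psi 0 = 0 := etrans (congr1 (fun u => u * _) phi0) (mul0r _).
  have := etrans (lipschitz_primitive K20 lpsi iv dpsi (lexx 0) ler01 (lexx 1))
    (etrans (congr2 (fun u u' => u - u') psi1 psi0) (subrr 0)).
  rewrite Rintegral_itv_obnd_cbnd; last first.
    apply: integrableS iv; [exact: mI01|exact: measurable_itv|exact: subset_itv_oc_cc].
  rewrite (@RintegralD _ _ _ mu I01 _ _ (@mI01 R) i1 i2).
  by move/eqP; rewrite addrC addr_eq0 => /eqP.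
(* At a point of differentiability the difference quotients have Q at most w^2 in the regularised
   state and converge to B t, so [Q_closed] applies; elsewhere B t = 0. *)
have QB t e : 0 <= t <= 1 -> 0 < e -> Q (ga t + e%:C%:M) (B t) <= w ^+ 2.
  move=> t01 e0; have pz := pd_reg (sg t t01) e0.
  have [->|[/andP[t0 t1] dF]] := Bgood t; first by rewrite Q0 sqr_ge0.
  apply: (@Q_closed R d p sigma J omega p12 psigma (ga t + e%:C%:M) _ w pz w0) => f f0.
  have [de de0 hde] := hQ t e t01 e0.
  have t1' : 0 < 1 - t by rewrite subr_gt0.
  have [h [[h1 h2] [h3 h4]]] : exists h : R, (fn2 (B t - h^-1%:C *: (F (t + h) - F t)) <= f ^+ 2
    /\ 0 < h) /\
      (h <= de /\ h <= 1 - t).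
    apply: (@filter_ex _ (0^'+) _); apply: filterI.
      by apply: filterI; [exact: (@derivative_limit F (B t) t f f0 dF)|exact: nbhs_right_gt].
    by apply: filterI; apply: nbhs_right_le.
  exists (h^-1%:C *: (F (t + h) - F t)) => //.
  rewrite QZ; have th : t <= t + h by rewrite lerDl ltW.
  have := hde (t + h) th; rewrite addrAC subrr add0r => /(_ _ h3) hh.
  apply: (@le_trans _ _ (h^-1 ^+ 2 * (w * h) ^+ 2)).
    by rewrite ler_wpM2l ?sqr_ge0 //; apply: hh; rewrite -lerBrDl.
  rewrite -exprMn mulrCA mulVf ?gt_eqF // mulr1.
  by rewrite ler_pXn2r ?nnegrE ?addr_ge0 ?(ltW f0) // lerDl ltW.
exists ga, B; split => //.
  by move=> t t01; apply: (weighted_norm2_le p12 psigma (sg t t01)) => e e0; exact: QB.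
(* The bound by the action, on [s, t] and with the constant density w^2. *)
have Wle s t : 0 <= s -> s < t -> t <= 1 -> W (ga s) (ga t) <= (t - s) * w.
  move=> s0 st t1.
  have sub r : s <= r <= t -> 0 <= r <= 1 by move=> /andP[sr rt]; rewrite (le_trans s0 sr) (le_trans rt).
  have ss : states (ga s) by apply: sg; apply: sub; rewrite lexx ltW.
  have stt : states (ga t) by apply: sg; apply: sub; rewrite lexx ltW.
  have key : ((W (ga s) (ga t) ^+ 2)%:E <= (t - s)%:E * \int[mu]_(r in `]s, t]) (w ^+ 2)%:E)%E.
    apply: (@W_action_bound R d p sigma J V omega p12 psigma d0 pairing ergodic ga
      (fun r => src (B r)) (fun=> (w ^+ 2)%:E) s t st).
    - by move=> r /sub; exact: sg.
    - move=> e e0; have [r r0 hr] := heine cg e0; exists r => // a b /sub ha /sub hb; exact: hr.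
    - move=> A a b sa ab bt; apply: (admissible_weak_primitive adm A) => //.
        exact: le_trans sa.
      exact: le_trans bt t1.
    - by move=> r _; rewrite lee_fin sqr_ge0.
    - by move=> r e /sub r01 e0; exists (B r) => //; rewrite lee_fin; exact: QB.
  have Ic : (\int[mu]_(r in `]s, t]) (w ^+ 2)%:E = (w ^+ 2 * (t - s))%:E)%E.
    rewrite integral_cst; last exact: measurable_itv.
    by rewrite [X in (_ * X)%E]lebesgue_measure_itv /= lte_fin st.
  rewrite Ic in key.
  have {}key : W (ga s) (ga t) ^+ 2 <= (t - s) * (w ^+ 2 * (t - s)) by rewrite -lee_fin; exact: key.
  have p1 : 0 <= W (ga s) (ga t) by apply: (W_ge0 p12 psigma d0 pairing ergodic).
  have p2 : 0 <= (t - s) * w by rewrite mulr_ge0 // subr_ge0 ltW.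
  rewrite -(ler_pXn2r (n := 2)) ?nnegrE // (le_trans key) //.
  by rewrite exprMn le_eqVlt; apply/orP; left; apply/eqP; ring.
(* The upper bounds on [0, s], [s, t] and [t, 1] add up to w, the distance of the end points, so the
   triangle inequality turns them into equalities. *)
have Weq s t : 0 <= s -> s <= t -> t <= 1 -> W (ga s) (ga t) = (t - s) * w.
  move=> s0 st t1.
  have s01 : 0 <= s <= 1 by rewrite s0 (le_trans st).
  have t01 : 0 <= t <= 1 by rewrite (le_trans s0 st).
  have I0 : 0 <= (0 : R) <= (1 : R) by rewrite lexx ler01.
  have I1 : 0 <= (1 : R) <= (1 : R) by rewrite lexx ler01.
  have Wle' a b : 0 <= a -> a <= b -> b <= 1 -> W (ga a) (ga b) <= (b - a) * w.
    move=> a0; rewrite le_eqVlt => /predU1P[<- b1|]; last exact: Wle.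
    have sa : states (ga a) by apply: sg; rewrite a0.
    have /(W_eq0 p12 psigma d0 pairing ergodic sa sa) -> : ga a = ga a by [].
    by rewrite subrr mul0r.
  have h1 := Wle' 0 s (lexx 0) s0 (le_trans st t1).
  have h2 := Wle' s t s0 st t1; have h3 := Wle' t 1 (le_trans s0 st) t1 (lexx 1).
  have T1 := W_triangle p12 psigma d0 pairing ergodic (sg 0 I0) (sg s s01) (sg 1 I1).
  have T2 := W_triangle p12 psigma d0 pairing ergodic (sg s s01) (sg t t01) (sg 1 I1).
  have E : W (ga 0) (ga 1) = w by rewrite ga0 /ga F1.
  have T1' : w <= W (ga 0) (ga s) + W (ga s) (ga 1) :=
    eq_ind _ (fun q : R => q <= _) T1 _ E.
  by apply: le_anti; rewrite h2; exact: (tight_triangle T1' T2 h1 h3).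
move=> s t /andP[s0 s1] /andP[t0 t1]; have [st|ts] := leP s t.
  by rewrite Weq // distrC ger0_norm // subr_ge0.
rewrite (W_sym p12 psigma d0 pairing ergodic) ?Weq ?(ltW ts) ?ger0_norm ?subr_ge0 ?(ltW ts) //.
  by apply: sg; rewrite s0.
by apply: sg; rewrite t0.
Qed.

End Minimizer.

(** * Length of a curve whose distances are proportional to time *)

Section CurveLength.
Variables (R : realType) (T : Type) (dist : T -> T -> R) (gamma : R -> T) (w : R).
Hypothesis dist_gamma : forall s t, 0 <= s <= 1 -> 0 <= t <= 1 ->
  dist (gamma s) (gamma t) = `|s - t| * w.

Lemma partition_length (l : seq R) a b : 0 <= a -> b <= 1 -> itv_partition a b l ->
  \sum_(i < size l) dist (gamma (nth b (a :: l) i)) (gamma (nth b (a :: l) i.+1)) = (b - a) * w.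
Proof.
elim: l a => [|c l IH] a a0 b1.
  by move=> /itv_partition_nil ->; rewrite big_ord0 subrr mul0r.
move=> [/= /andP[ac pl] lb].
have cl : itv_partition c b l by split.
have cb := itv_partition_le cl; have c0 := le_trans a0 (ltW ac).
rewrite big_ord_recl /= (IH c c0 b1 cl) dist_gamma; last 2 first.
- by rewrite a0 (le_trans (ltW ac)) // (le_trans cb).
- by rewrite c0 (le_trans cb).
by rewrite ler0_norm ?subr_le0 ?(ltW ac) // opprB -mulrDl; congr (_ * _); ring.
Qed.

Lemma curve_length_gamma s t : 0 <= s -> s <= t -> t <= 1 ->
  curve_length dist gamma s t = (w * (t - s))%:E.
Proof.
move=> s0 st t1; rewrite /curve_length.
have h l : itv_partition s t l -> (\sum_(i < size l)
      dist (gamma (nth t (s :: l) i)) (gamma (nth t (s :: l) i.+1)))%:E = (w * (t - s))%:E.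
  by move=> hl; rewrite (partition_length s0 t1 hl) mulrC.
have [l hl] : exists l, itv_partition s t l.
  move: st; rewrite le_eqVlt => /predU1P[<-|st]; first by exists [::]; split.
  by exists [:: t]; exact: itv_partition1.
apply/eqP; rewrite eq_le; apply/andP; split.
  by apply: ge_ereal_sup => u [m hm <-]; rewrite h.
by apply: ereal_sup_ubound; exists l; rewrite ?h.
Qed.

End CurveLength.

(** * Identification of the extended distance, completeness and minimizers *)

Section Extension.
Variables (R : realType) (d : nat).
Local Notation C := R[i].
Local Notation M := 'M[C]_d.
Local Notation mu := (@lebesgue_measure R).
Variables (p : R) (sigma : M) (J : nat) (V : 'I_J -> M) (omega : 'I_J -> R).
Implicit Types (A X Y x y z : M) (r s t l e f : R).
Hypotheses (p12 : 1 < p <= 2) (psigma : pd sigma) (d0 : (0 < d)%N).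
Hypothesis pairing : exists2 jp : 'I_J -> 'I_J, injective jp &
  forall j, (V j) ^t* = V (jp j) /\ omega (jp j) = - omega j.
Hypothesis ergodic : forall A, (forall j, partialj V j A = 0) -> exists c : C, A = c%:M.
Local Notation W := (W p sigma V omega).
Local Notation W2 := (W2p p sigma V omega).
Local Notation D2 := (@states R d `*` @states R d).

Lemma W_continuous_extension : continuous_extension p sigma V omega W.
Proof.
split=> [x y fx fy|].
  by rewrite (W_full p12 psigma d0 pairing ergodic) // (riemannian_distE p12 psigma d0 pairing ergodic).
have [k k0 hk] := W_cont p12 psigma d0 pairing ergodic.
apply/subspace_continuousP => -[x y] [/= sx sy].
have FF : Filter (within D2 (nbhs (x, y))) by exact: within_filter.
have c1 : Num.sqrt (nm (z.1 - x)) @[z --> within D2 (nbhs (x, y))] --> (0 : R).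
  rewrite -(@sqrtr0 R); apply: continuous_cvg; first exact: sqrt_continuous.
  have c0 : fst @ nbhs (x, y) --> x by exact: (@cvg_fst _ _ (nbhs x) (nbhs y)).
  have c4 : fst @ within D2 (nbhs (x, y)) --> x by exact: cvg_within_filter.
  by have := cvg_nm FF c4; exact.
have c2 : Num.sqrt (nm (z.2 - y)) @[z --> within D2 (nbhs (x, y))] --> (0 : R).
  rewrite -(@sqrtr0 R); apply: continuous_cvg; first exact: sqrt_continuous.
  have c0 : snd @ nbhs (x, y) --> y by exact: (@cvg_snd _ _ (nbhs x) (nbhs y)).
  have c4 : snd @ within D2 (nbhs (x, y)) --> y by exact: cvg_within_filter.
  by have := cvg_nm FF c4; exact.
have c3 : k * (Num.sqrt (nm (z.1 - x)) + Num.sqrt (nm (z.2 - y))) @[z --> within D2 (nbhs (x,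
  y))] --> (0 : R).
  rewrite -(mulr0 k) -(addr0 (0 : R)); apply: cvgMr; exact: cvgD.
apply/cvgrPdist_le => e e0.
have h1 : \forall z \near within D2 (nbhs (x, y)), D2 z by exact: withinT.
move/cvgrPdist_le : c3 => /(_ _ e0) h2.
apply: filterS2 h1 h2 => -[x' y'] [/= sx' sy']; rewrite sub0r normrN => h2.
apply: le_trans (hk _ _ _ _ sx sy sx' sy') _; apply: le_trans (le_trans (ler_norm _) h2).
by rewrite (nm_subC x) (nm_subC y).
Qed.

Lemma continuous_extension_push (U : M -> M -> R) x y e : continuous_extension p sigma V omega U ->
  states x -> states y -> 0 < e ->
  \forall r \near 0^'+, `|U x y - U (push r x) (push r y)| <= e.
Proof.
move=> [_ /subspace_continuousP cU] sx sy e0.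
have /cvgrPdist_le/(_ _ e0) := cU (x, y) (conj sx sy).
rewrite near_withinE => hU.
have cp z : states z -> push r z @[r --> 0^'+] --> z.
  move=> sz; apply/nm_cvgP; apply/cvgrPdist_le => f f0; near=> r.
  have r0 : 0 < r by near: r; exact: nbhs_right_gt.
  rewrite sub0r normrN ger0_norm ?nm_ge0 // (le_trans (push_nm d0 sz (ltW r0))) //.
  rewrite mulrC -ler_pdivlMr //; near: r; apply: nbhs_right_le.
  by rewrite divr_gt0.
have cpair : (push r x, push r y) @[r --> 0^'+] --> (x, y) by exact: (cvg_pair (cp x sx) (cp y sy)).
have h1 := cpair _ hU.
near=> r; have r0 : 0 < r by near: r; exact: nbhs_right_gt.
have r1 : r < 1 by near: r; exact: nbhs_right_lt.
have r01 : 0 < r < 1 by rewrite r0.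
have h : D2 (push r x, push r y) -> `|U x y - U (push r x) (push r y)| <= e by near: r; exact: h1.
by apply: h; split; apply: full_state; exact: push_full'.
Unshelve. all: by end_near. Qed.

(** W is a continuous extension, so [xget] does select one; any two agree because pushed states are
    full rank and converge to the given ones. *)
Lemma W2pE x y : states x -> states y -> W2 x y = W x y.
Proof.
move=> sx sy; have cW := W_continuous_extension.
have cW2 : continuous_extension p sigma V omega W2 by rewrite /W2p; apply: xgetPex; exists W.
apply/eqP; rewrite -subr_eq0 -normr_le0; apply: (@small_eq0 _ 2) => f f0.
have [r [[r0 r1] [h1 h2]]] : exists r : R, (0 < r /\ r < 1) /\
    (`|W x y - W (push r x) (push r y)| <= f /\ `|W2 x y - W2 (push r x) (push r y)| <= f).
  apply: (@filter_ex _ (0^'+) _); apply: filterI.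
    by apply: filterI; [exact: nbhs_right_gt|exact: nbhs_right_lt].
  by apply: filterI; exact: continuous_extension_push.
have r01 : 0 < r < 1 by rewrite r0.
have fx := push_full' d0 sx r01; have fy := push_full' d0 sy r01.
have E : W2 (push r x) (push r y) = W (push r x) (push r y).
  by rewrite cW2.1 // cW.1.
rewrite E distrC in h2.
have -> : W2 x y - W x y = - ((W x y - W (push r x) (push r y)) + (W (push r x) (push r y) - W2 x y)).
  by rewrite addrA subrK opprB.
rewrite normrN; apply: le_trans (ler_normD _ _) _.
by have -> : 2 * f = f + f by [rewrite mulr_natl mulr2n]; apply: lerD.
Qed.

(** A norm limit exists along an ultrafilter because states are bounded. The modulus of W turns it
    into a limit for W along that ultrafilter, and the Cauchy property extends this to the whole
    sequence. *)
Lemma W2p_complete : is_complete_on (@states R d) W2.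
Proof.
move=> u su cau.
have [U [UU UT]] := @ultraFilterLemma nat \oo _.
have UP : ProperFilter U := @ultra_proper _ _ UU.
have [Y hY] := @ultra_mx R d U UU u 1 (fun n => states_nm (su n)).
have near_nm f : 0 < f -> \forall n \near U, nm (u n - Y) <= f.
  move=> f0; move/cvgrPdist_le: hY => /(_ _ f0); apply: filterS => n.
  by rewrite sub0r normrN ger0_norm ?nm_ge0.
have sY : states Y.
  apply: states_closed d0 _ => f f0; have [n hn] := @filter_ex _ U _ _ (near_nm f f0).
  by exists (u n).
exists Y => //; have [k k0 hk] := W_modulus p12 psigma d0 pairing ergodic.
apply/cvgrPdist_le => e e0; have e2 : 0 < e / 2 by rewrite divr_gt0.
have [N hN] := cau _ e2; exists N => // m /= Nm.
have f0 : 0 < (e / 2 / k) ^+ 2 by rewrite exprn_gt0 // divr_gt0.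
have [n [n1 n2]] : exists n, (N <= n)%N /\ nm (u n - Y) <= (e / 2 / k) ^+ 2.
  apply: (@filter_ex _ U _); apply: filterI; last exact: near_nm.
  by apply: UT; exists N.
have := hN m n Nm n1; rewrite !W2pE // => h1.
have W0 : 0 <= W (u m) Y by exact: (W_ge0 p12 psigma d0 pairing ergodic).
rewrite sub0r normrN ger0_norm //.
apply: le_trans (W_triangle p12 psigma d0 pairing ergodic (su m) (su n) sY) _.
rewrite [e]splitr; apply: lerD; first exact: ltW.
apply: le_trans (hk _ _ (su n) sY) _; rewrite nm_subC mulrC -ler_pdivlMr //.
have ek : 0 <= e / 2 / k by rewrite !divr_ge0 // ltW.
by rewrite -[leRHS]ger0_norm // -sqrtr_sqr ler_wsqrtr.
Qed.

Lemma W2p_metric : is_metric_on (@states R d) W2.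
Proof.
split.
- by move=> x y sx sy; rewrite W2pE //; exact: (W_ge0 p12 psigma d0 pairing ergodic).
- by move=> x y sx sy; rewrite W2pE //; exact: (W_eq0 p12 psigma d0 pairing ergodic).
- by move=> x y sx sy; rewrite !W2pE //; exact: (W_sym p12 psigma d0 pairing ergodic).
- by move=> x y z sx sy sz; rewrite !W2pE //; exact: (W_triangle p12 psigma d0 pairing ergodic).
Qed.

(** The infimum is at least the square distance by [action_ge]; the curve of [minimizer_exists] has
    a density bounded by that square, hence attains it. *)
Lemma W2p_minimizer x y : states x -> states y ->
  ((W2 x y) ^+ 2)%:E = inf_action p sigma V omega x y /\
  exists gamma B, [/\ minimizer p sigma V omega x y gamma B,
    minimizing_geodesic (@states R d) W2 x y gamma &
    forall s t, 0 <= s <= 1 -> 0 <= t <= 1 -> W2 (gamma s) (gamma t) = `|s - t| * W2 x y].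
Proof.
move=> sx sy; rewrite !W2pE //.
have [ga [B [adm wB Wst]]] := minimizer_exists p12 psigma d0 pairing ergodic sx sy.
have [[sg _] _ _ g0 g1] := adm.
have le_act : (action p sigma omega ga B <= (W x y ^+ 2)%:E)%E.
  have c1 : (\int[mu]_(s in `[0%R, 1%R]) (W x y ^+ 2)%:E = (W x y ^+ 2)%:E)%E.
    rewrite integral_cst; last exact: mI01.
    by rewrite [X in (_ * X)%E]lebesgue_measure_itv /= lte_fin ltr01 oppr0 adde0 mule1.
  rewrite -c1; apply: ge0_integral_mono => t; rewrite /= in_itv /= => t01; last exact: wB.
  apply: le_trans (Q_le_weighted_norm2 omega p12 psigma (B t) (sg t t01) ltr01).
  rewrite lee_fin; apply: (Q_ge0 omega p12 psigma (B t)); exact: pd_reg (sg t t01) ltr01.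
have infE : (W x y ^+ 2)%:E = inf_action p sigma V omega x y.
  apply/eqP; rewrite eq_le; apply/andP; split.
    apply: le_ereal_inf_tmp => u [[g' B'] /= adm' <-].
    exact: (action_ge p12 psigma d0 pairing ergodic adm').
  by apply: le_trans le_act; apply: ereal_inf_lbound; exists (ga, B).
split => //; exists ga, B.
have W2st s t : 0 <= s <= 1 -> 0 <= t <= 1 -> W2 (ga s) (ga t) = `|s - t| * W x y.
  by move=> s01 t01; rewrite W2pE ?Wst //; exact: sg.
split => //.
- split => //; apply/eqP; rewrite eq_le -{1}infE le_act /=.
  by apply: ereal_inf_lbound; exists (ga, B).
- split => //.
  + by exists (W x y) => s t s0 st t1; exact: curve_length_gamma.
  + by rewrite (curve_length_gamma W2st) // subr0 mulr1 W2pE.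
Qed.

End Extension.

Theorem theorem4p11 (R : realType) (d : nat)
    (P : R -> {linear 'M[R[i]]_d -> 'M[R[i]]_d})
    (L : {linear 'M[R[i]]_d -> 'M[R[i]]_d}) (sigma : 'M[R[i]]_d)
    (J : nat) (V : 'I_J -> 'M[R[i]]_d) (omega : 'I_J -> R) (p : R) :
  quantum_markov_semigroup P -> has_generator P L -> primitive P sigma ->
  gns_detailed_balance L sigma -> alicki_form L sigma V omega ->
  1 < p <= 2 ->
  let D := @states R d in
  let W := W2p p sigma V omega in
  [/\ is_metric_on D W, is_complete_on D W & is_geodesic_on D W] /\
  forall rho0 rho1, D rho0 -> D rho1 ->
    ((W rho0 rho1) ^+ 2)%:E = inf_action p sigma V omega rho0 rho1 /\
    exists (gamma : R -> 'M[R[i]]_d) (B : R -> 'I_J -> 'M[R[i]]_d),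
      [/\ minimizer p sigma V omega rho0 rho1 gamma B,
          minimizing_geodesic D W rho0 rho1 gamma &
          forall s t, 0 <= s <= 1 -> 0 <= t <= 1 ->
            W (gamma s) (gamma t) = `|s - t| * W rho0 rho1].
Proof.
move=> qmsP genP primP gnsP alickiP p12 D W.
have psigma := primitive_pd primP.
(* A matrix of size 0 has trace 0, whereas sigma has trace 1. *)
have d0 : (0 < d)%N.
  rewrite lt0n; apply/eqP => d00; have [[[_ trs] _] _ _] := primP.
  move: trs; rewrite /mxtrace big1 => [/esym/eqP|i _]; first by rewrite oner_eq0.
  by have := ltn_ord i; rewrite {2}d00.
have pairing := alicki_pairing alickiP.
have ergodic := primitive_ergodic qmsP genP primP gnsP alickiP.
have main := W2p_minimizer p12 psigma d0 pairing ergodic.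
split; last exact: main.
split; [exact: W2p_metric|exact: W2p_complete|].
by move=> x y sx sy; have [_ [ga [B [_ h _]]]] := main x y sx sy; exists ga.
Qed.
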